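(* Let $n\ge1$ and let $\alpha_1,\dots,\alpha_n,\beta_1,\dots,\beta_n\in\mathbb{C}$ be such that $\alpha_k$ differs from $\beta_l$ modulo $1$ for all $1\le k,l\le n$. Let $z^n+A_1z^{n-1}+\dots+A_n$ be the polynomial with roots $e^{-2\pi i\alpha_k}$ and $z^n+B_1z^{n-1}+\dots+B_n$ the polynomial with roots $e^{-2\pi i\beta_k}$ ($k=1,\dots,n$), and put $A_0=1$. The monodromy matrices of the generalized hypergeometric equation $$\big[z(\theta+\alpha_1)\cdots(\theta+\alpha_n)-(\theta+\beta_1-1)\cdots(\theta+\beta_n-1)\big]f(z)=0,\qquad \theta=z\frac{d}{dz},$$ in the Mellin-Barnes basis $I_0,\dots,I_{n-1}$ are $$M_0=\begin{pmatrix}0&1&0&\cdots&0\\0&0&1&\cdots&0\\\vdots&&&&\vdots\\0&0&0&\cdots&1\\-B_n&-B_{n-1}&-B_{n-2}&\cdots&-B_1\end{pmatrix},$$ $$M_1=\begin{pmatrix}1+\frac{A_n-B_n}{B_n}&\frac{A_{n-1}-B_{n-1}}{B_n}&\frac{A_{n-2}-B_{n-2}}{B_n}&\cdots&\frac{A_1-B_1}{B_n}\\0&1&0&\cdots&0\\0&0&1&\cdots&0\\\vdots&&&&\vdots\\0&0&0&\cdots&1\end{pmatrix},$$ $$M_\infty=\begin{pmatrix}-\frac{A_{n-1}}{A_n}&-\frac{A_{n-2}}{A_n}&-\frac{A_{n-3}}{A_n}&\cdots&-\frac{A_0}{A_n}\\1&0&0&\cdots&0\\0&1&0&\cdots&0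\\\vdots&&&&\vdots\\0&0&\cdots&1&0\end{pmatrix}.$$
   Context: For $z\in\mathbb{C}\setminus\mathbb{R}_{\ge0}$ choose $\arg z\in(0,2\pi)$, which determines $z^s=|z|^se^{i\arg(z)s}$ (read as $e^{s(\log|z|+i\arg z)}$). For $j=0,1,\dots,n-1$, $$I_j(z)=\frac{(-1)^n}{(2\pi i)^n}\int_L\left(\prod_{k=1}^n\Gamma(\alpha_k+s)\Gamma(1-\beta_k-s)\right)e^{(2j-n)\pi is}z^s\,ds,$$ where $L$ is a path from $i\infty$ to $-i\infty$, lying on the imaginary axis for $|s|$ large, bent so that all points $-\alpha_k-m$ ($m\in\mathbb{Z}_{\ge0}$) are on the left of it and all points $1-\beta_k+m$ ($m\in\mathbb{Z}_{\ge0}$) are on the right of it (''left'' is the component of $\mathbb{C}\setminus L$ containing all $s$ off $L$ of large modulus with negative real part, ''right'' the other component). These integrals converge, and $I_0,\dots,I_{n-1}$ is a basis of solutions on $\mathbb{C}\setminus\mathbb{R}_{\ge0}$, called the Mellin-Barnes basis. Monodromy: the singularities are $0,1,\infty$. Take a base point in the upper half plane and loops $\gamma_0,\gamma_1$ that go from the base point inside the upper half plane to a point near $0$, respectively $1$, encircle that point once counterclockwise along a small circle and return the same way; $\gamma_\infty$ is the inverse of $\gamma_0$ followed by $\gamma_1$. If $F=(I_0,\dots,I_{n-1})^T$, analytic continuation along $\gamma_x$ transforms $F$ into $M_xF$; thus $M_0M_1M_\infty=\mathbb{I}$. *)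

(* Defs.v *)
(* Stdlib reals with Coquelicot's complex numbers, derivatives, improper
   integrals and matrices. *)
From Stdlib Require Export Reals Factorial.
From Coquelicot Require Export Coquelicot.

Open Scope R_scope.
Open Scope C_scope.

(** * Elementary and special functions on C *)

Definition Cexp (z : C) : C :=
  (exp (Re z) * cos (Im z), exp (Re z) * sin (Im z))%R.

(* C minus the closed half-line of nonnegative reals *)
Definition slit_plane (z : C) : Prop := ~ (Im z = 0 /\ 0 <= Re z)%R.

(* On [slit_plane] the argument lies in the open interval (0, 2 PI). *)
Definition arg (z : C) : R :=
  (if Rle_dec 0 (Im z) then acos (Re z / Cmod z)
   else 2 * PI - acos (Re z / Cmod z))%R.

Definition cpow (z s : C) : C := Cexp (s * (ln (Cmod z), arg z)).

(* f 1 * ... * f n; the empty product is 1 *)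
Fixpoint Cprod (f : nat -> C) (n : nat) : C :=
  match n with
  | O => 1
  | S m => Cprod f m * f (S m)
  end.

Definition C_Lim_seq (u : nat -> C) : C :=
  (real (Lim_seq (fun p => Re (u p))), real (Lim_seq (fun p => Im (u p)))).

(* The Euler-Gauss limit: p! p^s / (s (s + 1) ... (s + p)) tends to Gamma(s)
   for every s other than 0, -1, -2, ...  Values at these poles are junk. *)
Definition Gamma (s : C) : C :=
  C_Lim_seq (fun p =>
    RtoC (INR (fact p)) * Cexp (s * RtoC (ln (INR p)))
      / (s * Cprod (fun k => s + RtoC (INR k)) p)).

(** * Mellin-Barnes integrals *)

Definition C1 (g : R -> C) : Prop :=
  exists dg : R -> C, forall t,
    is_derive (V := C_R_NormedModule) g t (dg t) /\ continuous dg t.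

(* A piecewise C^1 path from i*oo to -i*oo.  The parameter is normalized so that
   L t = - i t outside a compact interval; a function is C^1 on a closed
   interval iff it agrees there with a function that is C^1 on R. *)
Definition path_ioo (L : R -> C) : Prop :=
  exists (N : nat) (a : nat -> R),
    (forall i, (i < N)%nat -> (a i < a (S i))%R) /\
    (forall i, (i < N)%nat ->
       exists g, C1 g /\ forall t, (a i <= t <= a (S i))%R -> L t = g t) /\
    (forall t, (t <= a O \/ a N <= t)%R -> L t = (0, - t)%R).

Definition unit_interval (t : R) : Prop := (0 <= t <= 1)%R.

(* Path components; since the complement of L is open, these are the same as
   connected components. *)
Definition same_component (L : R -> C) (x y : C) : Prop :=
  exists c : R -> C,
    continuous_on unit_interval c /\ c 0%R = x /\ c 1%R = y /\
    forall t u, unit_interval t -> c t <> L u.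

(* x lies in the component of C \ L that contains every point of large modulus
   with negative (resp. positive) real part; such points are off L as soon as
   the modulus is large enough. *)
Definition left_of (L : R -> C) (x : C) : Prop :=
  exists r : R, forall s, (r <= Cmod s)%R -> (Re s < 0)%R -> same_component L x s.

Definition right_of (L : R -> C) (x : C) : Prop :=
  exists r : R, forall s, (r <= Cmod s)%R -> (0 < Re s)%R -> same_component L x s.

(* The parameters alpha, beta are alpha 1, ..., alpha n and beta 1, ..., beta n. *)
Definition mellin_barnes_path (n : nat) (alpha beta : nat -> C) (L : R -> C) : Prop :=
  path_ioo L /\
  forall k m : nat, (1 <= k <= n)%nat ->
    left_of L (- alpha k - RtoC (INR m)) /\
    right_of L (1 - beta k + RtoC (INR m)).

(* L is differentiable outside a finite set, which does not affect integrals. *)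
Definition path_derive (L : R -> C) (t : R) : C :=
  (Derive (fun u => Re (L u)) t, Derive (fun u => Im (L u)) t).

Definition path_integral (L : R -> C) (f : C -> C) : C :=
  RInt_gen (V := C_R_CompleteNormedModule) (fun t => f (L t) * path_derive L t)
    (Rbar_locally m_infty) (Rbar_locally p_infty).

Definition mellin_barnes (n : nat) (alpha beta : nat -> C) (L : R -> C)
    (j : nat) (z : C) : C :=
  (-1) ^ n / (2 * RtoC PI * Ci) ^ n *
  path_integral L (fun s =>
    Cprod (fun k => Gamma (alpha k + s) * Gamma (1 - beta k - s)) n
    * Cexp (RtoC (2 * INR j - INR n)%R * RtoC PI * Ci * s) * cpow z s).

(** * The generalized hypergeometric equation *)

Definition theta (f : C -> C) (z : C) : C := z * C_derive f z.

(* (theta + c 1) ... (theta + c n) f; the factors commute *)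
Fixpoint theta_prod (c : nat -> C) (n : nat) (f : C -> C) : C -> C :=
  match n with
  | O => f
  | S m => fun z =>
      theta (theta_prod c m f) z + c (S m) * theta_prod c m f z
  end.

Definition hypergeometric_solution (n : nat) (alpha beta : nat -> C)
    (f : C -> C) : Prop :=
  (forall z, slit_plane z -> ex_derive f z) /\
  (forall z, slit_plane z ->
     z * theta_prod alpha n f z - theta_prod (fun k => beta k - 1) n f z = 0).

(* c 0 * F 0 z + ... + c (n - 1) * F (n - 1) z for n >= 1: the bound of [sum_n]
   is inclusive. *)
Definition lin_comb (n : nat) (c : nat -> C) (F : nat -> C -> C) (z : C) : C :=
  sum_n (fun j => c j * F j z) (pred n).

Definition basis_of_solutions (n : nat) (alpha beta : nat -> C)
    (F : nat -> C -> C) : Prop :=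
  (forall j, (j < n)%nat -> hypergeometric_solution n alpha beta (F j)) /\
  (forall c : nat -> C,
     (forall z, slit_plane z -> lin_comb n c F z = 0) ->
     forall j, (j < n)%nat -> c j = 0) /\
  (forall f, hypergeometric_solution n alpha beta f ->
     exists c : nat -> C, forall z, slit_plane z -> f z = lin_comb n c F z).

(** * Analytic continuation and monodromy *)

(* Paths are functions on R of which only the restriction to [0, 1] matters. *)

(* Continuation of the germ of f at gamma 0 to the germ of g at gamma 1, through
   a family of holomorphic germs Phi t at gamma t. *)
Definition analytic_continuation (gamma : R -> C) (f g : C -> C) : Prop :=
  exists Phi : R -> C -> C,
    (forall t, unit_interval t -> locally (gamma t) (fun z => ex_derive (Phi t) z)) /\
    (forall t, unit_interval t -> exists delta : R, (0 < delta)%R /\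
       forall u, unit_interval u -> (Rabs (u - t) < delta)%R ->
         locally (gamma u) (fun z => Phi u z = Phi t z)) /\
    locally (gamma 0%R) (fun z => Phi 0%R z = f z) /\
    locally (gamma 1%R) (fun z => Phi 1%R z = g z).

Definition path_concat (gamma delta : R -> C) (t : R) : C :=
  if Rle_dec t (1 / 2) then gamma (2 * t)%R else delta (2 * t - 1)%R.

Definition path_reverse (gamma : R -> C) (t : R) : C := gamma (1 - t)%R.

(* The circle around x from p to p, once counterclockwise *)
Definition circle (x p : C) (t : R) : C :=
  x + (p - x) * Cexp (RtoC (2 * PI * t)%R * Ci).

(* sigma goes in the upper half plane from the base point b to a point at
   distance less than 1 from x. For x = 0 or 1 this makes the circle around x
   through its end point small: it has no other singularity on it or inside. *)
Definition approach (x b : C) (sigma : R -> C) : Prop :=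
  continuous_on unit_interval sigma /\ sigma 0%R = b /\
  (forall t, unit_interval t -> (0 < Im (sigma t))%R) /\
  (Cmod (sigma 1%R - x) < 1)%R.

Definition loop (x : C) (sigma : R -> C) : R -> C :=
  path_concat sigma (path_concat (circle x (sigma 1%R)) (path_reverse sigma)).

(* With F the column (F 0, ..., F (n-1))^T, continuation along gamma turns F
   into M F. *)
Definition is_monodromy_matrix (n : nat) (F : nat -> C -> C) (gamma : R -> C)
    (M : @matrix C n n) : Prop :=
  forall i, (i < n)%nat ->
    analytic_continuation gamma (F i)
      (lin_comb n (fun j => coeff_mat zero M i j) F).

(** * The matrices *)

(* A 0, ..., A n are the coefficients, by decreasing degree, of the monic
   polynomial of degree n with roots r 1, ..., r n. *)
Definition monic_poly_with_roots (n : nat) (A r : nat -> C) : Prop :=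
  A O = 1 /\
  forall x : C, sum_n (fun k => A k * x ^ (n - k)) n = Cprod (fun k => x - r k) n.

Definition delta (i j : nat) : C := if Nat.eqb i j then 1 else 0.

(* Rows and columns are numbered from 0. *)

Definition M0 (n : nat) (B : nat -> C) : @matrix C n n :=
  mk_matrix n n (fun i j =>
    if Nat.eqb i (n - 1) then - B (n - j)%nat else delta (S i) j).

Definition M1 (n : nat) (A B : nat -> C) : @matrix C n n :=
  mk_matrix n n (fun i j =>
    if Nat.eqb i 0 then delta 0 j + (A (n - j)%nat - B (n - j)%nat) / B n
    else delta i j).

Definition Minf (n : nat) (A : nat -> C) : @matrix C n n :=
  mk_matrix n n (fun i j =>
    if Nat.eqb i 0 then - (A (n - 1 - j)%nat / A n) else delta i (S j)).

(* Main.v *)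
(** With w = log z and W(s) = prod_k Gamma(alpha_k + s) Gamma(1 - beta_k - s) e^(- n pi i s),
   the function I_j is, up to a common constant, the translate G(w + 2 pi i j) of the single
   function G(w) = int_L W(s) e^(w s) ds, holomorphic for 0 < Im w < 2 pi n.  Shifting L by 1
   gives the differential equation for G.  On Re w < 0 this equation is a holomorphic system
   of period 2 pi i, so G continues to that half-plane.  The translation w -> w + 2 pi i acts
   on the solutions with a characteristic polynomial that does not depend on w; letting
   Re w -> -oo identifies it as the polynomial with roots e^(- 2 pi i beta_k), and
   Cayley-Hamilton yields sum_k B_(n-k) G(w + 2 pi i k) = 0.  The same argument on Re w > 0
   gives the relation with the A_k.  These two relations are the nontrivial rows of M_0 and
   M_1, and M_inf follows from M_inf M_0 M_1 = 1.

   For the independence, a relation sum_j c_j I_j = 0 says that int_L W(s) P(e^(2 pi i s)) e^(w s) ds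
   vanishes on a strip, where P has the coefficients c_j.  This property survives the division
   of the weight by s - p for p far from the imaginary axis.  High powers of a rational kernel that peaks
   at one point of L then show that P(e^(2 pi i s)) vanishes at all distant points of the
   imaginary axis, hence P = 0. *)
Require Import Defs.
From Stdlib Require Import Lra Lia Classical ClassicalEpsilon FunctionalExtensionality List.
From HB Require Import structures.
From mathcomp Require all_boot all_fingroup all_algebra boolp.
Set Bullet Behavior "Strict Subproofs".

(** * Complex numbers: continuity and derivatives *)

(** The gamma factors decay like exp (- n pi |Im s|), and the twist e^(- n pi i s) moves the
    admissible range of Im w to (0, 2 pi n). All n translates thus live in one strip, and a relation
    is needed exactly when a continuation leaves it: around 0 only I_(n-1) does, around 1 only I_0.

    The alpha_k, or the beta_k, may be congruent modulo 1 among themselves, so local bases at oo or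
    0 may involve logarithms. The characteristic polynomial of the translation, computed as a limit
    over conjugate matrices, treats all cases alike.

    The path may cross itself, and its sides are given only through connected components. What is
    extracted from them is that p - 1 and p have the same winding number for the relevant poles p.
    The contour shift rests on this and subtracts principal parts one by one instead of summing
    residues.

    Gamma is a limit of finite products. Its decay on vertical lines is read off from the factors,
    with a function of x whose unit increments bound ln |1 + i t / x| from below. *)

Lemma Cmod_sub_sym (x y : C) : Cmod (x - y) = Cmod (y - x).
Proof. rewrite <- Cmod_opp. f_equal. ring. Qed.

Lemma Cmod_triangle_sub (x y : C) : Cmod (x - y) <= Cmod x + Cmod y.
Proof. rewrite <- (Cmod_opp y). apply Cmod_triangle. Qed.

Lemma Cmod_triangle_inv (x y : C) : Cmod x - Cmod y <= Cmod (x - y).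
Proof.
generalize (Cmod_triangle (x - y) y). replace (x - y + y) with x by ring. lra.
Qed.

Lemma im_le_Cmod (z : C) : Rabs (Im z) <= Cmod z.
Proof. apply Rle_trans with (2 := Rmax_Cmod z). apply Rmax_r. Qed.

Lemma Cmod_le_re_im (z : C) : Cmod z <= Rabs (Re z) + Rabs (Im z).
Proof.
replace z with (RtoC (Re z) + Ci * RtoC (Im z)) at 1.
- eapply Rle_trans; [apply Cmod_triangle|].
  rewrite Cmod_mult, Cmod_Ci, !Cmod_R. lra.
- destruct z; apply injective_projections; simpl; ring.
Qed.

Lemma re_sub (a b : C) : Re (a - b) = (Re a - Re b)%R.
Proof. destruct a, b; simpl; ring. Qed.

Lemma im_sub (a b : C) : Im (a - b) = (Im a - Im b)%R.
Proof. destruct a, b; simpl; ring. Qed.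

Lemma C_ext (a b : C) : Re a = Re b -> Im a = Im b -> a = b.
Proof. destruct a, b; simpl; intros; subst; reflexivity. Qed.

Lemma Cmod_le_eps_0 (z : C) :
  (forall eps : R, 0 < eps -> Cmod z <= eps) -> z = 0.
Proof.
intros H. apply Cmod_eq_0. apply Rle_antisym; [|apply Cmod_ge_0].
apply le_epsilon. intros e He. specialize (H e He). lra.
Qed.

Lemma Cmult_near (l m : C) e : 0 < e -> exists d, 0 < d /\ forall a b,
  Cmod (a - l) < d -> Cmod (b - m) < d -> Cmod (a * b - l * m) < e.
Proof.
intros He.
set (M := (Cmod l + Cmod m + 1)%R).
assert (HM : 1 <= M) by (unfold M; generalize (Cmod_ge_0 l) (Cmod_ge_0 m); lra).
set (e' := Rmin 1 (e / (2 * M))%R).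
assert (He' : 0 < e') by (apply Rmin_case; [lra|apply Rdiv_lt_0_compat; lra]).
exists e'. split; auto. intros a b K1 K2.
replace (a * b - l * m) with ((a - l) * (b - m) + (a - l) * m + l * (b - m)) by ring.
eapply Rle_lt_trans; [apply Cmod_triangle|].
eapply Rle_lt_trans; [apply Rplus_le_compat_r; apply Cmod_triangle|]. rewrite !Cmod_mult.
generalize (Cmod_ge_0 l) (Cmod_ge_0 m) (Cmod_ge_0 (a - l)) (Cmod_ge_0 (b - m)). intros.
assert (e' <= 1) by apply Rmin_l.
assert (E2 : e' * (2 * M) <= e).
{ apply Rle_trans with (e / (2 * M) * (2 * M))%R; [|right; field; lra].
  apply Rmult_le_compat_r; [lra|apply Rmin_r]. }
assert (Cmod (a - l) * Cmod (b - m) <= e' * 1) by (apply Rmult_le_compat; lra).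
assert (Cmod (a - l) * Cmod m <= e' * Cmod m) by (apply Rmult_le_compat; lra).
assert (Cmod l * Cmod (b - m) <= Cmod l * e') by (apply Rmult_le_compat; lra).
unfold M in E2. nra.
Qed.

(* Functions of a complex and of a real variable are treated together: [sub y x]
   is the increment from x to y as a complex number. *)
Definition elim {X : Type} (sub : X -> X -> C) (f : X -> C) (x : X) (l : C) : Prop :=
  forall e, 0 < e -> exists d, 0 < d /\ forall y, Cmod (sub y x) < d -> Cmod (f y - l) < e.

Definition econt {X : Type} (sub : X -> X -> C) (f : X -> C) (x : X) : Prop := elim sub f x (f x).

Definition rsub (u t : R) : C := RtoC (u - t).
Notation ccont := (econt Cminus).
Notation rcont := (econt rsub).

Section Econt.
Context {X : Type} (sub : X -> X -> C).

Lemma elim_both f g x l m P : elim sub f x l -> elim sub g x m ->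
  (exists d, 0 < d /\ forall a b, Cmod (a - l) < d -> Cmod (b - m) < d -> P a b) ->
  exists d, 0 < d /\ forall y, Cmod (sub y x) < d -> P (f y) (g y).
Proof.
intros Hf Hg [d [Hd H]]. destruct (Hf d Hd) as [d1 [Hd1 H1]]. destruct (Hg d Hd) as [d2 [Hd2 H2]].
exists (Rmin d1 d2). split; [apply Rmin_case; auto|]. intros y Hy.
apply H; [apply H1|apply H2]; eapply Rlt_le_trans; try apply Hy; [apply Rmin_l|apply Rmin_r].
Qed.

Lemma elim_plus f g x l m : elim sub f x l -> elim sub g x m -> elim sub (fun y => f y + g y) x (l + m).
Proof.
intros Hf Hg e He. apply (elim_both f g x l m (fun a b => Cmod (a + b - (l + m)) < e) Hf Hg).
exists (e / 2)%R. split; [lra|]. intros a b Ha Hb. replace (a + b - (l + m)) with ((a - l) + (b - m)) by ring.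
eapply Rle_lt_trans; [apply Cmod_triangle|]. lra.
Qed.

Lemma elim_mult f g x l m : elim sub f x l -> elim sub g x m -> elim sub (fun y => f y * g y) x (l * m).
Proof.
intros Hf Hg e He. apply (elim_both f g x l m (fun a b => Cmod (a * b - l * m) < e) Hf Hg). apply Cmult_near; auto.
Qed.

Lemma elim_const (c : C) x : elim sub (fun _ => c) x c.
Proof.
intros e He. exists 1%R. split; [lra|]. intros. replace (c - c) with (RtoC 0) by ring. rewrite Cmod_0. lra.
Qed.

Lemma econt_const (c : C) x : econt sub (fun _ => c) x.
Proof. apply elim_const. Qed.

Lemma econt_plus f g x : econt sub f x -> econt sub g x -> econt sub (fun y => f y + g y) x.
Proof. apply elim_plus. Qed.

Lemma econt_mult f g x : econt sub f x -> econt sub g x -> econt sub (fun y => f y * g y) x.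
Proof. apply elim_mult. Qed.

Lemma econt_ext f g x : (forall y, f y = g y) -> econt sub f x -> econt sub g x.
Proof. intros E. replace g with f; auto. extensionality y; auto. Qed.

Lemma econt_opp f x : econt sub f x -> econt sub (fun y => - f y) x.
Proof.
intros H. apply econt_ext with (fun y => (-1) * f y); [intros; ring|].
apply econt_mult; auto. apply econt_const.
Qed.

Lemma econt_minus f g x :
  econt sub f x -> econt sub g x -> econt sub (fun y => f y - g y) x.
Proof. intros. apply econt_plus; auto. apply econt_opp; auto. Qed.

Lemma econt_comp (f : C -> C) g x :
  ccont f (g x) -> econt sub g x -> econt sub (fun y => f (g y)) x.
Proof.
intros Hf Hg e He. destruct (Hf e He) as [d [Hd H]].
destruct (Hg d Hd) as [d' [Hd' H']]. exists d'. split; auto.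
Qed.

End Econt.

Lemma ccont_id z : ccont (fun x => x) z.
Proof. intros e He. exists e. split; auto. Qed.

Lemma ccont_inv (z : C) : z <> 0 -> ccont Cinv z.
Proof.
intros Hz e He. assert (Hm := proj1 (Cmod_gt_0 z) Hz).
exists (Rmin (Cmod z / 2) (e * (Cmod z * Cmod z) / 4))%R. split.
{ apply Rmin_case; [lra|]. apply Rdiv_lt_0_compat; [|lra]. repeat apply Rmult_lt_0_compat; auto. }
intros y Hy.
assert (H1 : Cmod (y - z) < Cmod z / 2) by (eapply Rlt_le_trans; [apply Hy|apply Rmin_l]).
assert (H2 : Cmod (y - z) < e * (Cmod z * Cmod z) / 4) by (eapply Rlt_le_trans; [apply Hy|apply Rmin_r]).
assert (H3 : Cmod z / 2 <= Cmod y).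
{ generalize (Cmod_triangle_inv z y). rewrite Cmod_sub_sym. lra. }
assert (Hy0 : y <> 0) by (apply Cmod_gt_0; lra).
replace (/ y - / z) with ((z - y) / (y * z)) by (field; auto).
rewrite Cmod_div, Cmod_mult by (apply Cmult_neq_0; auto).
rewrite Cmod_sub_sym. apply Rlt_div_l.
{ apply Rmult_lt_0_compat; lra. }
assert (e * (Cmod z / 2 * Cmod z) <= e * (Cmod y * Cmod z)).
{ apply Rmult_le_compat_l; [lra|]. apply Rmult_le_compat_r; lra. }
assert (0 < e * (Cmod z * Cmod z)) by (repeat apply Rmult_lt_0_compat; auto).
lra.
Qed.

(** Stated without a quotient, so that the points with [sub y z = 0] need no exclusion. *)
Definition eder {X : Type} (sub : X -> X -> C) (f : X -> C) (z : X) (l : C) : Prop :=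
  forall eps, 0 < eps -> exists d, 0 < d /\
    forall y, Cmod (sub y z) < d ->
      (Cmod (f y - f z - l * (sub y z)) <= eps * Cmod (sub y z)).

Notation cder := (eder Cminus).
Notation rder := (eder rsub).

Section Eder.
Context {X : Type} (sub : X -> X -> C).

(* Caratheodory's form of differentiability, from which the rules of calculus follow by taking limits. *)
Lemma eder_iff f z l : eder sub f z l <-> exists phi, elim sub phi z l /\ forall y, f y - f z = phi y * sub y z.
Proof.
split.
- intros H. exists (fun y => if Ceq_dec (sub y z) 0 then l else (f y - f z) / sub y z). split.
  + intros e He. destruct (H (e / 2)%R) as [d [Hd K]]; [lra|]. exists d. split; auto. intros y Hy. specialize (K y Hy).
    destruct Ceq_dec as [E|E]; [replace (l - l) with (RtoC 0) by ring; rewrite Cmod_0; auto|].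
    replace ((f y - f z) / sub y z - l) with ((f y - f z - l * sub y z) / sub y z) by (field; auto).
    assert (0 < Cmod (sub y z)) by (apply Cmod_gt_0; auto). rewrite Cmod_div by auto. apply Rlt_div_l; auto. nra.
  + intros y. destruct Ceq_dec as [E|E]; [|field; auto]. destruct (H 1%R) as [d [Hd K]]; [lra|].
    specialize (K y). rewrite E, Cmod_0, !Cmult_0_r, Rmult_0_r in *.
    apply Cmod_eq_0, Rle_antisym; [|apply Cmod_ge_0]. replace (f y - f z) with (f y - f z - 0) by ring. auto.
- intros [phi [H E]] e He. destruct (H e He) as [d [Hd K]]. exists d. split; auto. intros y Hy.
  rewrite E. replace (phi y * sub y z - l * sub y z) with ((phi y - l) * sub y z) by ring. rewrite Cmod_mult.
  apply Rmult_le_compat_r; [apply Cmod_ge_0|left; auto].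
Qed.

Lemma eder_cont f z l : eder sub f z l -> econt sub f z.
Proof.
intros H. apply eder_iff in H. destruct H as [phi [H E]].
assert (K : elim sub (fun y => phi y * sub y z) z (l * 0)).
{ apply elim_mult; auto. intros e He. exists e. split; auto. intros y Hy. replace (sub y z - 0) with (sub y z) by ring. auto. }
intros e He. destruct (K e He) as [d [Hd Kd]]. exists d. split; auto. intros y Hy.
rewrite E. replace (phi y * sub y z) with (phi y * sub y z - l * 0) by ring. auto.
Qed.

Lemma eder_ext f g z l : (forall y, f y = g y) -> eder sub f z l -> eder sub g z l.
Proof. intros E. replace g with f; auto. extensionality y; auto. Qed.

Lemma eder_eq f z l l' : l = l' -> eder sub f z l -> eder sub f z l'.
Proof. intros ->; auto. Qed.

Lemma eder_const c z : eder sub (fun _ => c) z 0.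
Proof.
intros e He. exists 1%R. split; [lra|]. intros.
replace (c - c - 0 * (sub y z)) with (RtoC 0) by ring. rewrite Cmod_0.
apply Rmult_le_pos; [lra|apply Cmod_ge_0].
Qed.

Lemma eder_plus f g z l m : eder sub f z l -> eder sub g z m -> eder sub (fun y => f y + g y) z (l + m).
Proof.
intros Hf Hg. apply eder_iff in Hf, Hg. destruct Hf as [u [Hu Eu]]. destruct Hg as [v [Hv Ev]].
apply eder_iff. exists (fun y => u y + v y). split; [apply elim_plus; auto|]. intros y.
rewrite Cmult_plus_distr_r, <- Eu, <- Ev. ring.
Qed.

Lemma eder_mult f g z l m : eder sub f z l -> eder sub g z m -> eder sub (fun y => f y * g y) z (l * g z + f z * m).
Proof.
intros Hf Hg. assert (Cg := eder_cont g z m Hg). apply eder_iff in Hf, Hg. destruct Hf as [u [Hu Eu]]. destruct Hg as [v [Hv Ev]].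
apply eder_iff. exists (fun y => u y * g y + f z * v y). split.
- apply elim_plus; apply elim_mult; auto. apply elim_const.
- intros y. transitivity (u y * sub y z * g y + f z * (v y * sub y z)); [|ring]. rewrite <- Eu, <- Ev. ring.
Qed.

Lemma eder_scal c f z l : eder sub f z l -> eder sub (fun y => c * f y) z (c * l).
Proof.
intros H. apply eder_eq with (0 * f z + c * l); [ring|].
apply (eder_mult (fun _ => c)); auto. apply eder_const.
Qed.

Lemma eder_opp f z l : eder sub f z l -> eder sub (fun y => - f y) z (- l).
Proof.
intros H. apply eder_ext with (fun y => (-1) * f y); [intros; ring|].
apply eder_eq with ((-1) * l); [ring|]. apply eder_scal; auto.
Qed.

Lemma eder_minus f g z l m :
  eder sub f z l -> eder sub g z m -> eder sub (fun y => f y - g y) z (l - m).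
Proof. intros. apply eder_plus; auto. apply eder_opp; auto. Qed.

End Eder.

Lemma eder_comp {X : Type} (sub : X -> X -> C) (f : C -> C) g z l m :
  cder f (g z) l -> eder sub g z m -> eder sub (fun y => f (g y)) z (l * m).
Proof.
intros Hf Hg. assert (Cg := eder_cont sub g z m Hg). apply eder_iff in Hf, Hg. destruct Hf as [u [Hu Eu]]. destruct Hg as [v [Hv Ev]].
apply eder_iff. exists (fun y => u (g y) * v y). split.
- apply elim_mult; auto. intros e He. destruct (Hu e He) as [d [Hd H]]. destruct (Cg d Hd) as [d' [Hd' H']]. exists d'. auto.
- intros y. rewrite Eu, Ev. ring.
Qed.

Lemma cder_ext_loc f g z l :
  (exists d, 0 < d /\ forall y, Cmod (y - z) < d -> f y = g y) ->
  cder f z l -> cder g z l.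
Proof.
intros [d0 [Hd0 E]] H e He. destruct (H e He) as [d [Hd H1]].
exists (Rmin d d0). split; [apply Rmin_case; auto|]. intros y Hy.
rewrite <- !E.
- apply H1. eapply Rlt_le_trans; [apply Hy|apply Rmin_l].
- replace (z - z) with (RtoC 0) by ring. rewrite Cmod_0; auto.
- eapply Rlt_le_trans; [apply Hy|apply Rmin_r].
Qed.

Lemma cder_id z : cder (fun x => x) z 1.
Proof.
intros e He. exists 1%R. split; [lra|]. intros.
replace (y - z - 1 * (y - z)) with (RtoC 0) by ring. rewrite Cmod_0.
apply Rmult_le_pos; [lra|apply Cmod_ge_0].
Qed.

Lemma cder_inv (z : C) : z <> 0 -> cder Cinv z (- / (z * z)).
Proof.
intros Hz e He. assert (Hm := proj1 (Cmod_gt_0 z) Hz).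
destruct (ccont_inv z Hz (e * Cmod z)%R) as [d [Hd H]].
{ apply Rmult_lt_0_compat; auto. }
exists (Rmin d (Cmod z)). split; [apply Rmin_case; auto|]. intros y Hy.
assert (Y1 : Cmod (y - z) < d) by (eapply Rlt_le_trans; [apply Hy|apply Rmin_l]).
assert (Y2 : Cmod (y - z) < Cmod z) by (eapply Rlt_le_trans; [apply Hy|apply Rmin_r]).
assert (Hy0 : y <> 0).
{ intros ->. replace (0 - z) with (- z) in Y2 by ring. rewrite Cmod_opp in Y2. lra. }
specialize (H y Y1).
replace (/ y - / z - - / (z * z) * (y - z)) with (- ((/ y - / z) * / z * (y - z))) by (field; auto).
rewrite Cmod_opp, !Cmod_mult, Cmod_inv by auto.
apply Rmult_le_compat_r; [apply Cmod_ge_0|].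
apply (Rmult_le_reg_r (Cmod z)); auto. field_simplify; lra.
Qed.

Lemma cder_pow n (z : C) : cder (fun y => y ^ n) z (INR n * z ^ (pred n)).
Proof.
induction n.
- simpl. apply eder_eq with (RtoC 0); [ring|]. apply eder_const.
- apply eder_eq with (1 * z ^ n + z * (INR n * z ^ pred n)).
  + rewrite S_INR, RtoC_plus. destruct n; simpl; ring.
  + apply (eder_mult _ (fun y => y) (fun y => y ^ n)); auto. apply cder_id.
Qed.

Lemma cder_iff f z l : cder f z l <-> is_derive (V := C_NormedModule) f z l.
Proof.
split.
- intros H. split.
  + apply (is_linear_scal_l (V := C_NormedModule)).
  + intros x Hx. apply (is_filter_lim_locally_unique (V := AbsRing_NormedModule C_AbsRing)) in Hx. subst x.
    intros eps. destruct (H eps (cond_pos eps)) as [d [Hd H1]].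
    exists (mkposreal d Hd). intros y Hy. specialize (H1 y Hy).
    change (Cmod (f y - f z - (y - z) * l) <= eps * Cmod (y - z)).
    rewrite (Cmult_comm (y - z)). exact H1.
- intros [_ H] e He. specialize (H z). destruct H with (eps := mkposreal e He) as [d Hd].
  { intros P HP; exact HP. }
  exists d. split; [apply cond_pos|]. intros y Hy. specialize (Hd y Hy).
  change (Cmod (f y - f z - (y - z) * l) <= e * Cmod (y - z)) in Hd.
  rewrite (Cmult_comm (y - z)) in Hd. exact Hd.
Qed.

Lemma rder_id t : rder RtoC t 1.
Proof.
intros e He. exists 1%R. split; [lra|]. intros y _. unfold rsub. rewrite RtoC_minus.
replace (RtoC y - RtoC t - 1 * (RtoC y - RtoC t)) with (RtoC 0) by ring. rewrite Cmod_0.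
apply Rmult_le_pos; [lra|apply Cmod_ge_0].
Qed.

Lemma cder_C_derive f z l : cder f z l -> C_derive f z = l.
Proof. intros. apply is_C_derive_unique, cder_iff; auto. Qed.

(** Balls of the product uniform structure are squares; the factor [sqrt 2] passes from them to
    discs. *)
Lemma locally_C_iff (z : C) (P : C -> Prop) :
  locally (T := C_UniformSpace) z P <->
  exists d, 0 < d /\ forall y, Cmod (y - z) < d -> P y.
Proof.
split.
- intros [d Hd]. exists d. split; [apply cond_pos|]. intros y Hy. apply Hd.
  apply C_NormedModule_mixin_compat1. exact Hy.
- intros [d [Hd H]]. assert (Hs : 0 < d / sqrt 2).
  { apply Rdiv_lt_0_compat; auto. apply sqrt_lt_R0; lra. }
  exists (mkposreal _ Hs). intros y Hy. apply H.
  assert (H2 := C_NormedModule_mixin_compat2 z y (mkposreal _ Hs) Hy). simpl in H2.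
  replace (sqrt 2 * (d / sqrt 2))%R with d in H2; [exact H2|].
  field. apply Rgt_not_eq, sqrt_lt_R0; lra.
Qed.

Lemma finite_max (f : nat -> R) m : exists M, 0 <= M /\ forall k, (k < m)%nat -> f k <= M.
Proof.
induction m; [exists 0%R; split; [lra|intros; lia]|]. destruct IHm as [M [HM H]].
exists (Rmax M (f m)). split; [eapply Rle_trans; [apply HM|apply Rmax_l]|]. intros k Hk.
destruct (Nat.eq_dec k m) as [->|]; [apply Rmax_r|]. eapply Rle_trans; [apply H; lia|apply Rmax_l].
Qed.

(** * Integrals of complex-valued functions of a real variable *)

Notation CR := C_R_CompleteNormedModule (only parsing).

Lemma rcont_iff (g : R -> C) t : rcont g t <-> continuous (U := C_UniformSpace) g t.
Proof.
split.
- intros H P HP. apply locally_C_iff in HP. destruct HP as [d [Hd HP]].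
  destruct (H d Hd) as [e [He H']]. exists (mkposreal e He). intros u Hu.
  apply HP, H'. unfold rsub. rewrite Cmod_R. exact Hu.
- intros H e He.
  destruct (H (fun z => (Cmod (z - g t) < e))) as [d Hd].
  { apply locally_C_iff. exists e. split; auto. }
  exists d. split; [apply cond_pos|]. intros u Hu. apply Hd.
  unfold rsub in Hu. rewrite Cmod_R in Hu. exact Hu.
Qed.

Lemma rcont_Cmod g t : rcont g t -> continuous (fun u => Cmod (g u)) t.
Proof.
intros H P [e HP]. destruct (H e (cond_pos e)) as [d [Hd H']].
exists (mkposreal d Hd). intros u Hu. apply HP.
assert (K : Cmod (g u - g t) < e) by (apply H'; unfold rsub; rewrite Cmod_R; exact Hu).
change (Rabs (Cmod (g u) - Cmod (g t)) < e).
apply Rabs_lt_between'.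
generalize (Cmod_triangle_inv (g u) (g t)) (Cmod_triangle_inv (g t) (g u)).
rewrite (Cmod_sub_sym (g t)). lra.
Qed.

Lemma rder_rcont g t l : rder g t l -> rcont g t.
Proof. apply eder_cont. Qed.

Lemma rder_iff g t l : rder g t l <-> is_derive (V := C_R_NormedModule) g t l.
Proof.
split.
- intros H. split.
  + apply (is_linear_scal_l (V := C_R_NormedModule)).
  + intros x Hx. apply (is_filter_lim_locally_unique (V := R_NormedModule)) in Hx. subst x.
    intros eps. destruct (H eps (cond_pos eps)) as [d [Hd H1]].
    exists (mkposreal d Hd). intros y Hy.
    assert (Hy' : Cmod (rsub y t) < d) by (unfold rsub; rewrite Cmod_R; exact Hy).
    specialize (H1 y Hy'). unfold rsub in H1. rewrite Cmod_R in H1.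
    change (norm (V := C_R_NormedModule) (Cminus (Cminus (g y) (g t)) (scal (V := C_R_NormedModule) (y - t)%R l)) <= eps * Rabs (y - t)).
    rewrite scal_R_Cmult, <- Cmod_norm, (Cmult_comm (RtoC (y - t))). exact H1.
- intros [_ H] e He. specialize (H t). destruct H with (eps := mkposreal e He) as [d Hd].
  { intros P HP; exact HP. }
  exists d. split; [apply cond_pos|]. intros y Hy. unfold rsub in *. rewrite Cmod_R in Hy |- *.
  specialize (Hd y Hy).
  change (norm (V := C_R_NormedModule) (Cminus (Cminus (g y) (g t)) (scal (V := C_R_NormedModule) (y - t)%R l)) <= e * Rabs (y - t)) in Hd.
  rewrite scal_R_Cmult, <- Cmod_norm, (Cmult_comm (RtoC (y - t))) in Hd. exact Hd.
Qed.

Lemma rder_RtoC (r : R -> R) t l : is_derive r t l -> rder (fun u => RtoC (r u)) t (RtoC l).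
Proof.
intros [_ H] e He. specialize (H t). destruct H with (eps := mkposreal e He) as [d Hd].
{ intros P HP; exact HP. }
exists d. split; [apply cond_pos|]. intros y Hy. unfold rsub in *. rewrite Cmod_R in Hy |- *.
specialize (Hd y Hy).
change (Rabs (r y - r t - (y - t) * l) <= e * Rabs (y - t)) in Hd.
rewrite <- RtoC_minus, <- RtoC_mult, <- RtoC_minus, Cmod_R, (Rmult_comm l). exact Hd.
Qed.

Lemma rder_re g t l : rder g t l -> is_derive (fun u => Re (g u)) t (Re l).
Proof.
intros H. split; [apply (is_linear_scal_l (V := R_NormedModule))|].
intros x Hx. apply (is_filter_lim_locally_unique (V := R_NormedModule)) in Hx. subst x.
intros eps. destruct (H eps (cond_pos eps)) as [d [Hd H1]].
exists (mkposreal d Hd). intros y Hy.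
assert (Hy' : Cmod (rsub y t) < d) by (unfold rsub; rewrite Cmod_R; exact Hy).
specialize (H1 y Hy'). unfold rsub in H1. rewrite (Cmod_R (y - t)) in H1.
change (Rabs (Re (g y) - Re (g t) - (y - t) * Re l) <= eps * Rabs (y - t)).
eapply Rle_trans; [|apply H1]. eapply Rle_trans; [|apply re_le_Cmod].
rewrite !re_sub, re_scal_r. right; f_equal; ring.
Qed.

Lemma rder_im g t l : rder g t l -> is_derive (fun u => Im (g u)) t (Im l).
Proof.
intros H. split; [apply (is_linear_scal_l (V := R_NormedModule))|].
intros x Hx. apply (is_filter_lim_locally_unique (V := R_NormedModule)) in Hx. subst x.
intros eps. destruct (H eps (cond_pos eps)) as [d [Hd H1]].
exists (mkposreal d Hd). intros y Hy.
assert (Hy' : Cmod (rsub y t) < d) by (unfold rsub; rewrite Cmod_R; exact Hy).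
specialize (H1 y Hy'). unfold rsub in H1. rewrite (Cmod_R (y - t)) in H1.
change (Rabs (Im (g y) - Im (g t) - (y - t) * Im l) <= eps * Rabs (y - t)).
eapply Rle_trans; [|apply H1]. eapply Rle_trans; [|apply im_le_Cmod].
rewrite !im_sub, im_scal_r. right; f_equal; ring.
Qed.

Lemma rder_pair g t l :
  is_derive (fun u => Re (g u)) t (Re l) -> is_derive (fun u => Im (g u)) t (Im l) -> rder g t l.
Proof.
intros H1 H2. apply eder_ext with (fun u => RtoC (Re (g u)) + Ci * RtoC (Im (g u))).
- intros u. apply C_ext; destruct (g u); simpl; ring.
- apply eder_eq with (RtoC (Re l) + Ci * RtoC (Im l)).
  { apply C_ext; destruct l; simpl; ring. }
  apply eder_plus; [|apply eder_scal]; apply rder_RtoC; auto.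
Qed.

Definition isI (f : R -> C) (a b : R) (l : C) : Prop := is_RInt (V := C_R_NormedModule) f a b l.
Definition CI (f : R -> C) (a b : R) : C := RInt (V := C_R_CompleteNormedModule) f a b.

Lemma isI_CI f a b l : isI f a b l -> CI f a b = l.
Proof. intros H. apply (is_RInt_unique (V := C_R_CompleteNormedModule) f a b l H). Qed.

Lemma isI_unique f a b l m : isI f a b l -> isI f a b m -> l = m.
Proof. intros H1 H2. rewrite <- (isI_CI _ _ _ _ H1). apply isI_CI; auto. Qed.

Lemma isI_re_im f a b l :
  isI f a b l <-> is_RInt (fun t => Re (f t)) a b (Re l) /\ is_RInt (fun t => Im (f t)) a b (Im l).
Proof.
split.
- intros H. split.
  + apply (is_RInt_fct_extend_fst (U := R_NormedModule) (V := R_NormedModule) f a b l H).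
  + apply (is_RInt_fct_extend_snd (U := R_NormedModule) (V := R_NormedModule) f a b l H).
- intros [H1 H2]. destruct l as [x y].
  apply (is_RInt_fct_extend_pair (U := R_NormedModule) (V := R_NormedModule) f a b x y H1 H2).
Qed.

Lemma isI_plus f g a b l m : isI f a b l -> isI g a b m -> isI (fun t => f t + g t) a b (l + m).
Proof. intros H1 H2. apply (is_RInt_plus (V := C_R_NormedModule) f g a b l m H1 H2). Qed.

Lemma isI_minus f g a b l m : isI f a b l -> isI g a b m -> isI (fun t => f t - g t) a b (l - m).
Proof. intros H1 H2. apply (is_RInt_minus (V := C_R_NormedModule) f g a b l m H1 H2). Qed.

Lemma is_RInt_scalR (f : R -> R) a b k l : is_RInt f a b l -> is_RInt (fun t => k * f t)%R a b (k * l)%R.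
Proof. intros H. apply (is_RInt_scal (V := R_NormedModule) f a b k l H). Qed.

Lemma isI_scal c f a b l : isI f a b l -> isI (fun t => c * f t) a b (c * l).
Proof.
intros H. apply isI_re_im in H. destruct H as [H1 H2]. apply isI_re_im. split.
- rewrite re_mult. apply (is_RInt_ext (fun t => (Re c * Re (f t) - Im c * Im (f t))%R)).
  { intros. rewrite re_mult. reflexivity. }
  apply (is_RInt_minus (V := R_NormedModule)); apply is_RInt_scalR; auto.
- rewrite im_mult. apply (is_RInt_ext (fun t => (Re c * Im (f t) + Im c * Re (f t))%R)).
  { intros. rewrite im_mult. reflexivity. }
  apply (is_RInt_plus (V := R_NormedModule)); apply is_RInt_scalR; auto.
Qed.

Lemma isI_scal_r c f a b l : isI f a b l -> isI (fun t => f t * c) a b (l * c).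
Proof.
intros H. rewrite Cmult_comm. replace (fun t => f t * c) with (fun t => c * f t).
- apply isI_scal; auto.
- extensionality t. ring.
Qed.

Lemma isI_ext f g a b l :
  (forall t, Rmin a b < t < Rmax a b -> f t = g t) -> isI f a b l -> isI g a b l.
Proof. intros H. apply is_RInt_ext. exact H. Qed.

Lemma isI_chasles f a b c l m : isI f a b l -> isI f b c m -> isI f a c (l + m).
Proof. intros H1 H2. apply (is_RInt_Chasles (V := C_R_NormedModule) f a b c l m H1 H2). Qed.

Lemma isI_swap f a b l : isI f a b l -> isI f b a (- l).
Proof. intros H. apply (is_RInt_swap (V := C_R_NormedModule) f b a l H). Qed.

Lemma isI_point f a : isI f a a 0.
Proof. apply (is_RInt_point (V := C_R_NormedModule)). Qed.

Lemma isI_const c a b : isI (fun _ => c) a b (RtoC (b - a) * c).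
Proof.
rewrite <- scal_R_Cmult. apply (is_RInt_const (V := C_R_NormedModule)).
Qed.

Lemma exI_cont f a b : (forall t, Rmin a b <= t <= Rmax a b -> rcont f t) -> isI f a b (CI f a b).
Proof.
intros H. apply (RInt_correct (V := C_R_CompleteNormedModule)).
apply (ex_RInt_continuous (V := C_R_CompleteNormedModule)). intros t Ht.
apply (proj1 (rcont_iff f t)). auto.
Qed.

Lemma isI_FTC F f a b :
  (forall t, Rmin a b <= t <= Rmax a b -> rder F t (f t)) ->
  (forall t, Rmin a b <= t <= Rmax a b -> rcont f t) -> isI f a b (F b - F a).
Proof.
intros H1 H2. apply (is_RInt_derive (V := C_R_CompleteNormedModule)).
- intros t Ht. apply (proj1 (rder_iff _ _ _)). auto.
- intros t Ht. apply (proj1 (rcont_iff f t)). auto.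
Qed.

Lemma isI_bound f a b l M : a <= b ->
  (forall t, a <= t <= b -> Cmod (f t) <= M) -> isI f a b l -> Cmod l <= (b - a) * M.
Proof.
intros Hab H HI. rewrite Cmod_norm.
apply (norm_RInt_le_const (V := C_R_NormedModule) f a b l M Hab); auto.
intros t Ht. rewrite <- Cmod_norm. auto.
Qed.

Lemma isI_bound_fun f (g : R -> R) a b l m : a <= b ->
  (forall t, a <= t <= b -> Cmod (f t) <= g t) -> isI f a b l -> is_RInt g a b m -> Cmod l <= m.
Proof.
intros Hab H HI HG. rewrite Cmod_norm.
apply (norm_RInt_le (V := C_R_NormedModule) f g a b l m Hab); auto.
intros t Ht. rewrite <- Cmod_norm. auto.
Qed.

(** * Goursat's theorem and primitives on open boxes *)

(** Open intervals, possibly unbounded, as predicates: together with [box] this one notion covers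
    the squares, strips and half-planes on which primitives are needed. *)
Definition oint (I : R -> Prop) : Prop :=
  (forall x y u, I x -> I y -> x <= u <= y -> I u) /\
  (forall x, I x -> exists d, 0 < d /\ forall y, Rabs (y - x) < d -> I y).

Definition box (I J : R -> Prop) (z : C) : Prop := I (Re z) /\ J (Im z).

Definition hol (U : C -> Prop) (f : C -> C) : Prop := forall z, U z -> exists l, cder f z l.

Definition copen (U : C -> Prop) : Prop :=
  forall z, U z -> exists d, 0 < d /\ forall y, Cmod (y - z) < d -> U y.

Lemma box_open I J : oint I -> oint J -> copen (box I J).
Proof.
intros [_ HI] [_ HJ] z [Hz1 Hz2]. destruct (HI _ Hz1) as [d1 [Hd1 H1]].
destruct (HJ _ Hz2) as [d2 [Hd2 H2]]. exists (Rmin d1 d2).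
split; [apply Rmin_case; auto|]. intros y Hy. split.
- apply H1. rewrite <- re_sub. eapply Rle_lt_trans; [apply re_le_Cmod|].
  eapply Rlt_le_trans; [apply Hy|apply Rmin_l].
- apply H2. rewrite <- im_sub. eapply Rle_lt_trans; [apply im_le_Cmod|].
  eapply Rlt_le_trans; [apply Hy|apply Rmin_r].
Qed.

Lemma oint_pos : oint (fun x => (0 < x)).
Proof.
split; [intros; lra|]. intros x Hx. exists x. split; auto. intros y Hy. apply Rabs_def2 in Hy. lra.
Qed.

Lemma oint_neg : oint (fun x => (x < 0)).
Proof.
split; [intros; lra|]. intros x Hx. exists (- x)%R. split; [lra|]. intros y Hy. apply Rabs_def2 in Hy. lra.
Qed.

Lemma oint_True : oint (fun _ => True).
Proof. split; auto. intros x _. exists 1%R. split; auto. lra. Qed.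

Lemma oint_between a b : oint (fun x => a < x < b).
Proof.
split; [intros; lra|]. intros x Hx. exists (Rmin (x - a) (b - x)). split; [apply Rmin_case; lra|].
intros y Hy. apply Rabs_def2 in Hy. assert (A := Rmin_l (x - a) (b - x)). assert (B := Rmin_r (x - a) (b - x)). lra.
Qed.

Lemma copen_re I : oint I -> copen (fun z => I (Re z)).
Proof. intros H z Hz. destruct (box_open I _ H oint_True z (conj Hz Logic.I)) as [d [Hd K]]. exists d. split; auto. intros y Hy. apply K; auto. Qed.

Lemma copen_im I : oint I -> copen (fun z => I (Im z)).
Proof. intros H z Hz. destruct (box_open _ I oint_True H z (conj Logic.I Hz)) as [d [Hd K]]. exists d. split; auto. intros y Hy. apply K; auto. Qed.

Lemma oint_minmax I x y u : oint I -> I x -> I y -> Rmin x y <= u <= Rmax x y -> I u.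
Proof.
intros [H _] Hx Hy Hu. destruct (Rle_dec x y).
- rewrite Rmin_left, Rmax_right in Hu by auto. apply (H x y); auto.
- rewrite Rmin_right, Rmax_left in Hu by lra. apply (H y x); auto.
Qed.

Lemma isI_bound_abs f a b l M :
  (forall t, Rmin a b <= t <= Rmax a b -> Cmod (f t) <= M) -> isI f a b l ->
  (Cmod l <= Rabs (b - a) * M).
Proof.
intros H HI. rewrite Cmod_norm.
apply (norm_RInt_le_const_abs (V := C_R_NormedModule) f a b l M); auto.
intros t Ht. rewrite <- Cmod_norm. auto.
Qed.

Lemma rder_hline (y : R) t : rder (fun x => (x, y)) t 1.
Proof. apply rder_pair; simpl; [apply (is_derive_id (K := R_AbsRing))|apply (is_derive_const (V := R_NormedModule))]. Qed.

Lemma rder_vline (x : R) t : rder (fun y => (x, y)) t Ci.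
Proof. apply rder_pair; simpl; [apply (is_derive_const (V := R_NormedModule))|apply (is_derive_id (K := R_AbsRing))]. Qed.

Lemma ccont_hline f (x y : R) : ccont f (x, y) -> rcont (fun t => f (t, y)) x.
Proof. intros H. apply econt_comp; auto. eapply rder_rcont, rder_hline. Qed.

Lemma ccont_vline f (x y : R) : ccont f (x, y) -> rcont (fun t => f (x, t)) y.
Proof. intros H. apply (econt_comp rsub f (fun t => (x, t))); auto. eapply rder_rcont, rder_vline. Qed.

Definition hseg (f : C -> C) (y x1 x2 : R) : C := CI (fun t => f (t, y)) x1 x2.
Definition vseg (f : C -> C) (x y1 y2 : R) : C := CI (fun t => f (x, t)) y1 y2.
Definition rect_int (f : C -> C) (x1 x2 y1 y2 : R) : C :=
  hseg f y1 x1 x2 + Ci * vseg f x2 y1 y2 - hseg f y2 x1 x2 - Ci * vseg f x1 y1 y2.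

Definition cont_rect (f : C -> C) (x1 x2 y1 y2 : R) : Prop :=
  forall x y, Rmin x1 x2 <= x <= Rmax x1 x2 -> Rmin y1 y2 <= y <= Rmax y1 y2 -> ccont f (x, y).

Lemma hseg_ok f x1 x2 y1 y2 y : cont_rect f x1 x2 y1 y2 -> Rmin y1 y2 <= y <= Rmax y1 y2 ->
  forall a b, Rmin x1 x2 <= a <= Rmax x1 x2 -> Rmin x1 x2 <= b <= Rmax x1 x2 ->
  isI (fun t => f (t, y)) a b (hseg f y a b).
Proof.
intros H Hy a b Ha Hb. apply exI_cont. intros t Ht. apply ccont_hline. apply H; auto.
split; [apply Rle_trans with (2 := proj1 Ht); apply Rmin_glb; lra|].
apply Rle_trans with (1 := proj2 Ht). apply Rmax_lub; lra.
Qed.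

Lemma vseg_ok f x1 x2 y1 y2 x : cont_rect f x1 x2 y1 y2 -> Rmin x1 x2 <= x <= Rmax x1 x2 ->
  forall a b, Rmin y1 y2 <= a <= Rmax y1 y2 -> Rmin y1 y2 <= b <= Rmax y1 y2 ->
  isI (fun t => f (x, t)) a b (vseg f x a b).
Proof.
intros H Hx a b Ha Hb. apply exI_cont. intros t Ht. apply ccont_vline. apply H; auto.
split; [apply Rle_trans with (2 := proj1 Ht); apply Rmin_glb; lra|].
apply Rle_trans with (1 := proj2 Ht). apply Rmax_lub; lra.
Qed.

Lemma Rmin_max_l x y : Rmin x y <= x <= Rmax x y.
Proof. split; [apply Rmin_l|apply Rmax_l]. Qed.
Lemma Rmin_max_r x y : Rmin x y <= y <= Rmax x y.
Proof. split; [apply Rmin_r|apply Rmax_r]. Qed.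

Lemma rect_split_x f x1 x2 y1 y2 m : cont_rect f x1 x2 y1 y2 -> Rmin x1 x2 <= m <= Rmax x1 x2 ->
  rect_int f x1 x2 y1 y2 = rect_int f x1 m y1 y2 + rect_int f m x2 y1 y2.
Proof.
intros H Hm. unfold rect_int.
pose proof (Rmin_max_l x1 x2). pose proof (Rmin_max_r x1 x2).
pose proof (Rmin_max_l y1 y2). pose proof (Rmin_max_r y1 y2).
assert (E : forall y, Rmin y1 y2 <= y <= Rmax y1 y2 -> hseg f y x1 x2 = hseg f y x1 m + hseg f y m x2).
{ intros y Hy. apply isI_CI. apply isI_chasles with m; eapply hseg_ok; eauto. }
rewrite !E by auto. ring.
Qed.

Lemma rect_split_y f x1 x2 y1 y2 m : cont_rect f x1 x2 y1 y2 -> Rmin y1 y2 <= m <= Rmax y1 y2 ->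
  rect_int f x1 x2 y1 y2 = rect_int f x1 x2 y1 m + rect_int f x1 x2 m y2.
Proof.
intros H Hm. unfold rect_int.
pose proof (Rmin_max_l x1 x2). pose proof (Rmin_max_r x1 x2).
pose proof (Rmin_max_l y1 y2). pose proof (Rmin_max_r y1 y2).
assert (E : forall x, Rmin x1 x2 <= x <= Rmax x1 x2 -> vseg f x y1 y2 = vseg f x y1 m + vseg f x m y2).
{ intros x Hx. apply isI_CI. apply isI_chasles with m; eapply vseg_ok; eauto. }
rewrite !E by auto. ring.
Qed.

Lemma rect_bound f x1 x2 y1 y2 M : cont_rect f x1 x2 y1 y2 ->
  (forall x y, Rmin x1 x2 <= x <= Rmax x1 x2 -> Rmin y1 y2 <= y <= Rmax y1 y2 -> Cmod (f (x, y)) <= M) ->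
  (Cmod (rect_int f x1 x2 y1 y2) <= 2 * (Rabs (x2 - x1) + Rabs (y2 - y1)) * M).
Proof.
intros H HM. unfold rect_int.
pose proof (Rmin_max_l x1 x2). pose proof (Rmin_max_r x1 x2).
pose proof (Rmin_max_l y1 y2). pose proof (Rmin_max_r y1 y2).
assert (Eh : forall y, Rmin y1 y2 <= y <= Rmax y1 y2 -> Cmod (hseg f y x1 x2) <= Rabs (x2 - x1) * M).
{ intros y Hy. eapply isI_bound_abs; [|eapply hseg_ok; eauto]. intros; apply HM; auto. }
assert (Ev : forall x, Rmin x1 x2 <= x <= Rmax x1 x2 -> Cmod (vseg f x y1 y2) <= Rabs (y2 - y1) * M).
{ intros y Hy. eapply isI_bound_abs; [|eapply vseg_ok; eauto]. intros; apply HM; auto. }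
eapply Rle_trans; [apply Cmod_triangle_sub|].
eapply Rle_trans; [apply Rplus_le_compat_r, Cmod_triangle_sub|].
eapply Rle_trans; [apply Rplus_le_compat_r, Rplus_le_compat_r, Cmod_triangle|].
rewrite !Cmod_mult, !Cmod_Ci.
generalize (Eh _ H2) (Eh _ H3) (Ev _ H0) (Ev _ H1). lra.
Qed.

Lemma rect_primitive F f x1 x2 y1 y2 : cont_rect f x1 x2 y1 y2 ->
  (forall x y, Rmin x1 x2 <= x <= Rmax x1 x2 -> Rmin y1 y2 <= y <= Rmax y1 y2 -> cder F (x, y) (f (x, y))) ->
  rect_int f x1 x2 y1 y2 = 0.
Proof.
intros H HF. unfold rect_int.
pose proof (Rmin_max_l x1 x2). pose proof (Rmin_max_r x1 x2).
pose proof (Rmin_max_l y1 y2). pose proof (Rmin_max_r y1 y2).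
assert (Eh : forall y, Rmin y1 y2 <= y <= Rmax y1 y2 -> hseg f y x1 x2 = F (x2, y) - F (x1, y)).
{ intros y Hy. apply isI_CI. apply (isI_FTC (fun t => F (t, y))).
  - intros t Ht. apply eder_eq with (f (t, y) * 1); [ring|].
    apply (eder_comp rsub F (fun t => (t, y))); [apply HF; auto|apply rder_hline].
  - intros t Ht. apply ccont_hline; auto. }
assert (Ev : forall x, Rmin x1 x2 <= x <= Rmax x1 x2 -> Ci * vseg f x y1 y2 = F (x, y2) - F (x, y1)).
{ intros x Hx. transitivity (CI (fun t => Ci * f (x, t)) y1 y2).
  - symmetry. apply isI_CI. apply isI_scal. eapply vseg_ok; eauto.
  - apply isI_CI. apply (isI_FTC (fun t => F (x, t))).
    + intros t Ht. apply eder_eq with (f (x, t) * Ci); [ring|].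
      apply (eder_comp rsub F (fun t => (x, t))); [apply HF; auto|apply rder_vline].
    + intros t Ht. apply econt_mult; [apply econt_const|]. apply ccont_vline; auto. }
rewrite !Eh, !Ev by auto. ring.
Qed.

Lemma rect_int_minus f g x1 x2 y1 y2 : cont_rect f x1 x2 y1 y2 -> cont_rect g x1 x2 y1 y2 ->
  rect_int (fun z => f z - g z) x1 x2 y1 y2 = rect_int f x1 x2 y1 y2 - rect_int g x1 x2 y1 y2.
Proof.
intros Hf Hg. unfold rect_int.
pose proof (Rmin_max_l x1 x2). pose proof (Rmin_max_r x1 x2).
pose proof (Rmin_max_l y1 y2). pose proof (Rmin_max_r y1 y2).
assert (Eh : forall y, Rmin y1 y2 <= y <= Rmax y1 y2 -> hseg (fun z => f z - g z) y x1 x2 = hseg f y x1 x2 - hseg g y x1 x2).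
{ intros y Hy. apply isI_CI. apply (isI_minus (fun t => f (t, y)) (fun t => g (t, y))); eapply hseg_ok; eauto. }
assert (Ev : forall x, Rmin x1 x2 <= x <= Rmax x1 x2 -> vseg (fun z => f z - g z) x y1 y2 = vseg f x y1 y2 - vseg g x y1 y2).
{ intros x Hx. apply isI_CI. apply (isI_minus (fun t => f (x, t)) (fun t => g (x, t))); eapply vseg_ok; eauto. }
rewrite !Eh, !Ev by auto. ring.
Qed.

Lemma RtoC_neq (x : R) : x <> 0%R -> RtoC x <> 0.
Proof. intros H E. apply H. apply RtoC_inj; auto. Qed.

(** Nested intervals: every left end lies below every right end, so the supremum of the left ends is
    a common point. *)
Lemma halving_limit (u : nat -> R) a :
  (0 <= a) -> (forall k, (u k <= u (S k) /\ u (S k) + a / 2 ^ S k <= u k + a / 2 ^ k)%R) ->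
  exists c, forall k, u k <= c <= u k + a / 2 ^ k.
Proof.
intros Ha H.
assert (P : forall k, 0 <= a / 2 ^ k).
{ intros. apply Rmult_le_pos; auto. left. apply Rinv_0_lt_compat, pow_lt; lra. }
assert (M1 : forall m k, u k <= u (m + k)%nat).
{ induction m; intros; simpl; [lra|]. eapply Rle_trans; [apply IHm|]. apply H. }
assert (M2 : forall m k, u (m + k)%nat + a / 2 ^ (m + k) <= u k + a / 2 ^ k).
{ induction m; intros; [simpl; lra|]. eapply Rle_trans; [|apply IHm]. apply H. }
assert (M3 : forall m k, u m <= u k + a / 2 ^ k).
{ intros m k. destruct (Nat.le_ge_cases m k).
  - replace k with ((k - m) + m)%nat by lia. apply Rle_trans with (u (k - m + m)%nat); [apply M1|].
    generalize (P (k - m + m)%nat). lra.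
  - specialize (M2 (m - k)%nat k). replace (m - k + k)%nat with m in M2 by lia. generalize (P m). lra. }
destruct (completeness (fun x => exists k, x = u k)) as [c [Hc1 Hc2]].
- exists (u O + a / 2 ^ 0)%R. intros x [k ->]. apply M3.
- exists (u O), O. reflexivity.
- exists c. intros k. split; [apply Hc1; exists k; auto|]. apply Hc2. intros x [m ->]. apply M3.
Qed.

Section Goursat.
Context (f : C -> C) (a b : R) (Ha : 0 <= a) (Hb : 0 <= b).

Let Q (k : nat) (p : R * R) : R :=
  Cmod (rect_int f (fst p) (fst p + a / 2 ^ k) (snd p) (snd p + b / 2 ^ k)).

(** One bisection step, acting on lower left corners. The first quarter whose integral has at least
    a quarter of the modulus is kept; when three quarters fail the test, the triangle inequality
    forces the last one, which is therefore not tested. *)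
Let next (k : nat) (p : R * R) : R * R :=
  let x := fst p in let y := snd p in
  let x' := (x + a / 2 ^ S k)%R in let y' := (y + b / 2 ^ S k)%R in
  if Rle_dec (Q k p / 4) (Q (S k) (x, y)) then (x, y) else
  if Rle_dec (Q k p / 4) (Q (S k) (x', y)) then (x', y) else
  if Rle_dec (Q k p / 4) (Q (S k) (x, y')) then (x, y') else (x', y').

Let sq (p0 : R * R) := fix sq k := match k with O => p0 | S k => next k (sq k) end.

Lemma goursat_aux x0 y0 :
  (forall x y, x0 <= x <= x0 + a -> y0 <= y <= y0 + b -> exists l, cder f (x, y) l) ->
  rect_int f x0 (x0 + a) y0 (y0 + b) = 0.
Proof.
intros Hf.
set (p := sq (x0, y0)).
assert (P2 : forall k, 0 < 2 ^ k) by (intros; apply pow_lt; lra).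
assert (HS : forall c k, (c / 2 ^ k = c / 2 ^ S k + c / 2 ^ S k)%R).
{ intros. simpl. field. apply Rgt_not_eq, P2. }
assert (Pos : forall c k, 0 <= c -> 0 <= c / 2 ^ k).
{ intros. apply Rmult_le_pos; auto. left. apply Rinv_0_lt_compat; auto. }
assert (Step : forall k, (fst (p (S k)) = fst (p k) \/ fst (p (S k)) = fst (p k) + a / 2 ^ S k)%R
   /\ (snd (p (S k)) = snd (p k) \/ snd (p (S k)) = snd (p k) + b / 2 ^ S k)%R).
{ intros k. change (p (S k)) with (next k (p k)). unfold next.
  repeat destruct Rle_dec; simpl; auto. }
assert (Nx : forall k, (fst (p k) <= fst (p (S k)) /\ fst (p (S k)) + a / 2 ^ S k <= fst (p k) + a / 2 ^ k)%R).
{ intros k. generalize (proj1 (Step k)) (HS a k) (Pos a (S k) Ha). intros [->| ->]; lra. }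
assert (Ny : forall k, (snd (p k) <= snd (p (S k)) /\ snd (p (S k)) + b / 2 ^ S k <= snd (p k) + b / 2 ^ k)%R).
{ intros k. generalize (proj2 (Step k)) (HS b k) (Pos b (S k) Hb). intros [->| ->]; lra. }
destruct (halving_limit (fun k => fst (p k)) a Ha Nx) as [cx Hcx].
destruct (halving_limit (fun k => snd (p k)) b Hb Ny) as [cy Hcy].
assert (Inx : forall k, (x0 <= fst (p k) /\ fst (p k) + a / 2 ^ k <= x0 + a)%R).
{ induction k; [simpl; lra|]. generalize (Nx k). lra. }
assert (Iny : forall k, (y0 <= snd (p k) /\ snd (p k) + b / 2 ^ k <= y0 + b)%R).
{ induction k; [simpl; lra|]. generalize (Ny k). lra. }
assert (Cont : forall k, cont_rect f (fst (p k)) (fst (p k) + a / 2 ^ k) (snd (p k)) (snd (p k) + b / 2 ^ k)).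
{ intros k x y Hx Hy. generalize (Pos a k Ha) (Pos b k Hb) (Inx k) (Iny k). intros.
  rewrite Rmin_left, Rmax_right in Hx by lra. rewrite Rmin_left, Rmax_right in Hy by lra.
  destruct (Hf x y) as [l Hl]; [lra|lra|]. eapply eder_cont; eauto. }
assert (Big : forall k, Q k (p k) <= 4 * Q (S k) (p (S k))).
{ intros k.
  generalize (Pos a (S k) Ha) (Pos b (S k) Hb) (HS a k) (HS b k). intros.
  assert (E : rect_int f (fst (p k)) (fst (p k) + a / 2 ^ k) (snd (p k)) (snd (p k) + b / 2 ^ k)
    = rect_int f (fst (p k)) (fst (p k) + a / 2 ^ S k) (snd (p k)) (snd (p k) + b / 2 ^ S k)
    + rect_int f (fst (p k)) (fst (p k) + a / 2 ^ S k) (snd (p k) + b / 2 ^ S k) (snd (p k) + b / 2 ^ S k + b / 2 ^ S k)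
    + (rect_int f (fst (p k) + a / 2 ^ S k) (fst (p k) + a / 2 ^ S k + a / 2 ^ S k) (snd (p k)) (snd (p k) + b / 2 ^ S k)
    + rect_int f (fst (p k) + a / 2 ^ S k) (fst (p k) + a / 2 ^ S k + a / 2 ^ S k)  (snd (p k) + b / 2 ^ S k) (snd (p k) + b / 2 ^ S k + b / 2 ^ S k))).
  { assert (Ck := Cont k).
    replace (fst (p k) + a / 2 ^ k)%R with (fst (p k) + a / 2 ^ S k + a / 2 ^ S k)%R in * by lra.
    replace (snd (p k) + b / 2 ^ k)%R with (snd (p k) + b / 2 ^ S k + b / 2 ^ S k)%R in * by lra.
    rewrite (rect_split_x _ _ _ _ _ (fst (p k) + a / 2 ^ S k)%R Ck).
    2:{ rewrite Rmin_left, Rmax_right; lra. }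
    f_equal; apply rect_split_y; try (rewrite Rmin_left, Rmax_right; lra);
    intros x y Hx Hy; apply Ck; auto; rewrite Rmin_left, Rmax_right in * by lra; lra. }
  assert (T : Q k (p k) <= Q (S k) (fst (p k), snd (p k)) + Q (S k) (fst (p k), snd (p k) + b / 2 ^ S k)%R
      + (Q (S k) (fst (p k) + a / 2 ^ S k, snd (p k))%R + Q (S k) (fst (p k) + a / 2 ^ S k, snd (p k) + b / 2 ^ S k)%R)).
  { unfold Q at 1. rewrite E. eapply Rle_trans; [apply Cmod_triangle|].
    apply Rplus_le_compat; apply Cmod_triangle. }
  change (p (S k)) with (next k (p k)). unfold next. cbv zeta.
  repeat destruct Rle_dec; lra. }
assert (Small : forall k, Q 0%nat (p 0%nat) <= 4 ^ k * Q k (p k)).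
{ induction k; [simpl; lra|]. eapply Rle_trans; [apply IHk|]. simpl (4 ^ S k)%R.
  rewrite (Rmult_comm 4), Rmult_assoc. apply Rmult_le_compat_l; [apply pow_le; lra|apply Big]. }
assert (E0 : rect_int f x0 (x0 + a) y0 (y0 + b) =
  rect_int f (fst (p 0%nat)) (fst (p 0%nat) + a / 2 ^ 0) (snd (p 0%nat)) (snd (p 0%nat) + b / 2 ^ 0)).
{ unfold p, sq, fst, snd. repeat f_equal; simpl; lra. }
rewrite E0. apply Cmod_le_eps_0. intros e He.
change (Q 0%nat (p 0%nat) <= e).
(* At stage k the remainder times the perimeter is at most
   [e / S2 * (2 * (a + b) * (a + b)) / 4 ^ k], and the factor [4 ^ k] lost by bisection cancels. The
   summand 1 keeps [S2] positive for a degenerate rectangle. *)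
set (S2 := (2 * (a + b) * (a + b) + 1)%R).
assert (HS2 : 1 <= S2) by (unfold S2; nra).
destruct (Hf cx cy) as [l Hl].
{ generalize (Hcx O) (Inx O). simpl. lra. }
{ generalize (Hcy O) (Iny O). simpl. lra. }
destruct (Hl (e / S2)%R) as [d [Hd Hl']]; [apply Rdiv_lt_0_compat; lra|].
assert (Hk : exists k, a / 2 ^ k + b / 2 ^ k < d).
{ destruct (pow_lt_1_zero (1/2)) with (y := (d / (a + b + 1))%R) as [N HN].
  - rewrite Rabs_pos_eq; lra.
  - apply Rdiv_lt_0_compat; lra.
  - exists N. specialize (HN N (le_n _)). rewrite Rabs_pos_eq in HN by (apply pow_le; lra).
    apply Rlt_div_r in HN; [|lra].
    replace (a / 2 ^ N + b / 2 ^ N)%R with ((1/2) ^ N * (a + b))%R.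
    + assert (0 < (1/2)^N) by (apply pow_lt; lra). lra.
    + unfold Rdiv at 1. rewrite Rmult_1_l, pow_inv. field. apply Rgt_not_eq, P2. }
destruct Hk as [k Hk].
generalize (Pos a k Ha) (Pos b k Hb) (Hcx k) (Hcy k). intros.
(* The affine part has a quadratic primitive and integrates to 0, so only the remainder [g]
   contributes. *)
set (g := fun z => f z - (f (cx, cy) + l * (z - (cx, cy)))).
assert (Cl : cont_rect (fun z => f (cx, cy) + l * (z - (cx, cy))) (fst (p k)) (fst (p k) + a / 2 ^ k) (snd (p k)) (snd (p k) + b / 2 ^ k)).
{ intros x y _ _. apply econt_plus; [apply econt_const|]. apply econt_mult; [apply econt_const|].
  apply econt_minus; [apply ccont_id|apply econt_const]. }
assert (E1 : rect_int f (fst (p k)) (fst (p k) + a / 2 ^ k) (snd (p k)) (snd (p k) + b / 2 ^ k)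
   = rect_int g (fst (p k)) (fst (p k) + a / 2 ^ k) (snd (p k)) (snd (p k) + b / 2 ^ k)).
{ unfold g. rewrite rect_int_minus; auto.
  rewrite (rect_primitive (fun z => f (cx, cy) * z + l / 2 * ((z - (cx, cy)) * (z - (cx, cy)))) (fun z => f (cx, cy) + l * (z - (cx, cy)))); auto.
  - ring.
  - intros x y _ _.
    eapply eder_eq; [|apply eder_plus; [apply eder_scal, cder_id|apply eder_scal, eder_mult; apply eder_minus; try apply cder_id; apply eder_const]].
    cbn beta; field. }
assert (B : Q k (p k) <= 2 * (a / 2 ^ k + b / 2 ^ k) * (e / S2 * (a / 2 ^ k + b / 2 ^ k))).
{ unfold Q. rewrite E1.
  eapply Rle_trans; [apply rect_bound with (M := (e / S2 * (a / 2 ^ k + b / 2 ^ k))%R)|].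
  3:{ replace (fst (p k) + a / 2 ^ k - fst (p k))%R with (a / 2 ^ k)%R by ring.
      replace (snd (p k) + b / 2 ^ k - snd (p k))%R with (b / 2 ^ k)%R by ring.
      rewrite !Rabs_pos_eq by auto. lra. }
  - intros x y Hx Hy. exact (econt_minus _ _ _ _ (Cont k x y Hx Hy) (Cl x y Hx Hy)).
  - intros x y Hx Hy. rewrite Rmin_left, Rmax_right in Hx by lra. rewrite Rmin_left, Rmax_right in Hy by lra. unfold g.
    assert (D : Cmod ((x, y) - (cx, cy)) <= a / 2 ^ k + b / 2 ^ k).
    { eapply Rle_trans; [apply Cmod_le_re_im|]. rewrite re_sub, im_sub. unfold Re, Im, fst, snd.
      apply Rplus_le_compat; apply Rabs_le; lra. }
    replace (f (x, y) - (f (cx, cy) + l * ((x, y) - (cx, cy)))) with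
      (f (x, y) - f (cx, cy) - l * ((x, y) - (cx, cy))) by ring.
    eapply Rle_trans; [apply Hl'; lra|]. apply Rmult_le_compat_l; auto.
    left. apply Rdiv_lt_0_compat; lra. }
eapply Rle_trans; [apply (Small k)|].
apply Rle_trans with (4 ^ k * (2 * (a / 2 ^ k + b / 2 ^ k) * (e / S2 * (a / 2 ^ k + b / 2 ^ k))))%R.
{ apply Rmult_le_compat_l; auto. apply pow_le; lra. }
replace (4 ^ k * (2 * (a / 2 ^ k + b / 2 ^ k) * (e / S2 * (a / 2 ^ k + b / 2 ^ k))))%R
  with (e / S2 * (2 * (a + b) * (a + b)))%R.
- apply Rle_trans with (e / S2 * S2)%R; [|right; field; lra].
  apply Rmult_le_compat_l; [left; apply Rdiv_lt_0_compat; lra|unfold S2; lra].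
- replace 4%R with (2 * 2)%R by ring. rewrite Rpow_mult_distr. field. split; try (apply Rgt_not_eq, P2); apply Rgt_not_eq; lra.
Qed.
End Goursat.

Lemma goursat f x1 x2 y1 y2 :
  (forall x y, Rmin x1 x2 <= x <= Rmax x1 x2 -> Rmin y1 y2 <= y <= Rmax y1 y2 -> exists l, cder f (x, y) l) ->
  rect_int f x1 x2 y1 y2 = 0.
Proof.
intros Hf.
assert (Cont : cont_rect f x1 x2 y1 y2).
{ intros x y Hx Hy. destruct (Hf x y Hx Hy). eapply eder_cont; eauto. }
assert (Sw : forall x1 x2 y1 y2, x1 <= x2 -> y1 <= y2 ->
   (forall x y, x1 <= x <= x2 -> y1 <= y <= y2 -> exists l, cder f (x, y) l) -> rect_int f x1 x2 y1 y2 = 0).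
{ clear. intros x1 x2 y1 y2 H1 H2 H.
  replace x2 with (x1 + (x2 - x1))%R by ring. replace y2 with (y1 + (y2 - y1))%R by ring.
  apply goursat_aux; try lra. intros; apply H; lra. }
pose proof (Rmin_max_l x1 x2). pose proof (Rmin_max_r x1 x2).
pose proof (Rmin_max_l y1 y2). pose proof (Rmin_max_r y1 y2).
assert (Hx : forall y, Rmin y1 y2 <= y <= Rmax y1 y2 -> hseg f y x2 x1 = - hseg f y x1 x2).
{ intros y Hy. apply isI_CI, isI_swap. eapply hseg_ok; eauto. }
assert (Hy : forall x, Rmin x1 x2 <= x <= Rmax x1 x2 -> vseg f x y2 y1 = - vseg f x y1 y2).
{ intros x Hx'. apply isI_CI, isI_swap. eapply vseg_ok; eauto. }
destruct (Rle_dec x1 x2), (Rle_dec y1 y2).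
- apply Sw; auto. intros; apply Hf; rewrite ?Rmin_left, ?Rmax_right by lra; lra.
- assert (E : rect_int f x1 x2 y1 y2 = - rect_int f x1 x2 y2 y1) by (unfold rect_int; rewrite !Hy by auto; ring).
  rewrite E, Sw; [ring|lra|lra|].
  intros; apply Hf; rewrite ?(Rmin_left x1), ?(Rmax_right x1), ?(Rmin_right y1), ?(Rmax_left y1) by lra; lra.
- assert (E : rect_int f x1 x2 y1 y2 = - rect_int f x2 x1 y1 y2) by (unfold rect_int; rewrite !Hx by auto; ring).
  rewrite E, Sw; [ring|lra|lra|].
  intros; apply Hf; rewrite ?(Rmin_right x1), ?(Rmax_left x1), ?(Rmin_left y1), ?(Rmax_right y1) by lra; lra.
- assert (E : rect_int f x1 x2 y1 y2 = rect_int f x2 x1 y2 y1) by (unfold rect_int; rewrite !Hx, !Hy by auto; ring).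
  rewrite E, Sw; [ring|lra|lra|].
  intros; apply Hf; rewrite ?(Rmin_right x1), ?(Rmax_left x1), ?(Rmin_right y1), ?(Rmax_left y1) by lra; lra.
Qed.

(** The primitive integrates along a horizontal and then a vertical segment. Vanishing over
    rectangles turns its increment from z to y into an integral of the same shape starting at z,
    which continuity of f then estimates. Assuming the vanishing, rather than holomorphy, lets the
    result serve for punctured boxes and for uniform limits. *)
Lemma morera I J f : oint I -> oint J -> (forall z, box I J z -> ccont f z) ->
  (forall x1 x2 y1 y2, I x1 -> I x2 -> J y1 -> J y2 -> rect_int f x1 x2 y1 y2 = 0) ->
  forall z0, box I J z0 -> exists F : C -> C, F z0 = 0 /\ forall z, box I J z -> cder F z (f z).
Proof.
intros HI HJ Cf Hf z0 Hz0.
set (F := fun z => hseg f (Im z0) (Re z0) (Re z) + Ci * vseg f (Re z) (Im z0) (Im z)).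
assert (CR : forall x1 x2 y1 y2, I x1 -> I x2 -> J y1 -> J y2 -> cont_rect f x1 x2 y1 y2).
{ intros x1 x2 y1 y2 H1 H2 H3 H4 x y Hx Hy. apply Cf.
  split; [apply (oint_minmax I x1 x2)|apply (oint_minmax J y1 y2)]; auto. }
assert (D : forall z y, box I J z -> box I J y ->
   F y - F z = hseg f (Im z) (Re z) (Re y) + Ci * vseg f (Re y) (Im z) (Im y)).
{ intros z y [Hz1 Hz2] [Hy1 Hy2]. destruct Hz0 as [H01 H02]. unfold F.
  assert (E1 : hseg f (Im z0) (Re z0) (Re y) = hseg f (Im z0) (Re z0) (Re z) + hseg f (Im z0) (Re z) (Re y)).
  { apply isI_CI. apply isI_chasles with (Re z);
    [apply (hseg_ok f (Re z0) (Re z) (Im z0) (Im z0))|apply (hseg_ok f (Re z) (Re y) (Im z0) (Im z0))];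
      auto using Rmin_max_l, Rmin_max_r. }
  assert (E2 : vseg f (Re y) (Im z0) (Im y) = vseg f (Re y) (Im z0) (Im z) + vseg f (Re y) (Im z) (Im y)).
  { apply isI_CI. apply isI_chasles with (Im z);
    [apply (vseg_ok f (Re y) (Re y) (Im z0) (Im z))|apply (vseg_ok f (Re y) (Re y) (Im z) (Im y))];
      auto using Rmin_max_l, Rmin_max_r. }
  assert (E3 : rect_int f (Re z) (Re y) (Im z0) (Im z) = 0).
  { apply Hf; auto. }
  unfold rect_int in E3. rewrite E1, E2.
  replace (hseg f (Im z) (Re z) (Re y)) with (hseg f (Im z) (Re z) (Re y) + 0) by ring.
  rewrite <- E3. ring. }
exists F. split.
{ unfold F, hseg, vseg. rewrite (isI_CI _ _ _ _ (isI_point _ _)), (isI_CI _ _ _ _ (isI_point _ _)). ring. }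
intros z Hz e He.
destruct (Cf z Hz (e / 2)%R) as [d1 [Hd1 H1]]; [lra|].
destruct (box_open I J HI HJ z Hz) as [d2 [Hd2 H2]].
exists (Rmin d1 d2 / 2)%R. assert (Hm : 0 < Rmin d1 d2) by (apply Rmin_case; lra). split; [lra|].
intros y Hy. assert (Hby : box I J y).
{ apply H2. generalize (Rmin_r d1 d2). lra. }
rewrite D by auto. destruct Hz as [Hz1 Hz2]. destruct Hby as [Hy1 Hy2].
assert (K : forall u v, Rmin (Re z) (Re y) <= u <= Rmax (Re z) (Re y) -> Rmin (Im z) (Im y) <= v <= Rmax (Im z) (Im y) ->
   (Cmod (f (u, v) - f z) <= e / 2)).
{ intros u v Hu Hv. left. apply H1. eapply Rle_lt_trans; [apply Cmod_le_re_im|].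
  rewrite re_sub, im_sub. simpl.
  assert (Rabs (u - Re z) <= Cmod (y - z)).
  { apply Rle_trans with (2 := re_le_Cmod _). rewrite re_sub.
    unfold Rmin, Rmax in Hu. destruct Rle_dec; [rewrite !Rabs_pos_eq|rewrite !Rabs_left1]; lra. }
  assert (Rabs (v - Im z) <= Cmod (y - z)).
  { apply Rle_trans with (2 := im_le_Cmod _). rewrite im_sub.
    unfold Rmin, Rmax in Hv. destruct Rle_dec; [rewrite !Rabs_pos_eq|rewrite !Rabs_left1]; lra. }
  generalize (Rmin_l d1 d2). lra. }
assert (Bh : Cmod (hseg f (Im z) (Re z) (Re y) - RtoC (Re y - Re z) * f z) <= Rabs (Re y - Re z) * (e / 2)).
{ eapply isI_bound_abs; [|apply (isI_minus (fun t => f (t, Im z)) (fun _ => f z)); [|apply isI_const]].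
  - intros t Ht. apply K; auto using Rmin_max_l.
  - eapply hseg_ok; [apply (CR (Re z) (Re y) (Im z) (Im z)); auto| | |]; auto using Rmin_max_l, Rmin_max_r. }
assert (Bv : Cmod (vseg f (Re y) (Im z) (Im y) - RtoC (Im y - Im z) * f z) <= Rabs (Im y - Im z) * (e / 2)).
{ eapply isI_bound_abs; [|apply (isI_minus (fun t => f (Re y, t)) (fun _ => f z)); [|apply isI_const]].
  - intros t Ht. apply K; auto using Rmin_max_r.
  - eapply vseg_ok; [apply (CR (Re y) (Re y) (Im z) (Im y)); auto| | |]; auto using Rmin_max_l, Rmin_max_r. }
replace (hseg f (Im z) (Re z) (Re y) + Ci * vseg f (Re y) (Im z) (Im y) - f z * (y - z)) with
 ((hseg f (Im z) (Re z) (Re y) - RtoC (Re y - Re z) * f z) + Ci * (vseg f (Re y) (Im z) (Im y) - RtoC (Im y - Im z) * f z)).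
- eapply Rle_trans; [apply Cmod_triangle|]. rewrite Cmod_mult, Cmod_Ci.
  generalize (re_le_Cmod (y - z)) (im_le_Cmod (y - z)). rewrite re_sub, im_sub. intros. nra.
- assert (Ez : y - z = RtoC (Re y - Re z) + Ci * RtoC (Im y - Im z)).
  { apply C_ext; destruct y, z; simpl; ring. }
  rewrite Ez. ring.
Qed.

(** The rectangle is cut into three: a copy shrunk by a factor t at the exceptional corner and two
    rectangles that avoid this corner. The latter contribute 0, and the small one at most its
    perimeter times a local bound of f. *)
Lemma goursat_corner f p1 p2 x y :
  (forall u v, Rmin p1 x <= u <= Rmax p1 x -> Rmin p2 y <= v <= Rmax p2 y ->
     ccont f (u, v) /\ ((u, v) <> (p1, p2) -> exists l, cder f (u, v) l)) ->
  rect_int f p1 x p2 y = 0.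
Proof.
intros H.
assert (Cont : cont_rect f p1 x p2 y) by (intros u v Hu Hv; apply H; auto).
destruct (H p1 p2) as [C0 _]; auto using Rmin_max_l.
destruct (C0 1%R) as [d [Hd HB]]; [lra|].
apply Cmod_le_eps_0. intros e He.
set (M := (Cmod (f (p1, p2)) + 1)%R).
assert (HM : 1 <= M) by (unfold M; generalize (Cmod_ge_0 (f (p1, p2))); lra).
set (K := (Rabs (x - p1) + Rabs (y - p2) + 1)%R).
assert (HK : 1 <= K) by (unfold K; generalize (Rabs_pos (x - p1)) (Rabs_pos (y - p2)); lra).
(* The three bounds keep the small rectangle inside the large one, inside the disc where |f| is at
   most [M], and make perimeter times [M] at most e. *)
set (t := Rmin 1 (Rmin (d / (2 * K)) (e / (4 * K * M)))%R).
assert (Ht : 0 < t).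
{ unfold t. repeat apply Rmin_case; [lra| |]; apply Rdiv_lt_0_compat; nra. }
assert (Ht1 : t <= 1) by apply Rmin_l.
assert (Htd : t * (2 * K) <= d).
{ apply Rle_trans with (d / (2 * K) * (2 * K))%R; [|right; field; lra].
  apply Rmult_le_compat_r; [lra|]. eapply Rle_trans; [apply Rmin_r|apply Rmin_l]. }
assert (Hte : t * (4 * K * M) <= e).
{ apply Rle_trans with (e / (4 * K * M) * (4 * K * M))%R; [|right; field; lra].
  apply Rmult_le_compat_r; [nra|]. eapply Rle_trans; [apply Rmin_r|apply Rmin_r]. }
set (x' := (p1 + t * (x - p1))%R). set (y' := (p2 + t * (y - p2))%R).
assert (Hx' : Rmin p1 x <= x' <= Rmax p1 x).
{ unfold x', Rmin, Rmax. destruct Rle_dec; nra. }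
assert (Hy' : Rmin p2 y <= y' <= Rmax p2 y).
{ unfold y', Rmin, Rmax. destruct Rle_dec; nra. }
assert (SubR : forall a b m u, Rmin a b <= m <= Rmax a b -> Rmin a m <= u <= Rmax a m -> Rmin a b <= u <= Rmax a b).
{ clear. intros a b m u. unfold Rmin, Rmax. repeat destruct Rle_dec; lra. }
assert (SubR2 : forall a b m u, Rmin a b <= m <= Rmax a b -> Rmin m b <= u <= Rmax m b -> Rmin a b <= u <= Rmax a b).
{ clear. intros a b m u. unfold Rmin, Rmax. repeat destruct Rle_dec; lra. }
rewrite (rect_split_x _ _ _ _ _ x') by auto.
assert (Cont1 : cont_rect f p1 x' p2 y).
{ intros u v Hu Hv. apply Cont; auto. eapply SubR; eauto. }
rewrite (rect_split_y f p1 x' p2 y y') by auto.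
assert (Z1 : rect_int f x' x p2 y = 0).
{ destruct (Req_dec x p1) as [->|Hne].
  - unfold x'. replace (p1 + t * (p1 - p1))%R with p1 by ring. unfold rect_int, hseg.
    rewrite !(isI_CI _ _ _ _ (isI_point _ _)). ring.
  - apply goursat. intros u v Hu Hv. destruct (H u v) as [_ H']; eauto.
    apply H'. intros E. injection E as E1 E2. subst u.
    unfold x', Rmin, Rmax in Hu. destruct Rle_dec; nra. }
assert (Z2 : rect_int f p1 x' y' y = 0).
{ destruct (Req_dec y p2) as [->|Hne].
  - unfold y'. replace (p2 + t * (p2 - p2))%R with p2 by ring. unfold rect_int, vseg.
    rewrite !(isI_CI _ _ _ _ (isI_point _ _)). ring.
  - apply goursat. intros u v Hu Hv. destruct (H u v) as [_ H']; eauto.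
    apply H'. intros E. injection E as E1 E2. subst v.
    unfold y', Rmin, Rmax in Hv. destruct Rle_dec; nra. }
rewrite Z1, Z2, !Cplus_0_r.
eapply Rle_trans; [apply rect_bound with (M := M)|].
- intros u v Hu Hv. apply Cont; eauto.
- intros u v Hu Hv.
  assert (D : Cmod ((u, v) - (p1, p2)) < d).
  { eapply Rle_lt_trans; [apply Cmod_le_re_im|]. rewrite re_sub, im_sub. simpl.
    assert (Rabs (u - p1) <= t * Rabs (x - p1)).
    { rewrite <- (Rabs_pos_eq t) by lra. rewrite <- Rabs_mult. unfold x' in Hu.
      clear - Hu. unfold Rmin, Rmax in Hu. unfold Rabs. repeat destruct Rle_dec; repeat destruct Rcase_abs; lra. }
    assert (Rabs (v - p2) <= t * Rabs (y - p2)).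
    { rewrite <- (Rabs_pos_eq t) by lra. rewrite <- Rabs_mult. unfold y' in Hv.
      clear - Hv. unfold Rmin, Rmax in Hv. unfold Rabs. repeat destruct Rle_dec; repeat destruct Rcase_abs; lra. }
    assert (t * Rabs (x - p1) + t * Rabs (y - p2) <= t * K) by (unfold K; nra).
    nra. }
  specialize (HB _ D). unfold M.
  replace (f (u, v)) with (f (p1, p2) + (f (u, v) - f (p1, p2))) by ring.
  eapply Rle_trans; [apply Cmod_triangle|]. lra.
- replace (x' - p1)%R with (t * (x - p1))%R by (unfold x'; ring).
  replace (y' - p2)%R with (t * (y - p2))%R by (unfold y'; ring).
  rewrite !Rabs_mult, (Rabs_pos_eq t) by lra.
  apply Rle_trans with (t * (4 * K * M))%R; auto. unfold K.
  generalize (Rabs_pos (x - p1)) (Rabs_pos (y - p2)). intros.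
  assert (0 <= t * M) by nra. nra.
Qed.

Lemma rect_swap f x1 x2 y1 y2 : cont_rect f x1 x2 y1 y2 ->
  rect_int f x2 x1 y1 y2 = - rect_int f x1 x2 y1 y2 /\ rect_int f x1 x2 y2 y1 = - rect_int f x1 x2 y1 y2.
Proof.
intros Cont.
pose proof (Rmin_max_l x1 x2). pose proof (Rmin_max_r x1 x2).
pose proof (Rmin_max_l y1 y2). pose proof (Rmin_max_r y1 y2).
assert (Hx : forall y, Rmin y1 y2 <= y <= Rmax y1 y2 -> hseg f y x2 x1 = - hseg f y x1 x2).
{ intros y Hy. apply isI_CI, isI_swap. eapply hseg_ok; eauto. }
assert (Hy : forall x, Rmin x1 x2 <= x <= Rmax x1 x2 -> vseg f x y2 y1 = - vseg f x y1 y2).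
{ intros x Hx'. apply isI_CI, isI_swap. eapply vseg_ok; eauto. }
unfold rect_int. split; rewrite ?Hx, ?Hy by auto; ring.
Qed.

(** If p lies in the rectangle, cutting through p leaves at most four rectangles with p as a corner;
    the signs of [rect_int] under exchange of ends bring each of them to the form of
    [goursat_corner]. *)
Lemma goursat_punctured I J f p : oint I -> oint J -> (forall z, box I J z -> ccont f z) ->
  (forall z, box I J z -> z <> p -> exists l, cder f z l) ->
  forall x1 x2 y1 y2, I x1 -> I x2 -> J y1 -> J y2 -> rect_int f x1 x2 y1 y2 = 0.
Proof.
intros HI HJ Cf Hf x1 x2 y1 y2 H1 H2 H3 H4.
assert (CR : forall x1 x2 y1 y2, I x1 -> I x2 -> J y1 -> J y2 -> cont_rect f x1 x2 y1 y2).
{ intros a1 a2 b1 b2 A1 A2 B1 B2 x y Hx Hy. apply Cf.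
  split; [apply (oint_minmax I a1 a2)|apply (oint_minmax J b1 b2)]; auto. }
destruct p as [p1 p2].
destruct (classic ((Rmin x1 x2 <= p1 <= Rmax x1 x2) /\ Rmin y1 y2 <= p2 <= Rmax y1 y2)) as [[Hp1 Hp2]|Hn].
- assert (I p1) by (apply (oint_minmax I x1 x2); auto). assert (J p2) by (apply (oint_minmax J y1 y2); auto).
  assert (Z : forall x y, I x -> J y -> rect_int f p1 x p2 y = 0).
  { intros x y Hx Hy. apply goursat_corner. intros u v Hu Hv.
    assert (box I J (u, v)) by (split; [apply (oint_minmax I p1 x)|apply (oint_minmax J p2 y)]; auto).
    split; auto. }
  rewrite (rect_split_x _ _ _ _ _ p1) by auto.
  rewrite (rect_split_y _ _ _ _ _ p2), (rect_split_y _ p1 x2 _ _ p2) by auto.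
  rewrite (Z x2 y2) by auto.
  rewrite (proj1 (rect_swap f p1 x1 y1 p2 (CR _ _ _ _ H H1 H3 H0))).
  rewrite (proj2 (rect_swap f p1 x1 p2 y1 (CR _ _ _ _ H H1 H0 H3))), (Z x1 y1) by auto.
  rewrite (proj1 (rect_swap f p1 x1 p2 y2 (CR _ _ _ _ H H1 H0 H4))), (Z x1 y2) by auto.
  rewrite (proj2 (rect_swap f p1 x2 p2 y1 (CR _ _ _ _ H H2 H0 H3))), (Z x2 y1) by auto.
  ring.
- apply goursat. intros x y Hx Hy. apply Hf.
  + split; [apply (oint_minmax I x1 x2)|apply (oint_minmax J y1 y2)]; auto.
  + intros E. injection E as -> ->. tauto.
Qed.

Theorem box_primitive I J f : oint I -> oint J -> hol (box I J) f ->
  forall z0, box I J z0 -> exists F : C -> C, F z0 = 0 /\ forall z, box I J z -> cder F z (f z).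
Proof.
intros HI HJ Hf.
assert (Cf : forall z, box I J z -> ccont f z).
{ intros z Hz. destruct (Hf z Hz). eapply eder_cont; eauto. }
(* There is no exceptional point here, so any value, such as 0, can be given for it. *)
apply morera; auto. apply (goursat_punctured I J f 0 HI HJ Cf). auto.
Qed.

(** * Cauchy's integral formula and its consequences *)

Lemma isI_segment F f x y :
  (forall t, 0 <= t <= 1 -> cder F (x + RtoC t * (y - x)) (f (x + RtoC t * (y - x)))) ->
  (forall t, 0 <= t <= 1 -> ccont f (x + RtoC t * (y - x))) ->
  isI (fun t => f (x + RtoC t * (y - x)) * (y - x)) 0 1 (F y - F x).
Proof.
intros HF Hc.
assert (E1 : x + RtoC 1 * (y - x) = y) by ring. assert (E0 : x + RtoC 0 * (y - x) = x) by ring.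
replace (F y - F x) with ((fun t => F (x + RtoC t * (y - x))) 1%R - (fun t => F (x + RtoC t * (y - x))) 0%R)
  by (cbv beta; rewrite E1, E0; reflexivity).
assert (D : forall t, rder (fun t => x + RtoC t * (y - x)) t (y - x)).
{ intros t. eapply eder_eq; [|apply eder_plus; [apply eder_const|apply eder_mult; [apply rder_id|apply eder_const]]]. cbv beta; ring. }
apply (isI_FTC (fun t => F (x + RtoC t * (y - x)))).
- intros t Ht. rewrite Rmin_left, Rmax_right in Ht by lra. apply (eder_comp rsub F); [auto|apply D].
- intros t Ht. rewrite Rmin_left, Rmax_right in Ht by lra. apply econt_mult; [|apply econt_const].
  apply econt_comp; auto. eapply rder_rcont; apply D.
Qed.

Lemma cder0_const F x y :
  (forall t, 0 <= t <= 1 -> cder F (x + RtoC t * (y - x)) 0) -> F y = F x.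
Proof.
intros H. apply Ceq_minus. apply (isI_unique (fun t => 0 * (y - x)) 0 1).
- apply (isI_segment F (fun _ => 0)); auto. intros; apply econt_const.
- assert (E : RtoC (1 - 0) * (0 * (y - x)) = 0) by ring.
  pose proof (isI_const (0 * (y - x)) 0 1) as Q. rewrite E in Q. exact Q.
Qed.

Lemma segment_disc (a x y : C) (r t : R) : 0 <= t <= 1 -> Cmod (x - a) < r -> Cmod (y - a) < r ->
  (Cmod (x + RtoC t * (y - x) - a) < r).
Proof.
intros Ht Hx Hy.
replace (x + RtoC t * (y - x) - a) with (RtoC (1 - t) * (x - a) + RtoC t * (y - a)) by (rewrite RtoC_minus; ring).
eapply Rle_lt_trans; [apply Cmod_triangle|]. rewrite !Cmod_mult, !Cmod_R, !Rabs_pos_eq by lra.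
destruct (Req_dec t 0) as [->|]; [lra|]. nra.
Qed.

Definition cis (t : R) : C := (cos t, sin t).

Lemma Cmod_cis t : Cmod (cis t) = 1%R.
Proof.
unfold Cmod, cis; simpl. rewrite !Rmult_1_r. rewrite <- sqrt_1. f_equal.
generalize (sin2_cos2 t). unfold Rsqr. lra.
Qed.

Lemma rder_cis t : rder cis t (Ci * cis t).
Proof.
apply rder_pair; simpl.
- auto_derive; auto. ring.
- auto_derive; auto. ring.
Qed.

Lemma cder_param (k : C -> R -> C) (k' : R -> C) z a b M rho : a <= b -> 0 < rho ->
  (forall y, Cmod (y - z) < rho -> exists l, isI (k y) a b l) -> (exists l, isI k' a b l) ->
  (forall y t, Cmod (y - z) < rho -> a <= t <= b ->
    (Cmod (k y t - k z t - k' t * (y - z)) <= M * Cmod (y - z) ^ 2)) ->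
  cder (fun y => CI (k y) a b) z (CI k' a b).
Proof.
intros Hab Hrho Hk [l' Hl'] HM e He.
set (K := ((b - a) * Rabs M + 1)%R).
assert (HK : 1 <= K) by (unfold K; generalize (Rabs_pos M); nra).
exists (Rmin rho (e / K)). split; [apply Rmin_case; auto; apply Rdiv_lt_0_compat; lra|].
intros y Hy. assert (Y1 : Cmod (y - z) < rho) by (eapply Rlt_le_trans; [apply Hy|apply Rmin_l]).
assert (Y2 : Cmod (y - z) < e / K) by (eapply Rlt_le_trans; [apply Hy|apply Rmin_r]).
destruct (Hk y Y1) as [l1 H1]. destruct (Hk z) as [l2 H2].
{ replace (z - z) with (RtoC 0) by ring. rewrite Cmod_0; auto. }
rewrite (isI_CI _ _ _ _ H1), (isI_CI _ _ _ _ H2), (isI_CI _ _ _ _ Hl').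
assert (B : Cmod (l1 - l2 - l' * (y - z)) <= (b - a) * (Rabs M * Cmod (y - z) ^ 2)).
{ eapply isI_bound; [auto| |apply isI_minus; [apply isI_minus; eauto|apply isI_scal_r; eauto]].
  intros t Ht. eapply Rle_trans; [apply HM; auto|]. apply Rmult_le_compat_r; [apply pow2_ge_0|apply Rle_abs]. }
eapply Rle_trans; [apply B|]. apply Rlt_div_r in Y2; [|lra].
generalize (Cmod_ge_0 (y - z)). intros P. unfold K in Y2.
assert ((b - a) * Rabs M * Cmod (y - z) <= e) by nra. simpl. nra.
Qed.

Section CauchyKernel.
Context (a : C) (r : R) (Hr : 0 < r) (psi : R -> C).
Hypothesis Hpsi : forall t, 0 <= t <= 2 * PI -> rcont psi t.

Let s (t : R) : C := a + RtoC r * cis t.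

(** The tangent factor of the circle is part of [psi], and 1/(2 pi i) is left out. Only the
    exponents 1, 2, 3 occur: Cauchy's formula has exponent 1, and two differentiations suffice to
    see that a derivative is again differentiable. *)
Definition cauchy_kernel (m : nat) (z : C) : C := CI (fun t => psi t / (s t - z) ^ m) 0 (2 * PI).

Lemma circle_dist z t : r - Cmod (z - a) <= Cmod (s t - z).
Proof.
unfold s. replace (a + RtoC r * cis t - z) with (RtoC r * cis t - (z - a)) by ring.
eapply Rle_trans; [|apply Cmod_triangle_inv]. rewrite Cmod_mult, Cmod_cis, Cmod_R, Rabs_pos_eq; lra.
Qed.

Lemma circle_dist_le z t : Cmod (s t - z) <= r + Cmod (z - a).
Proof.
unfold s. replace (a + RtoC r * cis t - z) with (RtoC r * cis t - (z - a)) by ring.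
eapply Rle_trans; [apply Cmod_triangle_sub|]. rewrite Cmod_mult, Cmod_cis, Cmod_R, Rabs_pos_eq; lra.
Qed.

Lemma circle_rcont t : rcont s t.
Proof.
apply econt_plus; [apply econt_const|]. apply econt_mult; [apply econt_const|].
eapply rder_rcont, rder_cis.
Qed.

Lemma circle_neq z t : Cmod (z - a) < r -> s t - z <> 0.
Proof. intros H. apply Cmod_gt_0. generalize (circle_dist z t). lra. Qed.

Lemma rcont_pow (g : R -> C) m t : rcont g t -> rcont (fun u => g u ^ m) t.
Proof.
intros H. induction m; simpl; [apply econt_const|apply econt_mult; auto].
Qed.

Lemma kernel_rcont m z t : Cmod (z - a) < r -> 0 <= t <= 2 * PI -> rcont (fun t => psi t / (s t - z) ^ m) t.
Proof.
intros Hz Ht. apply econt_mult; auto. apply (econt_comp rsub Cinv).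
- apply ccont_inv. apply Cpow_nz, circle_neq; auto.
- apply rcont_pow. apply econt_minus; [apply circle_rcont|apply econt_const].
Qed.

Lemma kernel_isI m z : Cmod (z - a) < r -> isI (fun t => psi t / (s t - z) ^ m) 0 (2 * PI) (cauchy_kernel m z).
Proof.
intros Hz. apply exI_cont. intros t Ht. rewrite Rmin_left, Rmax_right in Ht by (generalize PI_RGT_0; lra).
apply kernel_rcont; auto.
Qed.

Lemma psi_bounded : exists B, 0 <= B /\ forall t, 0 <= t <= 2 * PI -> Cmod (psi t) <= B.
Proof.
destruct (continuity_ab_maj (fun t => Cmod (psi t)) 0 (2 * PI)) as [M [HM _]].
- generalize PI_RGT_0; lra.
- intros t Ht. apply continuity_pt_filterlim. apply (rcont_Cmod psi t). auto.
- exists (Cmod (psi M)). split; [apply Cmod_ge_0|auto].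
Qed.

Lemma cauchy_kernel_der1 z : Cmod (z - a) < r -> cder (cauchy_kernel 1) z (cauchy_kernel 2 z).
Proof.
intros Hz. destruct psi_bounded as [B [HB0 HB]].
set (d := (r - Cmod (z - a))%R). assert (Hd : 0 < d) by (unfold d; lra).
assert (Hin : forall y, Cmod (y - z) < d / 2 -> Cmod (y - a) < r - d / 2).
{ intros y Hy. replace (y - a) with ((y - z) + (z - a)) by ring.
  eapply Rle_lt_trans; [apply Cmod_triangle|]. unfold d in *. lra. }
apply cder_param with (M := (B * (/ ((d/2) * (d * d))))%R) (rho := (d / 2)%R).
- generalize PI_RGT_0; lra.
- lra.
- intros y Hy. exists (cauchy_kernel 1 y). apply kernel_isI. specialize (Hin y Hy). lra.
- exists (cauchy_kernel 2 z). apply kernel_isI; auto.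
- intros y t Hy Ht. specialize (Hin y Hy).
  assert (N1 : s t - y <> 0) by (apply circle_neq; lra).
  assert (N2 : s t - z <> 0) by (apply circle_neq; lra).
  replace (psi t / (s t - y) ^ 1 - psi t / (s t - z) ^ 1 - psi t / (s t - z) ^ 2 * (y - z)) with
    (psi t * (/ ((s t - y) * ((s t - z) * (s t - z)))) * ((y - z) * (y - z))) by (field; auto).
  rewrite !Cmod_mult, Cmod_inv, !Cmod_mult by (repeat apply Cmult_neq_0; auto).
  replace (Cmod (y - z) ^ 2)%R with (Cmod (y - z) * Cmod (y - z))%R by ring.
  apply Rmult_le_compat_r; [generalize (Cmod_ge_0 (y - z)); nra|].
  apply Rmult_le_compat; auto; try apply Cmod_ge_0.
  { left. apply Rinv_0_lt_compat. repeat apply Rmult_lt_0_compat; apply Cmod_gt_0; auto. }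
  generalize (circle_dist y t) (circle_dist z t). intros D1 D2.
  apply Rinv_le_contravar; [repeat apply Rmult_lt_0_compat; lra|].
  apply Rmult_le_compat; try nra. apply Rmult_le_compat; unfold d in *; lra.
Qed.

Lemma cauchy_kernel_der2 z : Cmod (z - a) < r -> cder (cauchy_kernel 2) z (2 * cauchy_kernel 3 z).
Proof.
intros Hz. destruct psi_bounded as [B [HB0 HB]].
set (d := (r - Cmod (z - a))%R). assert (Hd : 0 < d) by (unfold d; lra).
assert (Hin : forall y, Cmod (y - z) < d / 2 -> Cmod (y - a) < r - d / 2).
{ intros y Hy. replace (y - a) with ((y - z) + (z - a)) by ring.
  eapply Rle_lt_trans; [apply Cmod_triangle|]. unfold d in *. lra. }
rewrite <- (isI_CI _ _ _ _ (isI_scal 2 _ _ _ _ (kernel_isI 3 z Hz))).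
(* The factor [10 * r] bounds |3 (s - z) - 2 (y - z)|, the numerator left by the second-order
   expansion: |s - z| is at most 2 r and |y - z| less than r / 2. *)
apply cder_param with (M := (B * (10 * r) * (/ ((d/2) * (d/2) * (d * d * d))))%R) (rho := (d / 2)%R).
- generalize PI_RGT_0; lra.
- lra.
- intros y Hy. exists (cauchy_kernel 2 y). apply kernel_isI. specialize (Hin y Hy). lra.
- eexists. apply isI_scal, kernel_isI; auto.
- intros y t Hy Ht. specialize (Hin y Hy).
  assert (N1 : s t - y <> 0) by (apply circle_neq; lra).
  assert (N2 : s t - z <> 0) by (apply circle_neq; lra).
  replace (psi t / (s t - y) ^ 2 - psi t / (s t - z) ^ 2 - 2 * (psi t / (s t - z) ^ 3) * (y - z)) with
    (psi t * (3 * (s t - z) - 2 * (y - z)) * (/ ((s t - y) * (s t - y) * ((s t - z) * (s t - z) * (s t - z)))) * ((y - z) * (y - z))) by (field; auto).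
  rewrite !Cmod_mult, Cmod_inv, !Cmod_mult by (repeat apply Cmult_neq_0; auto).
  replace (Cmod (y - z) ^ 2)%R with (Cmod (y - z) * Cmod (y - z))%R by ring.
  apply Rmult_le_compat_r; [generalize (Cmod_ge_0 (y - z)); nra|].
  generalize (circle_dist y t) (circle_dist z t) (circle_dist_le z t). intros D1 D2 D3.
  apply Rmult_le_compat; auto.
  { apply Rmult_le_pos; apply Cmod_ge_0. }
  { left. apply Rinv_0_lt_compat. repeat apply Rmult_lt_0_compat; apply Cmod_gt_0; auto. }
  { apply Rmult_le_compat; auto; try apply Cmod_ge_0.
    eapply Rle_trans; [apply Cmod_triangle_sub|]. rewrite !Cmod_mult, !Cmod_R, !Rabs_pos_eq by lra. unfold d in *. lra. }
  apply Rinv_le_contravar; [repeat apply Rmult_lt_0_compat; lra|].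
  repeat apply Rmult_le_compat; try (unfold d in *; lra); repeat apply Rmult_le_pos; lra.
Qed.

End CauchyKernel.

Lemma hol_der U f z : copen U -> hol U f -> U z -> cder f z (C_derive f z).
Proof.
intros _ Hf Hz. destruct (Hf z Hz) as [l Hl]. rewrite (cder_C_derive _ _ _ Hl). exact Hl.
Qed.

Lemma hol_cont U f z : hol U f -> U z -> ccont f z.
Proof. intros Hf Hz. destruct (Hf z Hz) as [l Hl]. eapply eder_cont; eauto. Qed.

Lemma oint_interval (x d : R) : oint (fun y => (Rabs (y - x) < d)).
Proof.
split.
- intros a b u Ha Hb Hu. apply Rabs_def1; apply Rabs_def2 in Ha; apply Rabs_def2 in Hb; lra.
- intros a Ha. exists (d - Rabs (a - x))%R. split; [lra|]. intros y Hy.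
  replace (y - x)%R with ((y - a) + (a - x))%R by ring.
  eapply Rle_lt_trans; [apply Rabs_triang|]. lra.
Qed.

Definition square (a : C) (d : R) : C -> Prop :=
  box (fun x => (Rabs (x - Re a) < d)) (fun y => (Rabs (y - Im a) < d)).

Lemma square_disc a d z : Cmod (z - a) < d -> square a d z.
Proof.
intros H. split; [rewrite <- re_sub|rewrite <- im_sub]; eapply Rle_lt_trans; try exact H;
[apply re_le_Cmod|apply im_le_Cmod].
Qed.

Lemma disc_square a d z : square a d z -> Cmod (z - a) < 2 * d.
Proof.
intros [H1 H2]. eapply Rle_lt_trans; [apply Cmod_le_re_im|]. rewrite re_sub, im_sub. lra.
Qed.

(** At p the quotient is so far only known to be continuous, which is why Goursat's theorem was
    extended to a puncture. Its holomorphy at p needs Cauchy's formula and comes with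
    [divided_difference]. *)
Lemma difference_quotient U f p : hol U f -> U p -> exists g, (forall y, U y -> y <> p -> exists m, cder g y m) /\
  (forall y, U y -> ccont g y) /\ forall z, f z = f p + (z - p) * g z.
Proof.
intros Hf Hp. destruct (Hf p Hp) as [l Hl].
set (g := fun y => if Ceq_dec y p then l else (f y - f p) / (y - p)).
assert (Dg : forall y, U y -> y <> p -> exists m, cder g y m).
{ intros y Hy Hne. destruct (Hf y Hy) as [m Hm]. eexists.
  assert (Hyz : y - p <> 0) by (apply Cminus_eq_contra; auto).
  apply cder_ext_loc with (fun y => (f y - f p) * / (y - p)).
  - exists (Cmod (y - p)). split; [apply Cmod_gt_0; auto|].
    intros x Hx. unfold g. destruct (Ceq_dec x p) as [->|]; [|reflexivity].
    rewrite Cmod_sub_sym in Hx. lra.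
  - apply eder_mult.
    + apply eder_minus; [exact Hm|apply eder_const].
    + apply (eder_comp Cminus Cinv (fun x => x - p)).
      * apply cder_inv; auto.
      * apply eder_minus; [apply cder_id|apply eder_const]. }
exists g. split; [exact Dg|]. split.
- intros y Hy. destruct (Ceq_dec y p) as [->|Hne].
  + intros e He. destruct (Hl (e / 2)%R) as [d [Hd H]]; [lra|]. exists d. split; auto.
    intros y Hy'. unfold g at 2. destruct (Ceq_dec p p) as [_|]; [|congruence].
    unfold g. destruct (Ceq_dec y p) as [->|Hne]; [replace (l - l) with (RtoC 0) by ring; rewrite Cmod_0; auto|].
    assert (Hyz : y - p <> 0) by (apply Cminus_eq_contra; auto).
    replace ((f y - f p) / (y - p) - l) with ((f y - f p - l * (y - p)) / (y - p)) by (field; auto).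
    rewrite Cmod_div by auto. assert (0 < Cmod (y - p)) by (apply Cmod_gt_0; auto).
    apply Rlt_div_l; auto. specialize (H y Hy'). nra.
  + destruct (Dg y Hy Hne). eapply eder_cont; eauto.
- intros z. unfold g. destruct (Ceq_dec z p) as [->|Hne]; [ring|]. field.
  apply Cminus_eq_contra; auto.
Qed.

Section CauchyFormula.
Context (a : C) (r : R) (Hr : 0 < r).
Let s (t : R) : C := a + RtoC r * cis t.
Let s' (t : R) : C := RtoC r * (Ci * cis t).

Lemma circle_rder t : rder s t (s' t).
Proof.
eapply eder_eq; [|apply eder_plus; [apply eder_const|apply eder_scal, rder_cis]].
unfold s'. ring.
Qed.

Lemma circle'_rcont t : rcont s' t.
Proof. unfold s'. repeat (apply econt_mult; [apply econt_const|]). eapply rder_rcont, rder_cis. Qed.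

Lemma circle_primitive F f : (forall t, cder F (s t) (f (s t))) -> (forall t, ccont f (s t)) ->
  isI (fun t => f (s t) * s' t) 0 (2 * PI) 0.
Proof.
intros HF Hf.
assert (E : F (s (2 * PI)) - F (s 0) = 0).
{ assert (E : s (2 * PI) = s 0).
  { unfold s, cis. rewrite cos_2PI, sin_2PI, cos_0, sin_0. reflexivity. }
  rewrite E. ring. }
rewrite <- E. apply (isI_FTC (fun t => F (s t))).
- intros t Ht. apply (eder_comp rsub F s); auto. apply circle_rder.
- intros t Ht. apply econt_mult; [apply econt_comp; auto; eapply rder_rcont, circle_rder|apply circle'_rcont].
Qed.

(** The derivative in z is the integral of ds / (s - z)^2, which has a primitive along the circle
    and so vanishes. The value is therefore the one at the centre, where the integrand is the
    constant i. *)
Lemma winding_number_one z : Cmod (z - a) < r -> cauchy_kernel a r s' 1 z = 2 * RtoC PI * Ci.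
Proof.
intros Hz.
assert (Hs' : forall t, 0 <= t <= 2 * PI -> rcont s' t) by (intros; apply circle'_rcont).
assert (E : cauchy_kernel a r s' 1 z = cauchy_kernel a r s' 1 a).
{ apply (cder0_const (cauchy_kernel a r s' 1)).
  intros t Ht.
  assert (Hin : Cmod (a + RtoC t * (z - a) - a) < r).
  { apply segment_disc; auto. replace (a - a) with (RtoC 0) by ring. rewrite Cmod_0; auto. }
  set (y := a + RtoC t * (z - a)) in *.
  eapply eder_eq; [|apply cauchy_kernel_der1; auto].
  assert (Ns : forall t, s t - y <> 0) by (intros; apply circle_neq; auto).
  eapply isI_unique; [apply kernel_isI; auto|].
  apply isI_ext with (fun t => / ((s t - y) * (s t - y)) * s' t).
  { intros u _. fold (s u). field. auto. }
  apply (circle_primitive (fun x => - / (x - y)) (fun x => / ((x - y) * (x - y)))).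
  - intros u. eapply eder_eq; [|apply eder_opp; apply (eder_comp Cminus Cinv (fun x => x - y));
      [apply cder_inv; auto|apply eder_minus; [apply cder_id|apply eder_const]]].
    cbv beta. field. auto.
  - intros u. apply (econt_comp Cminus Cinv (fun x => (x - y) * (x - y))).
    + apply ccont_inv. apply Cmult_neq_0; auto.
    + apply econt_mult; apply econt_minus; try apply ccont_id; apply econt_const. }
rewrite E. unfold cauchy_kernel. apply isI_CI.
apply isI_ext with (fun _ => Ci).
{ intros t _. unfold s'. assert (Rr : RtoC r * cis t <> 0).
  { apply Cmult_neq_0; [apply RtoC_neq; lra|]. apply Cmod_gt_0. rewrite Cmod_cis. lra. }
  replace (a + RtoC r * cis t - a) with (RtoC r * cis t) by ring.
  field. split; intros Z; apply Rr; rewrite Z; ring. }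
assert (E2 : RtoC (2 * PI - 0) * Ci = 2 * RtoC PI * Ci).
{ rewrite Rminus_0_r, RtoC_mult. reflexivity. }
rewrite <- E2. apply isI_const.
Qed.

(** With f s = f z + (s - z) g s, dividing by s - z leaves g, which has a primitive on the square,
    and f z times the winding integral. A square replaces the disc because primitives are
    constructed on boxes. *)
Theorem cauchy_formula f z : hol (square a (2 * r)) f -> Cmod (z - a) < r ->
  cauchy_kernel a r (fun t => f (s t) * s' t) 1 z = 2 * RtoC PI * Ci * f z.
Proof.
intros Hf Hz.
assert (Hsq : forall t, square a (2 * r) (s t)).
{ intros t. apply square_disc. unfold s. replace (a + RtoC r * cis t - a) with (RtoC r * cis t) by ring.
  rewrite Cmod_mult, Cmod_cis, Cmod_R, Rabs_pos_eq; lra. }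
assert (Hzs : square a (2 * r) z) by (apply square_disc; lra).
destruct (difference_quotient _ f z Hf Hzs) as [g [Dg [Cg Eg]]].
destruct (morera _ _ g (oint_interval (Re a) (2 * r)) (oint_interval (Im a) (2 * r)) Cg) with (z0 := z) as [G [_ HG]]; auto.
{ apply goursat_punctured with z; auto using oint_interval. }
assert (Ig : isI (fun t => g (s t) * s' t) 0 (2 * PI) 0).
{ apply (circle_primitive G); auto. intros t; apply HG, Hsq. }
assert (Ns : forall t, s t - z <> 0) by (intros; apply circle_neq; auto).
assert (Hs' : forall t, 0 <= t <= 2 * PI -> rcont s' t) by (intros; apply circle'_rcont).
rewrite <- (winding_number_one z Hz).
unfold cauchy_kernel at 1. apply isI_CI.
replace (cauchy_kernel a r s' 1 z * f z) with (0 + f z * cauchy_kernel a r s' 1 z) by ring.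
apply isI_ext with (fun t => g (s t) * s' t + f z * (s' t / (s t - z) ^ 1)).
- intros t _. fold (s t). rewrite (Eg (s t)). field. auto.
- apply isI_plus; auto. apply isI_scal. apply kernel_isI; auto.
Qed.

End CauchyFormula.

Theorem hol_C_derive U f : copen U -> hol U f -> hol U (C_derive f).
Proof.
intros HU Hf a Ha. destruct (HU a Ha) as [d [Hd HD]].
(* The square of half-side [2 * r] must lie in the disc of radius d, and by [disc_square] it lies in
   the one of radius [4 * r]. *)
set (r := (d / 4)%R). assert (Hr : 0 < r) by (unfold r; lra).
set (psi := fun t => f (a + RtoC r * cis t) * (RtoC r * (Ci * cis t))).
set (c := 2 * RtoC PI * Ci).
assert (Hc : c <> 0).
{ unfold c. repeat apply Cmult_neq_0; try apply RtoC_neq; try apply Ci_nz; generalize PI_RGT_0; lra. }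
assert (Hsq : hol (square a (2 * r)) f).
{ intros y Hy. apply Hf, HD. apply disc_square in Hy. unfold r in Hy. lra. }
assert (Hpsi : forall t, 0 <= t <= 2 * PI -> rcont psi t).
{ intros t _. apply econt_mult; [|apply (circle'_rcont r)].
  apply (econt_comp rsub f); [|apply circle_rcont]. apply (hol_cont _ _ _ Hsq).
  apply square_disc. replace (a + RtoC r * cis t - a) with (RtoC r * cis t) by ring.
  rewrite Cmod_mult, Cmod_cis, Cmod_R, Rabs_pos_eq; lra. }
assert (E : forall y, Cmod (y - a) < r -> cder f y (/ c * cauchy_kernel a r psi 2 y)).
{ intros y Hy. apply cder_ext_loc with (fun y => / c * cauchy_kernel a r psi 1 y).
  - exists (r - Cmod (y - a))%R. split; [lra|]. intros x Hx. unfold psi.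
    rewrite cauchy_formula; auto.
    + fold c. field. auto.
    + replace (x - a) with ((x - y) + (y - a)) by ring. eapply Rle_lt_trans; [apply Cmod_triangle|]. lra.
  - apply eder_scal. apply cauchy_kernel_der1; auto. }
exists (/ c * (2 * cauchy_kernel a r psi 3 a)).
assert (Haa : Cmod (a - a) < r) by (replace (a - a) with (RtoC 0) by ring; rewrite Cmod_0; auto).
apply cder_ext_loc with (fun y => / c * cauchy_kernel a r psi 2 y).
- exists r. split; auto. intros y Hy. symmetry. apply cder_C_derive. auto.
- apply eder_scal. apply cauchy_kernel_der2; auto.
Qed.

Lemma copen_square U a : copen U -> U a -> exists d, 0 < d /\ forall y, square a d y -> U y.
Proof.
intros HU Ha. destruct (HU a Ha) as [d [Hd H]]. exists (d / 2)%R. split; [lra|].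
intros y Hy. apply H. apply disc_square in Hy. lra.
Qed.

Lemma square_center a d : 0 < d -> square a d a.
Proof. intros Hd. apply square_disc. replace (a - a) with (RtoC 0) by ring. rewrite Cmod_0; auto. Qed.

(** The usual second half of Morera's theorem: f is locally the derivative of a holomorphic
    function, and such derivatives are holomorphic. Removable singularities and limits both reduce
    to it. *)
Lemma local_primitive_hol U f :
  (forall a, U a -> exists d F, 0 < d /\ forall y, square a d y -> cder F y (f y)) -> hol U f.
Proof.
intros H a Ha. destruct (H a Ha) as [d [F [Hd HF]]].
assert (HS : copen (square a d)) by (apply box_open; apply oint_interval).
destruct (hol_C_derive (square a d) F HS) with (z := a) as [l Hl].
- intros y Hy. exists (f y). auto.
- apply square_center; auto.
- exists l. apply cder_ext_loc with (C_derive F); auto.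
  exists d. split; auto. intros y Hy. apply cder_C_derive, HF, square_disc; auto.
Qed.

Lemma hol_removable U f p : copen U -> (forall z, U z -> ccont f z) ->
  (forall z, U z -> z <> p -> exists l, cder f z l) -> hol U f.
Proof.
intros HU Hc Hd. apply local_primitive_hol. intros a Ha.
destruct (copen_square U a HU Ha) as [d [Hd0 HS]].
destruct (morera _ _ f (oint_interval (Re a) d) (oint_interval (Im a) d)) with (z0 := a) as [F [_ HF]].
- intros z Hz. apply Hc, HS, Hz.
- apply goursat_punctured with p; auto using oint_interval.
- apply square_center; auto.
- exists d, F. split; auto.
Qed.

Lemma divided_difference U f p : copen U -> hol U f -> U p ->
  exists g, hol U g /\ forall z, f z = f p + (z - p) * g z.
Proof.
intros HU Hf Hp. destruct (difference_quotient U f p Hf Hp) as [g [Dg [Cg E]]]. exists g. split; auto.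
apply hol_removable with p; auto.
Qed.

(** * Locally uniform limits of holomorphic functions *)

Definition loc_unif (U : C -> Prop) (u : nat -> C -> C) (f : C -> C) : Prop :=
  forall a, U a -> exists d, 0 < d /\ forall e, 0 < e -> exists N, forall n, (N <= n)%nat ->
    forall y, square a d y -> Cmod (u n y - f y) <= e.

(** Rectangle integrals pass to the uniform limit, so they vanish for f as well; [morera] then gives
    local primitives. *)
Theorem weierstrass U u f : copen U -> (forall n, hol U (u n)) -> loc_unif U u f -> hol U f.
Proof.
intros HU Hu HL. apply local_primitive_hol. intros a Ha.
destruct (copen_square U a HU Ha) as [d1 [Hd1 HS1]].
destruct (HL a Ha) as [d2 [Hd2 H2]].
set (d := Rmin d1 d2). assert (Hd : 0 < d) by (apply Rmin_case; auto).
assert (S1 : forall y, square a d y -> U y).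
{ intros y [Y1 Y2]. apply HS1. split; (eapply Rlt_le_trans; [eassumption|apply Rmin_l]). }
assert (S2 : forall y, square a d y -> square a d2 y).
{ intros y [Y1 Y2]. split; (eapply Rlt_le_trans; [eassumption|apply Rmin_r]). }
assert (HSo : copen (square a d)) by (apply box_open; apply oint_interval).
assert (Cf : forall z, square a d z -> ccont f z).
{ intros z Hz e He. destruct (H2 (e / 4)%R) as [N HN]; [lra|].
  destruct (hol_cont U (u N) z (Hu N) (S1 z Hz) (e / 4)%R) as [r1 [Hr1 K1]]; [lra|].
  destruct (HSo z Hz) as [r2 [Hr2 K2]].
  exists (Rmin r1 r2). split; [apply Rmin_case; auto|]. intros y Hy.
  assert (Y1 : Cmod (y - z) < r1) by (eapply Rlt_le_trans; [apply Hy|apply Rmin_l]).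
  assert (Y2 : Cmod (y - z) < r2) by (eapply Rlt_le_trans; [apply Hy|apply Rmin_r]).
  replace (f y - f z) with ((u N y - u N z) - (u N y - f y) + (u N z - f z)) by ring.
  eapply Rle_lt_trans; [apply Cmod_triangle|].
  eapply Rle_lt_trans; [apply Rplus_le_compat_r, Cmod_triangle_sub|].
  generalize (HN N (le_n _) y (S2 y (K2 y Y2))) (HN N (le_n _) z (S2 z Hz)) (K1 y Y1). lra. }
destruct (morera _ _ f (oint_interval (Re a) d) (oint_interval (Im a) d) Cf) with (z0 := a) as [F [_ HF]].
- intros x1 x2 y1 y2 X1 X2 Y1 Y2. apply Cmod_le_eps_0. intros e He.
  assert (Box : forall x y, Rmin x1 x2 <= x <= Rmax x1 x2 -> Rmin y1 y2 <= y <= Rmax y1 y2 -> square a d (x, y)).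
  { intros x y Hx Hy. split.
    - apply (oint_minmax (fun t => (Rabs (t - Re a) < d)) x1 x2); auto using oint_interval.
    - apply (oint_minmax (fun t => (Rabs (t - Im a) < d)) y1 y2); auto using oint_interval. }
  set (K := (2 * (Rabs (x2 - x1) + Rabs (y2 - y1)) + 1)%R).
  assert (HK : 1 <= K) by (unfold K; generalize (Rabs_pos (x2 - x1)) (Rabs_pos (y2 - y1)); lra).
  destruct (H2 (e / K)%R) as [N HN]; [apply Rdiv_lt_0_compat; lra|].
  assert (Z : rect_int (u N) x1 x2 y1 y2 = 0).
  { apply goursat. intros x y Hx Hy. apply (Hu N). apply S1, Box; auto. }
  assert (E : rect_int f x1 x2 y1 y2 = - rect_int (fun z => u N z - f z) x1 x2 y1 y2).
  { rewrite rect_int_minus, Z; [ring| |].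
    - intros x y Hx Hy. apply (hol_cont U); auto.
    - intros x y Hx Hy. apply Cf; auto. }
  rewrite E, Cmod_opp. eapply Rle_trans; [apply rect_bound with (M := (e / K)%R)|].
  + intros x y Hx Hy. apply econt_minus; [apply (hol_cont U); auto|apply Cf; auto].
  + intros x y Hx Hy. apply (HN N (le_n _)). auto.
  + apply Rle_trans with (K * (e / K))%R; [|right; field; lra].
    apply Rmult_le_compat_r; [left; apply Rdiv_lt_0_compat; lra|unfold K; lra].
- apply square_center; auto.
- exists d, F. split; auto.
Qed.

(** * Exponential and logarithms *)

Lemma Cexp_plus a b : Cexp (a + b) = Cexp a * Cexp b.
Proof.
unfold Cexp. rewrite re_plus, im_plus, exp_plus, cos_plus, sin_plus.
apply C_ext; simpl; ring.
Qed.

Lemma Cexp_0 : Cexp 0 = 1.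
Proof. unfold Cexp. simpl. rewrite exp_0, cos_0, sin_0. apply C_ext; simpl; ring. Qed.

Lemma Cexp_neg a : Cexp (- a) * Cexp a = 1.
Proof. rewrite <- Cexp_plus. replace (- a + a) with (RtoC 0) by ring. apply Cexp_0. Qed.

Lemma Cexp_neq_0 a : Cexp a <> 0.
Proof. intros H. generalize (Cexp_neg a). rewrite H, Cmult_0_r. intros E. apply C1_nz. auto. Qed.

Lemma Cexp_opp a : Cexp (- a) = / Cexp a.
Proof.
assert (H := Cexp_neg a). assert (N := Cexp_neq_0 a).
replace (Cexp (- a)) with (Cexp (- a) * Cexp a / Cexp a) by (field; auto). rewrite H. field. auto.
Qed.

Lemma Cexp_cis a : Cexp a = RtoC (exp (Re a)) * cis (Im a).
Proof. unfold Cexp, cis. apply C_ext; simpl; ring. Qed.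

Lemma Cmod_Cexp a : Cmod (Cexp a) = exp (Re a).
Proof.
rewrite Cexp_cis, Cmod_mult, Cmod_cis, Cmod_R, Rabs_pos_eq; [ring|]. left; apply exp_pos.
Qed.

Lemma Cexp_RtoC x : Cexp (RtoC x) = RtoC (exp x).
Proof. unfold Cexp. simpl. rewrite cos_0, sin_0. apply C_ext; simpl; ring. Qed.

Lemma Cexp_pow n a : Cexp (RtoC (INR n) * a) = Cexp a ^ n.
Proof.
induction n.
- simpl. rewrite Cmult_0_l. apply Cexp_0.
- rewrite S_INR, RtoC_plus, Cmult_plus_distr_r, Cmult_1_l, Cexp_plus, IHn. simpl. ring.
Qed.

Lemma Cexp_2PI : Cexp (2 * RtoC PI * Ci) = 1.
Proof.
unfold Cexp. simpl. replace ((2 * PI - 0 * 0) * 0 - (2 * 0 + 0 * PI) * 1)%R with 0%R by ring.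
replace ((2 * PI - 0 * 0) * 1 + (2 * 0 + 0 * PI) * 0)%R with (2 * PI)%R by ring.
rewrite exp_0, cos_2PI, sin_2PI. apply C_ext; simpl; ring.
Qed.

Lemma Cexp_PI : Cexp (RtoC PI * Ci) = -1.
Proof.
unfold Cexp. simpl. replace (PI * 0 - 0 * 1)%R with 0%R by ring.
replace (PI * 1 + 0 * 0)%R with PI by ring.
rewrite exp_0, cos_PI, sin_PI. apply C_ext; simpl; ring.
Qed.

Lemma Cexp_period a n : Cexp (a + 2 * RtoC PI * Ci * RtoC (INR n)) = Cexp a.
Proof.
rewrite Cexp_plus, Cmult_comm, (Cmult_comm (2 * RtoC PI * Ci)), Cexp_pow, Cexp_2PI, Cpow_1_l. ring.
Qed.

Lemma Cexp_eq_1 a : Rabs (Im a) < 2 * PI -> Cexp a = 1 -> a = 0.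
Proof.
intros Ha H.
assert (E1 : Re (Cexp a) = 1%R) by (rewrite H; reflexivity).
assert (E2 : Im (Cexp a) = 0%R) by (rewrite H; reflexivity).
assert (Ex : exp (Re a) = 1%R) by (rewrite <- Cmod_Cexp, H, Cmod_1; reflexivity).
unfold Cexp in E1, E2. simpl in E1, E2. rewrite Ex in E1, E2. rewrite Rmult_1_l in E1, E2.
assert (R0 : Re a = 0%R).
{ apply exp_inv. rewrite Ex, exp_0. reflexivity. }
assert (I0 : Im a = 0%R).
{ apply Rabs_def2 in Ha. destruct (sin_eq_0_0 _ E2) as [k Hk].
  assert (PP := PI_RGT_0).
  assert (-2 < IZR k < 2) by (rewrite Hk in Ha; nra).
  assert (Hk2 : (-2 < k < 2)%Z) by (split; apply lt_IZR; lra).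
  assert (k = 0 \/ k = 1 \/ k = -1)%Z as [->|[->| ->]] by lia.
  - rewrite Hk. ring.
  - rewrite Hk in E1. rewrite Rmult_1_l, cos_PI in E1. lra.
  - rewrite Hk in E1. replace (-1 * PI)%R with (- PI)%R in E1 by ring. rewrite cos_neg, cos_PI in E1. lra. }
apply C_ext; auto.
Qed.

Lemma Cexp_inj a b : Rabs (Im a - Im b) < 2 * PI -> Cexp a = Cexp b -> a = b.
Proof.
intros Hd H. apply Ceq_minus. apply Cexp_eq_1.
- rewrite im_sub. auto.
- unfold Cminus. rewrite Cexp_plus, Cexp_opp, H. field. apply Cexp_neq_0.
Qed.

Lemma rder_Cexp_line h t : rder (fun t => Cexp (RtoC t * h)) t (h * Cexp (RtoC t * h)).
Proof.
destruct h as [x y]. apply rder_pair; simpl; auto_derive; auto; unfold Rminus; ring.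
Qed.

(** With c = 0 this represents e^h - 1 as an integral, with c = 1 the second-order remainder; both
    Taylor estimates follow by bounding the integrand, the second one using the first. *)
Lemma isI_Cexp_line h c : isI (fun t => h * (Cexp (RtoC t * h) - c)) 0 1 (Cexp h - 1 - c * h).
Proof.
set (F := fun t => Cexp (RtoC t * h) - RtoC t * (c * h)).
replace (Cexp h - 1 - c * h) with (F 1%R - F 0%R).
- apply isI_FTC.
  + intros t _. eapply eder_eq; [|apply eder_minus; [apply rder_Cexp_line|apply eder_mult; [apply rder_id|apply eder_const]]].
    cbv beta. ring.
  + intros t _. apply econt_mult; [apply econt_const|]. apply econt_minus; [|apply econt_const].
    eapply rder_rcont, rder_Cexp_line.
- unfold F. rewrite !Cmult_1_l, !Cmult_0_l, Cexp_0. ring.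
Qed.

Lemma exp_le x y : x <= y -> exp x <= exp y.
Proof. intros [H|H]; [left; apply exp_increasing; auto|subst; lra]. Qed.

Lemma Cmod_Cexp_le a : Cmod (Cexp a) <= exp (Cmod a).
Proof.
rewrite Cmod_Cexp. apply exp_le. eapply Rle_trans; [apply Rle_abs|apply re_le_Cmod].
Qed.

Lemma Cexp_sub_1 h : Cmod (Cexp h - 1) <= Cmod h * exp (Cmod h).
Proof.
generalize (isI_Cexp_line h 0). replace (Cexp h - 1 - 0 * h) with (Cexp h - 1) by ring. intros HI.
replace (Cmod h * exp (Cmod h))%R with ((1 - 0) * (Cmod h * exp (Cmod h)))%R by ring.
eapply isI_bound; [lra| |apply HI].
intros t Ht. cbv beta. replace (h * (Cexp (RtoC t * h) - 0)) with (h * Cexp (RtoC t * h)) by ring.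
rewrite Cmod_mult. apply Rmult_le_compat_l; [apply Cmod_ge_0|].
eapply Rle_trans; [apply Cmod_Cexp_le|]. apply exp_le. rewrite Cmod_mult, Cmod_R, Rabs_pos_eq by lra.
generalize (Cmod_ge_0 h). nra.
Qed.

Lemma Cexp_taylor2 h : Cmod (Cexp h - 1 - h) <= Cmod h ^ 2 * exp (Cmod h).
Proof.
generalize (isI_Cexp_line h 1). rewrite Cmult_1_l. intros HI.
replace (Cmod h ^ 2 * exp (Cmod h))%R with ((1 - 0) * (Cmod h * (Cmod h * exp (Cmod h))))%R by ring.
eapply isI_bound; [lra| |apply HI].
intros t Ht. cbv beta. rewrite Cmod_mult. apply Rmult_le_compat_l; [apply Cmod_ge_0|].
assert (E : Cmod (RtoC t * h) <= Cmod h).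
{ rewrite Cmod_mult, Cmod_R, Rabs_pos_eq by lra. generalize (Cmod_ge_0 h). nra. }
eapply Rle_trans; [apply Cexp_sub_1|]. apply Rmult_le_compat; auto.
- apply Cmod_ge_0.
- left; apply exp_pos.
- apply exp_le; auto.
Qed.

Lemma cder_Cexp z : cder Cexp z (Cexp z).
Proof.
intros e He. set (K := (exp (Re z) * exp 1)%R).
assert (HK : 0 < K) by (apply Rmult_lt_0_compat; apply exp_pos).
exists (Rmin 1 (e / K)). split; [apply Rmin_case; [lra|apply Rdiv_lt_0_compat; auto]|].
intros y Hy. assert (Y1 : Cmod (y - z) < 1) by (eapply Rlt_le_trans; [apply Hy|apply Rmin_l]).
assert (Y2 : Cmod (y - z) < e / K) by (eapply Rlt_le_trans; [apply Hy|apply Rmin_r]).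
apply Rlt_div_r in Y2; auto.
replace (Cexp y - Cexp z - Cexp z * (y - z)) with (Cexp z * (Cexp (y - z) - 1 - (y - z))).
- rewrite Cmod_mult, Cmod_Cexp.
  apply Rle_trans with (exp (Re z) * (Cmod (y - z) ^ 2 * exp 1))%R.
  + apply Rmult_le_compat_l; [left; apply exp_pos|]. eapply Rle_trans; [apply Cexp_taylor2|].
    apply Rmult_le_compat_l; [apply pow2_ge_0|]. apply exp_le; lra.
  + unfold K in Y2. generalize (Cmod_ge_0 (y - z)). intros. simpl. nra.
- replace y with (z + (y - z)) at 3 by ring. rewrite Cexp_plus. ring.
Qed.

Lemma cder_Cexp_lin c z : cder (fun x => Cexp (c * x)) z (c * Cexp (c * z)).
Proof.
eapply eder_eq; [|apply (eder_comp Cminus Cexp (fun x => c * x)); [apply cder_Cexp|apply eder_scal, cder_id]].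
ring.
Qed.

Lemma log1_exists : exists F : C -> C, F 1 = 0 /\ forall z, 0 < Re z -> cder F z (/ z).
Proof.
destruct (box_primitive _ _ Cinv oint_pos oint_True) with (z0 := RtoC 1) as [F [F0 HF]].
- intros z [Hz _]. eexists. apply cder_inv. intros E. rewrite E in Hz. simpl in Hz. lra.
- split; simpl; auto; lra.
- exists F. split; auto. intros z Hz. apply HF. split; auto.
Qed.

(** The principal logarithm on the right half-plane. Chosen as a primitive of 1/z that vanishes at
    1, so that its derivative needs no proof and only [Cexp (Log1 z) = z] is left. *)
Definition Log1 : C -> C := proj1_sig (constructive_indefinite_description _ log1_exists).

Lemma Log1_1 : Log1 1 = 0.
Proof. unfold Log1. destruct constructive_indefinite_description as [F HF]; simpl. apply HF. Qed.

Lemma cder_Log1 z : 0 < Re z -> cder Log1 z (/ z).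
Proof. unfold Log1. destruct constructive_indefinite_description as [F HF]; simpl. apply HF. Qed.

Lemma Cexp_Log1 z : 0 < Re z -> Cexp (Log1 z) = z.
Proof.
intros Hz. assert (Nz : z <> 0) by (intros E; rewrite E in Hz; simpl in Hz; lra).
assert (E : Cexp (Log1 z) * / z = Cexp (Log1 1) * / 1).
{ apply (cder0_const (fun z => Cexp (Log1 z) * / z)). intros t Ht.
  assert (Hr : 0 < Re (1 + RtoC t * (z - 1))).
  { rewrite re_plus, re_scal_l, re_sub. simpl. destruct (Req_dec t 0) as [->|]; [lra|]. nra. }
  set (y := 1 + RtoC t * (z - 1)) in *.
  assert (Ny : y <> 0) by (intros E; rewrite E in Hr; simpl in Hr; lra).
  eapply eder_eq; [|apply eder_mult; [apply (eder_comp Cminus Cexp Log1); [apply cder_Cexp|apply cder_Log1; auto]|apply cder_inv; auto]].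
  cbv beta. field. auto. }
rewrite Log1_1, Cexp_0 in E.
replace (Cexp (Log1 z)) with (Cexp (Log1 z) * / z * z) by (field; auto). rewrite E. field.
Qed.

Lemma Log1_small e : 0 < e -> exists d, 0 < d /\ d < 1 /\
  forall u, Cmod (u - 1) < d -> 0 < Re u /\ Cmod (Log1 u) < e.
Proof.
intros He. assert (H1 : 0 < Re 1) by (simpl; lra).
destruct (eder_cont _ _ _ _ (cder_Log1 1 H1) e He) as [d [Hd H]].
exists (Rmin d (1/2)). split; [apply Rmin_case; lra|]. split; [generalize (Rmin_r d (1/2)); lra|].
intros u Hu. split.
- generalize (re_le_Cmod (u - 1)). rewrite re_sub. simpl. intros K.
  generalize (Rmin_r d (1/2)). intros. unfold Rabs in K. destruct Rcase_abs; lra.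
- specialize (H u). rewrite Log1_1 in H. replace (Log1 u) with (Log1 u - 0) by ring. apply H.
  eapply Rlt_le_trans; [apply Hu|apply Rmin_l].
Qed.

Definition clog (z : C) : C := (ln (Cmod z), arg z).

Lemma Cmod_sq z : (Cmod z * Cmod z = Re z * Re z + Im z * Im z)%R.
Proof. generalize (Cmod2_alt z). simpl. lra. Qed.

Lemma cos_sin_arg (z : C) : z <> 0 -> cos (arg z) = (Re z / Cmod z)%R /\ sin (arg z) = (Im z / Cmod z)%R
  /\ 0 <= arg z <= 2 * PI.
Proof.
intros Hz. assert (Hm : 0 < Cmod z) by (apply Cmod_gt_0; auto).
assert (Hb : -1 <= Re z / Cmod z <= 1).
{ generalize (re_le_Cmod z). intros K. apply Rabs_le_between in K. split.
  - apply Rle_div_r; lra.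
  - apply Rle_div_l; lra. }
assert (Hs : sin (acos (Re z / Cmod z)) = (Rabs (Im z) / Cmod z)%R).
{ rewrite sin_acos by auto.
  replace (1 - (Re z / Cmod z)²)%R with ((Im z / Cmod z)²)%R.
  - rewrite sqrt_Rsqr_abs. unfold Rdiv. rewrite Rabs_mult, (Rabs_pos_eq (/ Cmod z)); auto.
    left; apply Rinv_0_lt_compat; auto.
  - unfold Rsqr. field_simplify; try lra. f_equal. generalize (Cmod_sq z). lra. }
generalize (acos_bound (Re z / Cmod z)). intros Ab.
unfold arg. destruct Rle_dec as [H|H].
- rewrite cos_acos, Hs by auto. rewrite Rabs_pos_eq by auto. repeat split; auto; generalize PI_RGT_0; lra.
- assert (E : (2 * PI - acos (Re z / Cmod z) = - acos (Re z / Cmod z) + 2 * INR 1 * PI)%R) by (simpl; ring).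
  rewrite E, cos_period, sin_period, cos_neg, sin_neg, cos_acos, Hs by auto.
  rewrite Rabs_left by lra. rewrite <- E. repeat split; auto; [field; lra| |]; lra.
Qed.

Lemma Cexp_clog (z : C) : z <> 0 -> Cexp (clog z) = z.
Proof.
intros Hz. assert (Hm : 0 < Cmod z) by (apply Cmod_gt_0; auto).
destruct (cos_sin_arg z Hz) as [H1 [H2 _]].
unfold Cexp, clog. simpl. rewrite exp_ln, H1, H2 by auto. apply C_ext; simpl; field; lra.
Qed.

Lemma slit_neq_0 (z : C) : slit_plane z -> z <> 0.
Proof. intros H E. apply H. rewrite E. simpl. lra. Qed.

Lemma Im_clog z : slit_plane z -> 0 < Im (clog z) < 2 * PI.
Proof.
intros Hz. assert (Nz := slit_neq_0 z Hz). destruct (cos_sin_arg z Nz) as [H1 [H2 H3]].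
assert (Hm : 0 < Cmod z) by (apply Cmod_gt_0; auto).
assert (K : arg z = 0%R \/ arg z = (2 * PI)%R -> False).
{ intros K. assert (cos (arg z) = 1 /\ sin (arg z) = 0)%R as [C S].
  { destruct K as [-> | ->]; [rewrite cos_0, sin_0|rewrite cos_2PI, sin_2PI]; auto. }
  rewrite C in H1. rewrite S in H2. apply Hz. split.
  - replace (Im z) with (Im z / Cmod z * Cmod z)%R by (field; lra). rewrite <- H2. ring.
  - replace (Re z) with (Re z / Cmod z * Cmod z)%R by (field; lra). rewrite <- H1. lra. }
change (Im (clog z)) with (arg z). split; apply Rnot_le_lt; intros Q; apply K; lra.
Qed.

Lemma clog_unique w : 0 < Im w < 2 * PI -> slit_plane (Cexp w) /\ clog (Cexp w) = w.
Proof.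
intros Hw. assert (S : slit_plane (Cexp w)).
{ intros [H1 H2]. unfold Cexp in H1, H2. simpl in H1, H2. assert (P := exp_pos (Re w)).
  assert (S : sin (Im w) = 0%R) by (apply Rmult_integral in H1; lra).
  destruct (sin_eq_0_0 _ S) as [k Hk]. assert (PP := PI_RGT_0).
  assert (0 < IZR k < 2) by (rewrite Hk in Hw; nra).
  assert (Hk2 : (0 < k < 2)%Z) by (split; apply lt_IZR; lra).
  assert (k = 1)%Z as -> by lia. rewrite Hk, Rmult_1_l, cos_PI in H2. nra. }
split; auto. apply Cexp_inj; [|apply Cexp_clog, Cexp_neq_0].
generalize (Im_clog _ S). intros. apply Rabs_def1; lra.
Qed.

Lemma slit_open : copen slit_plane.
Proof.
intros z Hz. destruct (Req_dec (Im z) 0) as [E|E].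
- assert (Hr : Re z < 0) by (apply Rnot_le_lt; intros Q; apply Hz; auto).
  exists (- Re z)%R. split; [lra|]. intros y Hy [_ H2].
  generalize (re_le_Cmod (y - z)). rewrite re_sub. intros K. apply Rabs_le_between in K. lra.
- exists (Rabs (Im z)). split; [apply Rabs_pos_lt; auto|]. intros y Hy [H1 _].
  generalize (im_le_Cmod (y - z)). rewrite im_sub, H1.
  replace (0 - Im z)%R with (- Im z)%R by ring. rewrite Rabs_Ropp. lra.
Qed.

(** Near z the function clog z + Log1 (y / z) is a logarithm of y whose imaginary part still lies in
    (0, 2 pi), hence it is [clog y] by uniqueness. This avoids differentiating the case distinction
    in [arg]. *)
Lemma cder_clog z : slit_plane z -> cder clog z (/ z).
Proof.
intros Hz. assert (Nz := slit_neq_0 z Hz). assert (HI := Im_clog z Hz).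
set (e := Rmin (Im (clog z)) (2 * PI - Im (clog z))).
assert (He : 0 < e) by (apply Rmin_case; lra).
destruct (Log1_small e He) as [d [Hd [_ HL]]].
assert (Hm : 0 < Cmod z) by (apply Cmod_gt_0; auto).
apply cder_ext_loc with (fun y => clog z + Log1 (y * / z)).
- exists (d * Cmod z)%R. split; [apply Rmult_lt_0_compat; auto|]. intros y Hy.
  destruct (HL (y * / z)) as [L1 L2].
  { replace (y * / z - 1) with ((y - z) / z) by (field; auto). rewrite Cmod_div by auto. apply Rlt_div_l; auto. }
  set (w := clog z + Log1 (y * / z)).
  assert (Hw : Cexp w = y).
  { unfold w. rewrite Cexp_plus, Cexp_clog, Cexp_Log1 by auto. field; auto. }
  rewrite <- Hw. symmetry. apply clog_unique. unfold w. rewrite im_plus.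
  generalize (im_le_Cmod (Log1 (y * / z))). intros K. apply Rabs_le_between in K.
  generalize (Rmin_l (Im (clog z)) (2 * PI - Im (clog z))) (Rmin_r (Im (clog z)) (2 * PI - Im (clog z))).
  fold e. lra.
- assert (E1 : z * / z = 1) by (field; auto).
  eapply eder_eq; [|apply eder_plus; [apply eder_const|apply (eder_comp Cminus Log1 (fun y => y * / z));
    [apply cder_Log1; rewrite E1; simpl; lra|apply eder_mult; [apply cder_id|apply eder_const]]]].
  cbv beta. rewrite E1. field. auto.
Qed.

Lemma upper_clog z : 0 < Im z -> slit_plane z /\ 0 < Im (clog z) < PI.
Proof.
intros H. assert (S : slit_plane z) by (intros [E _]; lra). split; auto.
generalize (Im_clog z S). intros K. split; [lra|]. apply Rnot_le_lt. intros Q.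
assert (E := Cexp_clog z (slit_neq_0 z S)). assert (Im (Cexp (clog z)) <= 0); [|rewrite E in *; lra].
unfold Cexp. simpl. assert (sin (arg z) <= 0) by (apply sin_le_0; simpl in *; lra).
generalize (exp_pos (ln (Cmod z))). nra.
Qed.

Lemma lower_clog z : Im z < 0 -> slit_plane z /\ PI < Im (clog z) < 2 * PI.
Proof.
intros H. assert (S : slit_plane z) by (intros [E _]; lra). split; auto.
generalize (Im_clog z S). intros K. split; [|lra]. apply Rnot_le_lt. intros Q.
assert (E := Cexp_clog z (slit_neq_0 z S)). assert (0 <= Im (Cexp (clog z))); [|rewrite E in *; lra].
unfold Cexp. simpl. assert (0 <= sin (arg z)) by (apply sin_ge_0; simpl in *; lra).
generalize (exp_pos (ln (Cmod z))). nra.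
Qed.

Lemma Re_clog_neg (z : C) : z <> 0 -> Cmod z < 1 -> Re (clog z) < 0.
Proof.
intros Hz H. simpl. rewrite <- ln_1. apply ln_increasing; auto. apply Cmod_gt_0; auto.
Qed.

Lemma Re_clog_pos z : 1 < Cmod z -> 0 < Re (clog z).
Proof. intros H. simpl. rewrite <- ln_1. apply ln_increasing; auto. lra. Qed.

(** * The Gamma function *)

Definition ccv (u : nat -> C) (l : C) : Prop :=
  forall e, 0 < e -> exists N, forall n, (N <= n)%nat -> Cmod (u n - l) < e.

Lemma ccv_unique u l m : ccv u l -> ccv u m -> l = m.
Proof.
intros H1 H2. apply Ceq_minus. apply Cmod_le_eps_0. intros e He.
destruct (H1 (e/2)%R) as [N1 K1]; [lra|]. destruct (H2 (e/2)%R) as [N2 K2]; [lra|].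
specialize (K1 (max N1 N2) (Nat.le_max_l _ _)). specialize (K2 (max N1 N2) (Nat.le_max_r _ _)).
replace (l - m) with ((u (max N1 N2) - m) - (u (max N1 N2) - l)) by ring.
eapply Rle_trans; [apply Cmod_triangle_sub|]. lra.
Qed.

Lemma ccv_const c : ccv (fun _ => c) c.
Proof. intros e He. exists O. intros. replace (c - c) with (RtoC 0) by ring. rewrite Cmod_0; auto. Qed.

Lemma ccv_mult u v l m : ccv u l -> ccv v m -> ccv (fun n => u n * v n) (l * m).
Proof.
intros H1 H2 e He. destruct (Cmult_near l m e He) as [d [Hd K]].
destruct (H1 d Hd) as [N1 K1]. destruct (H2 d Hd) as [N2 K2]. exists (max N1 N2). intros n Hn.
apply K; [apply K1|apply K2]; lia.
Qed.

Lemma ccv_ext u v l : (exists N, forall n, (N <= n)%nat -> u n = v n) -> ccv u l -> ccv v l.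
Proof.
intros [N0 E] H e He. destruct (H e He) as [N K]. exists (max N0 N). intros n Hn.
rewrite <- E by lia. apply K. lia.
Qed.

Lemma ccv_cauchy u : (forall e, 0 < e -> exists N, forall n, (N <= n)%nat -> Cmod (u n - u N) <= e) ->
  exists l, ccv u l.
Proof.
intros H.
assert (E : forall (p : C -> R), (forall a b, Rabs (p a - p b) <= Cmod (a - b)) ->
   exists l : R, is_lim_seq (fun n => p (u n)) l).
{ intros p Hp. destruct (proj2 (ex_lim_seq_cauchy_corr (fun n => p (u n)))) as [l Hl].
  - intros e. destruct (H (e / 3)%R) as [N HN]; [destruct e; simpl; lra|]. exists N. intros n m Hn Hm.
    eapply Rle_lt_trans; [apply Hp|].
    replace (u n - u m) with ((u n - u N) - (u m - u N)) by ring.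
    eapply Rle_lt_trans; [apply Cmod_triangle_sub|].
    generalize (HN n Hn) (HN m Hm). destruct e; simpl in *. lra.
  - exists l. exact Hl. }
destruct (E Re) as [x Hx]. { intros. rewrite <- re_sub. apply re_le_Cmod. }
destruct (E Im) as [y Hy]. { intros. rewrite <- im_sub. apply im_le_Cmod. }
exists (x, y). intros e He.
apply is_lim_seq_spec in Hx. apply is_lim_seq_spec in Hy.
assert (He2 : 0 < e / 2) by lra.
destruct (Hx (mkposreal _ He2)) as [N1 K1]. destruct (Hy (mkposreal _ He2)) as [N2 K2].
exists (max N1 N2). intros n Hn. simpl in *.
specialize (K1 n ltac:(lia)). specialize (K2 n ltac:(lia)).
eapply Rle_lt_trans; [apply Cmod_le_re_im|]. rewrite re_sub, im_sub. simpl. lra.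
Qed.

Lemma ccv_C_Lim_seq u l : ccv u l -> C_Lim_seq u = l.
Proof.
intros H. unfold C_Lim_seq.
assert (E : forall (p : C -> R), (forall a b, Rabs (p a - p b) <= Cmod (a - b)) ->
   Lim_seq (fun n => p (u n)) = p l).
{ intros p Hp. apply is_lim_seq_unique. apply is_lim_seq_spec. intros e.
  destruct (H e (cond_pos e)) as [N K]. exists N. intros n Hn. eapply Rle_lt_trans; [apply Hp|auto]. }
rewrite (E Re), (E Im).
- destruct l; reflexivity.
- intros. rewrite <- im_sub. apply im_le_Cmod.
- intros. rewrite <- re_sub. apply re_le_Cmod.
Qed.

Lemma ccv_Cmod_le u v l m : ccv u l -> ccv v m -> (exists N, forall n, (N <= n)%nat -> Cmod (u n) <= Cmod (v n)) ->
  (Cmod l <= Cmod m).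
Proof.
intros H1 H2 [N0 H]. apply le_epsilon. intros e He.
destruct (H1 (e/2)%R) as [N1 K1]; [lra|]. destruct (H2 (e/2)%R) as [N2 K2]; [lra|].
set (n := max N0 (max N1 N2)). specialize (K1 n ltac:(lia)). specialize (K2 n ltac:(lia)). specialize (H n ltac:(lia)).
generalize (Cmod_triangle_inv l (u n)) (Cmod_triangle_inv (v n) m). rewrite (Cmod_sub_sym l). lra.
Qed.

(** Relative increments of size K / p^2 are compared with the telescoping terms 2K/p - 2K/(p+1).
    Thus |u p| e^(2K/p) does not increase, which bounds the sequence, and summing the increments
    gives a tail of order 1/p. The explicit constants are what makes the convergence to Gamma
    locally uniform. *)
Lemma product_converges (u : nat -> C) N K : (1 <= N)%nat -> 0 <= K ->
  (forall p, (N <= p)%nat -> Cmod (u (S p) - u p) <= K / INR p ^ 2 * Cmod (u p)) ->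
  forall p q, (N <= p)%nat -> (p <= q)%nat ->
    (Cmod (u q - u p) <= Cmod (u N) * exp (2 * K) * (2 * K) / INR p).
Proof.
intros HN HK H.
assert (Pos : forall p, (N <= p)%nat -> 1 <= INR p).
{ intros p Hp. replace 1%R with (INR 1) by reflexivity. apply le_INR. lia. }
assert (T : forall p, (N <= p)%nat -> K / INR p ^ 2 <= 2 * K / INR p - 2 * K / INR (S p)).
{ intros p Hp. specialize (Pos p Hp). rewrite S_INR.
  replace (2 * K / INR p - 2 * K / (INR p + 1))%R with (K * (2 / (INR p * (INR p + 1))))%R by (field; lra).
  unfold Rdiv at 1. apply Rmult_le_compat_l; auto.
  apply (Rmult_le_reg_r (INR p ^ 2 * (INR p + 1))); [nra|]. field_simplify; nra. }
assert (Bd : forall q p, (N <= p)%nat -> Cmod (u (q + p)%nat) * exp (2 * K / INR (q + p)) <= Cmod (u p) * exp (2 * K / INR p)).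
{ induction q; intros p Hp; [simpl; lra|]. eapply Rle_trans; [|apply IHq; auto].
  simpl (S q + p)%nat. set (m := (q + p)%nat). assert (Hm : (N <= m)%nat) by (unfold m; lia).
  assert (Cmod (u (S m)) <= (1 + K / INR m ^ 2) * Cmod (u m)).
  { replace (u (S m)) with (u m + (u (S m) - u m)) by ring. eapply Rle_trans; [apply Cmod_triangle|].
    generalize (H m Hm). lra. }
  assert (1 + K / INR m ^ 2 <= exp (2 * K / INR m - 2 * K / INR (S m))).
  { eapply Rle_trans; [apply exp_ineq1_le|]. apply exp_le. auto. }
  replace (exp (2 * K / INR m))%R with (exp (2 * K / INR m - 2 * K / INR (S m)) * exp (2 * K / INR (S m)))%R
    by (rewrite <- exp_plus; f_equal; ring).
  rewrite <- Rmult_assoc. apply Rmult_le_compat_r; [left; apply exp_pos|].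
  rewrite Rmult_comm. generalize (Cmod_ge_0 (u m)). nra. }
set (M := (Cmod (u N) * exp (2 * K))%R).
assert (HM : 0 <= M) by (apply Rmult_le_pos; [apply Cmod_ge_0|left; apply exp_pos]).
assert (Bd2 : forall p, (N <= p)%nat -> Cmod (u p) <= M).
{ intros p Hp. specialize (Bd (p - N)%nat N (le_n _)). replace (p - N + N)%nat with p in Bd by lia.
  assert (1 <= exp (2 * K / INR p)).
  { rewrite <- exp_0. apply exp_le. apply Rmult_le_pos; [lra|]. left; apply Rinv_0_lt_compat. generalize (Pos p Hp); lra. }
  assert (exp (2 * K / INR N) <= exp (2 * K)).
  { apply exp_le. apply Rle_div_l; [generalize (Pos N (le_n _)); lra|]. generalize (Pos N (le_n _)). nra. }
  generalize (Cmod_ge_0 (u p)) (Cmod_ge_0 (u N)). unfold M. intros. nra. }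
assert (Q : forall q p, (N <= p)%nat -> Cmod (u (q + p)%nat - u p) <= M * (2 * K / INR p - 2 * K / INR (q + p))).
{ induction q; intros p Hp.
  - simpl. replace (u p - u p) with (RtoC 0) by ring. rewrite Cmod_0. lra.
  - simpl (S q + p)%nat. set (m := (q + p)%nat). assert (Hm : (N <= m)%nat) by (unfold m; lia).
    replace (u (S m) - u p) with ((u (S m) - u m) + (u m - u p)) by ring.
    eapply Rle_trans; [apply Cmod_triangle|]. specialize (IHq p Hp). fold m in IHq.
    assert (Cmod (u (S m) - u m) <= (2 * K / INR m - 2 * K / INR (S m)) * M).
    { eapply Rle_trans; [apply H; auto|]. apply Rmult_le_compat; auto.
      - apply Rmult_le_pos; auto. left. apply Rinv_0_lt_compat, pow_lt. generalize (Pos m Hm); lra.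
      - apply Cmod_ge_0. }
    lra. }
intros p q Hp Hq. specialize (Q (q - p)%nat p Hp). replace (q - p + p)%nat with q in Q by lia.
eapply Rle_trans; [apply Q|]. fold M.
assert (0 <= 2 * K / INR q).
{ apply Rmult_le_pos; [lra|]. left; apply Rinv_0_lt_compat. generalize (Pos q ltac:(lia)); lra. }
unfold Rdiv in *. nra.
Qed.

Definition gauss (p : nat) (s : C) : C :=
  RtoC (INR (fact p)) * Cexp (s * RtoC (ln (INR p))) / (s * Cprod (fun k => s + RtoC (INR k)) p).

Definition not_pole (s : C) : Prop := forall m : nat, s + RtoC (INR m) <> 0.

Lemma Cprod_S (f : nat -> C) n : Cprod f (S n) = Cprod f n * f (S n).
Proof. reflexivity. Qed.

Lemma Cprod_neq_0 (f : nat -> C) n : (forall k, (1 <= k <= n)%nat -> f k <> 0) -> Cprod f n <> 0.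
Proof.
induction n; intros H; simpl; [apply C1_nz|]. apply Cmult_neq_0; [apply IHn; intros; apply H; lia|apply H; lia].
Qed.

Lemma not_pole_0 s : not_pole s -> s <> 0.
Proof. intros H E. apply (H O). rewrite E. simpl. ring. Qed.

Lemma not_pole_den s p : not_pole s -> s * Cprod (fun k => s + RtoC (INR k)) p <> 0.
Proof.
intros H. apply Cmult_neq_0; [apply not_pole_0; auto|apply Cprod_neq_0; auto].
Qed.

Lemma RtoC_INR_neq p : (1 <= p)%nat -> RtoC (INR p) <> 0.
Proof. intros. apply RtoC_neq. apply not_0_INR. lia. Qed.

Lemma gauss_neq_0 s p : not_pole s -> gauss p s <> 0.
Proof.
intros H E. assert (D := not_pole_den s p H).
assert (F : RtoC (INR (fact p)) * Cexp (s * RtoC (ln (INR p))) = 0).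
{ replace (RtoC (INR (fact p)) * Cexp (s * RtoC (ln (INR p)))) with (gauss p s * (s * Cprod (fun k => s + RtoC (INR k)) p)).
  - rewrite E. ring.
  - unfold gauss. field. split; intros Z; apply D; rewrite Z; ring. }
apply Cmult_neq_0 in F; auto.
- apply RtoC_INR_neq. generalize (lt_O_fact p). lia.
- apply Cexp_neq_0.
Qed.

Definition gauss_ratio (p : nat) (s : C) : C :=
  Cexp (s * RtoC (ln (INR (S p)) - ln (INR p))) / (1 + s / RtoC (INR (S p))).

Lemma gauss_S p s : not_pole s -> gauss (S p) s = gauss p s * gauss_ratio p s.
Proof.
intros H. assert (D := not_pole_den s (S p) H). unfold gauss, gauss_ratio.
rewrite Cprod_S in *. set (P := Cprod (fun k => s + RtoC (INR k)) p) in *.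
assert (N1 : RtoC (INR (S p)) <> 0) by (apply RtoC_INR_neq; lia).
assert (N2 := H (S p)).
rewrite fact_simpl, mult_INR, RtoC_mult.
replace (s * RtoC (ln (INR (S p)))) with (s * RtoC (ln (INR p)) + s * RtoC (ln (INR (S p)) - ln (INR p))) by (rewrite RtoC_minus; ring).
rewrite Cexp_plus. field. repeat split; auto.
- intros E. apply N2. rewrite Cplus_comm. auto.
- intros Z; apply D; rewrite Z; ring.
- intros Z; apply D; rewrite Z; ring.
Qed.

Lemma ln_S_bounds p : (1 <= p)%nat -> / INR (S p) <= ln (INR (S p)) - ln (INR p) <= / INR p.
Proof.
intros Hp. assert (P1 : 0 < INR p) by (apply lt_0_INR; lia).
assert (E : INR (S p) = (INR p + 1)%R) by apply S_INR.
split.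
- assert (ln (INR p / INR (S p)) <= INR p / INR (S p) - 1).
  { assert (0 < INR p / INR (S p)) by (apply Rdiv_lt_0_compat; lra).
    generalize (exp_ineq1_le (ln (INR p / INR (S p)))). rewrite exp_ln by auto. lra. }
  rewrite ln_div in H by lra.
  replace (INR p / INR (S p) - 1)%R with (- / INR (S p))%R in H by (rewrite E; field; lra). lra.
- assert (ln (INR (S p) / INR p) <= INR (S p) / INR p - 1).
  { assert (0 < INR (S p) / INR p) by (apply Rdiv_lt_0_compat; lra).
    generalize (exp_ineq1_le (ln (INR (S p) / INR p))). rewrite exp_ln by auto. lra. }
  rewrite ln_div in H by lra.
  replace (INR (S p) / INR p - 1)%R with (/ INR p)%R in H by (rewrite E; field; lra). lra.
Qed.

(** With d = ln ((p+1)/p), the numerator is 1 + s d + O(d^2) and the denominator 1 + s/(p+1). Since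
    d differs from 1/(p+1) by O(1/p^2), the first-order terms cancel. The condition on p keeps the
    denominator at least 1/2 in modulus. *)
Lemma gauss_ratio_bound R s p : 0 <= R -> Cmod s <= R -> (1 <= p)%nat -> 2 * R <= INR p ->
  (Cmod (gauss_ratio p s - 1) <= 2 * (R ^ 2 * exp R + R) / INR p ^ 2).
Proof.
intros HR Hs Hp Hp2. destruct (ln_S_bounds p Hp) as [L1 L2].
set (d := (ln (INR (S p)) - ln (INR p))%R) in *.
assert (P1 : 1 <= INR p) by (replace 1%R with (INR 1) by reflexivity; apply le_INR; lia).
assert (E : INR (S p) = (INR p + 1)%R) by apply S_INR.
assert (P2 : 0 < / INR (S p)) by (apply Rinv_0_lt_compat; lra).
assert (P3 : / INR p <= 1) by (rewrite <- Rinv_1; apply Rinv_le_contravar; lra).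
assert (N1 : RtoC (INR (S p)) <> 0) by (apply RtoC_INR_neq; lia).
assert (Den : / 2 <= Cmod (1 + s / RtoC (INR (S p)))).
{ replace (1 + s / RtoC (INR (S p))) with (1 - (- (s / RtoC (INR (S p))))) by ring.
  eapply Rle_trans; [|apply Cmod_triangle_inv]. rewrite Cmod_opp, Cmod_1, Cmod_div, Cmod_R, Rabs_pos_eq by (auto; lra).
  assert (Cmod s / INR (S p) <= / 2); [|lra]. apply Rle_div_l; lra. }
assert (DN : 1 + s / RtoC (INR (S p)) <> 0) by (apply Cmod_gt_0; lra).
unfold gauss_ratio. fold d.
replace (Cexp (s * RtoC d) / (1 + s / RtoC (INR (S p))) - 1) with
  ((Cexp (s * RtoC d) - 1 - s * RtoC d + s * RtoC (d - / INR (S p))) / (1 + s / RtoC (INR (S p)))).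
2:{ rewrite RtoC_minus, RtoC_inv by lra. field. split; auto. intros Z; apply DN.
    replace (1 + s / RtoC (INR (S p))) with ((RtoC (INR (S p)) + s) / RtoC (INR (S p))) by (field; auto). rewrite Z. field; auto. }
rewrite Cmod_div by auto. apply Rle_div_l; [lra|].
assert (A1 : Cmod (s * RtoC d) <= R * / INR p).
{ rewrite Cmod_mult, Cmod_R, Rabs_pos_eq by lra. apply Rmult_le_compat; auto; [apply Cmod_ge_0|lra]. }
assert (A2 : Cmod (s * RtoC d) <= R) by (eapply Rle_trans; [apply A1|]; nra).
assert (A3 : Cmod (Cexp (s * RtoC d) - 1 - s * RtoC d) <= (R * / INR p) ^ 2 * exp R).
{ eapply Rle_trans; [apply Cexp_taylor2|]. apply Rmult_le_compat; [apply pow2_ge_0|left; apply exp_pos| |apply exp_le; auto].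
  apply pow_incr. split; [apply Cmod_ge_0|auto]. }
assert (A4 : Cmod (s * RtoC (d - / INR (S p))) <= R * (/ INR p * / INR p)).
{ rewrite Cmod_mult, Cmod_R, Rabs_pos_eq by lra. apply Rmult_le_compat; auto; [apply Cmod_ge_0|lra|].
  apply Rle_trans with (/ INR p - / INR (S p))%R; [lra|]. rewrite E.
  replace (/ INR p - / (INR p + 1))%R with (/ INR p * / (INR p + 1))%R by (field; lra).
  apply Rmult_le_compat_l; [lra|]. apply Rinv_le_contravar; lra. }
eapply Rle_trans; [apply Cmod_triangle|].
apply Rle_trans with ((R ^ 2 * exp R + R) * (/ INR p * / INR p))%R; [nra|].
replace (2 * (R ^ 2 * exp R + R) / INR p ^ 2 * Cmod (1 + s / RtoC (INR (S p))))%R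
  with ((R ^ 2 * exp R + R) * (/ INR p * / INR p) * (2 * Cmod (1 + s / RtoC (INR (S p)))))%R by (field; lra).
rewrite <- (Rmult_1_r ((R ^ 2 * exp R + R) * (/ INR p * / INR p))) at 1.
apply Rmult_le_compat_l; [|lra]. assert (0 < exp R) by apply exp_pos.
apply Rmult_le_pos; [nra|]. apply Rmult_le_pos; lra.
Qed.

Lemma nat_above (x : R) : exists n : nat, (1 <= n)%nat /\ x <= INR n.
Proof.
destruct (INR_unbounded x) as [n Hn]. exists (S n). split; [lia|]. rewrite S_INR. lra.
Qed.

Lemma gauss_cauchy R N s : not_pole s -> 0 <= R -> Cmod s <= R -> (1 <= N)%nat -> 2 * R <= INR N ->
  let K := (2 * (R ^ 2 * exp R + R))%R in
  forall p q, (N <= p)%nat -> (p <= q)%nat ->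
    (Cmod (gauss q s - gauss p s) <= Cmod (gauss N s) * exp (2 * K) * (2 * K) / INR p).
Proof.
intros Hs HR Hs2 HN HN2 K. apply product_converges; auto.
- unfold K. assert (0 < exp R) by apply exp_pos. nra.
- intros p Hp. rewrite gauss_S by auto.
  replace (gauss p s * gauss_ratio p s - gauss p s) with ((gauss_ratio p s - 1) * gauss p s) by ring.
  rewrite Cmod_mult. apply Rmult_le_compat_r; [apply Cmod_ge_0|].
  apply gauss_ratio_bound; auto; [lia|]. apply Rle_trans with (1 := HN2). apply le_INR; auto.
Qed.

Lemma archi_div (A e : R) : 0 < e -> exists n : nat, (1 <= n)%nat /\ forall p, (n <= p)%nat -> A / INR p <= e.
Proof.
intros He. destruct (nat_above (A / e)) as [n [Hn1 Hn]]. exists n. split; auto. intros p Hp.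
assert (INR n <= INR p) by (apply le_INR; auto).
assert (0 < INR p) by (apply lt_0_INR; lia).
apply Rle_div_l; auto. apply Rle_div_l in Hn; auto. nra.
Qed.

Lemma gauss_Gamma s : not_pole s -> ccv (fun p => gauss p s) (Gamma s).
Proof.
intros Hs. destruct (nat_above (2 * Cmod s)) as [N [HN1 HN2]].
assert (G := gauss_cauchy (Cmod s) N s Hs (Cmod_ge_0 s) (Rle_refl _) HN1 HN2). cbv zeta in G.
destruct (ccv_cauchy (fun p => gauss p s)) as [l Hl].
- intros e He.
  match type of G with forall p q, _ -> _ -> (_ <= ?A / INR p) => destruct (archi_div A e He) as [n [_ Hn]] end.
  exists (max n N). intros m Hm. eapply Rle_trans; [apply G; lia|]. apply Hn. lia.
- change (Gamma s) with (C_Lim_seq (fun p => gauss p s)). rewrite (ccv_C_Lim_seq _ _ Hl). exact Hl.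
Qed.

(** The reciprocals of the Gauss products satisfy the same kind of estimate, with 2K in place of K
    once K / p^2 is at most 1/2, hence converge too; the product of the two limits is 1. *)
Lemma Gamma_neq_0 s : not_pole s -> Gamma s <> 0.
Proof.
intros Hs. destruct (nat_above (2 * Cmod s)) as [N [HN1 HN2]].
set (K := (2 * (Cmod s ^ 2 * exp (Cmod s) + Cmod s))%R).
assert (HK : 0 <= K).
{ unfold K. assert (0 < exp (Cmod s)) by apply exp_pos. generalize (Cmod_ge_0 s). nra. }
destruct (nat_above (2 * K + 1)) as [N' [HN1' HN2']]. set (N0 := max N N').
assert (G := product_converges (fun p => / gauss p s) N0 (2 * K)).
destruct (ccv_cauchy (fun p => / gauss p s)) as [l Hl].
- intros e He.
  destruct (archi_div (Cmod (/ gauss N0 s) * exp (2 * (2 * K)) * (2 * (2 * K))) e He) as [n [_ Hn]].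
  exists (max n N0). intros m Hm. eapply Rle_trans; [apply G; try lia; try lra|apply Hn; lia].
  intros p Hp.
  assert (Ip : INR N' <= INR p) by (apply le_INR; lia).
  assert (B := gauss_ratio_bound (Cmod s) s p (Cmod_ge_0 s) (Rle_refl _)). fold K in B.
  assert (B' : Cmod (gauss_ratio p s - 1) <= K / INR p ^ 2).
  { apply B; [lia|]. apply Rle_trans with (1 := HN2). apply le_INR; lia. }
  assert (HKp : K / INR p ^ 2 <= / 2).
  { apply Rle_div_l; [apply pow_lt; lra|]. simpl. nra. }
  assert (Hr : / 2 <= Cmod (gauss_ratio p s)).
  { replace (gauss_ratio p s) with (1 - (- (gauss_ratio p s - 1))) by ring.
    eapply Rle_trans; [|apply Cmod_triangle_inv]. rewrite Cmod_opp, Cmod_1. lra. }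
  assert (Nr : gauss_ratio p s <> 0) by (apply Cmod_gt_0; lra).
  assert (Ng := gauss_neq_0 s p Hs).
  rewrite gauss_S by auto.
  replace (/ (gauss p s * gauss_ratio p s) - / gauss p s) with (- ((gauss_ratio p s - 1) * / gauss_ratio p s * / gauss p s)) by (field; auto).
  rewrite Cmod_opp, Cmod_mult. apply Rmult_le_compat_r; [apply Cmod_ge_0|].
  rewrite Cmod_mult, Cmod_inv by auto.
  replace (2 * K / INR p ^ 2)%R with (K / INR p ^ 2 * 2)%R by (unfold Rdiv; ring).
  apply Rmult_le_compat; auto; [apply Cmod_ge_0|left; apply Rinv_0_lt_compat; lra|].
  rewrite <- (Rinv_inv 2). apply Rinv_le_contravar; lra.
- intros E. assert (Hm := ccv_mult _ _ _ _ (gauss_Gamma s Hs) Hl). rewrite E, Cmult_0_l in Hm.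
  apply C1_nz. apply (ccv_unique (fun p => gauss p s * / gauss p s)); auto.
  apply ccv_ext with (fun _ => RtoC 1); [|apply ccv_const].
  exists O. intros n _. field. apply gauss_neq_0; auto.
Qed.

Lemma Cprod_shift s p : (s + 1) * Cprod (fun k => s + 1 + RtoC (INR k)) p = Cprod (fun k => s + RtoC (INR k)) (S p).
Proof.
induction p.
- simpl. ring.
- rewrite Cprod_S, (Cprod_S _ (S p)). rewrite Cmult_assoc, IHp. rewrite !S_INR, !RtoC_plus. ring.
Qed.

Lemma not_pole_S s : not_pole s -> not_pole (s + 1).
Proof.
intros H m E. apply (H (S m)). rewrite S_INR, RtoC_plus, <- E. ring.
Qed.

(** At finite level, [gauss p (s + 1)] is s times [gauss p s] divided by 1 + (s+1)/p, and this last
    factor tends to 1. *)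
Lemma Gamma_S s : not_pole s -> Gamma (s + 1) = s * Gamma s.
Proof.
intros Hs. apply (ccv_unique (fun p => gauss p (s + 1))); [apply gauss_Gamma, not_pole_S; auto|].
apply ccv_ext with (fun p => s * (/ (1 + (s + 1) / RtoC (INR p)) * gauss p s)).
- exists 1%nat. intros p Hp. unfold gauss. rewrite Cprod_shift, Cprod_S.
  assert (P : 0 < INR p) by (apply lt_0_INR; lia).
  assert (N1 : RtoC (INR p) <> 0) by (apply RtoC_INR_neq; auto).
  replace ((s + 1) * RtoC (ln (INR p))) with (s * RtoC (ln (INR p)) + RtoC (ln (INR p))) by ring.
  rewrite Cexp_plus, Cexp_RtoC, exp_ln by auto.
  assert (D := not_pole_den s (S p) Hs). rewrite Cprod_S in D.
  assert (N2 := Hs (S p)). rewrite S_INR, RtoC_plus in N2.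
  set (P1 := Cprod (fun k => s + RtoC (INR k)) p) in *.
  rewrite S_INR, RtoC_plus in D |- *.
  field. repeat split; auto; try (intros Z; apply D; rewrite Z; ring);
    intros Z; apply N2; rewrite <- Z; ring.
- rewrite <- (Cmult_1_l (Gamma s)). apply ccv_mult; [apply ccv_const|]. apply ccv_mult; [|apply gauss_Gamma; auto].
  intros e He.
  destruct (archi_div (2 * Cmod (s + 1)) (Rmin 1 e / 2)%R) as [n [Hn1 Hn]].
  { assert (0 < Rmin 1 e) by (apply Rmin_case; lra). lra. }
  exists n. intros p Hp. specialize (Hn p Hp).
  assert (P : 0 < INR p) by (apply lt_0_INR; lia).
  assert (N1 : RtoC (INR p) <> 0) by (apply RtoC_INR_neq; lia).
  assert (X : Cmod ((s + 1) / RtoC (INR p)) <= / 4 * Rmin 1 e).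
  { rewrite Cmod_div, Cmod_R, Rabs_pos_eq by (auto; lra). unfold Rdiv in *. lra. }
  set (x := (s + 1) / RtoC (INR p)) in *.
  assert (M1 := Rmin_l 1 e). assert (M2 := Rmin_r 1 e).
  assert (Hd : / 2 <= Cmod (1 + x)).
  { replace (1 + x) with (1 - (- x)) by ring. eapply Rle_trans; [|apply Cmod_triangle_inv]. rewrite Cmod_opp, Cmod_1. lra. }
  assert (Nd : 1 + x <> 0) by (apply Cmod_gt_0; lra).
  replace (/ (1 + x) - 1) with (- (x / (1 + x))) by (field; auto).
  rewrite Cmod_opp, Cmod_div by auto. apply Rlt_div_l; [lra|]. nra.
Qed.

Lemma cder_Cprod (f : nat -> C -> C) n (z : C) :
  (forall k, (1 <= k <= n)%nat -> exists l, cder (f k) z l) ->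
  exists l, cder (fun s => Cprod (fun k => f k s) n) z l.
Proof.
induction n; intros H.
- exists 0. simpl. apply (eder_const Cminus 1).
- destruct IHn as [l Hl]; [intros; apply H; lia|]. destruct (H (S n)) as [m Hm]; [lia|].
  eexists. simpl. apply eder_mult; eauto.
Qed.

Lemma not_pole_open : copen not_pole.
Proof.
intros s Hs.
assert (F : forall N, exists d, 0 < d /\ forall m, (m <= N)%nat -> d <= Cmod (s + RtoC (INR m))).
{ induction N.
  - exists (Cmod (s + RtoC (INR 0))). split; [apply Cmod_gt_0, Hs|]. intros m Hm. replace m with O by lia. lra.
  - destruct IHN as [d [Hd H]]. exists (Rmin d (Cmod (s + RtoC (INR (S N))))).
    split; [apply Rmin_case; auto; apply Cmod_gt_0, Hs|]. intros m Hm.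
    destruct (Nat.eq_dec m (S N)) as [->|]; [apply Rmin_r|]. eapply Rle_trans; [apply Rmin_l|]. apply H. lia. }
destruct (nat_above (Cmod s + 1)) as [N [_ HN]]. destruct (F N) as [d [Hd H]].
exists (Rmin d 1). split; [apply Rmin_case; lra|]. intros y Hy m E.
assert (Ey : Cmod (s + RtoC (INR m)) < Rmin d 1).
{ replace (s + RtoC (INR m)) with ((y + RtoC (INR m)) - (y - s)) by ring. rewrite E.
  replace (0 - (y - s)) with (- (y - s)) by ring. rewrite Cmod_opp. auto. }
generalize (Rmin_l d 1) (Rmin_r d 1). intros.
destruct (Nat.le_gt_cases m N) as [L|L].
- specialize (H m L). lra.
- assert (INR N <= INR m) by (apply le_INR; lia).
  generalize (Cmod_triangle_inv (RtoC (INR m)) (- s)). rewrite Cmod_opp, Cmod_R, Rabs_pos_eq by apply pos_INR.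
  replace (RtoC (INR m) - - s) with (s + RtoC (INR m)) by ring. lra.
Qed.

Lemma gauss_hol p : hol not_pole (gauss p).
Proof.
intros s Hs. assert (D := not_pole_den s p Hs).
assert (H1 : exists l, cder (fun s => s * Cprod (fun k => s + RtoC (INR k)) p) s l).
{ destruct (cder_Cprod (fun k s => s + RtoC (INR k)) p s) as [l Hl].
  - intros k _. eexists. apply eder_plus; [apply cder_id|apply eder_const].
  - eexists. apply eder_mult; [apply cder_id|exact Hl]. }
destruct H1 as [l Hl].
eexists. apply (eder_mult Cminus (fun s => RtoC (INR (fact p)) * Cexp (s * RtoC (ln (INR p))))).
- apply eder_scal. apply (eder_comp Cminus Cexp (fun s => s * RtoC (ln (INR p)))); [apply cder_Cexp|].
  apply eder_mult; [apply cder_id|apply eder_const].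
- apply (eder_comp Cminus Cinv); [apply cder_inv; auto|exact Hl].
Qed.

(** The rate in [gauss_cauchy] depends on s only through a bound R of |s| and through |gauss N s|
    for one fixed N, both of which are bounded near any point. *)
Theorem Gamma_hol : hol not_pole Gamma.
Proof.
apply weierstrass with (u := gauss); auto using not_pole_open, gauss_hol.
intros a Ha. set (R := (Cmod a + 2)%R). assert (HR : 0 <= R) by (unfold R; generalize (Cmod_ge_0 a); lra).
destruct (nat_above (2 * R)) as [N [HN1 HN2]].
destruct (copen_square _ _ not_pole_open Ha) as [d1 [Hd1 H1]].
destruct (hol_cont _ _ _ (gauss_hol N) Ha 1) as [d2 [Hd2 H2]]; [lra|].
set (d := Rmin d1 (Rmin (d2 / 2) 1)).
assert (Hd : 0 < d) by (unfold d; repeat apply Rmin_case; lra).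
exists d. split; auto. intros e He.
set (K := (2 * (R ^ 2 * exp R + R))%R).
assert (HK : 0 <= K) by (unfold K; assert (0 < exp R) by apply exp_pos; nra).
destruct (archi_div ((Cmod (gauss N a) + 1) * exp (2 * K) * (2 * K)) (e / 2)) as [n [Hn1 Hn]]; [lra|].
exists (max n N). intros p Hp y Hy.
assert (Hdd : (d <= d1 /\ d <= d2 / 2 /\ d <= 1)%R).
{ unfold d. generalize (Rmin_l d1 (Rmin (d2/2) 1)) (Rmin_r d1 (Rmin (d2/2) 1)) (Rmin_l (d2/2) 1) (Rmin_r (d2/2) 1). lra. }
assert (Hyp : not_pole y).
{ apply H1. destruct Hy. split; lra. }
assert (Hya := disc_square _ _ _ Hy).
assert (HyR : Cmod y <= R).
{ replace y with ((y - a) + a) by ring. eapply Rle_trans; [apply Cmod_triangle|]. unfold R. lra. }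
assert (HyN : Cmod (gauss N y) <= Cmod (gauss N a) + 1).
{ replace (gauss N y) with ((gauss N y - gauss N a) + gauss N a) by ring. eapply Rle_trans; [apply Cmod_triangle|].
  assert (Cmod (gauss N y - gauss N a) < 1) by (apply H2; lra). lra. }
destruct (gauss_Gamma y Hyp (e / 2)%R) as [q0 Hq]; [lra|].
set (q := max p q0).
replace (gauss p y - Gamma y) with ((gauss q y - Gamma y) - (gauss q y - gauss p y)) by ring.
eapply Rle_trans; [apply Cmod_triangle_sub|].
assert (B := gauss_cauchy R N y Hyp HR HyR HN1 HN2 p q ltac:(lia) ltac:(lia)). fold K in B.
assert (Cmod (gauss N y) * exp (2 * K) * (2 * K) / INR p <= e / 2).
{ eapply Rle_trans; [|apply (Hn p); lia]. apply Rmult_le_compat_r.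
  - left. apply Rinv_0_lt_compat, lt_0_INR. lia.
  - apply Rmult_le_compat_r; [lra|]. apply Rmult_le_compat_r; auto. left; apply exp_pos. }
specialize (Hq q ltac:(lia)). lra.
Qed.

(** Laurent series are avoided: the order m may be larger than that of the pole, and nothing is
    asked of the value of [phi] at p, which is arbitrary for [Gamma]. *)
Definition mero (phi : C -> C) (p : C) : Prop :=
  exists (m : nat) (f : C -> C) (d : R), 0 < d /\ hol (square p d) f /\
    forall s, square p d s -> s <> p -> phi s * (s - p) ^ m = f s.

Lemma square_open a d : copen (square a d).
Proof. apply box_open; apply oint_interval. Qed.

Lemma square_mono a d d' z : d <= d' -> square a d z -> square a d' z.
Proof. intros H [H1 H2]. split; eapply Rlt_le_trans; eauto. Qed.

Lemma hol_mero phi p d : 0 < d -> hol (square p d) phi -> mero phi p.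
Proof. intros Hd H. exists O, phi, d. repeat split; auto. intros. simpl. ring. Qed.

Lemma mero_mult f g p : mero f p -> mero g p -> mero (fun s => f s * g s) p.
Proof.
intros [m1 [f1 [d1 [H1 [A1 B1]]]]] [m2 [f2 [d2 [H2 [A2 B2]]]]].
exists (m1 + m2)%nat, (fun s => f1 s * f2 s), (Rmin d1 d2).
split; [apply Rmin_case; auto|]. split.
- intros z Hz. destruct (A1 z) as [l1 L1]; [eapply square_mono; [apply Rmin_l|eauto]|].
  destruct (A2 z) as [l2 L2]; [eapply square_mono; [apply Rmin_r|eauto]|].
  eexists. apply eder_mult; eauto.
- intros s Hs Hn. rewrite Cpow_add_r.
  rewrite <- (B1 s), <- (B2 s); auto; [ring| |].
  + eapply square_mono; [apply Rmin_r|exact Hs].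
  + eapply square_mono; [apply Rmin_l|exact Hs].
Qed.

Lemma mero_ext f g p : (forall s, f s = g s) -> mero f p -> mero g p.
Proof. intros E. replace g with f; auto. extensionality s; auto. Qed.

Lemma mero_ext_loc f g p d : 0 < d -> (forall s, square p d s -> s <> p -> f s = g s) -> mero f p -> mero g p.
Proof.
intros Hd E [m [h [d' [H1 [A1 B1]]]]]. exists m, h, (Rmin d d'). split; [apply Rmin_case; auto|]. split.
- intros z Hz. apply A1. eapply square_mono; [apply Rmin_r|eauto].
- intros s Hs Hn. rewrite <- E; auto; [apply B1; auto|].
  + eapply square_mono; [apply Rmin_r|exact Hs].
  + eapply square_mono; [apply Rmin_l|exact Hs].
Qed.

Lemma mero_Cprod (f : nat -> C -> C) n p : (forall k, (1 <= k <= n)%nat -> mero (f k) p) ->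
  mero (fun s => Cprod (fun k => f k s) n) p.
Proof.
induction n; intros H.
- apply hol_mero with 1%R; [lra|]. intros z _. exists 0. apply (eder_const Cminus 1).
- simpl. apply mero_mult; [apply IHn; intros; apply H; lia|apply H; lia].
Qed.

Lemma mero_translate f p c : mero f (p + c) -> mero (fun s => f (s + c)) p.
Proof.
intros [m [h [d [H1 [A1 B1]]]]].
assert (Sq : forall s, square p d s -> square (p + c) d (s + c)).
{ intros s [X Y]. split; rewrite ?re_plus, ?im_plus;
  [replace (Re s + Re c - (Re p + Re c))%R with (Re s - Re p)%R by ring|
   replace (Im s + Im c - (Im p + Im c))%R with (Im s - Im p)%R by ring]; auto. }
exists m, (fun s => h (s + c)), d. split; auto. split.
- intros z Hz. destruct (A1 (z + c) (Sq z Hz)) as [l Hl]. eexists.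
  apply (eder_comp Cminus h); [exact Hl|apply eder_plus; [apply cder_id|apply eder_const]].
- intros s Hs Hn. rewrite <- B1; auto.
  + f_equal. f_equal. ring.
  + intros E. apply Hn. replace s with (s + c - c) by ring. rewrite E. ring.
Qed.

Lemma mero_opp f p : mero f (- p) -> mero (fun s => f (- s)) p.
Proof.
intros [m [h [d [H1 [A1 B1]]]]].
assert (Sq : forall s, square p d s -> square (- p) d (- s)).
{ intros s [X Y]. split; rewrite ?re_opp, ?im_opp.
  - replace (- Re s - - Re p)%R with (- (Re s - Re p))%R by ring. rewrite Rabs_Ropp. auto.
  - replace (- Im s - - Im p)%R with (- (Im s - Im p))%R by ring. rewrite Rabs_Ropp. auto. }
exists m, (fun s => h (- s) * (-1) ^ m), d. split; auto. split.
- intros z Hz. destruct (A1 (- z) (Sq z Hz)) as [l Hl]. eexists.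
  apply eder_mult; [|apply eder_const].
  apply (eder_comp Cminus h); [exact Hl|apply eder_opp; apply cder_id].
- intros s Hs Hn. rewrite <- B1; auto.
  + rewrite <- Cmult_assoc, <- Cpow_mult_l. f_equal. f_equal. ring.
  + intros E. apply Hn. replace s with (- - s) by ring. rewrite E. ring.
Qed.

Lemma mero_inv p q : mero (fun s => / (s - q)) p.
Proof.
destruct (Ceq_dec p q) as [->|Hn].
- exists 1%nat, (fun _ => 1), 1%R. split; [lra|]. split.
  + intros z _. eexists. apply eder_const.
  + intros s _ Hs. field. apply Cminus_eq_contra; auto.
- assert (Hm : 0 < Cmod (p - q)) by (apply Cmod_gt_0, Cminus_eq_contra; auto).
  apply hol_mero with (Cmod (p - q) / 2)%R; [lra|]. intros z Hz. eexists.
  apply (eder_comp Cminus Cinv).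
  + apply cder_inv. intros E. apply disc_square in Hz.
    replace z with (z - q + q) in Hz by ring. rewrite E in Hz.
    replace (0 + q - p) with (- (p - q)) in Hz by ring. rewrite Cmod_opp in Hz. lra.
  + apply eder_minus; [apply cder_id|apply eder_const].
Qed.

Lemma Gamma_mero p : mero Gamma p.
Proof.
destruct (classic (not_pole p)) as [Hp|Hp].
- destruct (copen_square _ _ not_pole_open Hp) as [d [Hd H]]. apply hol_mero with d; auto.
  intros z Hz. apply Gamma_hol; auto.
- apply not_all_ex_not in Hp. destruct Hp as [m Hm]. apply NNPP in Hm.
  (* Induction downwards from the regular point 1, by Gamma (s) = Gamma (s + 1) / s; a pole -m is
     reached after m + 1 steps. *)
  assert (Q : forall m p, p + RtoC (INR m) = 1 -> mero Gamma p).
  { clear. induction m; intros p Hm.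
    - simpl in Hm. replace (p + 0) with p in Hm by ring. subst p.
      assert (N1 : not_pole 1).
      { intros k E. assert (E2 : (1 + INR k = 0)%R) by (apply RtoC_inj; rewrite RtoC_plus; auto). generalize (pos_INR k). lra. }
      destruct (copen_square _ _ not_pole_open N1) as [d [Hd H]]. apply hol_mero with d; auto.
      intros z Hz. apply Gamma_hol; auto.
    (* In a square of half-side 1/2 the integer p is the only one, so the functional equation holds
       at every other point. *)
    - apply mero_ext_loc with (fun s => Gamma (s + 1) * / (s - 0)) (1/2)%R; [lra| |].
      + intros s Hs Hn.
        assert (NP : not_pole s).
        { intros k E. apply Hn.
          assert (Es : s = - RtoC (INR k)) by (replace s with (s + RtoC (INR k) - RtoC (INR k)) by ring; rewrite E; ring).
          assert (Ep : p = - RtoC (INR m)).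
          { rewrite S_INR, RtoC_plus in Hm. replace p with (p + (RtoC (INR m) + 1) - 1 - RtoC (INR m)) by ring. rewrite Hm. ring. }
          destruct Hs as [Hs _]. rewrite Es, Ep in Hs. rewrite !re_opp, !re_RtoC in Hs.
          assert (Z : Rabs (IZR (Z.of_nat m - Z.of_nat k)) < 1).
          { rewrite minus_IZR, <- !INR_IZR_INZ. replace (INR m - INR k)%R with (- INR k - - INR m)%R by ring. lra. }
          rewrite <- abs_IZR in Z. apply lt_IZR in Z. assert (m = k) by lia. subst k. congruence. }
        rewrite Gamma_S by auto. field. replace (s - 0) with s by ring. apply not_pole_0; auto.
      + apply mero_mult; [|apply mero_inv]. apply mero_translate. apply IHm.
        rewrite S_INR, RtoC_plus in Hm. transitivity (p + (RtoC (INR m) + 1)); [ring|exact Hm]. }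
  apply (Q (S m)). rewrite S_INR, RtoC_plus, Cplus_assoc, Hm. ring.
Qed.

(* Half the primitive of ln (1 + t^2/x^2) in x. *)
Definition stirling_phase (t x : R) : R :=
  (x / 2 * (ln (x * x + t * t) - 2 * ln x) + t * atan (x / t))%R.

Lemma stirling_phase_der t x : 0 < t -> 0 < x ->
  is_derive (stirling_phase t) x ((ln (x * x + t * t) - 2 * ln x) / 2)%R.
Proof.
intros Ht Hx. unfold stirling_phase. assert (P : 0 < x * x + t * t) by nra.
auto_derive; [repeat split; auto; lra|]. field. repeat split; nra.
Qed.

Lemma ln_ratio_decr t x y : 0 < x <= y ->
  (ln (y * y + t * t) - 2 * ln y <= ln (x * x + t * t) - 2 * ln x).
Proof.
intros H.
assert (E : forall x, 0 < x -> (ln (x * x + t * t) - 2 * ln x = ln ((x * x + t * t) / (x * x)))%R).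
{ intros u Hu. rewrite ln_div by nra. rewrite ln_mult by auto. ring. }
rewrite !E by lra. apply ln_le; [apply Rdiv_lt_0_compat; nra|].
apply Rle_div_l; [nra|]. replace ((x * x + t * t) / (x * x) * (y * y))%R with ((x * x + t * t) * (y * y) / (x * x))%R by (field; lra).
apply Rle_div_r; [nra|]. assert (x * x <= y * y) by nra. assert (0 <= t * t) by nra. nra.
Qed.

(** The derivative of [stirling_phase t] decreases in x, so its increment over [x, x + 1] is at most
    the derivative at x, which is ln (|x + i t| / x). *)
Lemma stirling_phase_step t x : 0 < t -> 0 < x ->
  (x * exp (stirling_phase t (x + 1) - stirling_phase t x) <= sqrt (x * x + t * t)).
Proof.
intros Ht Hx.
destruct (MVT_gen (stirling_phase t) x (x + 1) (fun x => (ln (x * x + t * t) - 2 * ln x) / 2)%R) as [c [Hc E]].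
- intros y Hy. rewrite Rmin_left in Hy by lra. apply stirling_phase_der; lra.
- intros y Hy. rewrite Rmin_left in Hy by lra. apply continuity_pt_filterlim.
  apply (ex_derive_continuous (stirling_phase t)). eexists. apply stirling_phase_der; lra.
- rewrite Rmin_left, Rmax_right in Hc by lra. rewrite E.
  replace ((ln (c * c + t * t) - 2 * ln c) / 2 * (x + 1 - x))%R with ((ln (c * c + t * t) - 2 * ln c) / 2)%R by ring.
  apply Rle_trans with (x * exp ((ln (x * x + t * t) - 2 * ln x) / 2))%R.
  + apply Rmult_le_compat_l; [lra|]. apply exp_le. generalize (ln_ratio_decr t x c). lra.
  + right. replace ((ln (x * x + t * t) - 2 * ln x) / 2)%R with (ln (x * x + t * t) / 2 - ln x)%R by field.
    unfold Rminus. rewrite exp_plus, exp_Ropp, exp_ln by auto.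
    replace (exp (ln (x * x + t * t) / 2)) with (sqrt (x * x + t * t)); [field; lra|].
    apply sqrt_lem_1; [nra|left; apply exp_pos|]. rewrite <- exp_plus.
    replace (ln (x * x + t * t) / 2 + ln (x * x + t * t) / 2)%R with (ln (x * x + t * t)) by field.
    apply exp_ln. nra.
Qed.

Lemma Cmod_add_real s x : Cmod (s + RtoC x) = sqrt ((Re s + x) * (Re s + x) + Rabs (Im s) * Rabs (Im s)).
Proof.
unfold Cmod. f_equal. destruct s as [a b]. simpl.
rewrite !Rmult_1_r. rewrite <- Rabs_mult, (Rabs_pos_eq (b * b)) by nra. ring.
Qed.

(** Each factor |s + m| of the denominator exceeds Re s + m by at least the exponential of one
    increment of the phase, and these increments telescope. The numerators of the two Gauss products
    have equal modulus. *)
Lemma gauss_decay p s : 0 < Re s -> (Im s <> 0)%R ->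
  let t := Rabs (Im s) in
  (Cmod (gauss p s) <= Cmod (gauss p (RtoC (Re s))) * exp (stirling_phase t (Re s) - stirling_phase t (Re s + INR p + 1))).
Proof.
intros Hs Ht t. assert (Ht0 : 0 < t) by (apply Rabs_pos_lt; auto).
set (x := Re s) in *.
assert (Hx : not_pole (RtoC x)).
{ intros m E. assert (E2 : (x + INR m = 0)%R) by (apply RtoC_inj; rewrite RtoC_plus; auto). generalize (pos_INR m). lra. }
assert (Hsp : not_pole s).
{ intros m E. apply (f_equal Re) in E. rewrite re_plus, re_RtoC in E. simpl in E. fold x in E. generalize (pos_INR m). lra. }
assert (St : forall m : nat, (x + INR m) * exp (stirling_phase t (x + INR m + 1) - stirling_phase t (x + INR m)) <= Cmod (s + RtoC (INR m))).
{ intros m. rewrite Cmod_add_real. fold x t. apply stirling_phase_step; auto. generalize (pos_INR m). lra. }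
assert (D : (Cmod (RtoC x * Cprod (fun k => RtoC x + RtoC (INR k))%C p) * exp (stirling_phase t (x + INR p + 1) - stirling_phase t x)
   <= Cmod (s * Cprod (fun k => s + RtoC (INR k))%C p))%R).
{ induction p.
  - simpl Cprod. rewrite !Cmult_1_r. specialize (St O). simpl INR in *. rewrite Rplus_0_r in *.
    rewrite Cmod_R, Rabs_pos_eq by lra. replace (s + RtoC 0) with s in St by ring. exact St.
  - rewrite !Cprod_S, !Cmult_assoc, !(Cmod_mult (_ * _)).
    specialize (St (S p)).
    replace (Cmod (RtoC x + RtoC (INR (S p)))) with (x + INR (S p))%R.
    2:{ rewrite <- RtoC_plus, Cmod_R, Rabs_pos_eq; auto. generalize (pos_INR (S p)). lra. }
    replace (x + INR p + 1)%R with (x + INR (S p))%R in IHp by (rewrite S_INR; ring).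
    replace (stirling_phase t (x + INR (S p) + 1) - stirling_phase t x)%R with
      ((stirling_phase t (x + INR (S p)) - stirling_phase t x) + (stirling_phase t (x + INR (S p) + 1) - stirling_phase t (x + INR (S p))))%R by ring.
    rewrite exp_plus.
    eapply Rle_trans; [|apply Rmult_le_compat; [| |apply IHp|apply St]].
    + right. ring.
    + apply Rmult_le_pos; [apply Cmod_ge_0|left; apply exp_pos].
    + apply Rmult_le_pos; [generalize (pos_INR (S p)); lra|left; apply exp_pos]. }
assert (N1 := not_pole_den _ p Hx). assert (N2 := not_pole_den _ p Hsp).
unfold gauss. rewrite !Cmod_div by auto. rewrite !Cmod_mult, !Cmod_Cexp, !re_scal_r, re_RtoC. fold x.
set (A := (Cmod (RtoC (INR (fact p))) * exp (x * ln (INR p)))%R).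
assert (HA : 0 <= A) by (apply Rmult_le_pos; [apply Cmod_ge_0|left; apply exp_pos]).
rewrite <- !Cmod_mult.
set (d := Cmod (RtoC x * Cprod (fun k => RtoC x + RtoC (INR k))%C p)) in *.
set (d' := Cmod (s * Cprod (fun k => s + RtoC (INR k))%C p)) in *.
assert (Hd : 0 < d) by (apply Cmod_gt_0; auto). assert (Hd' : 0 < d') by (apply Cmod_gt_0; auto).
replace (stirling_phase t x - stirling_phase t (x + INR p + 1))%R with (- (stirling_phase t (x + INR p + 1) - stirling_phase t x))%R by ring.
rewrite exp_Ropp. set (E := exp (stirling_phase t (x + INR p + 1) - stirling_phase t x)) in *.
assert (HE : 0 < E) by apply exp_pos.
unfold Rdiv. rewrite Rmult_assoc. apply Rmult_le_compat_l; auto. rewrite <- Rinv_mult.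
apply Rinv_le_contravar; auto. apply Rmult_lt_0_compat; auto.
Qed.

Lemma atan_le_id y : 0 <= y -> atan y <= y.
Proof.
intros Hy. destruct (MVT_gen atan 0 y (fun c => / (1 + c ^ 2))%R) as [c [_ E]].
- intros u _. apply is_derive_Reals. generalize (derivable_pt_lim_atan u).
  replace (/ (1 + u ^ 2))%R with (/ (1 + u²))%R by (unfold Rsqr; f_equal; ring). auto.
- intros u _. apply derivable_continuous_pt, derivable_pt_atan.
- rewrite atan_0, !Rminus_0_r in E. rewrite E.
  assert (/ (1 + c ^ 2) <= 1); [|nra]. rewrite <- Rinv_1. apply Rinv_le_contravar; [lra|]. generalize (pow2_ge_0 c). lra.
Qed.

(** In the limit p -> oo of [gauss_decay], the phase at the far end is at least pi t / 2 - 1,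
    because t atan (y / t) tends to pi t / 2, while the phase at Re s is at most K ln (1 + t) + K.
    The two errors make up the factor e^(K + 1). *)
Lemma Gamma_decay_pos K s : 1 <= Re s <= INR K -> 1 <= Rabs (Im s) ->
  (Cmod (Gamma s) <= Cmod (Gamma (RtoC (Re s))) * (exp (INR K + 1) * (1 + Rabs (Im s)) ^ K * exp (- (PI / 2 * Rabs (Im s))))).
Proof.
intros Hs Ht0. set (t := Rabs (Im s)) in *. set (x := Re s) in *.
assert (Hx : not_pole (RtoC x)).
{ intros m E. assert (E2 : (x + INR m = 0)%R) by (apply RtoC_inj; rewrite RtoC_plus; auto). generalize (pos_INR m). lra. }
assert (Hsp : not_pole s).
{ intros m E. apply (f_equal Re) in E. rewrite re_plus, re_RtoC in E. simpl in E. fold x in E. generalize (pos_INR m). lra. }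
assert (Hi : Im s <> 0%R) by (intros E; unfold t in Ht0; rewrite E, Rabs_R0 in Ht0; lra).
set (B := (exp (INR K + 1) * (1 + t) ^ K * exp (- (PI / 2 * t)))%R).
assert (HB : 0 < B).
{ unfold B. repeat apply Rmult_lt_0_compat; try apply exp_pos. apply pow_lt; lra. }
rewrite <- (Rabs_pos_eq B), <- Cmod_R, <- Cmod_mult by lra.
apply (ccv_Cmod_le (fun p => gauss p s) (fun p => gauss p (RtoC x) * RtoC B)).
- apply gauss_Gamma; auto.
- apply ccv_mult; [apply gauss_Gamma; auto|apply ccv_const].
- assert (Pi := PI_RGT_0).
  assert (Hinv : 0 < / t <= 1) by (split; [apply Rinv_0_lt_compat; lra|rewrite <- Rinv_1; apply Rinv_le_contravar; lra]).
  assert (Pi2 : 1 < PI / 2) by (generalize PI2_1; lra).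
  (* Beyond this index atan (y / t) is at least pi / 2 - 1 / t, so that multiplication by t loses
     only 1. As t is at least 1, the angle pi / 2 - 1 / t is positive. *)
  destruct (nat_above (t * tan (PI / 2 - / t))) as [N [_ HN]]. exists N. intros p Hp.
  eapply Rle_trans; [apply gauss_decay; [fold x; lra|auto]|]. fold x t.
  rewrite Cmod_mult, Cmod_R, Rabs_pos_eq by lra.
  apply Rmult_le_compat_l; [apply Cmod_ge_0|].
  set (y := (x + INR p + 1)%R).
  assert (HNp : INR N <= INR p) by (apply le_INR; auto).
  assert (P1 : PI / 2 * t - 1 <= stirling_phase t y).
  { unfold stirling_phase.
    assert (H1 : 0 <= ln (y * y + t * t) - 2 * ln y).
    { assert (Hy : 0 < y) by (unfold y; generalize (pos_INR p); lra).
      assert (ln (y * y) <= ln (y * y + t * t)) by (apply ln_le; nra). rewrite ln_mult in H by auto. lra. }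
    assert (H2 : PI / 2 - / t <= atan (y / t)).
    { rewrite <- (atan_tan (PI / 2 - / t)) by lra.
      assert (tan (PI / 2 - / t) <= y / t).
      { apply (Rle_div_r (tan (PI / 2 - / t)) y t); [lra|]. unfold y. replace (tan (PI / 2 - / t) * t)%R with (t * tan (PI / 2 - / t))%R by ring. lra. }
      destruct H as [H|H]; [left; apply atan_increasing; auto|rewrite H; lra]. }
    assert (H3 : t * (PI / 2 - / t) <= t * atan (y / t)) by (apply Rmult_le_compat_l; lra).
    replace (t * (PI / 2 - / t))%R with (PI / 2 * t - 1)%R in H3 by (field; lra).
    assert (0 <= y / 2) by (unfold y; generalize (pos_INR p); lra). nra. }
  assert (P2 : stirling_phase t x <= INR K * ln (1 + t) + INR K).
  { unfold stirling_phase.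
    assert (H1 : ln (x * x + t * t) - 2 * ln x <= 2 * ln (1 + t)).
    { replace (ln (x * x + t * t) - 2 * ln x)%R with (ln ((x * x + t * t) / (x * x))).
      - replace (2 * ln (1 + t))%R with (ln ((1 + t) * (1 + t))) by (rewrite ln_mult by lra; ring).
        apply ln_le; [apply Rdiv_lt_0_compat; nra|]. apply Rle_div_l; [nra|].
        assert (1 <= x * x) by nra. nra.
      - rewrite ln_div by nra. rewrite (ln_mult x x) by lra. ring. }
    assert (H2 : t * atan (x / t) <= x).
    { replace x with (t * (x / t))%R at 2 by (field; lra). apply Rmult_le_compat_l; [lra|].
      apply atan_le_id. apply Rmult_le_pos; lra. }
    assert (H3 : 0 <= ln (1 + t)) by (rewrite <- ln_1; apply ln_le; lra).
    assert (x / 2 * (ln (x * x + t * t) - 2 * ln x) <= x / 2 * (2 * ln (1 + t))) by (apply Rmult_le_compat_l; lra).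
    nra. }
  apply Rle_trans with (exp ((INR K + 1) + INR K * ln (1 + t) + - (PI / 2 * t))).
  + apply exp_le. lra.
  + rewrite exp_plus, (exp_plus (INR K + 1)), <- ln_pow, exp_ln by (try apply pow_lt; lra). unfold B. lra.
Qed.

(** Each step multiplies by s + M, of modulus at least |Im s| and so at least 1. It reduces a strip
    around the imaginary axis to one in Re s >= 1. *)
Lemma Gamma_growth_up M s : 1 <= Rabs (Im s) -> Cmod (Gamma s) <= Cmod (Gamma (s + RtoC (INR M))).
Proof.
intros Hs. induction M.
- simpl. rewrite Cplus_0_r. lra.
- eapply Rle_trans; [apply IHM|]. rewrite S_INR, RtoC_plus, Cplus_assoc.
  assert (Hm : 1 <= Cmod (s + RtoC (INR M))).
  { eapply Rle_trans; [|apply im_le_Cmod]. rewrite im_plus, im_RtoC, Rplus_0_r. auto. }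
  rewrite Gamma_S.
  + rewrite Cmod_mult. generalize (Cmod_ge_0 (Gamma (s + RtoC (INR M)))). nra.
  + intros m E. apply (f_equal Im) in E. rewrite !im_plus, !im_RtoC in E. simpl in E.
    replace (Im s) with 0%R in Hs by lra. rewrite Rabs_R0 in Hs. lra.
Qed.

Theorem Gamma_decay R : exists A K, 0 <= A /\ forall s, Rabs (Re s) <= R -> 1 <= Rabs (Im s) ->
  (Cmod (Gamma s) <= A * (1 + Rabs (Im s)) ^ K * exp (- (PI / 2 * Rabs (Im s)))).
Proof.
destruct (nat_above (R + 1)) as [M [HM1 HM]].
(* For |Re s| <= R the translate by M >= R + 1 has real part in [1, 2 M], which is the range that
   [Gamma_decay_pos] asks for. *)
set (K := (M + M)%nat).
assert (HK : (INR K = INR M + INR M)%R) by apply plus_INR.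
assert (M1 : 1 <= INR M) by (replace 1%R with (INR 1) by reflexivity; apply le_INR; auto).
destruct (continuity_ab_maj (fun x => Cmod (Gamma (RtoC x))) 1 (INR K)) as [m [Hm _]].
{ lra. }
{ intros x Hx. apply continuity_pt_filterlim. apply (rcont_Cmod (fun x => Gamma (RtoC x))).
  apply (econt_comp rsub Gamma RtoC); [|eapply eder_cont, rder_id].
  apply (hol_cont _ _ _ Gamma_hol). intros k E.
  assert (E2 : (x + INR k = 0)%R) by (apply RtoC_inj; rewrite RtoC_plus; auto). generalize (pos_INR k). lra. }
exists (Cmod (Gamma (RtoC m)) * exp (INR K + 1))%R, K. split.
{ apply Rmult_le_pos; [apply Cmod_ge_0|left; apply exp_pos]. }
intros s Hs Ht. eapply Rle_trans; [apply (Gamma_growth_up M); auto|].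
apply Rabs_le_between in Hs.
set (s' := s + RtoC (INR M)). assert (Ei : Im s' = Im s) by (unfold s'; rewrite im_plus, im_RtoC; ring).
assert (Er : Re s' = (Re s + INR M)%R) by (unfold s'; rewrite re_plus, re_RtoC; ring).
rewrite <- Ei in *.
eapply Rle_trans; [apply (Gamma_decay_pos K); auto; lra|].
rewrite !Rmult_assoc. apply Rmult_le_compat_r.
- repeat apply Rmult_le_pos; try (left; apply exp_pos). apply pow_le. lra.
- apply Hm. lra.
Qed.

(** * Integrals along a Mellin-Barnes path *)

Definition vline (t : R) : C := (0, - t)%R.

Lemma vline_C1 : C1 vline.
Proof.
exists (fun _ => (0, -1)%R). intros t. split.
- apply (proj1 (rder_iff vline t _)). apply rder_pair; simpl; auto_derive; auto; ring.
- apply (continuous_const (U := R_UniformSpace) (V := C_UniformSpace)).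
Qed.

Section Path.
Context (L : R -> C) (HL : path_ioo L).

(** Reduces statements about [L] over an interval to single C^1 pieces and concatenation; outside
    the breakpoints the piece is [vline]. *)
Lemma path_ind (P : R -> R -> Prop) :
  (forall a b g, a <= b -> C1 g -> (forall t, a <= t <= b -> L t = g t) -> P a b) ->
  (forall a b c, a <= b <= c -> P a b -> P b c -> P a c) ->
  forall a b, a <= b -> P a b.
Proof.
intros H1 H2. destruct HL as [N [c [Hc [Hp Hl]]]].
assert (Q : forall i, (i <= N)%nat -> forall x y, x <= y <= c i -> P x y).
{ induction i; intros Hi x y Hxy.
  - apply H1 with vline; [lra|apply vline_C1|]. intros t Ht. apply Hl. lra.
  - destruct (Hp i) as [g [Hg1 Hg2]]; [lia|].
    destruct (Rle_dec y (c i)); [apply IHi; [lia|lra]|].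
    destruct (Rle_dec (c i) x).
    + apply H1 with g; [lra|auto|]. intros t Ht. apply Hg2. lra.
    + apply H2 with (c i); [lra|apply IHi; [lia|lra]|].
      apply H1 with g; [lra|auto|]. intros t Ht. apply Hg2. lra. }
intros x y Hxy. destruct (Rle_dec y (c N)); [apply (Q N (le_n _)); lra|].
destruct (Rle_dec (c N) x).
- apply H1 with vline; [lra|apply vline_C1|]. intros t Ht. apply Hl. lra.
- apply H2 with (c N); [lra|apply (Q N (le_n _)); lra|].
  apply H1 with vline; [lra|apply vline_C1|]. intros t Ht. apply Hl. lra.
Qed.

Lemma path_derive_piece a b g dg : (forall t, rder g t (dg t)) -> (forall t, a <= t <= b -> L t = g t) ->
  forall t, a < t < b -> path_derive L t = dg t.
Proof.
intros Hg E t Ht.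
assert (Loc : locally t (fun u => L u = g u)).
{ assert (Hd : 0 < Rmin (t - a) (b - t)) by (apply Rmin_case; lra).
  exists (mkposreal _ Hd). intros u Hu. apply E.
  change (Rabs (u - t) < Rmin (t - a) (b - t)) in Hu.
  generalize (Rmin_l (t - a) (b - t)) (Rmin_r (t - a) (b - t)). apply Rabs_def2 in Hu. lra. }
unfold path_derive. apply C_ext; simpl.
- rewrite (Derive_ext_loc _ (fun u => Re (g u))).
  + apply is_derive_unique, rder_re, Hg.
  + revert Loc. apply filter_imp. intros u ->. reflexivity.
- rewrite (Derive_ext_loc _ (fun u => Im (g u))).
  + apply is_derive_unique, rder_im, Hg.
  + revert Loc. apply filter_imp. intros u ->. reflexivity.
Qed.

Lemma C1_rder g : C1 g -> exists dg, forall t, rder g t (dg t) /\ rcont dg t.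
Proof.
intros [dg H]. exists dg. intros t. destruct (H t) as [A B]. split.
- apply rder_iff. exact A.
- apply rcont_iff. exact B.
Qed.

Lemma rcont_bounded (f : R -> C) a b : (forall t, rcont f t) ->
  exists B, 0 <= B /\ forall t, a <= t <= b -> Cmod (f t) <= B.
Proof.
intros H. destruct (Rle_dec a b) as [Hab|Hab].
- destruct (continuity_ab_maj (fun t => Cmod (f t)) a b Hab) as [M [HM _]].
  + intros t Ht. apply continuity_pt_filterlim. apply (rcont_Cmod f t). auto.
  + exists (Cmod (f M)). split; [apply Cmod_ge_0|auto].
- exists 0%R. split; [lra|]. intros t Ht. lra.
Qed.

Lemma path_FTC F f a b : a <= b -> (forall t, cder F (L t) (f (L t))) -> (forall t, ccont f (L t)) ->
  isI (fun t => f (L t) * path_derive L t) a b (F (L b) - F (L a)).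
Proof.
intros Hab HF Hf. revert a b Hab. apply path_ind.
- intros a b g Hab Hg E. destruct (C1_rder g Hg) as [dg Hdg].
  rewrite (E b), (E a) by lra.
  apply isI_ext with (fun t => f (g t) * dg t).
  { intros t Ht. rewrite Rmin_left, Rmax_right in Ht by lra.
    rewrite (path_derive_piece a b g dg) by (auto; intros; apply Hdg). rewrite E by lra. reflexivity. }
  apply (isI_FTC (fun t => F (g t))); intros t Ht; rewrite Rmin_left, Rmax_right in Ht by lra.
  + apply (eder_comp rsub F g); [rewrite <- E by lra; apply HF|apply Hdg].
  + apply econt_mult; [|apply Hdg]. apply econt_comp; [rewrite <- E by lra; apply Hf|].
    eapply eder_cont, Hdg.
- intros a b c Habc H1 H2. replace (F (L c) - F (L a)) with ((F (L b) - F (L a)) + (F (L c) - F (L b))) by ring.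
  eapply isI_chasles; eauto.
Qed.

Lemma path_straight : exists T, 1 <= T /\ forall t, T <= Rabs t -> L t = vline t.
Proof.
destruct HL as [N [c [Hc [Hp Hl]]]].
assert (Q : forall i, (i <= N)%nat -> c O <= c i).
{ induction i; intros Hi; [lra|]. generalize (Hc i ltac:(lia)) (IHi ltac:(lia)). lra. }
exists (Rabs (c O) + Rabs (c N) + 1)%R.
generalize (Rabs_pos (c O)) (Rabs_pos (c N)) (Rle_abs (c O)) (Rle_abs (c N)) (Rle_abs (- c O)) (Rle_abs (- c N)).
rewrite !Rabs_Ropp. intros. split; [lra|]. intros t Ht. apply Hl. destruct (Rle_dec 0 t); [rewrite (Rabs_pos_eq t) in Ht by lra|rewrite (Rabs_left t) in Ht by lra]; lra.
Qed.

Lemma path_cont t : rcont L t.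
Proof.
destruct HL as [N [c [Hc [Hp Hl]]]].
assert (One : forall a b g, C1 g -> (forall t, a <= t <= b -> L t = g t) -> a <= t <= b ->
   forall e, 0 < e -> exists d, 0 < d /\ forall u, a <= u <= b -> Rabs (u - t) < d -> Cmod (L u - L t) < e).
{ intros a b g Hg E Ht e He. destruct (C1_rder g Hg) as [dg Hdg].
  destruct (eder_cont _ _ _ _ (proj1 (Hdg t)) e He) as [d [Hd H]]. exists d. split; auto.
  intros u Hu Hud. rewrite !E by auto. apply H. unfold rsub. rewrite Cmod_R. auto. }
set (P := fun a b => (a <= t <= b) -> forall e, 0 < e -> exists d, 0 < d /\
   forall u, a <= u <= b -> Rabs (u - t) < d -> Cmod (L u - L t) < e).
assert (H : P (t - 1)%R (t + 1)%R).
{ apply path_ind; [| |lra].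
  - intros a b g Hab Hg E Ht. apply (One a b g); auto.
  - intros a b m Habm H1 H2 Ht e He.
    destruct (Rle_dec b t) as [L1|L1].
    + destruct (H2 ltac:(lra) e He) as [d2 [Hd2 K2]].
      destruct (Rle_dec t b) as [L2|L2].
      * destruct (H1 ltac:(lra) e He) as [d1 [Hd1 K1]]. exists (Rmin d1 d2). split; [apply Rmin_case; auto|].
        intros u Hu Hud. generalize (Rmin_l d1 d2) (Rmin_r d1 d2). intros.
        destruct (Rle_dec u b); [apply K1; lra|apply K2; lra].
      * exists (Rmin d2 (t - b)). split; [apply Rmin_case; lra|]. intros u Hu Hud.
        generalize (Rmin_l d2 (t - b)) (Rmin_r d2 (t - b)). intros. apply K2; [|lra]. apply Rabs_def2 in Hud. lra.
    + destruct (H1 ltac:(lra) e He) as [d1 [Hd1 K1]].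
      exists (Rmin d1 (b - t)). split; [apply Rmin_case; lra|]. intros u Hu Hud.
      generalize (Rmin_l d1 (b - t)) (Rmin_r d1 (b - t)). intros. apply K1; [|lra]. apply Rabs_def2 in Hud. lra. }
intros e He. destruct (H ltac:(lra) e He) as [d [Hd K]]. exists (Rmin d 1). split; [apply Rmin_case; lra|].
intros u Hu. unfold rsub in Hu. rewrite Cmod_R in Hu.
generalize (Rmin_l d 1) (Rmin_r d 1). intros. apply K; [|lra]. apply Rabs_def2 in Hu. lra.
Qed.

Lemma path_isI (phi : R -> C) a b : (forall t, rcont phi t) -> a <= b ->
  exists I, isI (fun t => phi t * path_derive L t) a b I.
Proof.
intros Hphi. revert a b. apply path_ind.
- intros a b g Hab Hg E. destruct (C1_rder g Hg) as [dg Hdg]. eexists.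
  apply isI_ext with (fun t => phi t * dg t).
  { intros t Ht. rewrite Rmin_left, Rmax_right in Ht by lra.
    rewrite (path_derive_piece a b g dg) by (auto; intros; apply Hdg). reflexivity. }
  apply exI_cont. intros t _. apply econt_mult; auto. apply Hdg.
- intros a b c Habc [I1 H1] [I2 H2]. eexists. eapply isI_chasles; eauto.
Qed.

(** The constant V plays the role of the length of [L] over [a, b]; it is fixed before the integrand
    is known. *)
Lemma path_isI_bound a b : a <= b -> exists V, 0 <= V /\ forall phi M I,
  (forall t, rcont phi t) -> (forall t, a <= t <= b -> Cmod (phi t) <= M) ->
  isI (fun t => phi t * path_derive L t) a b I -> Cmod I <= V * M.
Proof.
revert a b. apply path_ind.
- intros a b g Hab Hg E. destruct (C1_rder g Hg) as [dg Hdg].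
  destruct (rcont_bounded dg a b) as [B [HB0 HB]]; [intros; apply Hdg|].
  exists ((b - a) * B)%R. split; [apply Rmult_le_pos; lra|]. intros phi M I Hphi HM HI.
  replace ((b - a) * B * M)%R with ((b - a) * (M * B))%R by ring.
  apply (isI_bound (fun t => phi t * dg t)); auto.
  + intros t Ht. rewrite Cmod_mult. apply Rmult_le_compat; auto; apply Cmod_ge_0.
  + apply isI_ext with (fun t => phi t * path_derive L t); auto.
    intros t Ht. rewrite Rmin_left, Rmax_right in Ht by lra.
    rewrite (path_derive_piece a b g dg) by (auto; intros; apply Hdg). reflexivity.
- intros a b c Habc [V1 [P1 H1]] [V2 [P2 H2]]. exists (V1 + V2)%R. split; [lra|]. intros phi M I Hphi HM HI.
  destruct (path_isI phi a b Hphi) as [I1 HI1]; [lra|]. destruct (path_isI phi b c Hphi) as [I2 HI2]; [lra|].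
  replace I with (I1 + I2) by (eapply isI_unique; [eapply isI_chasles|]; eauto).
  eapply Rle_trans; [apply Cmod_triangle|].
  generalize (H1 phi M I1 Hphi ltac:(intros; apply HM; lra) HI1) (H2 phi M I2 Hphi ltac:(intros; apply HM; lra) HI2). lra.
Qed.

(** The improper integral with its convergence made part of the statement, the two ends going to
    infinity independently. It determines the value of [path_integral] and, unlike it, can be added
    and scaled without side conditions. *)
Definition intL (f : C -> C) (l : C) : Prop :=
  (forall a b, a <= b -> exists I, isI (fun t => f (L t) * path_derive L t) a b I) /\
  forall e, 0 < e -> exists T, forall a b I, a < - T -> T < b -> a <= b ->
    isI (fun t => f (L t) * path_derive L t) a b I -> Cmod (I - l) < e.

Lemma intL_path_integral f l : intL f l -> path_integral L f = l.
Proof.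
intros [H1 H2].
unfold path_integral.
apply (@is_RInt_gen_unique C_R_CompleteNormedModule (Rbar_locally m_infty) (Rbar_locally p_infty) _ _
  (fun t => f (L t) * path_derive L t) l).
intros P HP. apply locally_C_iff in HP. destruct HP as [e [He HP]].
destruct (H2 e He) as [T HT].
unfold filtermapi.
(* The comparison with 0 ensures [a <= b] even if T is negative. *)
apply Filter_prod with (Q := fun a => (a < Rmin (- T) 0)) (R := fun b => (Rmax T 0 < b)).
- exists (Rmin (- T) 0). auto.
- exists (Rmax T 0). auto.
- intros a b Ha Hb. simpl.
  generalize (Rmin_l (- T) 0) (Rmin_r (- T) 0) (Rmax_l T 0) (Rmax_r T 0). intros.
  destruct (H1 a b) as [I HI]; [lra|]. exists I. split; [exact HI|].
  apply HP. apply (HT a b I); auto; lra.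
Qed.

Lemma intL_unique f l m : intL f l -> intL f m -> l = m.
Proof. intros H1 H2. rewrite <- (intL_path_integral _ _ H1). apply intL_path_integral; auto. Qed.

Lemma intL_plus f g l m : intL f l -> intL g m -> intL (fun s => f s + g s) (l + m).
Proof.
intros [F1 F2] [G1 G2].
assert (S : forall a b I J, isI (fun t => f (L t) * path_derive L t) a b I -> isI (fun t => g (L t) * path_derive L t) a b J ->
   isI (fun t => (f (L t) + g (L t)) * path_derive L t) a b (I + J)).
{ intros a b I J HI HJ. apply isI_ext with (fun t => f (L t) * path_derive L t + g (L t) * path_derive L t);
    [intros; ring|apply isI_plus; auto]. }
split.
- intros a b Hab. destruct (F1 a b Hab) as [I HI]. destruct (G1 a b Hab) as [J HJ]. eexists. apply S; eauto.
- intros e He. destruct (F2 (e/2)%R) as [T1 K1]; [lra|]. destruct (G2 (e/2)%R) as [T2 K2]; [lra|].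
  exists (Rmax T1 T2). intros a b I Ha Hb Hab HI.
  generalize (Rmax_l T1 T2) (Rmax_r T1 T2). intros.
  destruct (F1 a b Hab) as [I1 HI1]. destruct (G1 a b Hab) as [I2 HI2].
  rewrite (isI_unique _ _ _ _ _ HI (S _ _ _ _ HI1 HI2)).
  replace (I1 + I2 - (l + m)) with ((I1 - l) + (I2 - m)) by ring.
  eapply Rle_lt_trans; [apply Cmod_triangle|].
  generalize (K1 a b I1 ltac:(lra) ltac:(lra) Hab HI1) (K2 a b I2 ltac:(lra) ltac:(lra) Hab HI2). lra.
Qed.

Lemma intL_scal c f l : intL f l -> intL (fun s => c * f s) (c * l).
Proof.
intros [F1 F2].
assert (S : forall a b I, isI (fun t => f (L t) * path_derive L t) a b I ->
   isI (fun t => (c * f (L t)) * path_derive L t) a b (c * I)).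
{ intros a b I HI. apply isI_ext with (fun t => c * (f (L t) * path_derive L t)); [intros; ring|apply isI_scal; auto]. }
split.
- intros a b Hab. destruct (F1 a b Hab) as [I HI]. eexists. apply S; eauto.
- intros e He. generalize (Cmod_ge_0 c). intros Hc.
  destruct (F2 (e / (Cmod c + 1))%R) as [T K]; [apply Rdiv_lt_0_compat; lra|].
  exists T. intros a b I Ha Hb Hab HI. destruct (F1 a b Hab) as [J HJ].
  rewrite (isI_unique _ _ _ _ _ HI (S _ _ _ HJ)).
  replace (c * J - c * l) with (c * (J - l)) by ring. rewrite Cmod_mult.
  specialize (K a b J Ha Hb Hab HJ). apply Rlt_div_r in K; [|lra]. generalize (Cmod_ge_0 (J - l)). nra.
Qed.

Lemma intL_ext f g l : (forall t, f (L t) = g (L t)) -> intL f l -> intL g l.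
Proof.
intros E. unfold intL.
replace (fun t => g (L t) * path_derive L t) with (fun t => f (L t) * path_derive L t); auto.
extensionality t. rewrite E. reflexivity.
Qed.

Lemma intL_minus f g l m : intL f l -> intL g m -> intL (fun s => f s - g s) (l - m).
Proof.
intros Hf Hg. apply intL_ext with (fun s => f s + (-1) * g s); [intros; ring|].
replace (l - m) with (l + (-1) * m) by ring. apply intL_plus; auto. apply intL_scal; auto.
Qed.

Lemma intL_FTC F f : (forall t, cder F (L t) (f (L t))) -> (forall t, ccont f (L t)) ->
  (forall e, 0 < e -> exists T, forall t, T < Rabs t -> Cmod (F (L t)) < e) -> intL f 0.
Proof.
intros HF Hf Hlim. split.
- intros a b Hab. eexists. apply (path_FTC F); auto.
- intros e He. destruct (Hlim (e / 2)%R) as [T HT]; [lra|]. exists (Rmax T 0). intros a b I Ha Hb Hab HI.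
  rewrite (isI_unique _ _ _ _ _ HI (path_FTC F f a b Hab HF Hf)).
  replace (F (L b) - F (L a) - 0) with (F (L b) - F (L a)) by ring.
  eapply Rle_lt_trans; [apply Cmod_triangle_sub|].
  generalize (Rmax_l T 0) (Rmax_r T 0). intros.
  assert (Cmod (F (L b)) < e / 2) by (apply HT; rewrite Rabs_pos_eq; lra).
  assert (Cmod (F (L a)) < e / 2) by (apply HT; rewrite Rabs_left; lra). lra.
Qed.

Lemma is_RInt_inv_sq x y : x <= y -> 0 < x \/ y < 0 -> is_RInt (fun t => / (t * t))%R x y (/ x - / y)%R.
Proof.
intros H Hs. replace (/ x - / y)%R with (minus (- / y) (- / x))%R by (unfold minus, plus, opp; simpl; ring).
apply (is_RInt_derive (fun t => - / t)%R); intros t Ht; rewrite Rmin_left, Rmax_right in Ht by lra.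
- auto_derive; [destruct Hs; lra|]. field. destruct Hs; lra.
- apply (continuous_comp (fun t => t * t)%R Rinv).
  + apply (continuous_mult (K := R_AbsRing)); apply continuous_id.
  + apply continuous_Rinv. destruct Hs; nra.
Qed.

Lemma path_derive_straight T t : (forall u, T <= Rabs u -> L u = vline u) -> T < Rabs t -> path_derive L t = - Ci.
Proof.
intros HT Ht.
assert (P : exists a b, a < t < b /\ forall u, a <= u <= b -> L u = vline u).
{ exists (t - (Rabs t - T) / 2)%R, (t + (Rabs t - T) / 2)%R. split; [lra|]. intros u Hu. apply HT.
  assert (Rabs (t - u) <= (Rabs t - T) / 2) by (apply Rabs_le; lra).
  generalize (Rabs_triang u (t - u)). replace (u + (t - u))%R with t by ring. lra. }
destruct P as [a [b [Hab E]]].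
apply (path_derive_piece a b vline (fun _ => - Ci)); auto.
intros u. apply rder_pair; simpl; auto_derive; auto; ring.
Qed.

(** K depends on [L] alone. The bound linear in M, not just convergence, is what differentiation
    under the integral and the peak estimate use. *)
Theorem intL_exists : exists K, 0 <= K /\ forall f M, 0 <= M -> (forall t, rcont (fun t => f (L t)) t) ->
  (forall t, Cmod (f (L t)) <= M / (1 + t * t)) -> exists l, intL f l /\ Cmod l <= K * M.
Proof.
destruct path_straight as [T [HT1 HT]].
destruct (path_isI_bound (- T) T) as [V [HV0 HV]]; [lra|].
(* V accounts for the bent part; each of the two straight tails is at most M / T, and T is at least
   1. *)
exists (V + 2)%R. split; [lra|]. intros f M HM Hc Hb.
set (phi := fun t => f (L t)) in *.
assert (Ex : forall a b, a <= b -> isI (fun t => phi t * path_derive L t) a b (CI (fun t => phi t * path_derive L t) a b)).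
{ intros a b Hab. destruct (path_isI phi a b Hc Hab) as [I HI]. rewrite (isI_CI _ _ _ _ HI). exact HI. }
set (J := CI (fun t => phi t * path_derive L t)) in *.
assert (Ch : forall a b c, a <= b <= c -> J a c = J a b + J b c).
{ intros a b c Habc. apply isI_CI. apply isI_chasles with b; apply Ex; lra. }
assert (D : forall t, T < Rabs t -> path_derive L t = - Ci) by (intros; apply (path_derive_straight T); auto).
assert (Cd : Cmod (- Ci) = 1%R) by (rewrite Cmod_opp; apply Cmod_Ci).
assert (Inv : forall t, 0 < t * t -> M / (1 + t * t) <= M * / (t * t)).
{ intros t Ht. apply Rmult_le_compat_l; auto. apply Rinv_le_contravar; lra. }
assert (Tp : forall x y, T <= x <= y -> Cmod (J x y) <= M / x).
{ intros x y Hxy. apply Rle_trans with (M * (/ x - / y))%R.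
  - apply (isI_bound_fun (fun t => phi t * - Ci) (fun t => M * / (t * t))%R x y); [lra| | |apply is_RInt_scalR, is_RInt_inv_sq; lra].
    + intros t Ht. rewrite Cmod_mult, Cd, Rmult_1_r. eapply Rle_trans; [apply Hb|apply Inv; nra].
    + eapply isI_ext; [|apply Ex; lra]. intros t Ht. rewrite Rmin_left in Ht by lra. cbv beta. rewrite D; auto.
      rewrite Rabs_pos_eq; lra.
  - assert (0 < / y) by (apply Rinv_0_lt_compat; lra). unfold Rdiv. nra. }
assert (Tm : forall x y, T <= y <= x -> Cmod (J (- x) (- y))%R <= M / y).
{ intros x y Hxy. apply Rle_trans with (M * (/ y - / x))%R.
  - apply (isI_bound_fun (fun t => phi t * - Ci) (fun t => M * / (t * t))%R (- x) (- y)); [lra| | |].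
    + intros t Ht. rewrite Cmod_mult, Cd, Rmult_1_r. eapply Rle_trans; [apply Hb|apply Inv; nra].
    + eapply isI_ext; [|apply Ex; lra]. intros t Ht. rewrite Rmax_right in Ht by lra. cbv beta. rewrite D; auto.
      rewrite Rabs_left; lra.
    + apply is_RInt_scalR. replace (/ y - / x)%R with (/ - x - / - y)%R by (field; lra). apply is_RInt_inv_sq; lra.
  - assert (0 < / x) by (apply Rinv_0_lt_compat; lra). unfold Rdiv. nra. }
set (Jn := fun n => J (- (T + INR n))%R (T + INR n)%R).
assert (Lim : forall a b n, T + INR n <= b -> a <= - (T + INR n) ->
   Cmod (J a b - Jn n) <= 2 * M / (T + INR n)).
{ intros a b n Hb' Ha'. unfold Jn. generalize (pos_INR n). intros Pn.
  rewrite (Ch a (- (T + INR n))%R b)%R, (Ch (- (T + INR n))%R (T + INR n)%R b)%R by lra.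
  replace (J a (- (T + INR n))%R + (J (- (T + INR n))%R (T + INR n)%R + J (T + INR n)%R b) - J (- (T + INR n))%R (T + INR n)%R)
   with (J a (- (T + INR n))%R + J (T + INR n)%R b) by ring.
  eapply Rle_trans; [apply Cmod_triangle|].
  specialize (Tm (- a) (T + INR n))%R. rewrite Ropp_involutive in Tm. specialize (Tp (T + INR n)%R b)%R.
  eapply Rle_trans; [apply Rplus_le_compat; [apply Tm; lra|apply Tp; lra]|]. right. field. lra. }
assert (Sm : forall e, 0 < e -> exists N, forall n, (N <= n)%nat -> 2 * M / (T + INR n) <= e).
{ intros e He. destruct (archi_div (2 * M) e He) as [N [HN1 HN]]. exists N. intros n Hn.
  apply Rle_trans with (2 * M / INR n)%R; [|apply HN; auto].
  assert (0 < INR n) by (apply lt_0_INR; lia).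
  assert (/ (T + INR n)%R <= / INR n) by (apply Rinv_le_contravar; lra). unfold Rdiv. nra. }
destruct (ccv_cauchy Jn) as [l Hl].
{ intros e He. destruct (Sm e He) as [n Hn]. exists n. intros m Hm. assert (INR n <= INR m) by (apply le_INR; auto).
  eapply Rle_trans; [apply Lim; lra|auto]. }
exists l. split.
- split; [intros a b Hab; eexists; apply Ex; auto|].
  intros e He. destruct (Hl (e / 2)%R) as [N1 HN1]; [lra|]. destruct (Sm (e / 2)%R) as [N2 HN2]; [lra|].
  set (n := max N1 N2). exists (T + INR n)%R. intros a b I Ha Hb' Hab HI.
  assert (EI : I = J a b) by (symmetry; apply isI_CI; exact HI). rewrite EI.
  replace (J a b - l) with ((J a b - Jn n) + (Jn n - l)) by ring.
  eapply Rle_lt_trans; [apply Cmod_triangle|]. specialize (HN2 n ltac:(unfold n; lia)).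
  assert (Z1 := Lim a b n ltac:(lra) ltac:(lra)). assert (Z2 := HN1 n ltac:(unfold n; lia)). lra.
- apply le_epsilon. intros e He. destruct (Hl e He) as [N HN]. specialize (HN N (le_n _)).
  replace l with (Jn N - (Jn N - l)) by ring.
  eapply Rle_trans; [apply Cmod_triangle_sub|]. apply Rplus_le_compat; [|lra].
  generalize (pos_INR N). intros PN. unfold Jn.
  rewrite (Ch (- (T + INR N))%R (- T) (T + INR N))%R, (Ch (- T)%R T (T + INR N))%R by lra.
  eapply Rle_trans; [apply Cmod_triangle|]. eapply Rle_trans; [apply Rplus_le_compat_l, Cmod_triangle|].
  assert (B1 := Tm (T + INR N)%R T ltac:(lra)). assert (B2 := Tp T (T + INR N)%R ltac:(lra)).
  assert (B3 := HV phi M (J (- T)%R T) Hc).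
  assert (M / T <= M) by (apply Rle_div_l; nra).
  assert (Cmod (J (- T)%R T) <= V * M).
  { apply B3; [|apply Ex; lra]. intros t _. eapply Rle_trans; [apply Hb|]. apply Rle_div_l; nra. }
  lra.
Qed.

End Path.

(** * Contour shift *)

(** Connectedness of [0, 1] as an induction principle: a property that spreads between neighbours in
    both directions reaches from 0 to 1. *)
Lemma unit_connected (P : R -> Prop) : P 0%R ->
  (forall t, unit_interval t -> exists d, 0 < d /\ forall u v, unit_interval u -> unit_interval v ->
     (Rabs (u - t) < d) -> Rabs (v - t) < d -> P u -> P v) -> P 1%R.
Proof.
intros H0 Hloc. set (E := fun t => unit_interval t /\ P t).
destruct (completeness E) as [s [Hs1 Hs2]].
- exists 1%R. intros t [[_ Ht] _]. auto.
- exists 0%R. split; auto. split; lra.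
- assert (Us : unit_interval s).
  { split; [apply Hs1; split; auto; split; lra|]. apply Hs2. intros t [[_ Ht] _]. auto. }
  destruct (Hloc s Us) as [d [Hd H]].
  assert (Ex : exists u, E u /\ s - d < u).
  { apply NNPP. intros N. assert (s <= s - d); [|lra]. apply Hs2. intros t Ht.
    apply Rnot_lt_le. intros Hlt. apply N. exists t. auto. }
  destruct Ex as [u [[Hu1 Hu2] Hu3]]. assert (u <= s) by (apply Hs1; split; auto).
  set (v := Rmin 1 (s + d / 2)).
  assert (Hv : unit_interval v /\ s <= v /\ v <= s + d / 2).
  { destruct Us. repeat split.
    - apply Rmin_glb; lra.
    - apply Rmin_l.
    - apply Rmin_glb; lra.
    - apply Rmin_r. }
  assert (Pv : P v).
  { apply (H u v); auto; try tauto; apply Rabs_def1; lra. }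
  assert (v <= s) by (apply Hs1; split; tauto).
  assert (s = 1%R).
  { unfold v, Rmin in H2. destruct Us. destruct Rle_dec in H2; lra. }
  replace 1%R with v; auto. destruct Hv as [[_ Hv] Hv2]. lra.
Qed.

Lemma continuous_on_unit (c : R -> C) t : continuous_on unit_interval c -> unit_interval t ->
  forall e, 0 < e -> exists d, 0 < d /\ forall u, unit_interval u -> Rabs (u - t) < d -> Cmod (c u - c t) < e.
Proof.
intros Hc Ht e He. specialize (Hc t Ht (fun z => Cmod (z - c t) < e)%R).
destruct Hc as [d Hd].
- apply locally_C_iff. exists e. auto.
- exists d. split; [apply cond_pos|]. intros u Hu Hut. apply Hd; auto.
Qed.

Section Shift.
Context (L : R -> C) (HL : path_ioo L).

Lemma path_near_vline : exists R0, 0 <= R0 /\ forall t, Cmod (L t - vline t) <= R0.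
Proof.
destruct (path_straight L HL) as [T [HT1 HT]].
destruct (rcont_bounded (fun t => L t - vline t) (- T) T) as [B [HB0 HB]].
- intros t. apply econt_minus; [apply path_cont; auto|]. eapply eder_cont with (l := (0, -1)%R).
  apply rder_pair; simpl; auto_derive; auto; ring.
- exists B. split; auto. intros t. destruct (Rle_dec T (Rabs t)) as [H|H].
  + rewrite HT by auto. replace (vline t - vline t) with (RtoC 0) by ring. rewrite Cmod_0; auto.
  + apply HB. assert (Rabs t < T) by lra. apply Rabs_def2 in H0. lra.
Qed.

Lemma Cmod_vline t : Cmod (vline t) = Rabs t.
Proof.
replace (vline t) with (RtoC (- t) * Ci) by (apply C_ext; simpl; ring).
rewrite Cmod_mult, Cmod_Ci, Cmod_R, Rabs_Ropp. ring.
Qed.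

Lemma path_large q B : exists T, 0 < T /\ forall t, T <= Rabs t -> B <= Cmod (L t - q).
Proof.
destruct path_near_vline as [R0 [HR0 H]]. exists (Rabs B + R0 + Cmod q + 1)%R.
generalize (Rabs_pos B) (Cmod_ge_0 q) (Rle_abs B). intros. split; [lra|]. intros t Ht.
replace (L t - q) with (vline t - (q - (L t - vline t))) by ring.
eapply Rle_trans; [|apply Cmod_triangle_inv]. rewrite Cmod_vline.
generalize (Cmod_triangle_sub q (L t - vline t)) (H t). lra.
Qed.

Lemma path_dist q : (forall t, q <> L t) -> exists d, 0 < d /\ forall t, d <= Cmod (L t - q).
Proof.
intros Hq. destruct (path_large q 1) as [T [HT0 HT]].
destruct (continuity_ab_min (fun t => Cmod (L t - q)) (- T) T) as [m [Hm _]]; [lra| |].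
- intros t _. apply continuity_pt_filterlim. apply (rcont_Cmod (fun t => L t - q)).
  apply econt_minus; [apply path_cont; auto|apply econt_const].
- exists (Rmin 1 (Cmod (L m - q))). split.
  + apply Rmin_case; [lra|]. apply Cmod_gt_0, Cminus_eq_contra. auto.
  + intros t. destruct (Rle_dec T (Rabs t)) as [H|H].
    * eapply Rle_trans; [apply Rmin_l|auto].
    * eapply Rle_trans; [apply Rmin_r|]. apply Hm. assert (Rabs t < T) by lra. apply Rabs_def2 in H0. lra.
Qed.

Lemma cder_inv_sub (q z : C) : z <> q -> cder (fun s => / (s - q)) z (- / ((z - q) * (z - q))).
Proof.
intros H. eapply eder_eq; [|apply (eder_comp Cminus Cinv (fun s => s - q)); [apply cder_inv, Cminus_eq_contra; auto|
  apply eder_minus; [apply cder_id|apply eder_const]]].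
cbv beta. ring.
Qed.

(* The difference of two simple poles has the primitive Log1 ((s - q)/(s - q')) along L
   when q' is much closer to q than L is; it vanishes at both ends. *)
Lemma pole_pair_near q q' d : (forall t, d <= Cmod (L t - q)) -> Cmod (q' - q) < d / 2 ->
  intL L (fun s => / (s - q) - / (s - q')) 0.
Proof.
intros Hd Hq.
assert (N1 : forall t, d / 2 <= Cmod (L t - q')).
{ intros t. replace (L t - q') with ((L t - q) - (q' - q)) by ring.
  eapply Rle_trans; [|apply Cmod_triangle_inv]. specialize (Hd t). lra. }
assert (Hd0 : 0 < d / 2) by (generalize (Cmod_ge_0 (q' - q)); lra).
assert (Nq : forall t, L t - q <> 0) by (intros t; apply Cmod_gt_0; specialize (Hd t); lra).
assert (Nq' : forall t, L t - q' <> 0) by (intros t; apply Cmod_gt_0; specialize (N1 t); lra).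
assert (Sm : forall t, (L t - q) / (L t - q') - 1 = (q' - q) / (L t - q')) by (intros t; field; auto).
apply (intL_FTC L HL (fun s => Log1 ((s - q) * / (s - q')))).
- intros t.
  assert (HR : 0 < Re ((L t - q) * / (L t - q'))).
  { generalize (re_le_Cmod ((L t - q) / (L t - q') - 1)). rewrite Sm at 2. rewrite Cmod_div, re_sub, re_RtoC by auto.
    assert (Cmod (q' - q) / Cmod (L t - q') < 1).
    { apply Rlt_div_l; [specialize (N1 t); lra|]. specialize (N1 t). lra. }
    intros K. apply Rabs_le_between in K. unfold Cdiv in K. lra. }
  eapply eder_eq; [|apply (eder_comp Cminus Log1 (fun s => (s - q) * / (s - q')));
    [apply cder_Log1; auto|apply eder_mult; [apply eder_minus; [apply cder_id|apply eder_const]|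
     apply cder_inv_sub; intros E; apply (Nq' t); rewrite E; ring]]].
  cbv beta. field. auto.
- intros t. eapply eder_cont. apply eder_minus; apply cder_inv_sub; intros E; [apply (Nq t)|apply (Nq' t)]; rewrite E; ring.
- intros e He. destruct (Log1_small e He) as [d' [Hd' [_ HLs]]].
  destruct (path_large q' (2 * Cmod (q' - q) / d')) as [T [_ HT]]. exists T. intros t Ht.
  specialize (HT t (Rlt_le _ _ Ht)).
  apply HLs. change ((L t - q) * / (L t - q')) with ((L t - q) / (L t - q')). rewrite Sm, Cmod_div by auto.
  specialize (N1 t). apply Rlt_div_l; [lra|].
  destruct (Req_dec (Cmod (q' - q)) 0) as [E|E]; [rewrite E; apply Rmult_lt_0_compat; lra|].
  generalize (Cmod_ge_0 (q' - q)). intros. apply Rle_div_l in HT; [|lra].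
  assert (Cmod (q' - q) > 0) by lra. nra.
Qed.

(** Along a path in the complement of [L], nearby pairs are settled by [pole_pair_near], and the
    differences telescope. *)
Lemma pole_pair x y : same_component L x y -> intL L (fun s => / (s - x) - / (s - y)) 0.
Proof.
intros [c [Hc [<- [<- Hn]]]].
apply (unit_connected (fun t => intL L (fun s => / (s - c 0%R) - / (s - c t)) 0)).
- destruct (path_dist (c 0%R)) as [d [Hd H]]; [intros t; apply Hn; split; lra|].
  apply pole_pair_near with d; auto. replace (c 0%R - c 0%R) with (RtoC 0) by ring. rewrite Cmod_0. lra.
- intros t Ht. destruct (path_dist (c t)) as [d [Hd H]]; [intros u; apply Hn; auto|].
  destruct (continuous_on_unit c t Hc Ht (d / 8)%R) as [r [Hr Hcr]]; [lra|].
  exists r. split; auto. intros u v Hu Hv Hut Hvt K.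
  apply intL_ext with (fun s => (/ (s - c 0%R) - / (s - c u)) + (/ (s - c u) - / (s - c v))); [intros; ring|].
  replace (RtoC 0) with (0 + 0) by ring. apply intL_plus; auto.
  specialize (Hcr u Hu Hut) as K1. specialize (Hcr v Hv Hvt) as K2.
  apply pole_pair_near with (d / 2)%R.
  + intros w. specialize (H w). replace (L w - c u) with ((L w - c t) - (c u - c t)) by ring.
    eapply Rle_trans; [|apply Cmod_triangle_inv]. lra.
  + replace (c v - c u) with ((c v - c t) - (c u - c t)) by ring. eapply Rle_lt_trans; [apply Cmod_triangle_sub|]. lra.
Qed.

(* x and y have the same winding number with respect to L *)
Definition homologous (x y : C) : Prop :=
  (forall t, L t <> x) /\ (forall t, L t <> y) /\ intL L (fun s => / (s - x) - / (s - y)) 0.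

Lemma same_component_homologous x y : same_component L x y -> homologous x y.
Proof.
intros H. assert (H' := pole_pair x y H). destruct H as [c [_ [H0 [H1 Hn]]]]. split; [|split; auto].
- intros t E. apply (Hn 0%R t); [split; lra|]. rewrite H0. auto.
- intros t E. apply (Hn 1%R t); [split; lra|]. rewrite H1. auto.
Qed.

Lemma homologous_common x y z : homologous x z -> homologous y z -> homologous x y.
Proof.
intros [A1 [A2 A3]] [B1 [B2 B3]]. split; [|split]; auto.
apply intL_ext with (fun s => (/ (s - x) - / (s - z)) - (/ (s - y) - / (s - z))); [intros; ring|].
replace (RtoC 0) with (0 - 0) by ring. apply intL_minus; auto.
Qed.

Lemma cder_pow_inv_sub (q z : C) k : z <> q ->
  cder (fun s => (/ (s - q)) ^ k) z (- INR k * (/ (z - q)) ^ S k).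
Proof.
intros H. eapply eder_eq; [|apply (eder_comp Cminus (fun x => x ^ k) (fun s => / (s - q))); [apply cder_pow|apply cder_inv_sub; auto]].
assert (z - q <> 0) by (apply Cminus_eq_contra; auto).
destruct k; simpl; [ring|]. field. auto.
Qed.

(** From order two on, each power has a primitive that tends to 0 at both ends of [L]. Only the
    simple pole depends on the position of p - 1 and p relative to [L]. *)
Lemma pole_shift p k : homologous (p - 1) p -> intL L (fun s => (/ (s + 1 - p)) ^ S k - (/ (s - p)) ^ S k) 0.
Proof.
intros Hp.
assert (N1 : forall t, L t <> p - 1 /\ L t <> p).
{ intros t. split; apply Hp. }
assert (E1 : forall s, s + 1 - p = s - (p - 1)) by (intros; ring).
destruct k.
- apply intL_ext with (fun s => / (s - (p - 1)) - / (s - p)); [|apply Hp].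
  intros t. rewrite E1, !Cpow_1_r. reflexivity.
- apply intL_ext with (fun s => (/ (s - (p - 1))) ^ S (S k) - (/ (s - p)) ^ S (S k)).
  { intros t. rewrite E1. reflexivity. }
  assert (NS : RtoC (INR (S k)) <> 0) by (apply RtoC_INR_neq; lia).
  apply (intL_FTC L HL (fun s => - / INR (S k) * ((/ (s - (p - 1))) ^ S k - (/ (s - p)) ^ S k))).
  + intros t. eapply eder_eq; [|apply eder_scal, eder_minus; apply cder_pow_inv_sub; apply N1].
    field. auto.
  + intros t. eapply eder_cont, eder_minus; apply cder_pow_inv_sub; apply N1.
  + intros e He. set (B := (2 / e + 1)%R).
    assert (HB : 1 < B) by (unfold B; assert (0 < 2 / e) by (apply Rdiv_lt_0_compat; lra); lra).
    destruct (path_large (p - 1) B) as [T1 [HT1 K1]]. destruct (path_large p B) as [T2 [HT2 K2]].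
    exists (Rmax T1 T2). intros t Ht.
    assert (G1 : T1 <= Rabs t) by (generalize (Rmax_l T1 T2); lra).
    assert (G2 : T2 <= Rabs t) by (generalize (Rmax_r T1 T2); lra).
    specialize (K1 t G1). specialize (K2 t G2).
    assert (Pw : forall z, B <= Cmod z -> Cmod ((/ z) ^ S k) <= / B).
    { intros z Hz. rewrite Cmod_pow, Cmod_inv by (apply Cmod_gt_0; lra).
      assert (I1 : 0 < / Cmod z) by (apply Rinv_0_lt_compat; lra).
      assert (I2 : / Cmod z <= / B) by (apply Rinv_le_contravar; lra).
      assert (I3 : / B <= 1) by (rewrite <- Rinv_1; apply Rinv_le_contravar; lra).
      simpl. rewrite <- (Rmult_1_r (/ B)). apply Rmult_le_compat; try lra; [apply pow_le; lra|].
      rewrite <- (pow1 k). apply pow_incr. lra. }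
    rewrite Cmod_mult, Cmod_opp, Cmod_inv, Cmod_R, Rabs_pos_eq by (auto; apply pos_INR).
    assert (Hk : 0 < / INR (S k) <= 1).
    { assert (1 <= INR (S k)) by (rewrite S_INR; generalize (pos_INR k); lra). split; [apply Rinv_0_lt_compat; lra|].
      rewrite <- Rinv_1. apply Rinv_le_contravar; lra. }
    assert (Hs : Cmod ((/ (L t - (p - 1))) ^ S k - (/ (L t - p)) ^ S k) <= 2 / B).
    { eapply Rle_trans; [apply Cmod_triangle_sub|]. generalize (Pw _ K1) (Pw _ K2). unfold Rdiv. lra. }
    assert (2 / B < e).
    { apply Rlt_div_l; [lra|]. unfold B. field_simplify; lra. }
    generalize (Cmod_ge_0 ((/ (L t - (p - 1))) ^ S k - (/ (L t - p)) ^ S k)). nra.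
Qed.

Definition strip (R : R) : C -> Prop := box (fun x => (Rabs x < R)) (fun _ => True).

Lemma oint_abs R : oint (fun x => (Rabs x < R)).
Proof.
generalize (oint_interval 0 R). replace (fun y => (Rabs (y - 0) < R)) with (fun x => (Rabs x < R)); auto.
extensionality y. rewrite Rminus_0_r. reflexivity.
Qed.

Definition tends0 (R : R) (phi : C -> C) : Prop :=
  forall e, 0 < e -> exists T, forall s, strip R s -> T <= Rabs (Im s) -> Cmod (phi s) <= e.

(** If F is a primitive of [phi] on the strip, then F (s + 1) - F s is one of the integrand. It
    equals the integral of [phi] over a horizontal unit segment, so it tends to 0 together with
    [phi]. *)
Lemma shift_hol R phi : (forall t, strip R (L t) /\ strip R (L t + 1)) -> hol (strip R) phi -> tends0 R phi ->
  intL L (fun s => phi (s + 1) - phi s) 0.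
Proof.
intros HR Hphi Hlim.
destruct (box_primitive _ _ phi (oint_abs R) oint_True Hphi) with (z0 := L 0%R) as [F [_ HF]]; [apply HR|].
assert (D : forall t, cder (fun s => F (s + 1) - F s) (L t) (phi (L t + 1) - phi (L t))).
{ intros t. apply eder_minus; [|apply HF, HR]. eapply eder_eq; [|apply (eder_comp Cminus F (fun s => s + 1));
    [apply HF, HR|apply eder_plus; [apply cder_id|apply eder_const]]]. ring. }
apply (intL_FTC L HL (fun s => F (s + 1) - F s)); auto.
- intros t. destruct (Hphi (L t + 1) (proj2 (HR t))) as [l1 H1]. destruct (Hphi (L t) (proj1 (HR t))) as [l2 H2].
  eapply eder_cont. apply eder_minus; [|exact H2]. apply (eder_comp Cminus phi (fun s => s + 1)); [exact H1|].
  apply eder_plus; [apply cder_id|apply eder_const].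
- intros e He. destruct (Hlim (e / 2)%R) as [T HT]; [lra|].
  destruct (path_straight L HL) as [T1 [HT1 HS]].
  exists (Rmax T T1). intros t Ht.
  assert (G1 : T <= Rabs t) by (generalize (Rmax_l T T1); lra).
  assert (G2 : T1 <= Rabs t) by (generalize (Rmax_r T T1); lra).
  destruct (HR t) as [R1 R2].
  assert (Seg : forall u, 0 <= u <= 1 -> strip R (L t + RtoC u * (L t + 1 - L t))).
  { intros u Hu. split; [|exact I]. destruct R1 as [R1 _]. destruct R2 as [R2 _].
    replace (L t + RtoC u * (L t + 1 - L t)) with (L t + RtoC u) by ring.
    rewrite re_plus in *. rewrite re_RtoC in *. apply Rabs_def2 in R1. apply Rabs_def2 in R2. apply Rabs_def1; lra. }
  assert (HI : isI (fun u => phi (L t + RtoC u * (L t + 1 - L t)) * (L t + 1 - L t)) 0 1 (F (L t + 1) - F (L t))).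
  { apply (isI_segment F phi).
    - intros u Hu. apply HF, Seg; auto.
    - intros u Hu. apply (hol_cont _ _ _ Hphi), Seg; auto. }
  apply Rle_lt_trans with ((1 - 0) * (e / 2))%R; [|lra].
  eapply isI_bound; [lra| |apply HI]. intros u Hu. cbv beta.
  replace (L t + 1 - L t) with (RtoC 1) at 2 by ring. rewrite Cmult_1_r. apply HT; [apply Seg; auto|].
  replace (L t + RtoC u * (L t + 1 - L t)) with (L t + RtoC u) by ring.
  rewrite im_plus, im_RtoC, HS by auto. simpl. rewrite Rplus_0_r, Rabs_Ropp. auto.
Qed.

Lemma tends0_pole R p k : tends0 R (fun s => (/ (s - p)) ^ S k).
Proof.
intros e He. exists (Rabs (Im p) + 1 + / e)%R. intros s _ Hs.
assert (Hi : 0 < / e) by (apply Rinv_0_lt_compat; auto).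
assert (B : 1 + / e <= Cmod (s - p)).
{ eapply Rle_trans; [|apply im_le_Cmod]. rewrite im_sub. generalize (Rabs_triang_inv (Im s) (Im p)). lra. }
rewrite Cmod_pow, Cmod_inv by (apply Cmod_gt_0; lra).
assert (I1 : 0 < / Cmod (s - p)) by (apply Rinv_0_lt_compat; lra).
assert (I2 : / Cmod (s - p) <= e) by (rewrite <- (Rinv_inv e); apply Rinv_le_contravar; lra).
assert (I3 : / Cmod (s - p) <= 1) by (rewrite <- Rinv_1; apply Rinv_le_contravar; lra).
simpl. rewrite <- (Rmult_1_r e). apply Rmult_le_compat; try lra; [apply pow_le; lra|].
rewrite <- (pow1 k). apply pow_incr. lra.
Qed.

Lemma hol_sub_pole U phi p k c : hol U phi -> (forall z, U z -> z <> p) ->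
  hol U (fun s => phi s - c * (/ (s - p)) ^ k).
Proof.
intros H Hp z Hz. destruct (H z Hz) as [l Hl]. eexists. apply eder_minus; [exact Hl|].
apply eder_scal, cder_pow_inv_sub. auto.
Qed.

Lemma mero_pole p q k c : mero (fun s => c * (/ (s - p)) ^ k) q.
Proof.
apply mero_mult.
- apply hol_mero with 1%R; [lra|]. intros z _. exists 0. apply (eder_const Cminus c).
- induction k.
  + apply hol_mero with 1%R; [lra|]. intros z _. exists 0. simpl. apply (eder_const Cminus 1).
  + simpl. apply mero_mult; auto. apply mero_inv.
Qed.

Lemma mero_plus f g p : mero f p -> mero g p -> mero (fun s => f s + g s) p.
Proof.
intros [m1 [f1 [d1 [H1 [A1 B1]]]]] [m2 [f2 [d2 [H2 [A2 B2]]]]].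
exists (m1 + m2)%nat, (fun s => f1 s * (s - p) ^ m2 + f2 s * (s - p) ^ m1), (Rmin d1 d2).
assert (Pw : forall m z, exists l, cder (fun s => (s - p) ^ m) z l).
{ intros m z. eexists. apply (eder_comp Cminus (fun x => x ^ m) (fun s => s - p)); [apply cder_pow|].
  apply eder_minus; [apply cder_id|apply eder_const]. }
split; [apply Rmin_case; auto|]. split.
- intros z Hz. destruct (A1 z) as [l1 L1]; [eapply square_mono; [apply Rmin_l|eauto]|].
  destruct (A2 z) as [l2 L2]; [eapply square_mono; [apply Rmin_r|eauto]|].
  destruct (Pw m1 z) as [k1 K1]. destruct (Pw m2 z) as [k2 K2].
  eexists. apply eder_plus; apply eder_mult; eauto.
- intros s Hs Hn. rewrite Cpow_add_r.
  rewrite <- (B1 s), <- (B2 s); auto; [ring| |].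
  + eapply square_mono; [apply Rmin_r|exact Hs].
  + eapply square_mono; [apply Rmin_l|exact Hs].
Qed.

(** Residue calculus without residues: induction on the list of poles and, for each pole, on its
    order. The shift integral of every subtracted principal term vanishes by [pole_shift], until a
    holomorphic function is left. The homology hypothesis expresses that no pole is crossed. *)
Theorem contour_shift R (P : list C) : (forall t, strip R (L t) /\ strip R (L t + 1)) ->
  forall phi, hol (fun s => strip R s /\ ~ In s P) phi -> tends0 R phi ->
  (forall p, In p P -> mero phi p /\ homologous (p - 1) p) ->
  intL L (fun s => phi (s + 1) - phi s) 0.
Proof.
intros HR. induction P as [|p P IH]; intros phi Hphi Hlim HP.
- apply shift_hol with R; auto. intros z Hz. apply Hphi. auto.
- destruct (HP p (or_introl eq_refl)) as [[m [f [d [Hd [Hf Ef]]]]] Hsc].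
  assert (HP' : forall q, In q P -> mero phi q /\ homologous (q - 1) q) by (intros q Hq; apply HP; right; auto).
  clear HP. revert phi f Hphi Hlim Hf Ef HP'. induction m; intros phi f Hphi Hlim Hf Ef HP'.
  (* Order 0: the singularity is removable but the value of [phi] at p may be arbitrary. Correcting
     it does not affect the integral, since neither [L] nor its translate passes through p. *)
  + set (phi' := fun s => if Ceq_dec s p then f p else phi s).
    assert (N1 : forall t, L t <> p - 1 /\ L t <> p).
    { intros t. split; apply Hsc. }
    assert (Ep : forall s, s <> p -> phi' s = phi s).
    { intros s Hs. unfold phi'. destruct (Ceq_dec s p); [contradiction|reflexivity]. }
    apply intL_ext with (fun s => phi' (s + 1) - phi' s).
    { intros t. destruct (N1 t) as [Na Nb]. rewrite !Ep; auto. intros E. apply Na. rewrite <- E. ring. }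
    apply IH.
    * intros z [Hz1 Hz2]. destruct (Ceq_dec z p) as [->|Hne].
      -- destruct (Hf p) as [l Hl]; [apply square_center; auto|]. exists l. apply cder_ext_loc with f; auto.
         exists d. split; auto. intros y Hy. unfold phi'. destruct (Ceq_dec y p) as [->|Hy']; auto.
         rewrite <- Ef; auto; [simpl; ring|]. apply square_disc; auto.
      -- destruct (Hphi z) as [l Hl]; [split; auto; intros [E|E]; auto|]. exists l. apply cder_ext_loc with phi; auto.
         exists (Cmod (z - p)). split; [apply Cmod_gt_0, Cminus_eq_contra; auto|]. intros y Hy. symmetry. apply Ep.
         intros ->. rewrite Cmod_sub_sym in Hy. lra.
    * intros e He. destruct (Hlim e He) as [T HT]. exists (Rmax T (Rabs (Im p) + 1)). intros s Hs Hi.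
      rewrite Ep; [apply HT; auto; eapply Rle_trans; [apply Rmax_l|eauto]|]. intros ->.
      generalize (Rmax_r T (Rabs (Im p) + 1)). lra.
    * intros q Hq. destruct (HP' q Hq) as [Mq Sq]. split; auto.
      destruct (Ceq_dec q p) as [->|Hne].
      -- apply mero_ext_loc with phi d; auto. intros s _ Hs. symmetry; auto.
      -- assert (0 < Cmod (q - p)) by (apply Cmod_gt_0, Cminus_eq_contra; auto).
         apply mero_ext_loc with phi (Cmod (q - p) / 2)%R; auto; [lra|]. intros s Hs _. symmetry. apply Ep.
         intros ->. apply disc_square in Hs. rewrite Cmod_sub_sym in Hs. lra.
  + destruct (divided_difference (square p d) f p (square_open p d) Hf (square_center p d Hd)) as [g [Hg Eg]].
    (* The top coefficient is [f p]; once its term is removed, f = f p + (s - p) g shows that order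
       m suffices, with g as the new regular part. *)
    apply intL_ext with (fun s => (phi (s + 1) - f p * (/ (s + 1 - p)) ^ S m - (phi s - f p * (/ (s - p)) ^ S m))
       + f p * ((/ (s + 1 - p)) ^ S m - (/ (s - p)) ^ S m)); [intros; ring|].
    replace (RtoC 0) with (0 + f p * 0) by ring. apply intL_plus; [|apply intL_scal, pole_shift; auto].
    apply (IHm (fun s => phi s - f p * (/ (s - p)) ^ S m) g); auto.
    * apply hol_sub_pole; auto. intros z [_ Hz] ->. apply Hz. left; auto.
    * intros e He. assert (Hfp := Cmod_ge_0 (f p)). destruct (Hlim (e / 2)%R) as [T1 H1]; [lra|].
      destruct (tends0_pole R p m (e / 2 / (Cmod (f p) + 1))%R) as [T2 H2]; [apply Rdiv_lt_0_compat; lra|].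
      exists (Rmax T1 T2). intros s Hs Hi. eapply Rle_trans; [apply Cmod_triangle_sub|].
      assert (A1 := H1 s Hs (Rle_trans _ _ _ (Rmax_l T1 T2) Hi)).
      assert (A2 := H2 s Hs (Rle_trans _ _ _ (Rmax_r T1 T2) Hi)).
      rewrite Cmod_mult. apply Rle_div_r in A2; [|lra]. generalize (Cmod_ge_0 ((/ (s - p)) ^ S m)). nra.
    * intros s Hs Hn. assert (Ns : s - p <> 0) by (apply Cminus_eq_contra; auto).
      assert (E := Ef s Hs Hn). rewrite (Eg s) in E.
      assert (Epw : (/ (s - p)) ^ S m * (s - p) ^ S m = 1) by (rewrite <- Cpow_mult_l, Cinv_l, Cpow_1_l by auto; reflexivity).
      assert (Ex : (s - p) * ((phi s - f p * (/ (s - p)) ^ S m) * (s - p) ^ m) = (s - p) * g s).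
      { replace ((s - p) * ((phi s - f p * (/ (s - p)) ^ S m) * (s - p) ^ m)) with
         (phi s * (s - p) ^ S m - f p * ((/ (s - p)) ^ S m * (s - p) ^ S m)) by (rewrite !(Cpow_S (s - p)); ring).
        rewrite E, Epw. ring. }
      replace ((phi s - f p * (/ (s - p)) ^ S m) * (s - p) ^ m) with
        (/ (s - p) * ((s - p) * ((phi s - f p * (/ (s - p)) ^ S m) * (s - p) ^ m))) by (field; auto).
      rewrite Ex. field. auto.
    * intros q Hq. destruct (HP' q Hq) as [Mq Sq]. split; auto.
      apply mero_ext with (fun s => phi s + (- f p) * (/ (s - p)) ^ S m); [intros; ring|].
      apply mero_plus; auto. apply mero_pole.
Qed.

End Shift.

(** * Laplace transforms along the path *)

Lemma exp_mult_INR x n : (exp x ^ n)%R = exp (INR n * x).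
Proof.
induction n; [simpl; rewrite Rmult_0_l, exp_0; auto|].
rewrite S_INR, Rmult_plus_distr_r, exp_plus, Rmult_1_l, <- IHn. simpl. ring.
Qed.

Lemma poly_exp K rho : 0 < rho -> exists A, 0 < A /\ forall x, 0 <= x -> (1 + x) ^ K <= A * exp (rho * x).
Proof.
(* This rate makes K d at most rho; dividing by K + 1 rather than K includes the case K = 0. *)
intros Hr. set (d := (rho / (INR K + 1))%R).
assert (HK := pos_INR K). assert (Hd : 0 < d) by (apply Rdiv_lt_0_compat; lra).
set (c := (1 + / d)%R). assert (Hi : 0 < / d) by (apply Rinv_0_lt_compat; auto).
exists (c ^ K)%R. split; [apply pow_lt; unfold c; lra|]. intros x Hx.
assert (B : 1 + x <= c * exp (d * x)).
{ assert (1 + d * x <= exp (d * x)) by apply exp_ineq1_le.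
  assert (c * (1 + d * x) <= c * exp (d * x)) by (apply Rmult_le_compat_l; unfold c; lra).
  assert (c * (1 + d * x) = 1 + d * x + / d + x)%R by (unfold c; field; lra).
  assert (0 <= d * x) by nra. lra. }
apply Rle_trans with ((c * exp (d * x)) ^ K)%R; [apply pow_incr; lra|].
rewrite Rpow_mult_distr. apply Rmult_le_compat_l; [apply pow_le; unfold c; lra|].
rewrite exp_mult_INR. apply exp_le.
assert (E : (d * (INR K + 1) = rho)%R) by (unfold d; field; lra).
rewrite <- E. nra.
Qed.

Lemma exp_small A d e : 0 < d -> 0 < e -> exists T, 0 < T /\ forall x, T <= x -> A * exp (- (d * x)) <= e.
Proof.
intros Hd He. exists (Rabs A / (d * e) + 1)%R.
assert (H0 : 0 <= Rabs A / (d * e)) by (apply Rmult_le_pos; [apply Rabs_pos|left; apply Rinv_0_lt_compat; nra]).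
split; [lra|]. intros x Hx. rewrite exp_Ropp. assert (P := exp_pos (d * x)).
change (A / exp (d * x) <= e). apply Rle_div_l; auto.
assert (1 + d * x <= exp (d * x)) by apply exp_ineq1_le.
assert (Rabs A / (d * e) * (d * e) <= x * (d * e)) by (apply Rmult_le_compat_r; nra).
replace (Rabs A / (d * e) * (d * e))%R with (Rabs A) in H1 by (field; lra).
generalize (Rle_abs A). nra.
Qed.

Section Laplace.
Context (L : R -> C) (HL : path_ioo L).

(* The weight om may be integrated along L against exp (w s) when Im w = y. *)
Definition expdec (om : C -> C) (y : R) : Prop :=
  (forall t, rcont (fun t => om (L t)) t) /\
  exists M r, 0 <= M /\ 0 < r /\ forall t, Cmod (om (L t)) * exp (y * t) <= M * exp (- (r * Rabs t)).

Lemma expdec_intro om y : (forall t, rcont (fun t => om (L t)) t) ->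
  (exists A K T r, 0 < r /\ forall t, T <= Rabs t ->
     (Cmod (om (L t)) * exp (y * t) <= A * (1 + Rabs t) ^ K * exp (- (r * Rabs t)))) -> expdec om y.
Proof.
intros Hc [A [K [T [r [Hr H]]]]]. split; auto.
destruct (poly_exp K (r / 2)) as [B [HB0 HB]]; [lra|].
(* The last two exponentials cancel: D bounds |om| e^(y t) on the compact part, where no decay is
   assumed. *)
destruct (rcont_bounded (fun t => om (L t) * Cexp (RtoC t * RtoC y) * Cexp (RtoC t * RtoC (r / 2)) * Cexp (RtoC t * RtoC (- (r / 2)))) (- Rabs T) (Rabs T)) as [D [HD0 HD]].
{ intros t. repeat apply econt_mult; auto; eapply rder_rcont, rder_Cexp_line. }
set (E := exp (r * Rabs T)). assert (HE : 0 < E) by apply exp_pos.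
exists (Rabs A * B + D * E)%R, (r / 2)%R.
assert (HA := Rabs_pos A). split; [nra|]. split; [lra|]. intros t.
assert (P := exp_pos (- (r / 2 * Rabs t))).
destruct (Rle_dec (Rabs T) (Rabs t)) as [Ht|Ht].
- apply Rle_trans with (Rabs A * B * exp (- (r / 2 * Rabs t)))%R; [|apply Rmult_le_compat_r; nra].
  eapply Rle_trans; [apply H; generalize (Rle_abs T); lra|].
  replace (- (r * Rabs t))%R with (- (r / 2 * Rabs t) + - (r / 2 * Rabs t))%R by field. rewrite exp_plus, <- !Rmult_assoc.
  apply Rmult_le_compat_r; [lra|].
  specialize (HB (Rabs t) (Rabs_pos t)).
  assert (Z : (exp (r / 2 * Rabs t) * exp (- (r / 2 * Rabs t)) = 1)%R) by (rewrite <- exp_plus, Rplus_opp_r, exp_0; auto).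
  assert ((1 + Rabs t) ^ K * exp (- (r / 2 * Rabs t)) <= B).
  { apply Rle_trans with (B * exp (r / 2 * Rabs t) * exp (- (r / 2 * Rabs t)))%R; [apply Rmult_le_compat_r; lra|].
    rewrite Rmult_assoc, Z. lra. }
  assert (0 <= (1 + Rabs t) ^ K * exp (- (r / 2 * Rabs t))).
  { apply Rmult_le_pos; [apply pow_le; generalize (Rabs_pos t); lra|lra]. }
  generalize (Rle_abs A). rewrite !Rmult_assoc. intros. nra.
- assert (Ht' : Rabs t < Rabs T) by lra. apply Rabs_def2 in Ht' as Ht2.
  specialize (HD t ltac:(lra)). rewrite !Cmod_mult, !Cmod_Cexp, !re_mult, !re_RtoC, !im_RtoC in HD.
  rewrite !Rmult_0_l, !Rminus_0_r in HD. rewrite Rmult_assoc, <- exp_plus in HD.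
  replace (t * (r / 2) + t * - (r / 2))%R with 0%R in HD by ring. rewrite exp_0, Rmult_1_r, (Rmult_comm t) in HD.
  eapply Rle_trans; [apply HD|].
  assert (1 <= E * exp (- (r / 2 * Rabs t))).
  { unfold E. rewrite <- exp_plus, <- exp_0. apply exp_le. generalize (Rabs_pos t). nra. }
  apply Rle_trans with (D * E * exp (- (r / 2 * Rabs t)))%R; [rewrite Rmult_assoc; nra|].
  apply Rmult_le_compat_r; nra.
Qed.

Lemma expdec_mult om u y : expdec om y -> (forall t, rcont (fun t => u (L t)) t) ->
  (exists A K, forall t, Cmod (u (L t)) <= A * (1 + Rabs t) ^ K) -> expdec (fun s => u s * om s) y.
Proof.
intros [Hc [M [r [HM [Hr H]]]]] Hu [A [K HA]]. apply expdec_intro.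
- intros t. apply (econt_mult rsub (fun t => u (L t)) (fun t => om (L t))); auto.
- exists (A * M)%R, K, 0%R, r. split; auto. intros t _. rewrite Cmod_mult.
  specialize (H t). specialize (HA t). assert (P := exp_pos (y * t)).
  generalize (Cmod_ge_0 (u (L t))) (Cmod_ge_0 (om (L t))). intros P1 P2.
  rewrite Rmult_assoc.
  replace (A * M * (1 + Rabs t) ^ K * exp (- (r * Rabs t)))%R with ((A * (1 + Rabs t) ^ K) * (M * exp (- (r * Rabs t))))%R by ring.
  apply Rmult_le_compat; auto. nra.
Qed.

Lemma path_growth : exists A, 0 <= A /\ forall t, Cmod (L t) <= A * (1 + Rabs t).
Proof.
destruct (path_near_vline L HL) as [R0 [HR0 H]]. exists (R0 + 1)%R. split; [lra|]. intros t.
replace (L t) with (vline t + (L t - vline t)) by ring. eapply Rle_trans; [apply Cmod_triangle|].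
rewrite Cmod_vline. generalize (H t) (Rabs_pos t). nra.
Qed.

Lemma expdec_lin om c y : expdec om y -> expdec (fun s => (s + c) * om s) y.
Proof.
intros H. apply (expdec_mult om (fun s => s + c)); auto.
- intros t. apply econt_plus; [apply path_cont; auto|apply econt_const].
- destruct path_growth as [A [HA0 HA]]. exists (A + Cmod c)%R, 1%nat. intros t.
  eapply Rle_trans; [apply Cmod_triangle|]. generalize (HA t) (Rabs_pos t) (Cmod_ge_0 c). simpl. nra.
Qed.

Lemma expdec_scal om c y : expdec om y -> expdec (fun s => c * om s) y.
Proof.
intros H. apply (expdec_mult om (fun _ => c)); auto.
- intros t. apply econt_const.
- exists (Cmod c), O. intros t. simpl. lra.
Qed.

Lemma expdec_plus f g y : expdec f y -> expdec g y -> expdec (fun s => f s + g s) y.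
Proof.
intros [Hc1 [M1 [r1 [HM1 [Hr1 H1]]]]] [Hc2 [M2 [r2 [HM2 [Hr2 H2]]]]]. split.
- intros t. apply (econt_plus rsub (fun t => f (L t)) (fun t => g (L t))); auto.
- exists (M1 + M2)%R, (Rmin r1 r2). split; [lra|]. split; [apply Rmin_case; auto|]. intros t.
  assert (P := exp_pos (y * t)). specialize (H1 t). specialize (H2 t).
  assert (E : forall r, Rmin r1 r2 <= r -> exp (- (r * Rabs t)) <= exp (- (Rmin r1 r2 * Rabs t))).
  { intros r Hr. apply exp_le. generalize (Rabs_pos t). nra. }
  generalize (E r1 (Rmin_l _ _)) (E r2 (Rmin_r _ _)) (Cmod_triangle (f (L t)) (g (L t))). intros. nra.
Qed.

Lemma expdec_ext f g y : (forall t, f (L t) = g (L t)) -> expdec f y -> expdec g y.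
Proof.
intros E [Hc [M [r [HM [Hr H]]]]]. split.
- intros t. apply econt_ext with (fun t => f (L t)); auto.
- exists M, r. repeat split; auto. intros t. rewrite <- E. auto.
Qed.

Lemma expdec_near om y : expdec om y -> exists r, 0 < r /\ forall y', Rabs (y' - y) < r -> expdec om y'.
Proof.
intros [Hc [M [r [HM [Hr H]]]]]. exists (r / 2)%R. split; [lra|]. intros y' Hy. split; auto.
exists M, (r / 2)%R. repeat split; auto; [lra|]. intros t. specialize (H t).
replace (y' * t)%R with (y * t + (y' - y) * t)%R by ring. rewrite exp_plus, <- Rmult_assoc.
apply Rle_trans with (M * exp (- (r * Rabs t)) * exp ((y' - y) * t))%R.
- apply Rmult_le_compat_r; [left; apply exp_pos|auto].
- rewrite Rmult_assoc, <- exp_plus. apply Rmult_le_compat_l; auto. apply exp_le.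
  assert ((y' - y) * t <= r / 2 * Rabs t); [|lra].
  eapply Rle_trans; [apply Rle_abs|]. rewrite Rabs_mult. apply Rmult_le_compat_r; [apply Rabs_pos|lra].
Qed.

Lemma Cmod_Cexp_path : exists R0, 0 <= R0 /\ forall w t, Cmod (Cexp (w * L t)) <= exp (Cmod w * R0) * exp (Im w * t).
Proof.
destruct (path_near_vline L HL) as [R0 [HR0 H]]. exists R0. split; auto. intros w t.
rewrite Cmod_Cexp, <- exp_plus. apply exp_le.
replace (w * L t) with (w * (L t - vline t) + w * vline t) by ring. rewrite re_plus. apply Rplus_le_compat.
- eapply Rle_trans; [apply Rle_abs|]. eapply Rle_trans; [apply re_le_Cmod|]. rewrite Cmod_mult.
  apply Rmult_le_compat_l; [apply Cmod_ge_0|auto].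
- right. rewrite re_mult. simpl. ring.
Qed.

Definition J (om : C -> C) (w : C) : C := path_integral L (fun s => om s * Cexp (w * s)).

Lemma rcont_Cexp_path w t : rcont (fun t => Cexp (w * L t)) t.
Proof.
apply (econt_comp rsub Cexp (fun t => w * L t)); [eapply eder_cont, cder_Cexp|].
apply econt_mult; [apply econt_const|apply path_cont; auto].
Qed.

Lemma inv_sq_exp r : 0 < r -> exists A, 0 < A /\ forall t, exp (- (r * Rabs t)) <= A / (1 + t * t).
Proof.
intros Hr. destruct (poly_exp 2 r Hr) as [A [HA H]]. exists A. split; auto. intros t.
apply Rle_div_r; [nra|]. specialize (H (Rabs t) (Rabs_pos t)).
assert (E : (t * t = Rabs t * Rabs t)%R) by (rewrite <- Rabs_mult, Rabs_pos_eq; nra).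
rewrite exp_Ropp. assert (P := exp_pos (r * Rabs t)). rewrite Rmult_comm. apply Rle_div_l; auto.
generalize (Rabs_pos t). simpl in H. nra.
Qed.

Lemma J_intL om w : expdec om (Im w) -> intL L (fun s => om s * Cexp (w * s)) (J om w).
Proof.
intros [Hc [M [r [HM [Hr H]]]]].
destruct (intL_exists L HL) as [K [HK HE]]. destruct Cmod_Cexp_path as [R0 [HR0 Hw]].
destruct (inv_sq_exp r Hr) as [A [HA0 HA]].
destruct (HE (fun s => om s * Cexp (w * s)) (M * exp (Cmod w * R0) * A)%R) as [l [Hl _]].
- repeat apply Rmult_le_pos; auto; [left; apply exp_pos|lra].
- intros t. apply (econt_mult rsub (fun t => om (L t))); auto. apply rcont_Cexp_path.
- intros t. rewrite Cmod_mult. specialize (Hw w t). specialize (H t). specialize (HA t).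
  assert (P := exp_pos (Cmod w * R0)).
  apply Rle_trans with (Cmod (om (L t)) * (exp (Cmod w * R0) * exp (Im w * t)))%R.
  + apply Rmult_le_compat_l; [apply Cmod_ge_0|auto].
  + apply Rle_trans with (M * exp (- (r * Rabs t)) * exp (Cmod w * R0))%R; [nra|].
    unfold Rdiv in *. assert (0 <= M * exp (Cmod w * R0)) by nra. nra.
- unfold J. rewrite (intL_path_integral L _ _ Hl). exact Hl.
Qed.

(** Differentiation under the integral: the weight of the remainder is om e^(w s) (e^(eta s) - 1 -
    eta s), and its Taylor bound is quadratic in eta as long as e^(|eta s|) does not consume the
    decay of the weight. *)
Lemma J_der om w : expdec om (Im w) -> cder (J om) w (J (fun s => s * om s) w).
Proof.
intros Hom.
assert (Hsom : expdec (fun s => s * om s) (Im w)).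
{ apply expdec_ext with (fun s => (s + 0) * om s); [intros; ring|]. apply expdec_lin; auto. }
destruct (expdec_near om (Im w) Hom) as [r1 [Hr1 Hn]].
destruct Hom as [Hc [M [r [HM [Hr H]]]]] eqn:E0. clear E0.
destruct (intL_exists L HL) as [K [HK HE]]. destruct Cmod_Cexp_path as [R0 [HR0 Hw]].
destruct path_growth as [A1 [HA1 HG]].
destruct (inv_sq_exp (r / 2)) as [A [HA0 HA]]; [lra|].
(* The decay rate r is divided up: r/4 absorbs e^(|eta s|) for |eta| < q, r/4 absorbs the factor
   |s|^2, and r/2 is left to make the integral converge. *)
set (q := (r / 4 / (A1 + 1))%R). assert (Hq : 0 < q) by (unfold q; repeat apply Rdiv_lt_0_compat; lra).
destruct (poly_exp 2 (r / 4)) as [A2 [HA2 HA2']]; [lra|].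
set (B := (M * exp (Cmod w * R0) * (A1 * A1 * A2 * exp (r / 4)) * A)%R).
assert (HB : 0 <= B).
{ unfold B. assert (P1 := exp_pos (Cmod w * R0)). assert (P2 := exp_pos (r / 4)).
  repeat apply Rmult_le_pos; lra. }
intros e He. exists (Rmin (Rmin r1 q) (e / (K * B + 1)))%R.
assert (HKB : 0 <= K * B) by nra.
split; [repeat apply Rmin_case; auto; apply Rdiv_lt_0_compat; lra|]. intros y Hy.
generalize (Rmin_l (Rmin r1 q) (e / (K * B + 1))) (Rmin_r (Rmin r1 q) (e / (K * B + 1))) (Rmin_l r1 q) (Rmin_r r1 q). intros M1 M2 M3 M4.
assert (Hye : expdec om (Im y)).
{ apply Hn. rewrite <- im_sub. eapply Rle_lt_trans; [apply im_le_Cmod|lra]. }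
set (eta := y - w) in *.
assert (HI := intL_minus L _ _ _ _ (intL_minus L _ _ _ _ (J_intL om y Hye) (J_intL om w Hom)) (intL_scal L eta _ _ (J_intL _ w Hsom))).
rewrite (Cmult_comm _ eta).
destruct (HE (fun s => om s * Cexp (y * s) - om s * Cexp (w * s) - eta * (s * om s * Cexp (w * s))) (B * Cmod eta ^ 2)%R) as [l [Hl Hb]].
- apply Rmult_le_pos; auto. apply pow2_ge_0.
- intros t. assert (Hct := Hc t).
  apply econt_minus; [apply econt_minus|apply econt_mult; [apply econt_const|apply econt_mult; [apply econt_mult|]]];
    try apply rcont_Cexp_path; try apply (econt_mult rsub (fun t => om (L t))); auto; try apply rcont_Cexp_path. apply path_cont; auto.
- intros t. set (s := L t).
  replace (om s * Cexp (y * s) - om s * Cexp (w * s) - eta * (s * om s * Cexp (w * s))) with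
    (om s * Cexp (w * s) * (Cexp (eta * s) - 1 - eta * s)).
  2:{ replace (y * s) with (w * s + eta * s) by (unfold eta; ring). rewrite Cexp_plus. ring. }
  rewrite !Cmod_mult. specialize (Hw w t). specialize (H t). specialize (HA t). specialize (HG t). fold s in Hw, H, HG.
  assert (T2 := Cexp_taylor2 (eta * s)). rewrite !Cmod_mult in T2.
  assert (Et : Cmod eta * Cmod s <= r / 4 + r / 4 * Rabs t).
  { apply Rle_trans with (q * (A1 * (1 + Rabs t)))%R.
    - apply Rmult_le_compat; try apply Cmod_ge_0; lra.
    - assert (q * A1 <= r / 4).
      { unfold q. assert (A1 / (A1 + 1) <= 1) by (apply Rle_div_l; lra).
        replace (r / 4 / (A1 + 1) * A1)%R with (r / 4 * (A1 / (A1 + 1)))%R by (field; lra). nra. }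
      generalize (Rabs_pos t). nra. }
  assert (Ex : exp (Cmod eta * Cmod s) <= exp (r / 4) * exp (r / 4 * Rabs t)) by (rewrite <- exp_plus; apply exp_le; auto).
  assert (S2 : Cmod s ^ 2 <= A1 * A1 * (A2 * exp (r / 4 * Rabs t))).
  { specialize (HA2' (Rabs t) (Rabs_pos t)). apply Rle_trans with ((A1 * (1 + Rabs t)) ^ 2)%R.
    - apply pow_incr. split; [apply Cmod_ge_0|auto].
    - rewrite Rpow_mult_distr. replace (A1 ^ 2)%R with (A1 * A1)%R by ring. apply Rmult_le_compat_l; nra. }
  apply Rle_trans with ((M * exp (- (r * Rabs t)) * exp (Cmod w * R0)) *
     (Cmod eta ^ 2 * (A1 * A1 * (A2 * exp (r / 4 * Rabs t))) * (exp (r / 4) * exp (r / 4 * Rabs t))))%R.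
  + apply Rmult_le_compat.
    * apply Rmult_le_pos; apply Cmod_ge_0.
    * apply Cmod_ge_0.
    * assert (P := exp_pos (Cmod w * R0)).
      apply Rle_trans with (Cmod (om s) * (exp (Cmod w * R0) * exp (Im w * t)))%R.
      -- apply Rmult_le_compat_l; [apply Cmod_ge_0|auto].
      -- nra.
    * eapply Rle_trans; [apply T2|]. rewrite Rpow_mult_distr. apply Rmult_le_compat; auto.
      -- apply Rmult_le_pos; apply pow2_ge_0.
      -- left; apply exp_pos.
      -- apply Rmult_le_compat_l; [apply pow2_ge_0|auto].
  + replace (- (r * Rabs t))%R with (- (r / 2 * Rabs t) + - (r / 4 * Rabs t) + - (r / 4 * Rabs t))%R by field.
    rewrite !exp_plus, (exp_Ropp (r / 4 * Rabs t)).
    assert (P := exp_pos (r / 4 * Rabs t)).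
    replace (M * (exp (- (r / 2 * Rabs t)) * / exp (r / 4 * Rabs t) * / exp (r / 4 * Rabs t)) * exp (Cmod w * R0) *
      (Cmod eta ^ 2 * (A1 * A1 * (A2 * exp (r / 4 * Rabs t))) * (exp (r / 4) * exp (r / 4 * Rabs t))))%R
     with ((M * exp (Cmod w * R0) * (A1 * A1 * A2 * exp (r / 4)) * Cmod eta ^ 2) * exp (- (r / 2 * Rabs t)))%R by (field; lra).
    unfold B. replace (M * exp (Cmod w * R0) * (A1 * A1 * A2 * exp (r / 4)) * A * Cmod eta ^ 2 / (1 + t * t))%R
     with ((M * exp (Cmod w * R0) * (A1 * A1 * A2 * exp (r / 4)) * Cmod eta ^ 2) * (A / (1 + t * t)))%R by (unfold Rdiv; ring).
    apply Rmult_le_compat_l; auto.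
    assert (P1 := exp_pos (Cmod w * R0)). assert (P2 := exp_pos (r / 4)). assert (P3 := pow2_ge_0 (Cmod eta)).
    repeat apply Rmult_le_pos; try lra; apply Cmod_ge_0.
- rewrite (intL_unique L _ _ _ HI Hl). eapply Rle_trans; [apply Hb|].
  assert (Hyq : Cmod eta < e / (K * B + 1)) by lra. apply Rlt_div_r in Hyq; [|lra].
  generalize (Cmod_ge_0 eta). intros. simpl. nra.
Qed.

Lemma J_plus f g w : expdec f (Im w) -> expdec g (Im w) -> J (fun s => f s + g s) w = J f w + J g w.
Proof.
intros Hf Hg. apply intL_path_integral.
apply intL_ext with (fun s => f s * Cexp (w * s) + g s * Cexp (w * s)); [intros; ring|].
apply intL_plus; apply J_intL; auto.
Qed.

Lemma J_scal c f w : expdec f (Im w) -> J (fun s => c * f s) w = c * J f w.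
Proof.
intros Hf. apply intL_path_integral.
apply intL_ext with (fun s => c * (f s * Cexp (w * s))); [intros; ring|].
apply intL_scal, J_intL; auto.
Qed.

Lemma J_ext f g w : (forall t, f (L t) = g (L t)) -> expdec f (Im w) -> J f w = J g w.
Proof.
intros E Hf. symmetry. apply intL_path_integral. eapply intL_ext; [|apply J_intL, Hf].
intros t. simpl. rewrite E. reflexivity.
Qed.

End Laplace.

(** * The Mellin-Barnes integral as a solution *)

(* In the variable w = log z, theta becomes d/dw. *)
Fixpoint Dprod (c : nat -> C) (m : nat) (f : C -> C) : C -> C :=
  match m with
  | O => f
  | S m => fun w => C_derive (Dprod c m f) w + c (S m) * Dprod c m f w
  end.

(** A polynomial factor is tolerated because Gamma carries a power of |Im s|; this way rates simply
    add in products. The constants may depend on the strip. *)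
Definition decays (f : C -> C) (c : R) : Prop :=
  forall R, exists A K T, 0 <= A /\ forall s, Rabs (Re s) <= R -> T <= Rabs (Im s) ->
    (Cmod (f s) <= A * (1 + Rabs (Im s)) ^ K * exp (- (c * Rabs (Im s)))).

Lemma decays_mult f g a b : decays f a -> decays g b -> decays (fun s => f s * g s) (a + b).
Proof.
intros Hf Hg R. destruct (Hf R) as [A1 [K1 [T1 [P1 H1]]]]. destruct (Hg R) as [A2 [K2 [T2 [P2 H2]]]].
exists (A1 * A2)%R, (K1 + K2)%nat, (Rmax T1 T2). split; [nra|]. intros s Hs Ht.
specialize (H1 s Hs (Rle_trans _ _ _ (Rmax_l T1 T2) Ht)). specialize (H2 s Hs (Rle_trans _ _ _ (Rmax_r T1 T2) Ht)).
rewrite Cmod_mult, pow_add.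
replace (- ((a + b) * Rabs (Im s)))%R with (- (a * Rabs (Im s)) + - (b * Rabs (Im s)))%R by ring. rewrite exp_plus.
eapply Rle_trans; [apply Rmult_le_compat; try apply Cmod_ge_0; eassumption|]. right. ring.
Qed.

Lemma decays_Cprod (f : nat -> C -> C) a n : (forall k, decays (f k) a) ->
  decays (fun s => Cprod (fun k => f k s) n) (INR n * a).
Proof.
intros H. induction n.
- intros R. exists 1%R, O, 0%R. split; [lra|]. intros s _ _. simpl. rewrite Cmod_1.
  replace (- (0 * a * Rabs (Im s)))%R with 0%R by ring. rewrite exp_0. lra.
- rewrite S_INR, Rmult_plus_distr_r, Rmult_1_l. simpl. apply decays_mult; auto.
Qed.

Lemma decays_ext f g a : (forall s, f s = g s) -> decays f a -> decays g a.
Proof. intros E. replace g with f; auto. extensionality s. auto. Qed.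

Lemma decays_Gamma_affine (e : R) (a : C) : (e = 1 \/ e = -1)%R -> decays (fun s => Gamma (a + RtoC e * s)) (PI / 2).
Proof.
intros He R. destruct (Gamma_decay (Rabs (Re a) + R)) as [A [K [HA H]]].
set (q := Rabs (Im a)). assert (Hq : 0 <= q) by apply Rabs_pos.
exists (A * (1 + q) ^ K * exp (PI / 2 * q))%R, K, (1 + q)%R.
split. { repeat apply Rmult_le_pos; auto; [apply pow_le; lra|left; apply exp_pos]. }
intros s Hs Ht.
assert (Er : Re (a + RtoC e * s) = (Re a + e * Re s)%R) by (rewrite re_plus, re_scal_l; auto).
assert (Ei : Im (a + RtoC e * s) = (Im a + e * Im s)%R) by (rewrite im_plus, im_scal_l; auto).
assert (Ae : Rabs e = 1%R) by (destruct He; subst; [rewrite Rabs_pos_eq; lra|rewrite Rabs_left; lra]).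
assert (I1 : Rabs (Im s) - q <= Rabs (Im (a + RtoC e * s)) <= Rabs (Im s) + q).
{ rewrite Ei. unfold q. generalize (Rabs_triang (Im a) (e * Im s)) (Rabs_triang_inv (e * Im s) (- Im a)).
  replace (e * Im s - - Im a)%R with (Im a + e * Im s)%R by ring. rewrite Rabs_Ropp, Rabs_mult, Ae. lra. }
assert (I2 : Rabs (Re (a + RtoC e * s)) <= Rabs (Re a) + R).
{ rewrite Er. eapply Rle_trans; [apply Rabs_triang|]. rewrite Rabs_mult, Ae. lra. }
eapply Rle_trans; [apply H; auto; lra|].
set (x := Rabs (Im s)) in *. set (x' := Rabs (Im (a + RtoC e * s))) in *.
assert (B1 : (1 + x') ^ K <= (1 + q) ^ K * (1 + x) ^ K).
{ rewrite <- Rpow_mult_distr. apply pow_incr. split; [lra|]. assert (0 <= x) by apply Rabs_pos. nra. }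
assert (B2 : exp (- (PI / 2 * x')) <= exp (PI / 2 * q) * exp (- (PI / 2 * x))).
{ rewrite <- exp_plus. apply exp_le. assert (Pi := PI_RGT_0). nra. }
replace (A * (1 + q) ^ K * exp (PI / 2 * q) * (1 + x) ^ K * exp (- (PI / 2 * x)))%R with
  (A * ((1 + q) ^ K * (1 + x) ^ K) * (exp (PI / 2 * q) * exp (- (PI / 2 * x))))%R by ring.
assert (0 <= (1 + x') ^ K) by (apply pow_le; unfold x'; generalize (Rabs_pos (Im (a + RtoC e * s))); lra).
apply Rmult_le_compat; auto; [apply Rmult_le_pos; auto|left; apply exp_pos|apply Rmult_le_compat_l; auto].
Qed.

Lemma decays_Gamma_plus a : decays (fun s => Gamma (a + s)) (PI / 2).
Proof.
apply decays_ext with (fun s => Gamma (a + RtoC 1 * s)); [intros; f_equal; ring|].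
apply decays_Gamma_affine; auto.
Qed.

Lemma decays_Gamma_minus a : decays (fun s => Gamma (a - s)) (PI / 2).
Proof.
apply decays_ext with (fun s => Gamma (a + RtoC (-1) * s)); [intros; f_equal; ring|].
apply decays_Gamma_affine; auto.
Qed.

Definition gamma_prod (n : nat) (alpha beta : nat -> C) (s : C) : C :=
  Cprod (fun k => Gamma (alpha k + s) * Gamma (1 - beta k - s)) n.

Definition rot (n : nat) : C := RtoC (INR n) * RtoC PI * Ci.

Definition mb_weight (n : nat) (alpha beta : nat -> C) (s : C) : C :=
  gamma_prod n alpha beta s * Cexp (- rot n * s).

Lemma gamma_prod_decays n alpha beta : decays (gamma_prod n alpha beta) (INR n * PI).
Proof.
apply decays_Cprod with (f := fun k s => Gamma (alpha k + s) * Gamma (1 - beta k - s)).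
intros k. replace PI with (PI / 2 + PI / 2)%R by field.
apply decays_mult; [apply decays_Gamma_plus|apply decays_Gamma_minus].
Qed.

Lemma Cprod_ext f g n : (forall k, (1 <= k <= n)%nat -> f k = g k) -> Cprod f n = Cprod g n.
Proof.
induction n; intros H; simpl; auto. rewrite IHn, H; auto; [lia|]. intros; apply H; lia.
Qed.

Lemma Cprod_mult f g n : Cprod (fun k => f k * g k) n = Cprod f n * Cprod g n.
Proof. induction n; simpl; [ring|]. rewrite IHn. ring. Qed.

Lemma Cprod_const c n : Cprod (fun _ => c) n = c ^ n.
Proof. induction n; simpl; auto. rewrite IHn. ring. Qed.

Lemma Dprod_J L (HL : path_ioo L) c om y0 y1 : (forall y, y0 < y < y1 -> expdec L om y) ->
  forall m w, y0 < Im w < y1 ->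
    expdec L (fun s => Cprod (fun k => s + c k) m * om s) (Im w) /\
    Dprod c m (J L om) w = J L (fun s => Cprod (fun k => s + c k) m * om s) w.
Proof.
intros Hom.
assert (Hex : forall m y, y0 < y < y1 -> expdec L (fun s => Cprod (fun k => s + c k) m * om s) y).
{ induction m; intros y Hy.
  - apply expdec_ext with om; auto. intros t. simpl. ring.
  - apply expdec_ext with (fun s => (s + c (S m)) * (Cprod (fun k => s + c k) m * om s)).
    + intros t. simpl. ring.
    + apply expdec_lin; auto. }
induction m; intros w Hw; split; auto.
- simpl. apply J_ext; auto. intros t. ring.
- simpl.
  assert (D : cder (Dprod c m (J L om)) w (J L (fun s => s * (Cprod (fun k => s + c k) m * om s)) w)).
  { apply cder_ext_loc with (J L (fun s => Cprod (fun k => s + c k) m * om s)).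
    - exists (Rmin (Im w - y0) (y1 - Im w)). split; [apply Rmin_case; lra|]. intros x Hx.
      symmetry. apply IHm. generalize (Rmin_l (Im w - y0) (y1 - Im w)) (Rmin_r (Im w - y0) (y1 - Im w)) (im_le_Cmod (x - w)).
      rewrite im_sub. intros. assert (K : Rabs (Im x - Im w) < Rmin (Im w - y0) (y1 - Im w)) by lra.
      apply Rabs_def2 in K. lra.
    - apply J_der; auto. }
  rewrite (cder_C_derive _ _ _ D), (proj2 (IHm w Hw)).
  rewrite <- J_scal by auto. rewrite <- J_plus; auto.
  + apply J_ext; auto.
    * intros t. simpl. ring.
    * apply expdec_ext with (fun s => (s + c (S m)) * (Cprod (fun k => s + c k) m * om s)); [intros; ring|].
      apply expdec_lin; auto.
  + apply expdec_ext with (fun s => (s + 0) * (Cprod (fun k => s + c k) m * om s)); [intros; ring|]. apply expdec_lin; auto.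
  + apply expdec_scal; auto.
Qed.

Section MB.
Context (n : nat) (alpha beta : nat -> C) (L : R -> C) (HL : mellin_barnes_path n alpha beta L).

Let HP : path_ioo L := proj1 HL.

(** Both poles are joined, off [L], to one real point far to the left, beyond the two radii that
    [left_of] provides. *)
Lemma mb_left k m : (1 <= k <= n)%nat ->
  homologous L (- alpha k - RtoC (INR m) - 1) (- alpha k - RtoC (INR m)).
Proof.
intros Hk. destruct (proj1 (proj2 HL k m Hk)) as [r Hr]. destruct (proj1 (proj2 HL k (S m) Hk)) as [r' Hr'].
set (s := RtoC (- (Rabs r + Rabs r' + 1))).
assert (Hs : (Cmod s = Rabs r + Rabs r' + 1)%R).
{ unfold s. rewrite Cmod_R, Rabs_Ropp, Rabs_pos_eq; auto. generalize (Rabs_pos r) (Rabs_pos r'). lra. }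
assert (Hre : Re s < 0) by (unfold s; rewrite re_RtoC; generalize (Rabs_pos r) (Rabs_pos r'); lra).
apply homologous_common with s; auto; apply same_component_homologous; auto.
- replace (- alpha k - RtoC (INR m) - 1) with (- alpha k - RtoC (INR (S m))) by (rewrite S_INR, RtoC_plus; ring).
  apply Hr'; auto. rewrite Hs. generalize (Rle_abs r') (Rabs_pos r). lra.
- apply Hr; auto. rewrite Hs. generalize (Rle_abs r) (Rabs_pos r'). lra.
Qed.

Lemma mb_right k m : (1 <= k <= n)%nat ->
  homologous L (1 - beta k + RtoC (INR m)) (1 - beta k + RtoC (INR m) + 1).
Proof.
intros Hk. destruct (proj2 (proj2 HL k m Hk)) as [r Hr]. destruct (proj2 (proj2 HL k (S m) Hk)) as [r' Hr'].
set (s := RtoC (Rabs r + Rabs r' + 1)).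
assert (Hs : (Cmod s = Rabs r + Rabs r' + 1)%R).
{ unfold s. rewrite Cmod_R, Rabs_pos_eq; auto. generalize (Rabs_pos r) (Rabs_pos r'). lra. }
assert (Hre : 0 < Re s) by (unfold s; rewrite re_RtoC; generalize (Rabs_pos r) (Rabs_pos r'); lra).
apply homologous_common with s; auto; apply same_component_homologous; auto.
- apply Hr; auto. rewrite Hs. generalize (Rle_abs r) (Rabs_pos r'). lra.
- replace (1 - beta k + RtoC (INR m) + 1) with (1 - beta k + RtoC (INR (S m))) by (rewrite S_INR, RtoC_plus; ring).
  apply Hr'; auto. rewrite Hs. generalize (Rle_abs r') (Rabs_pos r). lra.
Qed.

Lemma mb_not_pole_l k t : (1 <= k <= n)%nat -> not_pole (alpha k + L t).
Proof.
intros Hk m E. destruct (mb_left k m Hk) as [_ [H _]]. apply (H t).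
replace (L t) with (alpha k + L t + RtoC (INR m) - alpha k - RtoC (INR m)) by ring. rewrite E. ring.
Qed.

Lemma mb_not_pole_r k t : (1 <= k <= n)%nat -> not_pole (1 - beta k - L t).
Proof.
intros Hk m E. destruct (mb_right k m Hk) as [H _]. apply (H t).
replace (L t) with (1 - beta k + RtoC (INR m) - (1 - beta k - L t + RtoC (INR m))) by ring. rewrite E. ring.
Qed.

Lemma ccont_Cprod (f : nat -> C -> C) m (z : C) : (forall k, (1 <= k <= m)%nat -> exists l, cder (f k) z l) ->
  ccont (fun s => Cprod (fun k => f k s) m) z.
Proof. intros H. destruct (cder_Cprod f m z H) as [l Hl]. eapply eder_cont; eauto. Qed.

Lemma cder_Gamma_plus (a z : C) : not_pole (a + z) -> exists l, cder (fun s => Gamma (a + s)) z l.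
Proof.
intros H. destruct (Gamma_hol _ H) as [l Hl]. eexists.
apply (eder_comp Cminus Gamma (fun s => a + s)); [exact Hl|]. apply eder_plus; [apply eder_const|apply cder_id].
Qed.

Lemma cder_Gamma_minus (a z : C) : not_pole (a - z) -> exists l, cder (fun s => Gamma (a - s)) z l.
Proof.
intros H. destruct (Gamma_hol _ H) as [l Hl]. eexists.
apply (eder_comp Cminus Gamma (fun s => a - s)); [exact Hl|]. apply eder_minus; [apply eder_const|apply cder_id].
Qed.

Lemma rcont_mb_weight t : rcont (fun t => mb_weight n alpha beta (L t)) t.
Proof.
apply (econt_mult rsub (fun t => gamma_prod n alpha beta (L t))).
- apply (econt_comp rsub (gamma_prod n alpha beta) L); [|apply path_cont; auto].
  apply (ccont_Cprod (fun k s => Gamma (alpha k + s) * Gamma (1 - beta k - s))). intros k Hk.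
  destruct (cder_Gamma_plus (alpha k) (L t)) as [l1 H1]; [apply mb_not_pole_l; auto|].
  destruct (cder_Gamma_minus (1 - beta k) (L t)) as [l2 H2]; [apply mb_not_pole_r; auto|].
  eexists. apply eder_mult; eauto.
- apply rcont_Cexp_path; auto.
Qed.

Lemma expdec_mb_weight y : 0 < y < 2 * PI * INR n -> expdec L (mb_weight n alpha beta) y.
Proof.
intros Hy. apply expdec_intro; [exact rcont_mb_weight|].
destruct (gamma_prod_decays n alpha beta 0) as [A [K [T [HA H]]]].
destruct (path_straight L HP) as [T' [HT1 HT]].
set (r := Rmin y (2 * PI * INR n - y)). assert (Hr : 0 < r) by (apply Rmin_case; lra).
assert (R1 := Rmin_l y (2 * PI * INR n - y)). assert (R2 := Rmin_r y (2 * PI * INR n - y)). fold r in R1, R2.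
exists A, K, (Rmax T T')%R, r. split; auto. intros t Ht.
assert (Ht1 : T <= Rabs t) by (generalize (Rmax_l T T'); lra).
assert (Ht2 : T' <= Rabs t) by (generalize (Rmax_r T T'); lra).
rewrite HT by auto. unfold mb_weight. rewrite Cmod_mult, Cmod_Cexp.
assert (E : Re (- rot n * vline t) = (- (INR n * PI * t))%R) by (unfold rot; simpl; ring).
rewrite E. specialize (H (vline t)). simpl in H. rewrite Rabs_R0, Rabs_Ropp in H.
specialize (H (Rle_refl _) Ht1).
eapply Rle_trans; [apply Rmult_le_compat_r; [left; apply exp_pos|apply Rmult_le_compat_r; [left; apply exp_pos|apply H]]|].
rewrite !(Rmult_assoc (A * (1 + Rabs t) ^ K)). apply Rmult_le_compat_l.
{ apply Rmult_le_pos; auto. apply pow_le. generalize (Rabs_pos t). lra. }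
rewrite <- !exp_plus. apply exp_le.
destruct (Rle_dec 0 t); [rewrite Rabs_pos_eq by auto|rewrite Rabs_left by lra]; nra.
Qed.

(** The second gamma factor is moved by one on purpose. On [L] the functional equation then yields
    the product of the s + beta_k - 1 times the integrand, and on [L] + 1 the product of the s +
    alpha_k times e^w times the integrand. The two sides of the differential equation are therefore
    one function integrated over [L] + 1 and over [L]; the sign (-1)^n is the same on both, from
    Gamma (2 - beta - s) on [L] and from e^(- n pi i) on [L] + 1. *)
Definition shifted_weight (w s : C) : C :=
  Cprod (fun k => Gamma (alpha k + s) * Gamma (2 - beta k - s)) n * Cexp ((w - rot n) * s).

Lemma Cexp_rot : Cexp (rot n) = (-1) ^ n.
Proof.
unfold rot. rewrite <- Cmult_assoc, Cexp_pow, Cexp_PI. reflexivity.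
Qed.

Lemma pow_m1_sq : (-1) ^ n * (-1) ^ n = 1.
Proof. rewrite <- Cpow_mult_l. replace (-1 * -1) with (RtoC 1) by ring. apply Cpow_1_l. Qed.

Lemma shifted_weight_0 w t :
  shifted_weight w (L t) = (-1) ^ n * (Cprod (fun k => L t + (beta k - 1)) n * mb_weight n alpha beta (L t) * Cexp (w * L t)).
Proof.
unfold shifted_weight, mb_weight, gamma_prod.
replace ((w - rot n) * L t) with (- rot n * L t + w * L t) by ring. rewrite Cexp_plus.
rewrite (Cprod_ext _ (fun k => (-1) * ((L t + (beta k - 1)) * (Gamma (alpha k + L t) * Gamma (1 - beta k - L t))))).
- rewrite !Cprod_mult, Cprod_const. ring.
- intros k Hk. replace (2 - beta k - L t) with ((1 - beta k - L t) + 1) by ring.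
  rewrite Gamma_S by (apply mb_not_pole_r; auto). ring.
Qed.

Lemma shifted_weight_1 w t :
  shifted_weight w (L t + 1) = (-1) ^ n * (Cexp w * (Cprod (fun k => L t + alpha k) n * mb_weight n alpha beta (L t) * Cexp (w * L t))).
Proof.
unfold shifted_weight, mb_weight, gamma_prod.
replace ((w - rot n) * (L t + 1)) with (- rot n * L t + w * L t + w + - rot n) by ring. rewrite !Cexp_plus.
rewrite Cexp_opp, Cexp_rot.
assert (E : / (-1) ^ n = (-1) ^ n).
{ assert (N : (-1) ^ n <> 0) by (apply Cpow_nz; intros E; apply (f_equal Re) in E; simpl in E; lra).
  rewrite <- (Cmult_1_l (/ (-1) ^ n)), <- pow_m1_sq. field. auto. }
rewrite E.
rewrite (Cprod_ext _ (fun k => (L t + alpha k) * (Gamma (alpha k + L t) * Gamma (1 - beta k - L t)))).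
- rewrite !Cprod_mult. ring.
- intros k Hk. replace (alpha k + (L t + 1)) with ((alpha k + L t) + 1) by ring.
  rewrite Gamma_S by (apply mb_not_pole_l; auto).
  replace (2 - beta k - (L t + 1)) with (1 - beta k - L t) by ring. ring.
Qed.

Lemma cder_Cexp_any c z : exists l, cder (fun s => Cexp (c * s)) z l.
Proof. eexists. apply cder_Cexp_lin. Qed.

(** No pole is crossed. For p = - alpha_k - m both p and p - 1 are to the left of [L]; for p = 2 -
    beta_k + m both are to the right, since p - 1 is already a pole of the unshifted weight. *)
Lemma shifted_weight_shift w : 0 < Im w < 2 * PI * INR n ->
  intL L (fun s => shifted_weight w (s + 1) - shifted_weight w s) 0.
Proof.
intros Hw.
destruct (path_near_vline L HP) as [R0 [HR0 HR0']].
set (R := (R0 + 2)%R).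
assert (HR : forall t, strip R (L t) /\ strip R (L t + 1)).
{ intros t. assert (Rabs (Re (L t)) <= R0).
  { eapply Rle_trans; [|apply (HR0' t)]. eapply Rle_trans; [|apply re_le_Cmod]. rewrite re_sub. simpl. right; f_equal; ring. }
  split; split; try exact I; [unfold R; lra|]. rewrite re_plus, re_RtoC. unfold R.
  eapply Rle_lt_trans; [apply Rabs_triang|]. rewrite Rabs_R1. lra. }
(* Poles with index larger than M have real parts outside the strip, so that a finite list of
   candidates is enough. *)
assert (HM : exists M : nat, forall k, (1 <= k <= n)%nat -> (R + Cmod (alpha k) <= INR M /\ R + Cmod (2 - beta k) <= INR M)%R).
{ destruct (finite_max (fun k => R + Cmod (alpha k))%R (S n)) as [M1 [P1 H1]].
  destruct (finite_max (fun k => R + Cmod (2 - beta k))%R (S n)) as [M2 [P2 H2]].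
  destruct (nat_above (M1 + M2)) as [M [_ HM]]. exists M. intros k Hk.
  specialize (H1 k ltac:(lia)). specialize (H2 k ltac:(lia)). cbv beta in H1, H2. lra. }
destruct HM as [M HM].
set (idx := list_prod (seq 1 n) (seq 0 (S M))).
set (P := map (fun km => - alpha (fst km) - RtoC (INR (snd km))) idx ++ map (fun km => 2 - beta (fst km) + RtoC (INR (snd km))) idx).
assert (Idx : forall k m, (1 <= k <= n)%nat -> (m <= M)%nat -> In (k, m) idx).
{ intros k m Hk Hm. apply in_prod; apply in_seq; lia. }
apply (contour_shift L HP R P HR).
- intros z [[Hz _] HzP].
  destruct (cder_Cprod (fun k s => Gamma (alpha k + s) * Gamma (2 - beta k - s)) n z) as [l Hl].
  + intros k Hk. destruct (HM k Hk) as [M1 M2]. apply Rabs_def2 in Hz.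
    assert (Far : forall m : nat, (m > M)%nat -> INR M < INR m) by (intros; apply lt_INR; lia).
    destruct (cder_Gamma_plus (alpha k) z) as [l1 H1].
    { intros m E. apply HzP. apply in_or_app. left. apply in_map_iff. exists (k, m). split.
      - simpl. replace z with (alpha k + z + RtoC (INR m) - alpha k - RtoC (INR m)) by ring. rewrite E. ring.
      - apply Idx; auto. apply Nat.nlt_ge. intros Hm. specialize (Far m Hm).
        apply (f_equal Re) in E. rewrite !re_plus, re_RtoC in E. simpl in E.
        generalize (re_le_Cmod (alpha k)). intros K. apply Rabs_le_between in K. lra. }
    destruct (cder_Gamma_minus (2 - beta k) z) as [l2 H2].
    { intros m E. apply HzP. apply in_or_app. right. apply in_map_iff. exists (k, m). split.
      - simpl. replace z with (2 - beta k + RtoC (INR m) - (2 - beta k - z + RtoC (INR m))) by ring. rewrite E. ring.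
      - apply Idx; auto. apply Nat.nlt_ge. intros Hm. specialize (Far m Hm).
        apply (f_equal Re) in E. rewrite re_plus, (re_sub (2 - beta k)), re_RtoC in E. simpl Re at 3 in E.
        generalize (re_le_Cmod (2 - beta k)). intros K. apply Rabs_le_between in K. simpl in E, K. lra. }
    eexists. apply eder_mult; eauto.
  + destruct (cder_Cexp_any (w - rot n) z) as [l' Hl']. eexists. apply eder_mult; eauto.
- assert (Dg : decays (fun s => Cprod (fun k => Gamma (alpha k + s) * Gamma (2 - beta k - s)) n) (INR n * PI)).
  { apply (decays_Cprod (fun k s => Gamma (alpha k + s) * Gamma (2 - beta k - s))). intros k.
    replace PI with (PI / 2 + PI / 2)%R by field. apply decays_mult; [apply decays_Gamma_plus|apply decays_Gamma_minus]. }
  destruct (Dg R) as [A [K [T [HA H]]]].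
  (* The exponential rate that remains when e^((w - n pi i) s) is set against the decay n pi of the
     gamma factors; one half of it absorbs the polynomial factor. *)
  set (dl := Rmin (Im w) (2 * PI * INR n - Im w)). assert (Hdl : 0 < dl) by (apply Rmin_case; lra).
  assert (R1 := Rmin_l (Im w) (2 * PI * INR n - Im w)). assert (R2 := Rmin_r (Im w) (2 * PI * INR n - Im w)). fold dl in R1, R2.
  destruct (poly_exp K (dl / 2)) as [B [HB0 HB]]; [lra|].
  intros e He. destruct (exp_small (A * B * exp (Rabs (Re w) * R)) (dl / 2) e) as [T' [HT0 HT]]; [lra|auto|].
  exists (Rmax T T'). intros s [Hs _] Ht.
  assert (Ht1 : T <= Rabs (Im s)) by (generalize (Rmax_l T T'); lra).
  assert (Ht2 : T' <= Rabs (Im s)) by (generalize (Rmax_r T T'); lra).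
  specialize (H s (Rlt_le _ _ Hs) Ht1). specialize (HT _ Ht2). specialize (HB _ (Rabs_pos (Im s))).
  unfold shifted_weight. rewrite Cmod_mult, Cmod_Cexp.
  assert (Ex : Re ((w - rot n) * s) <= Rabs (Re w) * R + (INR n * PI - dl) * Rabs (Im s)).
  { assert (E : Re ((w - rot n) * s) = (Re w * Re s - (Im w - INR n * PI) * Im s)%R) by (rewrite re_mult, re_sub, im_sub; replace (Re (rot n)) with 0%R by (unfold rot; simpl; ring); replace (Im (rot n)) with (INR n * PI)%R by (unfold rot; simpl; ring); ring).
    rewrite E. assert (Re w * Re s <= Rabs (Re w) * R).
    { eapply Rle_trans; [apply Rle_abs|]. rewrite Rabs_mult. apply Rmult_le_compat_l; [apply Rabs_pos|lra]. }
    assert (- ((Im w - INR n * PI) * Im s) <= (INR n * PI - dl) * Rabs (Im s)); [|lra].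
    destruct (Rle_dec 0 (Im s)); [rewrite Rabs_pos_eq by auto|rewrite Rabs_left by lra]; nra. }
  eapply Rle_trans; [|apply HT].
  eapply Rle_trans; [apply Rmult_le_compat; [apply Cmod_ge_0|left; apply exp_pos|apply H|apply exp_le, Ex]|].
  rewrite exp_plus.
  set (x := Rabs (Im s)) in *.
  replace (A * (1 + x) ^ K * exp (- (INR n * PI * x)) * (exp (Rabs (Re w) * R) * exp ((INR n * PI - dl) * x)))%R
   with (A * exp (Rabs (Re w) * R) * ((1 + x) ^ K * (exp (- (INR n * PI * x)) * exp ((INR n * PI - dl) * x))))%R by ring.
  rewrite <- exp_plus. replace (- (INR n * PI * x) + (INR n * PI - dl) * x)%R with (- (dl / 2 * x) + - (dl / 2 * x))%R by field.
  rewrite exp_plus.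
  replace (A * B * exp (Rabs (Re w) * R) * exp (- (dl / 2 * x)))%R with (A * exp (Rabs (Re w) * R) * (B * exp (- (dl / 2 * x))))%R by ring.
  assert (P1 := exp_pos (- (dl / 2 * x))).
  assert (Z : (exp (dl / 2 * x) * exp (- (dl / 2 * x)) = 1)%R) by (rewrite <- exp_plus, Rplus_opp_r, exp_0; auto).
  apply Rmult_le_compat_l; [apply Rmult_le_pos; auto; left; apply exp_pos|].
  rewrite <- Rmult_assoc. apply Rmult_le_compat_r; [lra|].
  apply Rle_trans with (B * exp (dl / 2 * x) * exp (- (dl / 2 * x)))%R; [apply Rmult_le_compat_r; lra|].
  rewrite Rmult_assoc, Z. lra.
- intros p Hp. split.
  + apply mero_mult.
    * apply (mero_Cprod (fun k s => Gamma (alpha k + s) * Gamma (2 - beta k - s))). intros k _. apply mero_mult.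
      -- apply mero_ext with (fun s => Gamma (s + alpha k)); [intros; f_equal; ring|]. apply mero_translate, Gamma_mero.
      -- apply mero_ext with (fun s => Gamma (- (s + (beta k - 2)))); [intros; f_equal; ring|].
         apply (mero_translate (fun s => Gamma (- s))). apply mero_opp, Gamma_mero.
    * apply hol_mero with 1%R; [lra|]. intros z _. apply cder_Cexp_any.
  + apply in_app_or in Hp. destruct Hp as [Hp|Hp]; apply in_map_iff in Hp; destruct Hp as [[k m] [<- Hp]]; simpl;
      apply in_prod_iff in Hp; destruct Hp as [Hk _]; apply in_seq in Hk.
    * apply mb_left. lia.
    * replace (2 - beta k + RtoC (INR m) - 1) with (1 - beta k + RtoC (INR m)) by ring.
      replace (2 - beta k + RtoC (INR m)) with (1 - beta k + RtoC (INR m) + 1) by ring. apply mb_right. lia.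
Qed.

Theorem mb_ode w : 0 < Im w < 2 * PI * INR n ->
  Cexp w * Dprod alpha n (J L (mb_weight n alpha beta)) w = Dprod (fun k => beta k - 1) n (J L (mb_weight n alpha beta)) w.
Proof.
intros Hw.
destruct (Dprod_J L HP alpha _ _ _ (fun y => expdec_mb_weight y) n w Hw) as [A1 A2].
destruct (Dprod_J L HP (fun k => beta k - 1) _ _ _ (fun y => expdec_mb_weight y) n w Hw) as [B1 B2].
rewrite A2, B2. apply Ceq_minus.
assert (I1 := intL_scal L (Cexp w) _ _ (J_intL L HP _ w A1)). assert (I2 := J_intL L HP _ w B1).
assert (I3 := intL_scal L ((-1) ^ n) _ _ (shifted_weight_shift w Hw)).
rewrite Cmult_0_r in I3.
eapply intL_unique; [apply intL_minus; eauto|].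
eapply intL_ext; [|exact I3]. intros t. cbv beta. rewrite shifted_weight_0, shifted_weight_1.
transitivity ((-1) ^ n * (-1) ^ n * (Cexp w * (Cprod (fun k : nat => L t + alpha k) n * mb_weight n alpha beta (L t) * Cexp (w * L t)) -
  Cprod (fun k : nat => L t + (beta k - 1)) n * mb_weight n alpha beta (L t) * Cexp (w * L t))); [ring|].
rewrite pow_m1_sq. ring.
Qed.

End MB.

(** * Linear systems of differential equations *)

Fixpoint Csum (f : nat -> C) (n : nat) : C :=
  match n with O => 0 | S m => Csum f m + f m end.

Fixpoint Rsum (f : nat -> R) (n : nat) : R :=
  match n with O => 0%R | S m => (Rsum f m + f m)%R end.

Lemma Csum_ext f g n : (forall k, (k < n)%nat -> f k = g k) -> Csum f n = Csum g n.
Proof. induction n; intros H; simpl; auto. rewrite IHn, H; auto. Qed.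

Lemma Csum_plus f g n : Csum (fun k => f k + g k) n = Csum f n + Csum g n.
Proof. induction n; simpl; [ring|]. rewrite IHn. ring. Qed.

Lemma Csum_scal c f n : Csum (fun k => c * f k) n = c * Csum f n.
Proof. induction n; simpl; [ring|]. rewrite IHn. ring. Qed.

Lemma Csum_0 n : Csum (fun _ => 0) n = 0.
Proof. induction n; simpl; auto. rewrite IHn. ring. Qed.

Lemma Csum_swap (f : nat -> nat -> C) n m : Csum (fun i => Csum (fun j => f i j) m) n = Csum (fun j => Csum (fun i => f i j) n) m.
Proof.
induction n; simpl; [rewrite Csum_0; auto|]. rewrite IHn, <- Csum_plus. reflexivity.
Qed.

Lemma Csum_delta (f : nat -> C) n k : (k < n)%nat -> Csum (fun j => delta k j * f j) n = f k.
Proof.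
unfold delta. induction n; intros H; [lia|]. simpl. destruct (Nat.eq_dec k n) as [->|Hne].
- rewrite Nat.eqb_refl. rewrite (Csum_ext _ (fun _ => 0)), Csum_0; [ring|].
  intros j Hj. replace (Nat.eqb n j) with false by (symmetry; apply Nat.eqb_neq; lia). ring.
- rewrite IHn by lia. replace (Nat.eqb k n) with false by (symmetry; apply Nat.eqb_neq; lia). ring.
Qed.

Lemma Csum_bound f n B : (forall k, (k < n)%nat -> Cmod (f k) <= B) -> Cmod (Csum f n) <= INR n * B.
Proof.
induction n; intros H; [simpl; rewrite Cmod_0; lra|]. rewrite S_INR. simpl Csum.
eapply Rle_trans; [apply Cmod_triangle|]. generalize (IHn ltac:(intros; apply H; lia)) (H n ltac:(lia)). lra.
Qed.

Lemma eder_Csum {X} (sub : X -> X -> C) (f : nat -> X -> C) (z : X) (d : nat -> C) n :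
  (forall k, (k < n)%nat -> eder sub (f k) z (d k)) -> eder sub (fun y => Csum (fun k => f k y) n) z (Csum d n).
Proof.
induction n; intros H; simpl; [apply (eder_const sub 0)|]. apply eder_plus; auto.
Qed.

Lemma econt_Csum {X} (sub : X -> X -> C) (f : nat -> X -> C) (z : X) n :
  (forall k, (k < n)%nat -> econt sub (f k) z) -> econt sub (fun y => Csum (fun k => f k y) n) z.
Proof.
induction n; intros H; simpl; [apply (econt_const sub 0)|]. apply econt_plus; auto.
Qed.

(** Cauchy-Schwarz against the constant vector 1. *)
Lemma Rsum_sq_le f n : (Rsum f n * Rsum f n <= INR n * Rsum (fun k => f k * f k) n)%R.
Proof.
induction n; [simpl; lra|]. rewrite S_INR. simpl Rsum.
set (s := Rsum f n) in *. set (e := Rsum (fun k => f k * f k)%R n) in *. set (y := f n).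
destruct n as [|n].
- unfold s, e. simpl. lra.
- set (m := INR (S n)) in *. assert (Hm : 0 < m) by (apply lt_0_INR; lia).
  assert (H1 : 2 * s * y <= s * s / m + m * (y * y)).
  { assert (0 <= (s - m * y) * (s - m * y) / m) by (apply Rmult_le_pos; [apply (Rle_0_sqr (s - m * y))|left; apply Rinv_0_lt_compat; auto]).
    replace ((s - m * y) * (s - m * y) / m)%R with (s * s / m - 2 * s * y + m * (y * y))%R in H by (field; lra). lra. }
  assert (s * s / m <= e) by (apply Rle_div_l; lra). nra.
Qed.

Lemma Rsum_nonneg f n : (forall k, (k < n)%nat -> 0 <= f k) -> 0 <= Rsum f n.
Proof. induction n; intros H; simpl; [lra|]. generalize (IHn ltac:(intros; apply H; lia)) (H n ltac:(lia)). lra. Qed.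

Lemma Rsum_le f g n : (forall k, (k < n)%nat -> f k <= g k) -> Rsum f n <= Rsum g n.
Proof. induction n; intros H; simpl; [lra|]. generalize (IHn ltac:(intros; apply H; lia)) (H n ltac:(lia)). lra. Qed.

Lemma Rsum_term f n k : (forall k, (k < n)%nat -> 0 <= f k) -> (k < n)%nat -> f k <= Rsum f n.
Proof.
induction n; intros H Hk; [lia|]. simpl. assert (H' := Rsum_nonneg f n ltac:(intros; apply H; lia)).
destruct (Nat.eq_dec k n) as [->|]; [lra|]. generalize (IHn ltac:(intros; apply H; lia) ltac:(lia)) (H n ltac:(lia)). lra.
Qed.

Lemma Rsum_scal c f n : Rsum (fun k => c * f k)%R n = (c * Rsum f n)%R.
Proof. induction n; simpl; [ring|]. rewrite IHn. ring. Qed.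

Lemma is_derive_Rsum (f : nat -> R -> R) (d : nat -> R) t n :
  (forall k, (k < n)%nat -> is_derive (f k) t (d k)) -> is_derive (fun t => Rsum (fun k => f k t) n) t (Rsum d n).
Proof.
induction n; intros H; simpl; [apply (is_derive_const (V := R_NormedModule))|].
apply (is_derive_plus (V := R_NormedModule)); auto.
Qed.

Lemma Csum_le_Rsum f n : (Cmod (Csum f n) <= Rsum (fun k => Cmod (f k)) n)%R.
Proof.
induction n; simpl; [rewrite Cmod_0; lra|]. eapply Rle_trans; [apply Cmod_triangle|]. lra.
Qed.

Definition energy (n : nat) (x : nat -> C) : R := Rsum (fun k => Cmod (x k) * Cmod (x k))%R n.

Lemma energy_0 n (x : nat -> C) : (forall k, (k < n)%nat -> x k = 0) -> energy n x = 0%R.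
Proof.
unfold energy. induction n; intros H; simpl; auto. rewrite IHn, H by auto. rewrite Cmod_0. ring.
Qed.

Lemma energy_term n (x : nat -> C) k : (k < n)%nat -> Cmod (x k) * Cmod (x k) <= energy n x.
Proof.
intros Hk. apply (Rsum_term (fun k => Cmod (x k) * Cmod (x k))%R); auto.
intros j _. generalize (Cmod_ge_0 (x j)). nra.
Qed.

(** Squares of moduli are used because the modulus itself is not differentiable at 0. Cauchy-Schwarz
    turns the cross term 2 Lam s^2 into 2 Lam n E, and 2 f s <= n f^2 + E accounts for the
    inhomogeneity and for the summand 1 in the rate. Then E e^(- c t) - n f^2 t does not
    increase. *)
Lemma gronwall n (x d : nat -> R -> C) (Lam f T : R) : 0 <= T -> 0 <= Lam -> 0 <= f ->
  (forall k t, (k < n)%nat -> 0 <= t <= T -> rder (x k) t (d k t)) ->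
  (forall k t, (k < n)%nat -> 0 <= t <= T -> (Cmod (d k t) <= Lam * Rsum (fun j => Cmod (x j t)) n + f)%R) ->
  (energy n (fun k => x k T) <= (energy n (fun k => x k 0%R) + INR n * (f * f) * T) * exp ((2 * Lam * INR n + 1) * T))%R.
Proof.
intros HT HL Hf Hd Hb. set (c := (2 * Lam * INR n + 1)%R). assert (Hn := pos_INR n).
assert (Hc : 0 <= c) by (unfold c; nra).
set (E := fun t => energy n (fun k => x k t)).
set (dE := fun t => Rsum (fun k => 2 * (Re (x k t) * Re (d k t) + Im (x k t) * Im (d k t)))%R n).
assert (DE : forall t, 0 <= t <= T -> is_derive E t (dE t)).
{ intros t Ht. apply (is_derive_Rsum (fun k t => Cmod (x k t) * Cmod (x k t))%R). intros k Hk.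
  assert (H1 := rder_re _ _ _ (Hd k t Hk Ht)). assert (H2 := rder_im _ _ _ (Hd k t Hk Ht)).
  apply (is_derive_ext (fun t => Re (x k t) * Re (x k t) + Im (x k t) * Im (x k t))%R).
  { intros u. symmetry. apply Cmod_sq. }
  replace (2 * (Re (x k t) * Re (d k t) + Im (x k t) * Im (d k t)))%R with
    ((Re (d k t) * Re (x k t) + Re (x k t) * Re (d k t)) + (Im (d k t) * Im (x k t) + Im (x k t) * Im (d k t)))%R by ring.
  apply (is_derive_plus (V := R_NormedModule)); apply (is_derive_mult (K := R_AbsRing)); auto; intros; apply Rmult_comm. }
assert (BE : forall t, 0 <= t <= T -> dE t <= c * E t + INR n * (f * f)).
{ intros t Ht. set (s := Rsum (fun j => Cmod (x j t)) n).
  assert (Hs : 0 <= s) by (apply Rsum_nonneg; intros; apply Cmod_ge_0).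
  assert (B1 : (dE t <= Rsum (fun k => (2 * (Lam * s + f)) * Cmod (x k t))%R n)%R).
  { apply Rsum_le. intros k Hk. specialize (Hb k t Hk Ht). fold s in Hb.
    assert (Re (x k t) * Re (d k t) + Im (x k t) * Im (d k t) <= Cmod (x k t) * Cmod (d k t)).
    { replace (Re (x k t) * Re (d k t) + Im (x k t) * Im (d k t))%R with (Re (x k t * Cconj (d k t))).
      - eapply Rle_trans; [apply Rle_abs|]. eapply Rle_trans; [apply re_le_Cmod|]. rewrite Cmod_mult, Cmod_conj. lra.
      - rewrite re_mult, re_conj, im_conj. ring. }
    generalize (Cmod_ge_0 (x k t)). nra. }
  rewrite Rsum_scal in B1. fold s in B1.
  assert (CS := Rsum_sq_le (fun j => Cmod (x j t)) n).
  change (s * s <= INR n * E t) in CS.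
  assert (E0 : 0 <= E t) by (apply Rsum_nonneg; intros j _; generalize (Cmod_ge_0 (x j t)); nra).
  assert (H2 : 2 * f * s <= INR n * (f * f) + E t).
  { destruct n as [|m].
    - unfold s. simpl. nra.
    - assert (Hm : 0 < INR (S m)) by (apply lt_0_INR; lia). set (N := INR (S m)) in *.
      assert (0 <= (s - N * f) * (s - N * f) / N) by (apply Rmult_le_pos; [apply (Rle_0_sqr (s - N * f))|left; apply Rinv_0_lt_compat; auto]).
      replace ((s - N * f) * (s - N * f) / N)%R with (s * s / N - 2 * f * s + N * (f * f))%R in H by (field; lra).
      assert (s * s / N <= E t) by (apply Rle_div_l; lra). lra. }
  unfold c. nra. }
set (g := fun t => (E t * exp (- (c * t)) - INR n * (f * f) * t)%R).
assert (Dg : forall t, 0 <= t <= T -> is_derive g t ((dE t - c * E t) * exp (- (c * t)) - INR n * (f * f))%R).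
{ intros t Ht. unfold g.
  replace ((dE t - c * E t) * exp (- (c * t)) - INR n * (f * f))%R with
    ((dE t * exp (- (c * t)) + E t * (- c * exp (- (c * t)))) - INR n * (f * f))%R by ring.
  apply (is_derive_minus (V := R_NormedModule)).
  - apply (is_derive_mult (K := R_AbsRing) E (fun t => exp (- (c * t))) t (dE t) (- c * exp (- (c * t)))%R); [apply DE; auto| |intros; apply Rmult_comm].
    auto_derive; auto. ring.
  - auto_derive; auto. ring. }
assert (Mono : g T <= g 0).
{ destruct (MVT_gen g 0 T (fun t => (dE t - c * E t) * exp (- (c * t)) - INR n * (f * f))%R) as [z [Hz EQ]].
  - intros t Ht. rewrite Rmin_left, Rmax_right in Ht by lra. apply Dg. lra.
  - intros t Ht. rewrite Rmin_left, Rmax_right in Ht by lra. apply continuity_pt_filterlim.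
    apply (ex_derive_continuous g). eexists. apply Dg. lra.
  - rewrite Rmin_left, Rmax_right in Hz by lra. rewrite Rminus_0_r in EQ.
    assert ((dE z - c * E z) * exp (- (c * z)) - INR n * (f * f) <= 0).
    { specialize (BE z Hz). assert (P := exp_pos (- (c * z))).
      assert (exp (- (c * z)) <= 1) by (rewrite <- exp_0; apply exp_le; nra).
      assert (0 <= INR n * (f * f)) by (repeat apply Rmult_le_pos; auto). nra. }
    nra. }
unfold g in Mono. rewrite !Rmult_0_r, Ropp_0, exp_0, Rminus_0_r, Rmult_1_r in Mono.
change (E T <= (E 0 + INR n * (f * f) * T) * exp (c * T)).
assert (Z : (exp (- (c * T)) * exp (c * T) = 1)%R) by (rewrite <- exp_plus, Rplus_opp_l, exp_0; auto).
replace (E T) with (E T * exp (- (c * T)) * exp (c * T))%R by (rewrite Rmult_assoc, Z; ring).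
apply Rmult_le_compat_r; [left; apply exp_pos|lra].
Qed.

Definition linsys (n : nat) (a : nat -> nat -> C -> C) (U : C -> Prop) (u : nat -> C -> C) : Prop :=
  forall k w, (k < n)%nat -> U w -> cder (u k) w (Csum (fun j => a k j w * u j w) n).

Lemma linsys_sub n a (U V : C -> Prop) u : (forall w, V w -> U w) -> linsys n a U u -> linsys n a V u.
Proof. intros H Hu k w Hk Hw. apply Hu; auto. Qed.

Lemma linsys_comb n a U m (c : nat -> C) (u : nat -> nat -> C -> C) : (forall i, (i < m)%nat -> linsys n a U (u i)) ->
  linsys n a U (fun k w => Csum (fun i => c i * u i k w) m).
Proof.
intros H k w Hk Hw.
apply eder_eq with (Csum (fun i => c i * Csum (fun j => a k j w * u i j w) n) m).
- rewrite (Csum_ext _ (fun i => Csum (fun j => c i * (a k j w * u i j w)) n)) by (intros; rewrite Csum_scal; auto).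
  rewrite Csum_swap. apply Csum_ext. intros j _. rewrite <- Csum_scal. apply Csum_ext. intros; ring.
- apply (eder_Csum Cminus (fun i w => c i * u i k w)). intros i Hi. apply eder_scal. apply H; auto.
Qed.

Lemma linsys_minus n a U u v : linsys n a U u -> linsys n a U v -> linsys n a U (fun k w => u k w - v k w).
Proof.
intros Hu Hv k w Hk Hw. eapply eder_eq; [|apply eder_minus; [apply Hu|apply Hv]; auto].
rewrite <- (Cmult_1_l (Csum (fun j => a k j w * v j w) n)) at 1.
replace (Csum (fun j => a k j w * u j w) n - 1 * Csum (fun j => a k j w * v j w) n) with
 (Csum (fun j => a k j w * u j w) n + (-1) * Csum (fun j => a k j w * v j w) n) by ring.
rewrite <- Csum_scal, <- Csum_plus. apply Csum_ext. intros; ring.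
Qed.

Definition convex (U : C -> Prop) : Prop :=
  forall x y t, U x -> U y -> 0 <= t <= 1 -> U (x + RtoC t * (y - x)).

Lemma oint_convex I x y t : oint I -> I x -> I y -> 0 <= t <= 1 -> I (x + t * (y - x))%R.
Proof. intros [H _] Hx Hy Ht. destruct (Rle_dec x y); [apply (H x y)|apply (H y x)]; auto; nra. Qed.

Lemma convex_re I : oint I -> convex (fun z => I (Re z)).
Proof. intros H x y t Hx Hy Ht. rewrite re_plus, re_scal_l, re_sub. apply oint_convex; auto. Qed.

Lemma convex_im I : oint I -> convex (fun z => I (Im z)).
Proof. intros H x y t Hx Hy Ht. rewrite im_plus, im_scal_l, im_sub. apply oint_convex; auto. Qed.

Lemma finite_bound (f : nat -> R -> C) n : (forall k t, (k < n)%nat -> 0 <= t <= 1 -> rcont (f k) t) ->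
  exists M, 0 <= M /\ forall k t, (k < n)%nat -> 0 <= t <= 1 -> Cmod (f k t) <= M.
Proof.
induction n; intros H; [exists 0%R; split; [lra|intros; lia]|].
destruct IHn as [M [HM0 HM]]; [intros; apply H; auto|].
destruct (continuity_ab_maj (fun t => Cmod (f n t)) 0 1) as [m [Hm _]]; [lra| |].
- intros t Ht. apply continuity_pt_filterlim. apply (rcont_Cmod (f n) t). apply H; auto.
- exists (Rmax M (Cmod (f n m))). split; [eapply Rle_trans; [apply HM0|apply Rmax_l]|].
  intros k t Hk Ht. destruct (Nat.eq_dec k n) as [->|].
  + eapply Rle_trans; [apply Hm; auto|apply Rmax_r].
  + eapply Rle_trans; [apply HM; auto; lia|apply Rmax_l].
Qed.

Lemma rder_segment (x y : C) t : rder (fun t => x + RtoC t * (y - x)) t (y - x).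
Proof.
eapply eder_eq; [|apply eder_plus; [apply eder_const|apply eder_mult; [apply rder_id|apply eder_const]]].
cbv beta. ring.
Qed.

(** Gronwall's inequality without inhomogeneity, along the segment from w0 to w, on which the
    coefficients are bounded by compactness. *)
Theorem linsys_unique n a U u w0 : convex U -> (forall k j z, (k < n)%nat -> (j < n)%nat -> U z -> ccont (a k j) z) ->
  linsys n a U u -> U w0 -> (forall k, (k < n)%nat -> u k w0 = 0) ->
  forall k w, (k < n)%nat -> U w -> u k w = 0.
Proof.
intros HU Ha Hu H0 Hz k w Hk Hw.
set (p := fun t => w0 + RtoC t * (w - w0)).
assert (Hp : forall t, 0 <= t <= 1 -> U (p t)) by (intros; apply HU; auto).
assert (Bd : forall m, (m <= n)%nat -> exists M, 0 <= M /\ forall k j t, (k < m)%nat -> (j < n)%nat -> 0 <= t <= 1 -> Cmod (a k j (p t)) <= M).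
{ induction m; intros Hm; [exists 0%R; split; [lra|intros; lia]|]. destruct IHm as [M [HM0 HM]]; [lia|].
  destruct (finite_bound (fun j t => a m j (p t)) n) as [M' [HM0' HM']].
  - intros j t Hj Ht. apply (econt_comp rsub (a m j) p); [apply Ha; auto; lia|]. eapply eder_cont, rder_segment.
  - exists (M + M')%R. split; [lra|]. intros i j t Hi Hj Ht. destruct (Nat.eq_dec i m) as [->|].
    + specialize (HM' j t Hj Ht). lra.
    + specialize (HM i j t ltac:(lia) Hj Ht). lra. }
destruct (Bd n (le_n _)) as [M [HM0 HM]].
assert (G := gronwall n (fun k t => u k (p t)) (fun k t => Csum (fun j => a k j (p t) * u j (p t)) n * (w - w0)) (M * Cmod (w - w0)) 0 1).
assert (E : (energy n (fun k => u k (p 1%R)) <= 0)%R).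
{ eapply Rle_trans; [apply G; try lra|].
  - apply Rmult_le_pos; auto; apply Cmod_ge_0.
  - intros i t Hi Ht. apply (eder_comp rsub (u i) p); [apply Hu; auto|apply rder_segment].
  - intros i t Hi Ht. rewrite Cmod_mult, Rplus_0_r.
    rewrite (Rmult_comm M), Rmult_assoc, Rmult_comm. apply Rmult_le_compat_l; [apply Cmod_ge_0|].
    eapply Rle_trans; [apply Csum_le_Rsum|]. rewrite <- Rsum_scal. apply Rsum_le. intros j Hj. rewrite Cmod_mult.
    apply Rmult_le_compat_r; [apply Cmod_ge_0|]. apply HM; auto.
  - cbv beta. rewrite (energy_0 n (fun k => u k (p 0%R))); [right; ring|]. intros i Hi. cbv beta.
    replace (p 0%R) with w0 by (unfold p; ring). auto. }
replace w with (p 1%R) by (unfold p; ring).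
assert (T := energy_term n (fun k => u k (p 1%R)) k Hk). cbv beta in T.
apply Cmod_eq_0. generalize (Cmod_ge_0 (u k (p 1%R))). nra.
Qed.

(** * Global solutions on the left half-plane *)

Section Picard.
Context (n : nat) (a : nat -> nat -> C -> C).

Definition lhp (z : C) : Prop := (Re z < 0).

Lemma lhp_open : copen lhp. Proof. exact (copen_re _ oint_neg). Qed.

Lemma lhp_is_convex : convex lhp. Proof. exact (convex_re _ oint_neg). Qed.

Hypothesis Ha : forall k j, (k < n)%nat -> (j < n)%nat -> hol lhp (a k j).
Hypothesis Hbd : forall d, 0 < d -> exists M, forall k j w, (k < n)%nat -> (j < n)%nat -> Re w <= - d -> Cmod (a k j w) <= M.

Context (w0 : C) (Hw0 : lhp w0) (c : nat -> C).

(** Choosing the primitive by [epsilon] makes it a total operation that can be iterated; it is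
    meaningful only for g holomorphic on the half-plane. *)
Let prim (g : C -> C) : C -> C :=
  epsilon (inhabits (fun _ => RtoC 0)) (fun F => F w0 = 0 /\ forall z, lhp z -> cder F z (g z)).

Lemma prim_spec g : hol lhp g -> prim g w0 = 0 /\ forall z, lhp z -> cder (prim g) z (g z).
Proof.
intros Hg. unfold prim. apply epsilon_spec.
destruct (box_primitive _ _ g oint_neg oint_True) with (z0 := w0) as [F [F0 HF]].
- intros z [Hz _]. apply Hg; auto.
- split; auto.
- exists F. split; auto. intros z Hz. apply HF. split; auto.
Qed.

Let rhs (u : nat -> C -> C) (k : nat) (z : C) : C := Csum (fun j => a k j z * u j z) n.

(** The increments of the Picard iteration: by linearity each is the integral operator applied to
    the previous one, and the solution is their sum. *)
Fixpoint picard_term (m k : nat) : C -> C :=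
  match m with
  | O => fun _ => c k
  | S m => prim (rhs (picard_term m) k)
  end.

Lemma rhs_hol u k : (k < n)%nat -> (forall j, (j < n)%nat -> hol lhp (u j)) -> hol lhp (rhs u k).
Proof.
intros Hk Hu z Hz. unfold rhs.
assert (forall m, (m <= n)%nat -> exists l, cder (fun z => Csum (fun j => a k j z * u j z) m) z l).
{ induction m; intros Hm; simpl; [exists 0; apply (eder_const Cminus 0)|].
  destruct IHm as [l Hl]; [lia|]. destruct (Ha k m Hk ltac:(lia) z Hz) as [l1 H1]. destruct (Hu m ltac:(lia) z Hz) as [l2 H2].
  eexists. apply eder_plus; [exact Hl|]. apply eder_mult; eauto. }
apply H; auto.
Qed.

Lemma picard_hol m : forall k, (k < n)%nat -> hol lhp (picard_term m k).
Proof.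
induction m; intros k Hk z Hz; simpl.
- exists 0. apply (eder_const Cminus (c k)).
- eexists. apply prim_spec; auto. apply rhs_hol; auto.
Qed.

Lemma lhp_convex d : convex (fun z => (Re z <= - d)).
Proof.
intros x y t Hx Hy Ht. rewrite re_plus, re_scal_l, re_sub. nra.
Qed.

Lemma prim_segment g w : hol lhp g -> lhp w ->
  isI (fun t => g (w0 + RtoC t * (w - w0)) * (w - w0)) 0 1 (prim g w).
Proof.
intros Hg Hw. destruct (prim_spec g Hg) as [P0 P1].
replace (prim g w) with (prim g w - prim g w0) by (rewrite P0; ring).
assert (Q : forall t, 0 <= t <= 1 -> lhp (w0 + RtoC t * (w - w0))).
{ intros t Ht. set (d := Rmin (- Re w0) (- Re w)). unfold lhp in *.
  assert (Hd : 0 < d) by (apply Rmin_case; lra).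
  assert (K : Re (w0 + RtoC t * (w - w0)) <= - d); [|lra].
  apply lhp_convex; auto; unfold d; [generalize (Rmin_l (- Re w0) (- Re w))|generalize (Rmin_r (- Re w0) (- Re w))]; lra. }
apply (isI_segment (prim g) g); auto. intros t Ht. apply (hol_cont lhp); auto.
Qed.

(* The primitive of a function bounded by exp (lam |z - w0|) gains a factor 1/lam. *)
Lemma prim_bound g w B lam : 0 < lam -> hol lhp g -> lhp w ->
  (forall t, 0 <= t <= 1 -> Cmod (g (w0 + RtoC t * (w - w0))%C) <= B * exp (lam * (t * Cmod (w - w0)))) ->
  (Cmod (prim g w) <= B / lam * (exp (lam * Cmod (w - w0)) - 1)).
Proof.
intros Hl Hg Hw H. set (r := Cmod (w - w0)) in *.
assert (Hr : 0 <= r) by apply Cmod_ge_0.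
apply (isI_bound_fun (fun t => g (w0 + RtoC t * (w - w0)) * (w - w0)) (fun t => B / lam * (lam * r * exp (lam * (t * r))))%R 0 1); [lra| | |].
- intros t Ht. rewrite Cmod_mult. fold r. specialize (H t Ht).
  replace (B / lam * (lam * r * exp (lam * (t * r))))%R with (B * exp (lam * (t * r)) * r)%R by (field; lra).
  apply Rmult_le_compat_r; auto.
- apply prim_segment; auto.
- apply is_RInt_scalR.
  replace (exp (lam * r) - 1)%R with (minus (exp (lam * (1 * r))) (exp (lam * (0 * r))))%R.
  + apply (is_RInt_derive (fun t => exp (lam * (t * r)))%R).
    * intros t _. auto_derive; auto. ring.
    * intros t _. apply (ex_derive_continuous (fun t => lam * r * exp (lam * (t * r)))%R). auto_derive; auto.
  + unfold minus, plus, opp; simpl. rewrite Rmult_1_l, Rmult_0_l, Rmult_0_r, exp_0. ring.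
Qed.

(** In the norm weighted by exp (- lam |w - w0|) the integral operator has norm at most n M / lam.
    With lam at least 2 n M it contracts by 1/2 on the whole of Re w <= - d, so the series converges
    there at once and no local solutions have to be patched. *)
Lemma picard_bound d : 0 < d -> Re w0 <= - d -> exists B lam, 0 <= B /\ 0 < lam /\
  forall m k w, (k < n)%nat -> Re w <= - d -> Cmod (picard_term m k w) <= B / 2 ^ m * exp (lam * Cmod (w - w0)).
Proof.
intros Hd H0. destruct (Hbd d Hd) as [M HM].
set (B := Rsum (fun k => Cmod (c k)) n). exists B.
assert (HB : 0 <= B) by (apply Rsum_nonneg; intros; apply Cmod_ge_0).
set (lam := (2 * (INR n * (Rabs M + 1)) + 1)%R). exists lam.
assert (Hn := pos_INR n). assert (HM0 := Rabs_pos M).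
assert (Hlam : 0 < lam) by (unfold lam; nra).
repeat split; auto. induction m; intros k w Hk Hw.
- simpl. unfold Rdiv. rewrite Rinv_1, Rmult_1_r.
  apply Rle_trans with B; [apply (Rsum_term (fun k => Cmod (c k))); auto; intros; apply Cmod_ge_0|].
  assert (1 <= exp (lam * Cmod (w - w0))).
  { rewrite <- exp_0. apply exp_le. generalize (Cmod_ge_0 (w - w0)). nra. }
  nra.
- set (Bm := (B / 2 ^ m)%R) in *.
  assert (P2 : 0 < 2 ^ m) by (apply pow_lt; lra).
  assert (HBm : 0 <= Bm) by (apply Rmult_le_pos; auto; left; apply Rinv_0_lt_compat; auto).
  simpl picard_term. eapply Rle_trans.
  + apply (prim_bound _ w (INR n * Rabs M * Bm) lam Hlam).
    * apply rhs_hol; auto. apply picard_hol.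
    * unfold lhp. lra.
    * intros t Ht. unfold rhs. rewrite !Rmult_assoc. apply Csum_bound. intros j Hj. rewrite Cmod_mult.
      assert (Hc : Re (w0 + RtoC t * (w - w0)) <= - d) by (apply lhp_convex; auto).
      apply Rmult_le_compat; try apply Cmod_ge_0.
      -- eapply Rle_trans; [apply HM; auto|apply Rle_abs].
      -- eapply Rle_trans; [apply IHm; auto|]. right. f_equal. f_equal. f_equal.
         replace (w0 + RtoC t * (w - w0) - w0) with (RtoC t * (w - w0)) by ring.
         rewrite Cmod_mult, Cmod_R, Rabs_pos_eq by lra. reflexivity.
  + replace (B / 2 ^ S m)%R with (Bm / 2)%R by (unfold Bm; simpl; field; lra).
    assert (P := exp_pos (lam * Cmod (w - w0))).
    assert (INR n * Rabs M * Bm / lam <= Bm / 2).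
    { apply Rle_div_l; auto. unfold lam. nra. }
    assert (0 <= INR n * Rabs M * Bm / lam).
    { apply Rmult_le_pos; [apply (Rmult_le_pos (INR n * Rabs M)); auto; apply Rmult_le_pos; auto|left; apply Rinv_0_lt_compat; auto]. }
    nra.
Qed.

Let psum (N k : nat) (w : C) : C := Csum (fun m => picard_term m k w) (S N).
Let sol (k : nat) (w : C) : C := C_Lim_seq (fun N => psum N k w).

Lemma psum_cauchy d : 0 < d -> Re w0 <= - d -> exists B lam, 0 <= B /\ 0 < lam /\
  forall k w p q, (k < n)%nat -> Re w <= - d -> (p <= q)%nat ->
    (Cmod (psum q k w - psum p k w) <= B / 2 ^ p * exp (lam * Cmod (w - w0))).
Proof.
intros Hd H0. destruct (picard_bound d Hd H0) as [B [lam [HB [Hl H]]]]. exists B, lam. repeat split; auto.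
intros k w p q Hk Hw Hpq. set (E := exp (lam * Cmod (w - w0))).
assert (HE : 0 < E) by apply exp_pos.
assert (Q : forall j, Cmod (psum (j + p) k w - psum p k w) <= (B / 2 ^ p - B / 2 ^ (j + p)) * E).
{ induction j.
  - simpl. replace (psum p k w - psum p k w) with (RtoC 0) by ring. rewrite Cmod_0. right. ring.
  - simpl (S j + p)%nat.
    replace (psum (S (j + p)) k w - psum p k w) with ((psum (j + p) k w - psum p k w) + picard_term (S (j + p)) k w) by (unfold psum; simpl; ring).
    eapply Rle_trans; [apply Cmod_triangle|]. specialize (H (S (j + p)) k w Hk Hw). fold E in H.
    assert (P2 : 0 < 2 ^ (j + p)) by (apply pow_lt; lra).
    replace (B / 2 ^ (j + p))%R with (B / 2 ^ S (j + p) + B / 2 ^ S (j + p))%R in IHj by (simpl; field; lra).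
    nra. }
specialize (Q (q - p)%nat). replace (q - p + p)%nat with q in Q by lia. eapply Rle_trans; [apply Q|].
apply Rmult_le_compat_r; [lra|]. assert (0 <= B / 2 ^ q); [|lra].
apply Rmult_le_pos; auto. left. apply Rinv_0_lt_compat, pow_lt. lra.
Qed.

Lemma half_pow_small B e : 0 < e -> exists N : nat, forall p, (N <= p)%nat -> B / 2 ^ p <= e.
Proof.
intros He. destruct (archi_div (Rabs B) e He) as [N [HN1 HN]]. exists N. intros p Hp. specialize (HN p Hp).
assert (Hip : 0 < INR p) by (apply lt_0_INR; lia).
assert (INR p <= 2 ^ p).
{ clear. induction p; [simpl; lra|]. rewrite S_INR. simpl. assert (1 <= 2 ^ p) by (apply pow_R1_Rle; lra). lra. }
apply Rle_trans with (Rabs B / INR p)%R; auto.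
apply Rle_trans with (Rabs B / 2 ^ p)%R.
- apply Rmult_le_compat_r; [left; apply Rinv_0_lt_compat; lra|apply Rle_abs].
- apply Rmult_le_compat_l; [apply Rabs_pos|]. apply Rinv_le_contravar; lra.
Qed.

Lemma psum_limit d : 0 < d -> Re w0 <= - d -> exists B lam, 0 <= B /\ 0 < lam /\
  forall k w p, (k < n)%nat -> Re w <= - d ->
    (Cmod (sol k w - psum p k w) <= B / 2 ^ p * exp (lam * Cmod (w - w0))).
Proof.
intros Hd H0. destruct (psum_cauchy d Hd H0) as [B [lam [HB [Hl H]]]]. exists B, lam. repeat split; auto.
intros k w p Hk Hw.
assert (Hc : ccv (fun N => psum N k w) (sol k w)).
{ destruct (ccv_cauchy (fun N => psum N k w)) as [l Hlim].
  - intros e He. destruct (half_pow_small (B * exp (lam * Cmod (w - w0))) e He) as [N HN]. exists N. intros q Hq.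
    eapply Rle_trans; [apply H; auto|]. specialize (HN N (le_n _)). unfold Rdiv in *. lra.
  - unfold sol. rewrite (ccv_C_Lim_seq _ _ Hlim). exact Hlim. }
apply le_epsilon. intros e He. destruct (Hc e He) as [N HN].
set (q := max N p). specialize (HN q ltac:(unfold q; lia)). specialize (H k w p q Hk Hw ltac:(unfold q; lia)).
replace (sol k w - psum p k w) with ((psum q k w - psum p k w) - (psum q k w - sol k w)) by ring.
eapply Rle_trans; [apply Cmod_triangle_sub|]. lra.
Qed.

Lemma psum_hol N k : (k < n)%nat -> hol lhp (psum N k).
Proof.
intros Hk z Hz. unfold psum. generalize (S N). intros m. induction m; simpl; [exists 0; apply (eder_const Cminus 0)|].
destruct IHm as [l Hl]. destruct (picard_hol m k Hk z Hz) as [l' Hl']. eexists. apply eder_plus; eauto.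
Qed.

Lemma sol_hol k : (k < n)%nat -> hol lhp (sol k).
Proof.
intros Hk. apply weierstrass with (fun N => psum N k); [exact lhp_open|intros; apply psum_hol; auto|].
intros z Hz. unfold lhp in *.
set (d := Rmin (- Re w0) (- Re z / 2)). assert (Hd : 0 < d) by (apply Rmin_case; lra).
assert (D1 := Rmin_l (- Re w0) (- Re z / 2)). assert (D2 := Rmin_r (- Re w0) (- Re z / 2)). fold d in D1, D2.
destruct (psum_limit d Hd ltac:(lra)) as [B [lam [HB [Hl H]]]].
exists d. split; auto. intros e He.
destruct (half_pow_small (B * exp (lam * (2 * d + Cmod (z - w0)))) e He) as [N HN]. exists N. intros p Hp y Hy.
specialize (HN p Hp). rewrite Cmod_sub_sym.
assert (Hy1 : Re y <= - d) by (destruct Hy as [Hy _]; apply Rabs_def2 in Hy; lra).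
eapply Rle_trans; [apply H; auto|]. eapply Rle_trans; [|apply HN].
unfold Rdiv. rewrite !Rmult_assoc. apply Rmult_le_compat_l; auto. rewrite Rmult_comm.
apply Rmult_le_compat_r; [left; apply Rinv_0_lt_compat, pow_lt; lra|]. apply exp_le. apply Rmult_le_compat_l; [lra|].
replace (y - w0) with ((y - z) + (z - w0)) by ring. eapply Rle_trans; [apply Cmod_triangle|]. apply disc_square in Hy. lra.
Qed.

(** The partial sums satisfy the integral equation up to one index, and the tail bound allows
    passage to the limit under the integral. Every point lies in some half-plane Re w <= - d that
    also contains [w0]. *)
Theorem picard : exists u, linsys n a lhp u /\ (forall k, (k < n)%nat -> u k w0 = c k).
Proof.
assert (Key : forall k w, (k < n)%nat -> lhp w -> sol k w = c k + prim (rhs sol k) w).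
{ intros k w Hk Hw.
  set (d := Rmin (- Re w0) (- Re w)). unfold lhp in *. assert (Hd : 0 < d) by (apply Rmin_case; lra).
  assert (D1 := Rmin_l (- Re w0) (- Re w)). assert (D2 := Rmin_r (- Re w0) (- Re w)). fold d in D1, D2.
  destruct (psum_limit d Hd ltac:(lra)) as [B [lam [HB [Hl H]]]]. destruct (Hbd d Hd) as [M HM].
  set (r := Cmod (w - w0)). assert (Hr : 0 <= r) by apply Cmod_ge_0.
  assert (HG : hol lhp (rhs sol k)) by (apply rhs_hol; auto; apply sol_hol).
  assert (PS : forall N, psum (S N) k w = c k + Csum (fun m => prim (rhs (picard_term m) k) w) (S N)).
  { induction N; [unfold psum; simpl; ring|].
    replace (psum (S (S N)) k w) with (psum (S N) k w + picard_term (S (S N)) k w) by (unfold psum; simpl; ring).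
    rewrite IHN. simpl. ring. }
  assert (PI : forall N, isI (fun t => rhs (psum N) k (w0 + RtoC t * (w - w0)) * (w - w0)) 0 1 (psum (S N) k w - c k)).
  { intros N. rewrite PS.
    replace (c k + Csum (fun m => prim (rhs (picard_term m) k) w) (S N) - c k) with (Csum (fun m => prim (rhs (picard_term m) k) w) (S N)) by ring.
    unfold psum. generalize (S N). intros m. induction m.
    - simpl. apply isI_ext with (fun _ => 0).
      + intros t _. unfold rhs. rewrite (Csum_ext _ (fun _ => 0)), Csum_0; [ring|]. intros; simpl; ring.
      + generalize (isI_const 0 0 1). rewrite Cmult_0_r. auto.
    - simpl Csum at 2. apply isI_ext with (fun t => rhs (fun k w => Csum (fun m => picard_term m k w) m) k (w0 + RtoC t * (w - w0)) * (w - w0)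
         + rhs (picard_term m) k (w0 + RtoC t * (w - w0)) * (w - w0)).
      + intros t _. unfold rhs. rewrite <- Cmult_plus_distr_r, <- Csum_plus. f_equal. apply Csum_ext. intros; simpl; ring.
      + apply isI_plus; auto. apply prim_segment; auto. apply rhs_hol; auto. apply picard_hol. }
  apply Ceq_minus. apply Cmod_le_eps_0. intros e He.
  destruct (half_pow_small (B * exp (lam * r) * (1 + INR n * Rabs M * r)) e He) as [N HN]. specialize (HN N (le_n _)).
  assert (A1 := H k w (S N) Hk ltac:(lra)). fold r in A1.
  assert (A2 : Cmod ((psum (S N) k w - c k) - prim (rhs sol k) w) <= (1 - 0) * (INR n * (Rabs M * (B / 2 ^ N * exp (lam * r))) * r)).
  { eapply isI_bound; [lra| |apply isI_minus; [apply PI|apply prim_segment; auto]].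
    intros t Ht. cbv beta. set (z := w0 + RtoC t * (w - w0)).
    assert (Hz : Re z <= - d) by (apply lhp_convex; auto; lra).
    replace (rhs (psum N) k z * (w - w0) - rhs sol k z * (w - w0)) with ((rhs (psum N) k z - rhs sol k z) * (w - w0)) by ring.
    rewrite Cmod_mult. fold r. apply Rmult_le_compat_r; auto.
    replace (rhs (psum N) k z - rhs sol k z) with (Csum (fun j => a k j z * (psum N j z - sol j z)) n).
    2:{ unfold rhs. transitivity (Csum (fun j => a k j z * psum N j z) n + (-1) * Csum (fun j => a k j z * sol j z) n); [|ring].
        rewrite <- Csum_scal, <- Csum_plus. apply Csum_ext. intros; ring. }
    apply Csum_bound. intros j Hj. rewrite Cmod_mult. apply Rmult_le_compat; try apply Cmod_ge_0.
    - eapply Rle_trans; [apply HM; auto|apply Rle_abs].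
    - rewrite Cmod_sub_sym. eapply Rle_trans; [apply H; auto|].
      apply Rmult_le_compat_l; [apply Rmult_le_pos; auto; left; apply Rinv_0_lt_compat, pow_lt; lra|].
      apply exp_le. apply Rmult_le_compat_l; [lra|]. unfold z.
      replace (w0 + RtoC t * (w - w0) - w0) with (RtoC t * (w - w0)) by ring.
      rewrite Cmod_mult, Cmod_R, Rabs_pos_eq by lra. fold r. nra. }
  replace (sol k w - (c k + prim (rhs sol k) w)) with ((sol k w - psum (S N) k w) + ((psum (S N) k w - c k) - prim (rhs sol k) w)) by ring.
  eapply Rle_trans; [apply Cmod_triangle|]. eapply Rle_trans; [apply Rplus_le_compat; eassumption|].
  eapply Rle_trans; [|apply HN].
  assert (P2 : 0 < 2 ^ N) by (apply pow_lt; lra).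
  replace (B / 2 ^ S N)%R with (B / 2 ^ N / 2)%R by (simpl; field; lra).
  replace (B * exp (lam * r) * (1 + INR n * Rabs M * r) / 2 ^ N)%R with (B / 2 ^ N * exp (lam * r) * (1 + INR n * Rabs M * r))%R by (unfold Rdiv; ring).
  assert (0 <= B / 2 ^ N * exp (lam * r)) by (apply Rmult_le_pos; [apply Rmult_le_pos; auto; left; apply Rinv_0_lt_compat; auto|left; apply exp_pos]).
  nra. }
exists sol. split.
- intros k w Hk Hw.
  assert (HG : hol lhp (rhs sol k)) by (apply rhs_hol; auto; apply sol_hol).
  destruct (lhp_open w Hw) as [d [Hd Hd']].
  apply cder_ext_loc with (fun w => c k + prim (rhs sol k) w).
  + exists d. split; auto. intros y Hy. symmetry. apply Key; auto.
  + eapply eder_eq; [|apply eder_plus; [apply eder_const|apply prim_spec; auto]]. unfold rhs. ring.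
- intros k Hk. rewrite Key by auto.
  assert (HG : hol lhp (rhs sol k)) by (apply rhs_hol; auto; apply sol_hol).
  rewrite (proj1 (prim_spec _ HG)). ring.
Qed.

End Picard.

(** * Linear algebra over C *)

Definition mat_vec (n : nat) (A : nat -> nat -> C) (v : nat -> C) (i : nat) : C := Csum (fun j => A i j * v j)%C n.

Lemma ccv_plus (u v : nat -> C) (l m : C) : ccv u l -> ccv v m -> ccv (fun n => u n + v n) (l + m).
Proof.
intros H1 H2 e He. destruct (H1 (e/2)%R) as [N1 K1]; [lra|]. destruct (H2 (e/2)%R) as [N2 K2]; [lra|].
exists (Nat.max N1 N2). intros n Hn. specialize (K1 n ltac:(lia)). specialize (K2 n ltac:(lia)).
replace (u n + v n - (l + m)) with ((u n - l) + (v n - m)) by ring.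
eapply Rle_lt_trans; [apply Cmod_triangle|]. lra.
Qed.

Module LinAlg.
Import all_boot all_fingroup all_algebra boolp.
Import GRing.Theory.
Set Bullet Behavior "Strict Subproofs".

(** A name of its own for the type, on which the MathComp field structure is declared. Determinants
    and Cayley-Hamilton are used inside this module only; its results are exported with [Csum] and
    plain functions. *)
Definition CC : Type := Complex.C.
HB.instance Definition _ := gen_eqMixin CC.
HB.instance Definition _ := gen_choiceMixin CC.

Lemma CC_addA : associative (Cplus : CC -> CC -> CC). Proof. exact Cplus_assoc. Qed.
Lemma CC_addC : commutative (Cplus : CC -> CC -> CC). Proof. exact Cplus_comm. Qed.
Lemma CC_add0 : left_id (RtoC 0 : CC) (Cplus : CC -> CC -> CC). Proof. exact Cplus_0_l. Qed.
Lemma CC_addN : left_inverse (RtoC 0 : CC) (Copp : CC -> CC) (Cplus : CC -> CC -> CC).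
Proof. move=> x. rewrite Cplus_comm. exact: Cplus_opp_r. Qed.
HB.instance Definition _ := GRing.isZmodule.Build CC CC_addA CC_addC CC_add0 CC_addN.

Lemma CC_mulA : associative (Cmult : CC -> CC -> CC). Proof. exact Cmult_assoc. Qed.
Lemma CC_mulC : commutative (Cmult : CC -> CC -> CC). Proof. exact Cmult_comm. Qed.
Lemma CC_mul1 : left_id (RtoC 1 : CC) (Cmult : CC -> CC -> CC). Proof. exact Cmult_1_l. Qed.
Lemma CC_mulD : left_distributive (Cmult : CC -> CC -> CC) (Cplus : CC -> CC -> CC).
Proof. move=> x y z. exact: Cmult_plus_distr_r. Qed.
Lemma CC_1_neq_0 : is_true ((RtoC 1 : CC) != 0%R).
Proof. apply/eqP. exact C1_nz. Qed.
HB.instance Definition _ := GRing.Zmodule_isComNzRing.Build CC CC_mulA CC_mulC CC_mul1 CC_mulD CC_1_neq_0.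

Lemma CC_mulV : forall x : CC, is_true (x != 0%R) -> Cmult (Cinv x) x = (1%R : CC).
Proof. move=> x /eqP Hx. exact: Cinv_l. Qed.
Lemma CC_inv0 : (Cinv (0%R : CC) : CC) = 0%R.
Proof.
change (Cinv (RtoC 0) = RtoC 0). unfold Cinv. apply C_ext; simpl; unfold Rdiv; ring.
Qed.
HB.instance Definition _ := GRing.ComNzRing_isField.Build CC CC_mulV CC_inv0.

Local Open Scope ring_scope.

Lemma sum_Csum n (F : nat -> CC) : \sum_(i < n) F i = Csum F n.
Proof.
elim: n => [|n IH]; first by rewrite big_ord0.
by rewrite big_ord_recr IH.
Qed.

Lemma prod_Cprod n (F : nat -> CC) : \prod_(i < n) F i.+1 = Cprod F n.
Proof.
elim: n => [|n IH]; first by rewrite big_ord0.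
by rewrite big_ord_recr IH.
Qed.

Lemma expr_Cpow (x : CC) n : x ^+ n = Cpow x n.
Proof. elim: n => [|n IH] //. by rewrite exprS IH. Qed.

Lemma natr_INR n : (n%:R : CC) = RtoC (INR n).
Proof.
elim: n => [|n IH] //. rewrite S_INR RtoC_plus -natr1 IH. reflexivity.
Qed.

Definition mx n (A : nat -> nat -> Complex.C) : 'M[CC]_n := \matrix_(i, j) (A i j : CC).

(** The alternative used to prove that solutions span: either the initial vectors in the rows of [A]
    are dependent or every initial vector is a combination of them. *)
Lemma kernel_or_solvable n (A : nat -> nat -> Complex.C) :
  (exists c : nat -> Complex.C, (exists j, (j < n)%coq_nat /\ c j <> RtoC 0) /\
     forall k, (k < n)%coq_nat -> Csum (fun j => Cmult (c j) (A j k)) n = RtoC 0) \/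
  (forall v : nat -> Complex.C, exists c : nat -> Complex.C, forall k, (k < n)%coq_nat ->
     Csum (fun j => Cmult (c j) (A j k)) n = v k).
Proof.
pose M := mx n A.
pose ext (v : 'rV[CC]_n) (j : nat) : CC := if insub j is Some i then v 0 i else 0.
have extE v (i : 'I_n) : ext v i = v 0 i by rewrite /ext valK.
have mulE v (k : 'I_n) : Csum (fun j => Cmult (ext v j) (A j k)) n = (v *m M) 0 k.
{ rewrite mxE -(sum_Csum n (fun j => Cmult (ext v j) (A j k))). apply: eq_bigr => i _.
  by rewrite extE mxE. }
case: (boolP (\det M == 0)) => [/det0P [v v0 vM]|dM].
- left. exists (ext v). split.
  + have [i Hi] : exists i, v 0 i != 0.
    { case: (pickP (fun i => v 0 i != 0)) => [i Hi|H]; first by exists i. case/eqP: v0.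
      apply/rowP => i. rewrite mxE. apply/eqP. have := H i. by case: eqP. }
    exists (i : nat). split; first by apply/ltP. rewrite extE. move/eqP: Hi. exact.
  + move=> k /ltP Hk. by rewrite (mulE v (Ordinal Hk)) vM mxE.
- right=> w. pose wv : 'rV[CC]_n := \row_i (w i : CC).
  exists (ext (wv *m invmx M)) => k /ltP Hk.
  rewrite (mulE _ (Ordinal Hk)) mulmxKV; last by rewrite unitmxE unitfE.
  by rewrite mxE.
Qed.

Lemma ccv_bigsum (I : Type) (r : seq I) (F : nat -> I -> CC) (l : I -> CC) :
  (forall i, ccv (fun m => F m i) (l i)) -> ccv (fun m => \sum_(i <- r) F m i) (\sum_(i <- r) l i).
Proof.
move=> H. elim: r => [|i r IH].
- apply: (ccv_ext (fun _ => RtoC 0) _ _); last by rewrite big_nil; apply: ccv_const. by exists O => m _; rewrite big_nil.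
- apply: (ccv_ext (fun m => F m i + \sum_(i <- r) F m i : CC) _ _); first by exists O => m _; rewrite big_cons.
  rewrite big_cons. exact: ccv_plus.
Qed.

Lemma ccv_bigprod (I : Type) (r : seq I) (F : nat -> I -> CC) (l : I -> CC) :
  (forall i, ccv (fun m => F m i) (l i)) -> ccv (fun m => \prod_(i <- r) F m i) (\prod_(i <- r) l i).
Proof.
move=> H. elim: r => [|i r IH].
- apply: (ccv_ext (fun _ => RtoC 1) _ _); last by rewrite big_nil; apply: ccv_const. by exists O => m _; rewrite big_nil.
- apply: (ccv_ext (fun m => F m i * \prod_(i <- r) F m i : CC) _ _); first by exists O => m _; rewrite big_cons.
  rewrite big_cons. exact: (ccv_mult (fun m => F m i) _ _ _).
Qed.

Lemma ccv_det n (M : nat -> 'M[CC]_n) (L : 'M[CC]_n) :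
  (forall i j, ccv (fun m => M m i j) (L i j)) -> ccv (fun m => \det (M m)) (\det L).
Proof.
move=> H. apply: (ccv_bigsum _ _ (fun m (s : 'S_n) => (-1) ^+ s * \prod_i M m i (s i))) => s.
apply: (ccv_mult (fun _ => (-1) ^+ s : CC) _ _ _); first exact: ccv_const.
exact: (ccv_bigprod _ _ (fun m i => M m i (s i))).
Qed.

Lemma char_poly_horner n (A : 'M[CC]_n) (x : CC) : ((char_poly A).[x] : CC) = \det (x%:M - A).
Proof.
rewrite /char_poly -horner_evalE -det_map_mx. congr (\det _).
apply/matrixP => i j. rewrite !mxE /= /horner_eval. rewrite !hornerE.
case: (i == j); by rewrite ?mulr1n ?mulr0n !hornerE.
Qed.

(** A nonzero difference would have all natural numbers as roots, more than its size allows. *)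
Lemma poly_eq_fun (p q : {poly CC}) : (forall x, p.[x] = q.[x]) -> p = q.
Proof.
move=> H. apply/eqP. rewrite -subr_eq0. apply/negPn/negP => nz.
pose rs := [seq (k%:R : CC) | k <- iota 0 (size (p - q))].
have := @max_poly_roots _ (p - q) rs nz.
have -> : all (root (p - q)) rs.
{ apply/allP => x _. by rewrite rootE !hornerE H subrr. }
have -> : uniq rs.
{ rewrite map_inj_uniq ?iota_uniq // => a b. rewrite !natr_INR => E. apply: INR_eq. exact: RtoC_inj. }
move=> /(_ isT isT). by rewrite size_map size_iota ltnn.
Qed.

(** All [Pm m] are conjugate to P, so det (x - Pm m) does not depend on m; its limit is the
    determinant of a triangular matrix. The conjugating matrices [Ym m] only have to be invertible,
    and their convergence is never asked for. Cayley-Hamilton is finally applied to the single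
    vector v. *)
Theorem charpoly_limit n (P : nat -> nat -> Complex.C) (Pm Ym : nat -> nat -> nat -> Complex.C)
  (Pinf : nat -> nat -> Complex.C) (r B v : nat -> Complex.C) :
  (forall m i k, (i < n)%coq_nat -> (k < n)%coq_nat ->
     Csum (fun j => Cmult (Pm m i j) (Ym m j k)) n = Csum (fun j => Cmult (Ym m i j) (P j k)) n) ->
  (forall m c, (forall i, (i < n)%coq_nat -> Csum (fun j => Cmult (Ym m i j) (c j)) n = RtoC 0) ->
     forall j, (j < n)%coq_nat -> c j = RtoC 0) ->
  (forall i j, (i < n)%coq_nat -> (j < n)%coq_nat -> ccv (fun m => Pm m i j) (Pinf i j)) ->
  (forall i j, (j < i)%coq_nat -> (i < n)%coq_nat -> Pinf i j = RtoC 0) ->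
  (forall k, (k < n)%coq_nat -> Pinf k k = r (S k)) ->
  (forall x, Csum (fun k => Cmult (B (n - k)%coq_nat) (Cpow x k)) (S n) = Cprod (fun k => Cminus x (r k)) n) ->
  forall i, (i < n)%coq_nat ->
    Csum (fun k => Cmult (B (n - k)%coq_nat) (Nat.iter k (mat_vec n P) v i)) (S n) = RtoC 0.
Proof.
case: n => [|n] HPY HY Hlim Htri Hdiag HB i0 Hi0; first lia.
pose N := n.+1. pose MP := mx N P.
have ltI (i : 'I_N) : (i < N)%coq_nat by apply/ltP.
have sim m : (mx N (Pm m)) *m (mx N (Ym m)) = (mx N (Ym m)) *m MP.
{ apply/matrixP => i k. rewrite !mxE.
  transitivity (Csum (fun j => Cmult (Pm m i j) (Ym m j k)) N).
  - rewrite -sum_Csum. by apply: eq_bigr => j _; rewrite !mxE.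
  - rewrite HPY // -sum_Csum. by apply: eq_bigr => j _; rewrite !mxE. }
have detY m : \det (mx N (Ym m)) != 0.
{ rewrite -det_tr. apply/negP => /det0P [c c0 cY]. case/eqP: c0. apply/rowP => j. rewrite [RHS]mxE.
  pose ext (j : nat) : CC := if insub j is Some i then c 0 i else 0.
  have extE (i : 'I_N) : ext i = c 0 i by rewrite /ext valK.
  rewrite -extE. apply: (HY m ext) => // i /ltP Hi.
  have := congr1 (fun M : 'rV[CC]_N => M 0 (Ordinal Hi)) cY. rewrite !mxE => E. apply: (eq_trans _ E).
  rewrite -sum_Csum. apply: eq_bigr => k _. by rewrite !mxE -extE mulrC. }
have detE m (x : CC) : \det (x%:M - mx N (Pm m)) = \det (x%:M - MP).
{ apply: (mulIf (detY m)). rewrite -det_mulmx [RHS]mulrC -det_mulmx. congr (\det _).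
  by rewrite mulmxBl mulmxBr sim scalar_mxC. }
have detinf (x : CC) : \det (x%:M - MP) = \det (x%:M - mx N Pinf).
{ apply: (ccv_unique (fun _ : nat => \det (x%:M - MP) : CC) _ _); first exact: ccv_const.
  apply: (ccv_ext (fun m => \det (x%:M - mx N (Pm m)) : CC) _ _); first by exists O => m _; rewrite detE.
  apply: ccv_det => i j. rewrite !mxE.
  apply: (ccv_ext (fun m => x *+ (i == j) + - (Pm m i j : CC) : CC) _ _); first by exists O => m _; rewrite !mxE.
  apply: ccv_plus; first exact: ccv_const.
  apply: (ccv_ext (fun m => Cmult (RtoC (-1)) (Pm m i j)) _ _).
  { exists O => m _. change (- (Pm m i j : CC)) with (Copp (Pm m i j)). ring. }
  have E : Cmult (RtoC (-1)) (Pinf i j) = (- (Pinf i j : CC) : CC).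
  { change (- (Pinf i j : CC)) with (Copp (Pinf i j)). ring. }
  rewrite -E. apply: (ccv_mult (fun _ => RtoC (-1)) (fun m => Pm m i j)); first exact: ccv_const. exact: Hlim. }
have dettri (x : CC) : \det (x%:M - mx N Pinf) = Cprod (fun k => Cminus x (r k)) N.
{ rewrite -det_tr det_trig.
  - transitivity (\prod_(k < N) (Cminus x (r (S k)) : CC)).
    + apply: eq_bigr => k _. rewrite !mxE eqxx mulr1n Hdiag //.
    + exact: prod_Cprod N (fun k => Cminus x (r k)).
  - apply/is_trig_mxP => i j Hij. rewrite !mxE. rewrite Htri //; last by apply/ltP.
    have -> : (j == i) = false by apply/eqP => E; rewrite E ltnn in Hij. by rewrite mulr0n add0r oppr0. }
have cp : char_poly MP = \poly_(k < N.+1) (B (N - k)%coq_nat : CC).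
{ apply: poly_eq_fun => x. rewrite char_poly_horner detinf dettri -HB horner_poly -sum_Csum.
  apply: eq_bigr => k _. by rewrite expr_Cpow. }
have CH := Cayley_Hamilton MP. rewrite cp poly_def rmorph_sum /= in CH.
pose V : 'cV[CC]_N := \col_j (v j : CC).
have itE k (i : 'I_N) : (MP ^+ k *m V) i 0 = Nat.iter k (mat_vec N P) v i.
{ elim: k i => [|k IH] i; first by rewrite expr0 mul1mx mxE.
  rewrite exprS -mulmxA mxE /= /mat_vec -(sum_Csum N (fun j => Cmult (P i j) (Nat.iter k (mat_vec N P) v j))). apply: eq_bigr => j _. by rewrite IH mxE. }
have := congr1 (fun M : 'M[CC]_N => (M *m V) (Ordinal (introT ltP Hi0)) 0) CH.
move=> E. rewrite mul0mx [RHS]mxE mulmx_suml summxE in E.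
apply: (eq_trans _ E). rewrite -(sum_Csum N.+1 (fun k => Cmult (B (N - k)%coq_nat) (Nat.iter k (mat_vec N P) v i0))). apply: eq_bigr => k _.
rewrite linearZ /= rmorphXn /= horner_mx_X -scalemxAl mxE itE. by [].
Qed.

End LinAlg.

(** * Periodic systems on the left half-plane *)

Definition period : C := 2 * RtoC PI * Ci.

Notation along w t := (w + RtoC t * period).
Notation shift w j := (along w (INR j)).

Lemma re_period : Re period = 0%R. Proof. unfold period. simpl. ring. Qed.

Lemma im_period : Im period = (2 * PI)%R. Proof. unfold period. simpl. ring. Qed.

Lemma Cexp_plus_period w : Cexp (w + period) = Cexp w.
Proof. rewrite Cexp_plus. unfold period. rewrite Cexp_2PI. ring. Qed.

Lemma lhp_plus_period w : lhp w -> lhp (w + period).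
Proof. unfold lhp. rewrite re_plus, re_period. lra. Qed.

Lemma cder_translate f w h l : cder f (w + h) l -> cder (fun w => f (w + h)) w l.
Proof.
intros H. eapply eder_eq; [|apply (eder_comp Cminus f (fun w => w + h) w l); [exact H|apply eder_plus; [apply cder_id|apply eder_const]]].
ring.
Qed.

Section Transition.
Context (n : nat) (a : nat -> nat -> C -> C).
Hypothesis Ha : forall k j, (k < n)%nat -> (j < n)%nat -> hol lhp (a k j).
Hypothesis Hbd : forall d, 0 < d -> exists M, forall k j w, (k < n)%nat -> (j < n)%nat -> Re w <= - d -> Cmod (a k j w) <= M.

(** The fundamental matrix normalized at [w0]: j numbers the columns, and the next argument the
    rows. *)
Definition transition (w0 : C) (j : nat) : nat -> C -> C :=
  epsilon (inhabits (fun _ _ => RtoC 0)) (fun u => linsys n a lhp u /\ forall k, (k < n)%nat -> u k w0 = delta k j).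

Lemma transition_spec w0 j : lhp w0 ->
  linsys n a lhp (transition w0 j) /\ forall k, (k < n)%nat -> transition w0 j k w0 = delta k j.
Proof. intros H. unfold transition. apply epsilon_spec. apply picard; auto. Qed.

Lemma lhp_coef_cont k j z : (k < n)%nat -> (j < n)%nat -> lhp z -> ccont (a k j) z.
Proof. intros. apply (hol_cont lhp); auto. Qed.

Lemma Csum_delta_l (f : nat -> C) m k : (k < m)%nat -> Csum (fun j => f j * delta k j) m = f k.
Proof. intros H. rewrite <- (Csum_delta f m k H). apply Csum_ext. intros; ring. Qed.

Lemma linsys_transition u w0 k w : linsys n a lhp u -> lhp w0 -> lhp w -> (k < n)%nat ->
  u k w = Csum (fun j => transition w0 j k w * u j w0) n.
Proof.
intros Hu H0 Hw Hk. apply Ceq_minus.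
rewrite (Csum_ext _ (fun j => u j w0 * transition w0 j k w)) by (intros; ring).
apply (linsys_unique n a lhp (fun k w => u k w - Csum (fun j => u j w0 * transition w0 j k w) n) w0); auto.
- exact lhp_is_convex.
- intros. apply lhp_coef_cont; auto.
- apply linsys_minus; auto. apply linsys_comb. intros. apply transition_spec; auto.
- intros i Hi. rewrite (Csum_ext _ (fun j => u j w0 * delta i j)).
  + rewrite Csum_delta_l by auto. ring.
  + intros j Hj. rewrite (proj2 (transition_spec w0 j H0)); auto.
Qed.

Lemma transition_inj w0 w1 c : lhp w0 -> lhp w1 ->
  (forall i, (i < n)%nat -> Csum (fun j => transition w0 j i w1 * c j) n = 0) -> forall j, (j < n)%nat -> c j = 0.
Proof.
intros H0 H1 Hc j Hj.
rewrite <- (Csum_delta_l c n j Hj).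
rewrite (Csum_ext _ (fun i => c i * transition w0 i j w0)).
2:{ intros i Hi. rewrite (proj2 (transition_spec w0 i H0)); auto. }
apply (linsys_unique n a lhp (fun k w => Csum (fun i => c i * transition w0 i k w) n) w1); auto.
- exact lhp_is_convex.
- intros. apply lhp_coef_cont; auto.
- apply linsys_comb. intros. apply transition_spec; auto.
- intros i Hi. rewrite <- (Hc i Hi). apply Csum_ext. intros; ring.
Qed.

Hypothesis Hper : forall k j w, a k j (w + period) = a k j w.

Definition monodromy (w : C) (k j : nat) : C := transition w j k (w + period).

Lemma linsys_plus_period u : linsys n a lhp u -> linsys n a lhp (fun k w => u k (w + period)).
Proof.
intros Hu k w Hk Hw. apply cder_translate.
rewrite (Csum_ext _ (fun j => a k j (w + period) * u j (w + period))) by (intros; rewrite Hper; auto).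
apply Hu; auto. apply lhp_plus_period; auto.
Qed.

Lemma monodromy_step u w k : linsys n a lhp u -> lhp w -> (k < n)%nat ->
  u k (w + period) = mat_vec n (monodromy w) (fun j => u j w) k.
Proof. intros Hu Hw Hk. apply linsys_transition; auto. apply lhp_plus_period; auto. Qed.

Lemma monodromy_iter m : forall u w k, linsys n a lhp u -> lhp w -> (k < n)%nat ->
  u k (shift w m) = Nat.iter m (mat_vec n (monodromy w)) (fun j => u j w) k.
Proof.
induction m; intros u w k Hu Hw Hk.
- simpl. f_equal. ring.
- rewrite S_INR, RtoC_plus.
  replace (w + (RtoC (INR m) + 1) * period) with (w + RtoC (INR m) * period + period) by ring.
  rewrite (IHm (fun k w => u k (w + period)) w k (linsys_plus_period u Hu) Hw Hk).
  rewrite Nat.iter_succ_r.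
  assert (E : forall m v v', (forall j, (j < n)%nat -> v j = v' j) -> forall k, (k < n)%nat ->
    Nat.iter m (mat_vec n (monodromy w)) v k = Nat.iter m (mat_vec n (monodromy w)) v' k).
  { clear. induction m; intros v v' Hv k Hk; simpl; auto. unfold mat_vec at 1 3. apply Csum_ext. intros j Hj.
    f_equal. apply IHm; auto. }
  apply E; auto. intros. apply monodromy_step; auto.
Qed.

(** The k-th fundamental solution at [w1 + period] is computed in two ways: by the monodromy at
    [w1], or by translating the solution first and expanding it at [w0]. *)
Lemma monodromy_conj w0 w1 i k : lhp w0 -> lhp w1 -> (i < n)%nat -> (k < n)%nat ->
  Csum (fun j => monodromy w1 i j * transition w0 k j w1) n = Csum (fun j => transition w0 j i w1 * monodromy w0 j k) n.
Proof.
intros H0 H1 Hi Hk. destruct (transition_spec w0 k H0) as [S _].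
transitivity (transition w0 k i (w1 + period)).
- symmetry. apply (monodromy_step (transition w0 k) w1 i); auto.
- apply (linsys_transition (fun k' w => transition w0 k k' (w + period)) w0 i w1); auto. apply linsys_plus_period; auto.
Qed.

End Transition.

(** * The companion system and its monodromy relation *)

Section Companion.
Context (n : nat) (c b : nat -> C).

(* The system of u_k = (D + b_1) ... (D + b_k) u_0 with u_n = q * sum_j c_j u_j. *)
Definition companion (q : C -> C) (k j : nat) (w : C) : C :=
  (if Nat.eqb (S k) n then q w * c j else delta (S k) j) - b (S k) * delta k j.

Lemma companion_hol U q k j : hol U q -> hol U (companion q k j).
Proof.
intros Hq z Hz. destruct (Hq z Hz) as [l Hl]. unfold companion.
destruct (Nat.eqb (S k) n); eexists.
- apply eder_minus; [|apply (eder_const Cminus (b (S k) * delta k j))]. apply eder_mult; [exact Hl|apply (eder_const Cminus (c j))].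
- apply (eder_const Cminus (delta (S k) j - b (S k) * delta k j)).
Qed.

Lemma Cmod_delta i j : Cmod (delta i j) <= 1.
Proof. unfold delta. destruct (Nat.eqb i j); [rewrite Cmod_1|rewrite Cmod_0]; lra. Qed.

Lemma companion_bound : exists M, 0 <= M /\ forall q k j w Q, (k < n)%nat -> (j < n)%nat -> Cmod (q w) <= Q ->
  (Cmod (companion q k j w) <= M * (1 + Q)).
Proof.
destruct (finite_max (fun k => Cmod (c k)) n) as [M1 [P1 H1]].
destruct (finite_max (fun k => Cmod (b (S k))) n) as [M2 [P2 H2]].
exists (1 + M1 + M2)%R. split; [lra|]. intros q k j w Q Hk Hj HQ.
specialize (H1 j Hj). specialize (H2 k Hk). cbv beta in H1, H2.
assert (D1 := Cmod_delta (S k) j). assert (D2 := Cmod_delta k j).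
assert (Q0 := Rle_trans _ _ _ (Cmod_ge_0 _) HQ).
assert (C1 := Cmod_ge_0 (c j)). assert (C2 := Cmod_ge_0 (b (S k))). assert (C3 := Cmod_ge_0 (delta k j)).
assert (C4 := Cmod_ge_0 (q w)).
assert (K : Cmod (b (S k) * delta k j) <= M2) by (rewrite Cmod_mult; nra).
unfold companion. eapply Rle_trans; [apply Cmod_triangle_sub|].
destruct (Nat.eqb (S k) n); [rewrite Cmod_mult|]; nra.
Qed.

Lemma companion_sum q u k w : (k < n)%nat ->
  Csum (fun j => companion q k j w * u j) n =
  (if Nat.eqb (S k) n then q w * Csum (fun j => c j * u j) n else u (S k)) - b (S k) * u k.
Proof.
intros Hk. unfold companion.
transitivity (Csum (fun j => (if Nat.eqb (S k) n then q w * c j else delta (S k) j) * u j) n + Csum (fun j => - b (S k) * (delta k j * u j)) n).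
{ rewrite <- Csum_plus. apply Csum_ext. intros; ring. }
rewrite Csum_scal, Csum_delta by auto.
destruct (Nat.eqb (S k) n) eqn:E.
- rewrite <- Csum_scal. rewrite (Csum_ext (fun j => q w * c j * u j) (fun k => q w * (c k * u k))) by (intros; ring). ring.
- apply Nat.eqb_neq in E. rewrite Csum_delta by lia. ring.
Qed.

(** Solves the equation for its top term: e^w (u_n + sum_j c_j u_j) = u_n means u_n = qexp w * sum_j
    c_j u_j. The singularity e^w = 1 is the point z = 1, which both half-planes avoid. *)
Definition qexp (w : C) : C := Cexp w / (1 - Cexp w).

Lemma qexp_denom w : 1 - exp (Re w) <= Cmod (1 - Cexp w).
Proof. generalize (Cmod_triangle_inv 1 (Cexp w)). rewrite Cmod_1, Cmod_Cexp. auto. Qed.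

Lemma qexp_denom_pos d w : 0 < d -> Re w <= - d -> 0 < 1 - exp (- d) <= Cmod (1 - Cexp w).
Proof.
intros Hd Hw. assert (H := qexp_denom w). assert (E := exp_le _ _ Hw).
assert (exp (- d) < 1) by (rewrite <- exp_0; apply exp_increasing; lra). lra.
Qed.

Lemma qexp_denom_nz w : lhp w -> 1 - Cexp w <> 0.
Proof.
intros H E. unfold lhp in H. destruct (qexp_denom_pos (- Re w) w) as [H1 H2]; [lra|lra|].
rewrite E, Cmod_0 in H2. lra.
Qed.

Lemma qexp_cder w : 1 - Cexp w <> 0 -> exists l, cder qexp w l.
Proof.
intros H. eexists. apply eder_mult; [apply cder_Cexp|].
apply (eder_comp Cminus Cinv (fun w => 1 - Cexp w)); [apply cder_inv; auto|].
apply eder_minus; [apply (eder_const Cminus 1)|apply cder_Cexp].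
Qed.

Lemma qexp_bound d w : 0 < d -> Re w <= - d -> Cmod (qexp w) <= exp (Re w) / (1 - exp (- d)).
Proof.
intros Hd Hw. destruct (qexp_denom_pos d w Hd Hw) as [H1 H2].
assert (N : 1 - Cexp w <> 0) by (intros E; rewrite E, Cmod_0 in H2; lra).
unfold qexp. rewrite Cmod_div by auto. rewrite Cmod_Cexp. unfold Rdiv.
apply Rmult_le_compat_l; [left; apply exp_pos|]. apply Rinv_le_contravar; auto.
Qed.

Lemma companion_qexp_hol k j : (k < n)%nat -> (j < n)%nat -> hol lhp (companion qexp k j).
Proof. intros _ _. apply companion_hol. intros z Hz. apply qexp_cder, qexp_denom_nz; auto. Qed.

Lemma companion_qexp_bound d : 0 < d -> exists M, forall k j w, (k < n)%nat -> (j < n)%nat -> Re w <= - d ->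
  (Cmod (companion qexp k j w) <= M).
Proof.
intros Hd. destruct companion_bound as [M [HM H]].
exists (M * (1 + 1 / (1 - exp (- d))))%R. intros k j w Hk Hj Hw. apply H; auto.
eapply Rle_trans; [apply (qexp_bound d); auto|]. unfold Rdiv.
destruct (qexp_denom_pos d w Hd Hw) as [H1 _]. apply Rmult_le_compat_r; [left; apply Rinv_0_lt_compat; auto|].
rewrite <- exp_0. apply exp_le. lra.
Qed.

Lemma companion_qexp_period k j w : companion qexp k j (w + period) = companion qexp k j w.
Proof. unfold companion, qexp. rewrite Cexp_plus_period. reflexivity. Qed.

Definition zero_fun (_ : C) : C := 0.

Lemma companion_0_hol k j : (k < n)%nat -> (j < n)%nat -> hol lhp (companion zero_fun k j).
Proof. intros _ _. apply companion_hol. intros z _. exists 0. apply (eder_const Cminus 0). Qed.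

Lemma companion_0_bound d : 0 < d -> exists M, forall k j w, (k < n)%nat -> (j < n)%nat -> Re w <= - d ->
  (Cmod (companion zero_fun k j w) <= M)%R.
Proof.
intros Hd. destruct companion_bound as [M [HM H]].
exists (M * (1 + 0))%R. intros k j w Hk Hj Hw. apply H; auto. unfold zero_fun. rewrite Cmod_0. lra.
Qed.

Lemma scalar_solution (u : C -> C) (e : C) w0 w : (forall w, lhp w -> cder u w (- e * u w)) -> lhp w0 -> lhp w ->
  u w = Cexp (- e * (w - w0)) * u w0.
Proof.
intros Hu H0 Hw.
assert (K : u w * Cexp (e * w) = u w0 * Cexp (e * w0)).
{ apply (cder0_const (fun w => u w * Cexp (e * w))). intros t Ht.
  assert (L := lhp_is_convex w0 w t H0 Hw Ht).
  eapply eder_eq; [|apply eder_mult; [apply Hu; exact L|apply cder_Cexp_lin]]. cbv beta. ring. }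
replace (- e * (w - w0)) with (e * w0 + - (e * w)) by ring. rewrite Cexp_plus.
transitivity (u w * Cexp (e * w) * Cexp (- (e * w))).
- rewrite <- Cmult_assoc, (Cmult_comm (Cexp (e * w))), Cexp_neg. ring.
- rewrite K. ring.
Qed.

Definition base_point : C := RtoC (-1).

Lemma lhp_base : lhp base_point. Proof. unfold lhp. simpl. lra. Qed.

Definition limit_monodromy : nat -> nat -> C := monodromy n (companion zero_fun) base_point.

Lemma limit_monodromy_spec j : linsys n (companion zero_fun) lhp (transition n (companion zero_fun) base_point j) /\
  forall k, (k < n)%nat -> transition n (companion zero_fun) base_point j k base_point = delta k j.
Proof. apply transition_spec; [apply companion_0_hol|apply companion_0_bound|apply lhp_base]. Qed.

(** For q = 0 the equation of index k involves only u_k and u_(k+1), and the last one only itself.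
    Descending from k = n - 1, each component below the diagonal solves a scalar equation with
    initial value 0. *)
Lemma limit_monodromy_lower j : forall m k w, (k + m = n)%nat -> (j < k)%nat -> (k < n)%nat -> lhp w ->
  transition n (companion zero_fun) base_point j k w = 0.
Proof.
destruct (limit_monodromy_spec j) as [S1 S2].
induction m; intros k w Hm Hj Hk Hw; [lia|].
rewrite (scalar_solution (transition n (companion zero_fun) base_point j k) (b (S k)) base_point w); auto using lhp_base.
- rewrite S2 by auto. unfold delta. replace (Nat.eqb k j) with false by (symmetry; apply Nat.eqb_neq; lia). ring.
- intros z Hz. eapply eder_eq; [|apply S1; auto]. rewrite companion_sum by auto.
  destruct (Nat.eqb (S k) n) eqn:E; [unfold zero_fun; ring|]. apply Nat.eqb_neq in E.
  rewrite IHm by (auto; lia). ring.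
Qed.

Lemma limit_monodromy_triangular i j : (j < i)%nat -> (i < n)%nat -> limit_monodromy i j = 0.
Proof.
intros Hj Hi. unfold limit_monodromy, monodromy. apply (limit_monodromy_lower j (n - i)); auto; [lia|].
apply lhp_plus_period, lhp_base.
Qed.

Lemma limit_monodromy_diag k : (k < n)%nat -> limit_monodromy k k = Cexp (- (period * b (S k))).
Proof.
intros Hk. unfold limit_monodromy, monodromy. destruct (limit_monodromy_spec k) as [S1 S2].
rewrite (scalar_solution (transition n (companion zero_fun) base_point k k) (b (S k)) base_point); auto using lhp_base, lhp_plus_period.
- rewrite S2 by auto. unfold delta. rewrite Nat.eqb_refl, Cmult_1_r. f_equal. ring.
- intros z Hz. eapply eder_eq; [|apply S1; auto]. rewrite companion_sum by auto.
  destruct (Nat.eqb (S k) n) eqn:E; [unfold zero_fun; ring|]. apply Nat.eqb_neq in E.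
  rewrite (limit_monodromy_lower k (n - S k)) by (auto; lia). ring.
Qed.

Lemma rder_line_comp (u : C -> C) w h t l : cder u (w + RtoC t * h) l -> rder (fun t => u (w + RtoC t * h)) t (l * h).
Proof.
intros H. apply (eder_comp rsub u (fun t => w + RtoC t * h)); auto.
eapply eder_eq; [|apply eder_plus; [apply eder_const|apply eder_mult; [apply rder_id|apply eder_const]]].
cbv beta. ring.
Qed.

Lemma lhp_shift w t : lhp w -> lhp (along w t).
Proof. unfold lhp. rewrite re_plus, re_scal_l, re_period. lra. Qed.

Lemma exp_neg_INR e : 0 < e -> exists N, forall m, (N <= m)%nat -> exp (- INR m) < e.
Proof.
intros He. destruct (nat_above (1 - ln e)) as [N [_ HN]]. exists N. intros m Hm.
rewrite <- (exp_ln e) by auto. apply exp_increasing. apply le_INR in Hm. lra.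
Qed.

(* As Re w tends to -oo, the companion system along the period tends to the one with q = 0. *)
Lemma monodromy_limit i j : (i < n)%nat -> (j < n)%nat ->
  ccv (fun m => monodromy n (companion qexp) (base_point - RtoC (INR m)) i j) (limit_monodromy i j).
Proof.
intros Hi Hj.
destruct companion_bound as [M [HM0 HM]].
set (psi := transition n (companion zero_fun) base_point j).
destruct (limit_monodromy_spec j) as [S1 S2]. fold psi in S1, S2.
assert (HB : exists Bp, 0 <= Bp /\ forall k t, (k < n)%nat -> 0 <= t <= 1 -> Cmod (psi k (along base_point t)%C) <= Bp).
{ apply (finite_bound (fun k t => psi k (along base_point t))). intros k t Hk _.
  eapply rder_rcont, rder_line_comp. apply S1; auto. apply lhp_shift, lhp_base. }
destruct HB as [Bp [HBp0 HBp]].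
destruct (finite_max (fun k => Cmod (c k)) n) as [Mc [Pc Hc]]. cbv beta in Hc.
set (q1 := (1 - exp (- 1))%R). assert (Hq1 : 0 < q1).
{ unfold q1. generalize (exp_increasing (- 1) 0 ltac:(lra)). rewrite exp_0. lra. }
(* The coefficients of the system, bounded with |q| <= 1 / q1, times the speed 2 pi at which the
   period is run through. *)
set (Lam := (M * (1 + 1 / q1) * (2 * PI))%R).
(* The difference of the two solutions satisfies the system with q and the inhomogeneity q * sum_j
   c_j psi_j; F bounds the latter after the factor e^(- m) has been split off from q. *)
set (F := (1 / q1 * Mc * (INR n * Bp) * (2 * PI))%R).
assert (PI0 := PI_RGT_0). assert (Iq : 0 < 1 / q1) by (apply Rdiv_lt_0_compat; lra).
assert (Hn := pos_INR n).
assert (HLam : 0 <= Lam) by (unfold Lam; apply Rmult_le_pos; [apply Rmult_le_pos|]; lra).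
assert (HF : 0 <= F) by (unfold F; assert (0 <= INR n * Bp) by (apply Rmult_le_pos; lra); assert (0 <= 1 / q1 * Mc) by (apply Rmult_le_pos; lra); apply Rmult_le_pos; [apply Rmult_le_pos|]; lra).
set (K := exp ((2 * Lam * INR n + 1) * 1)). assert (HK : 0 < K) by apply exp_pos.
intros e He.
(* Gronwall bounds the squared distance by e^(- m) X, hence the requirement e^(- m) < e^2 / X
   below. *)
set (X := (INR n * (F * F) * K + 1)%R). assert (HX : 1 <= X).
{ unfold X. assert (0 <= INR n * (F * F) * K) by (assert (0 <= F * F) by nra; apply Rmult_le_pos; [apply Rmult_le_pos|]; lra). lra. }
destruct (exp_neg_INR (Rmin 1 (e * e / X))) as [N HN].
{ apply Rmin_case; [lra|]. apply Rdiv_lt_0_compat; nra. }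
exists N. intros m Hm. specialize (HN m Hm).
assert (E1 : exp (- INR m) < 1) by (eapply Rlt_le_trans; [exact HN|apply Rmin_l]).
assert (E2 : exp (- INR m) < e * e / X) by (eapply Rlt_le_trans; [exact HN|apply Rmin_r]).
assert (E0 := exp_pos (- INR m)).
set (w1 := base_point - RtoC (INR m)).
assert (R1 : forall t, Re (along w1 t)%C = (- 1 - INR m)%R).
{ intros t. unfold w1, base_point. rewrite re_plus, re_scal_l, re_period, re_sub. simpl. ring. }
assert (H1 : lhp w1). { unfold lhp. specialize (R1 0%R). rewrite Cmult_0_l, Cplus_0_r in R1. rewrite R1. generalize (pos_INR m). lra. }
assert (HQ : forall t, Cmod (qexp (along w1 t)%C) <= exp (- INR m) * (1 / q1)).
{ intros t. eapply Rle_trans; [apply (qexp_bound 1); [lra|rewrite R1; generalize (pos_INR m); lra]|].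
  fold q1. unfold Rdiv. rewrite Rmult_1_l. apply Rmult_le_compat_r; [left; apply Rinv_0_lt_compat; auto|].
  rewrite R1. apply exp_le. lra. }
destruct (transition_spec n (companion qexp) companion_qexp_hol companion_qexp_bound w1 j H1) as [T1 T2].
set (phi := transition n (companion qexp) w1 j) in *.
(* The limit system has constant coefficients, so its solution started at the fixed [base_point] can
   be compared with the one started at the receding point [w1]. *)
assert (G := gronwall n (fun k t => phi k (along w1 t) - psi k (along base_point t))
  (fun k t => Csum (fun l => companion qexp k l (along w1 t) * phi l (along w1 t)) n * period
            - Csum (fun l => companion zero_fun k l (along base_point t) * psi l (along base_point t)) n * period)
  Lam (F * exp (- INR m)) 1).
assert (HFm : 0 <= F * exp (- INR m)) by (apply Rmult_le_pos; lra).
specialize (G ltac:(lra) HLam HFm).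
assert (G' := fun A B => G A B). clear G.
assert (P : Cmod period = (2 * PI)%R).
{ unfold period. rewrite !Cmod_mult, !Cmod_R. rewrite !Rabs_pos_eq by lra. replace (Cmod Ci) with 1%R; [ring|].
  unfold Cmod, Ci. simpl. rewrite !Rmult_0_l, !Rmult_1_r, Rplus_0_l. symmetry. apply sqrt_1. }
specialize (G' ltac:(intros k t Hk _; apply (eder_minus rsub (fun t => phi k (along w1 t)));
   [apply (rder_line_comp (phi k)); apply T1; auto; apply lhp_shift; auto
   |apply (rder_line_comp (psi k)); apply S1; auto; apply lhp_shift, lhp_base])).
assert (Hd : forall k t, (k < n)%nat -> 0 <= t <= 1 ->
  (Cmod (Csum (fun l => companion qexp k l (along w1 t) * phi l (along w1 t)) n * period
       - Csum (fun l => companion zero_fun k l (along base_point t) * psi l (along base_point t)) n * period)%C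
   <= Lam * Rsum (fun l => Cmod (phi l (along w1 t) - psi l (along base_point t))%C) n + F * exp (- INR m))%R).
{ intros k t Hk Ht.
  set (x := fun l => phi l (along w1 t)). set (y := fun l => psi l (along base_point t)).
  set (z := w1 + RtoC t * period).
  replace (Csum (fun l => companion qexp k l z * phi l z) n * period - Csum (fun l => companion zero_fun k l (along base_point t) * psi l (along base_point t)) n * period)
    with (Csum (fun l => companion qexp k l z * (x l - y l)) n * period
          + (if Nat.eqb (S k) n then qexp z * Csum (fun l => c l * y l) n else 0) * period).
  2:{ rewrite (companion_sum qexp (fun l => x l - y l) k z Hk).
      change (Csum (fun l => companion qexp k l z * phi l z) n) with (Csum (fun l => companion qexp k l z * x l) n).
      change (Csum (fun l => companion zero_fun k l (along base_point t) * psi l (along base_point t)) n)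
        with (Csum (fun l => companion zero_fun k l (along base_point t) * y l) n).
      rewrite (companion_sum qexp x k z Hk), (companion_sum zero_fun y k _ Hk). unfold zero_fun.
      replace (Csum (fun j => c j * (x j - y j)) n) with (Csum (fun j => c j * x j) n - Csum (fun j => c j * y j) n).
      - destruct (Nat.eqb (S k) n); ring.
      - replace (Csum (fun j => c j * x j) n - Csum (fun j => c j * y j) n) with (Csum (fun j => c j * x j) n + (-1) * Csum (fun j => c j * y j) n) by ring.
        rewrite <- Csum_scal, <- Csum_plus. apply Csum_ext. intros; ring. }
  eapply Rle_trans; [apply Cmod_triangle|]. rewrite !Cmod_mult, P.
  assert (Hz := HQ t). fold z in Hz.
  apply Rplus_le_compat.
  - unfold Lam. rewrite (Rmult_comm (M * (1 + 1 / q1))), Rmult_assoc, Rmult_comm.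
    apply Rmult_le_compat_l; [lra|]. eapply Rle_trans; [apply Csum_le_Rsum|]. rewrite <- Rsum_scal. apply Rsum_le. intros l Hl.
    rewrite Cmod_mult. apply Rmult_le_compat_r; [apply Cmod_ge_0|]. apply HM; auto.
    eapply Rle_trans; [apply Hz|]. nra.
  - unfold F. replace (1 / q1 * Mc * (INR n * Bp) * (2 * PI) * exp (- INR m))%R with (exp (- INR m) * (1 / q1) * (INR n * (Mc * Bp)) * (2 * PI))%R by ring.
    apply Rmult_le_compat_r; [lra|].
    assert (Hs : (Cmod (Csum (fun l => c l * y l)%C n) <= INR n * (Mc * Bp))%R).
    { apply Csum_bound. intros l Hl. rewrite Cmod_mult. apply Rmult_le_compat; auto; try apply Cmod_ge_0. apply HBp; auto. }
    destruct (Nat.eqb (S k) n).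
    + rewrite Cmod_mult. apply Rmult_le_compat; auto; apply Cmod_ge_0.
    + rewrite Cmod_0. apply Rmult_le_pos; apply Rmult_le_pos; try lra. apply Rmult_le_pos; lra. }
specialize (G' Hd). cbv beta in G'.
rewrite (energy_0 n (fun k => phi k (along w1 0) - psi k (along base_point 0))) in G'.
2:{ intros k Hk. rewrite !Cmult_0_l, !Cplus_0_r, S2, T2 by auto. ring. }
assert (T := energy_term n (fun k => phi k (along w1 1) - psi k (along base_point 1)) i Hi). cbv beta in T.
rewrite !Cmult_1_l in T.
change (Cmod (phi i (w1 + period) - psi i (base_point + period))%C < e).
set (r := Cmod (phi i (w1 + period) - psi i (base_point + period))) in *. assert (Hr : 0 <= r) by apply Cmod_ge_0.
fold K in G'. rewrite !Cmult_1_l in G'.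
assert (Q : r * r <= exp (- INR m) * X).
{ eapply Rle_trans; [exact T|]. eapply Rle_trans; [exact G'|]. unfold X.
  replace ((0 + INR n * (F * exp (- INR m) * (F * exp (- INR m))) * 1) * K)%R with (exp (- INR m) * (INR n * (F * F) * K * exp (- INR m)))%R by ring.
  apply Rmult_le_compat_l; [lra|]. unfold X in HX. nra. }
assert (Q2 : r * r < e * e).
{ eapply Rle_lt_trans; [exact Q|]. apply (Rmult_lt_compat_r X) in E2; [|lra]. replace (e * e / X * X)%R with (e * e)%R in E2 by (field; lra). exact E2. }
nra.
Qed.

Theorem monodromy_relation B u k w :
  (forall x, Csum (fun k => B (n - k)%nat * x ^ k) (S n) = Cprod (fun k => x - Cexp (- (period * b k))) n) ->
  linsys n (companion qexp) lhp u -> lhp w -> (k < n)%nat ->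
  Csum (fun m => B (n - m)%nat * u k (shift w m)) (S n) = 0.
Proof.
intros HB Hu Hw Hk.
rewrite (Csum_ext _ (fun m => B (n - m)%nat * Nat.iter m (mat_vec n (monodromy n (companion qexp) w)) (fun j => u j w) k)).
2:{ intros m _. f_equal. apply monodromy_iter; auto using companion_qexp_hol, companion_qexp_bound, companion_qexp_period. }
(* Base points receding to the left; the monodromies there are all conjugate to the one at w. *)
set (wm := fun m => base_point - RtoC (INR m)).
assert (Hwm : forall m, lhp (wm m)).
{ intros m. unfold lhp, wm, base_point. rewrite re_sub. simpl. generalize (pos_INR m). lra. }
apply (LinAlg.charpoly_limit n _ (fun m => monodromy n (companion qexp) (wm m)) (fun m k j => transition n (companion qexp) w j k (wm m))
  limit_monodromy (fun k => Cexp (- (period * b k))) B); auto.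
- intros m i l Hi Hl. apply monodromy_conj; auto using companion_qexp_hol, companion_qexp_bound, companion_qexp_period.
- intros m d Hd. apply (transition_inj n (companion qexp) companion_qexp_hol companion_qexp_bound w (wm m)); auto.
- intros. apply monodromy_limit; auto.
- exact limit_monodromy_triangular.
- exact limit_monodromy_diag.
Qed.

End Companion.

(** * From the equation to the companion system and its continuation *)

Lemma Dprod_hol U c m f : copen U -> hol U f -> hol U (Dprod c m f).
Proof.
intros HU Hf. induction m; simpl; auto. intros z Hz.
destruct (hol_C_derive U _ HU IHm z Hz) as [l1 H1]. destruct (IHm z Hz) as [l2 H2].
eexists. apply eder_plus; [exact H1|apply eder_scal; exact H2].
Qed.

Lemma cder_ext_open U f g z l : copen U -> U z -> (forall y, U y -> f y = g y) -> cder f z l -> cder g z l.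
Proof.
intros HU Hz H. apply cder_ext_loc. destruct (HU z Hz) as [d [Hd HD]]. exists d. split; auto.
Qed.

(* The coefficients of (D + alpha_1) ... (D + alpha_m) in the basis (D + b_1) ... (D + b_k). *)
Fixpoint Dcoef (alpha b : nat -> C) (m k : nat) : C :=
  match m with
  | O => delta 0 k
  | S m => (match k with O => 0 | S k => Dcoef alpha b m k end) + (alpha (S m) - b (S k)) * Dcoef alpha b m k
  end.

Lemma Dcoef_above alpha b m : forall k, (m < k)%nat -> Dcoef alpha b m k = 0.
Proof.
induction m; intros k Hk; simpl.
- destruct k; [lia|reflexivity].
- destruct k; [lia|]. rewrite !IHm by lia. ring.
Qed.

Lemma Dcoef_top alpha b m : Dcoef alpha b m m = 1.
Proof. induction m; simpl; [reflexivity|]. rewrite IHm, (Dcoef_above _ _ m (S m)) by lia. ring. Qed.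

Lemma Csum_shift (f : nat -> C) m : Csum f (S m) = f O + Csum (fun k => f (S k)) m.
Proof. induction m; simpl in *; [ring|]. rewrite IHm. ring. Qed.

Lemma Dprod_expand U alpha b f : copen U -> hol U f -> forall m w, U w ->
  Dprod alpha m f w = Csum (fun k => Dcoef alpha b m k * Dprod b k f w) (S m).
Proof.
intros HU Hf. induction m; intros w Hw.
- simpl. unfold delta. simpl. ring.
- change (Dprod alpha (S m) f w) with (C_derive (Dprod alpha m f) w + alpha (S m) * Dprod alpha m f w).
  assert (D : cder (Dprod alpha m f) w (Csum (fun k => Dcoef alpha b m k * (Dprod b (S k) f w - b (S k) * Dprod b k f w)) (S m))).
  { apply (cder_ext_open U (fun w => Csum (fun k => Dcoef alpha b m k * Dprod b k f w) (S m))); auto.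
    - intros y Hy. symmetry. apply IHm; auto.
    - apply (eder_Csum Cminus (fun k w => Dcoef alpha b m k * Dprod b k f w)). intros k _. apply eder_scal.
      eapply eder_eq; [|apply (hol_der U); auto; apply Dprod_hol; auto].
      change (Dprod b (S k) f w) with (C_derive (Dprod b k f) w + b (S k) * Dprod b k f w). ring. }
  rewrite (cder_C_derive _ _ _ D), IHm by auto. rewrite <- Csum_scal, <- Csum_plus.
  transitivity (Csum (fun k => (alpha (S m) - b (S k)) * Dcoef alpha b m k * Dprod b k f w) (S m)
    + Csum (fun k => Dcoef alpha b m k * Dprod b (S k) f w) (S m)).
  + rewrite <- Csum_plus. apply Csum_ext. intros; ring.
  + rewrite (Csum_shift (fun k => Dcoef alpha b (S m) k * _) (S m)).
    transitivity (Csum (fun k => (alpha (S m) - b (S k)) * Dcoef alpha b m k * Dprod b k f w) (S (S m))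
     + Csum (fun k => Dcoef alpha b m k * Dprod b (S k) f w) (S m)).
    * simpl Csum at 3. rewrite (Dcoef_above _ _ m (S m)) by lia. simpl Csum. ring.
    * rewrite (Csum_shift (fun k => (alpha (S m) - b (S k)) * Dcoef alpha b m k * Dprod b k f w) (S m)).
      rewrite <- Cplus_assoc, <- Csum_plus. f_equal; [simpl; ring|]. apply Csum_ext. intros k _.
      change (Dcoef alpha b (S m) (S k)) with (Dcoef alpha b m k + (alpha (S m) - b (S (S k))) * Dcoef alpha b m (S k)). ring.
Qed.

(** Expanding the alpha-product in the b-products has top coefficient 1, so the equation can be
    solved for the n-th b-product wherever 1 - e^w is nonzero. *)
Lemma companion_of_equation n alpha b U f : (1 <= n)%nat -> copen U -> hol U f ->
  (forall w, U w -> 1 - Cexp w <> 0) ->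
  (forall w, U w -> Cexp w * Dprod alpha n f w = Dprod b n f w) ->
  linsys n (companion n (Dcoef alpha b n) b qexp) U (fun k => Dprod b k f).
Proof.
intros Hn HU Hf Hq Heq k w Hk Hw.
apply eder_eq with (C_derive (Dprod b k f) w); [|apply (hol_der U); auto; apply Dprod_hol; auto].
rewrite companion_sum by auto.
replace (C_derive (Dprod b k f) w) with (Dprod b (S k) f w - b (S k) * Dprod b k f w) by (simpl; ring).
f_equal. destruct (Nat.eqb (S k) n) eqn:E; auto. apply Nat.eqb_eq in E. rewrite E.
specialize (Heq w Hw). rewrite (Dprod_expand U alpha b f HU Hf n w Hw) in Heq. simpl Csum in Heq. rewrite Dcoef_top in Heq.
specialize (Hq w Hw). unfold qexp.
set (T := Csum (fun j => Dcoef alpha b n j * Dprod b j f w) n) in *. set (D := Dprod b n f w) in *.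
transitivity ((D - Cexp w * D) / (1 - Cexp w)); [field; auto|].
replace (D - Cexp w * D) with (Cexp w * T); [field; auto|]. rewrite <- Heq at 1. ring.
Qed.

Lemma companion_qexp_cont n c b k j w : 1 - Cexp w <> 0 -> ccont (companion n c b qexp k j) w.
Proof.
intros H. apply (hol_cont (fun w => 1 - Cexp w <> 0)); auto. apply companion_hol. intros z Hz. apply qexp_cder; auto.
Qed.

(** The Picard solution with the initial vector of f at w0 agrees with f on V by uniqueness on the
    convex set V. Its component of index 0 is the extension, and the relation is
    [monodromy_relation] for this component. *)
Theorem lhp_extension n alpha b V f w0 : (1 <= n)%nat -> copen V -> convex V -> (forall w, V w -> lhp w) -> V w0 -> hol V f ->
  (forall w, V w -> Cexp w * Dprod alpha n f w = Dprod b n f w) ->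
  exists H, hol lhp H /\ (forall w, V w -> H w = f w) /\
    forall B, (forall x, Csum (fun k => B (n - k)%nat * x ^ k) (S n) = Cprod (fun k => x - Cexp (- (period * b k))) n) ->
      forall w, lhp w -> Csum (fun m => B (n - m)%nat * H (shift w m)) (S n) = 0.
Proof.
intros Hn HV Hcv Hsub H0 Hf Heq.
set (c := Dcoef alpha b n).
destruct (picard n (companion n c b qexp) (companion_qexp_hol n c b) (companion_qexp_bound n c b) w0 (Hsub w0 H0)
  (fun k => Dprod b k f w0)) as [u [Hu Hu0]].
exists (u O). split; [|split].
- intros w Hw. eexists. apply Hu; auto.
- assert (Q : forall w, V w -> 1 - Cexp w <> 0) by (intros; apply qexp_denom_nz; auto).
  intros w Hw. apply Ceq_minus. change (u O w - Dprod b 0 f w = 0).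
  apply (linsys_unique n (companion n c b qexp) V (fun k w => u k w - Dprod b k f w) w0); auto.
  + intros. apply companion_qexp_cont; auto.
  + apply linsys_minus; [apply (linsys_sub n _ lhp); auto|]. apply companion_of_equation; auto.
  + intros k Hk. rewrite Hu0 by auto. ring.
- intros B HB w Hw. apply (monodromy_relation n c b B u O w HB Hu Hw). lia.
Qed.

Lemma Dprod_reflect U c f : copen U -> hol U f -> forall m w, U (- w) ->
  Dprod (fun k => - c k) m (fun w => f (- w)) w = (-1) ^ m * Dprod c m f (- w).
Proof.
intros HU Hf.
assert (HU' : copen (fun w => U (- w))).
{ intros z Hz. destruct (HU _ Hz) as [d [Hd H]]. exists d. split; auto. intros y Hy. apply H.
  replace (- y - - z) with (- (y - z)) by ring. rewrite Cmod_opp. auto. }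
induction m; intros w Hw; [simpl; ring|].
change (C_derive (Dprod (fun k => - c k) m (fun w => f (- w))) w + - c (S m) * Dprod (fun k => - c k) m (fun w => f (- w)) w
  = (-1) ^ S m * (C_derive (Dprod c m f) (- w) + c (S m) * Dprod c m f (- w))).
rewrite (cder_C_derive _ _ ((-1) ^ m * (C_derive (Dprod c m f) (- w) * (- (1))))).
- rewrite IHm by auto. simpl. ring.
- apply (cder_ext_open (fun w => U (- w)) (fun w => (-1) ^ m * Dprod c m f (- w))); auto.
  + intros y Hy. symmetry. apply IHm; auto.
  + apply eder_scal. apply (eder_comp Cminus (Dprod c m f) Copp); [apply (hol_der U); auto; apply Dprod_hol; auto|].
    apply eder_opp, cder_id.
Qed.

Definition rhp (w : C) : Prop := (0 < Re w).

(** The reflection w -> - w interchanges the half-planes and, after multiplication by e^(- w), the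
    roles of alpha and b up to sign. This is why the roots become e^(2 pi i alpha_k) and the
    translations run backwards. *)
Theorem rhp_extension n alpha b V f w0 : (1 <= n)%nat -> copen V -> convex V -> (forall w, V w -> rhp w) -> V w0 -> hol V f ->
  (forall w, V w -> Cexp w * Dprod alpha n f w = Dprod b n f w) ->
  exists H, hol rhp H /\ (forall w, V w -> H w = f w) /\
    forall A, (forall x, Csum (fun k => A (n - k)%nat * x ^ k) (S n) = Cprod (fun k => x - Cexp (period * alpha k)) n) ->
      forall w, rhp w -> Csum (fun m => A (n - m)%nat * H (w - RtoC (INR m) * period)) (S n) = 0.
Proof.
intros Hn HV Hcv Hsub H0 Hf Heq.
assert (Opp : forall w : C, - - w = w) by (intros; ring).
destruct (lhp_extension n (fun k => - b k) (fun k => - alpha k) (fun w => V (- w)) (fun w => f (- w)) (- w0)) as [H [H1 [H2 H3]]]; auto.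
- intros z Hz. destruct (HV _ Hz) as [d [Hd H]]. exists d. split; auto. intros y Hy. apply H.
  replace (- y - - z) with (- (y - z)) by ring. rewrite Cmod_opp. auto.
- intros x y t Hx Hy Ht. replace (- (x + RtoC t * (y - x))) with (- x + RtoC t * (- y - - x)) by ring. apply Hcv; auto.
- intros w Hw. specialize (Hsub _ Hw). unfold rhp, lhp in *. rewrite re_opp in Hsub. lra.
- rewrite Opp. auto.
- intros w Hw. destruct (Hf _ Hw) as [l Hl]. eexists. apply (eder_comp Cminus f Copp); [exact Hl|apply eder_opp, cder_id].
- intros w Hw. rewrite !(Dprod_reflect V) by auto. rewrite <- (Heq _ Hw).
  transitivity ((-1) ^ n * (Cexp (- w) * Cexp w) * Dprod alpha n f (- w)); [ring|]. rewrite Cexp_neg. ring.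
- assert (L : forall w, rhp w -> lhp (- w)) by (intros w Hw; unfold rhp, lhp in *; rewrite re_opp; lra).
  exists (fun w => H (- w)). split; [|split].
  + intros w Hw. destruct (H1 _ (L w Hw)) as [l Hl]. eexists. apply (eder_comp Cminus H Copp); [exact Hl|apply eder_opp, cder_id].
  + intros w Hw. rewrite H2, Opp by (rewrite Opp; auto). auto.
  + intros A HA w Hw. rewrite <- (H3 A) with (w := - w); [|intros x; rewrite HA; apply Cprod_ext; intros; do 2 f_equal; ring|auto].
    apply Csum_ext. intros m _. do 2 f_equal. ring.
Qed.

(** * Injectivity of the Laplace transform along a path *)

Lemma RInt_lower (rho : R -> R) a x y b v c : a <= x <= y -> y <= b -> is_RInt rho a b v ->
  (forall t, a <= t <= b -> 0 <= rho t) -> (forall t, x <= t <= y -> c <= rho t) -> c * (y - x) <= v.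
Proof.
intros Hx Hy HI H0 Hc.
assert (E : ex_RInt rho a b) by (exists v; auto).
assert (E1 : ex_RInt rho a x) by (apply (ex_RInt_Chasles_1 (V := R_CompleteNormedModule) rho a x b); [lra|auto]).
assert (E2 : ex_RInt rho x b) by (apply (ex_RInt_Chasles_2 (V := R_CompleteNormedModule) rho a x b); [lra|auto]).
assert (E3 : ex_RInt rho x y) by (apply (ex_RInt_Chasles_1 (V := R_CompleteNormedModule) rho x y b); [lra|auto]).
assert (E4 : ex_RInt rho y b) by (apply (ex_RInt_Chasles_2 (V := R_CompleteNormedModule) rho x y b); [lra|auto]).
rewrite <- (is_RInt_unique _ _ _ _ HI).
rewrite <- (RInt_Chasles rho a x b E1 E2), <- (RInt_Chasles rho x y b E3 E4). unfold plus. simpl.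
assert (P1 : 0 <= RInt rho a x) by (apply RInt_ge_0; [lra|auto|intros; apply H0; lra]).
assert (P4 : 0 <= RInt rho y b) by (apply RInt_ge_0; [lra|auto|intros; apply H0; lra]).
assert (P3 : c * (y - x) <= RInt rho x y).
{ replace (c * (y - x))%R with (RInt (fun _ => c) x y) by (rewrite RInt_const; unfold scal; simpl; unfold mult; simpl; ring).
  apply RInt_le; [lra|apply ex_RInt_const|auto|intros; apply Hc; lra]. }
lra.
Qed.

(** A continuous cutoff, equal to 1 within distance d of s1 and to 0 beyond 2 d. It splits an
    integral along [L] into a near and a far part without breaking the continuity of the
    integrand. *)
Definition plateau (s1 : C) (d : R) (s : C) : R := Rmin 1 (Rmax 0 (2 - Cmod (s - s1) / d)).

Lemma plateau_range s1 d s : 0 <= plateau s1 d s <= 1.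
Proof. unfold plateau. split; [apply Rmin_case; [lra|apply Rmax_l]|apply Rmin_l]. Qed.

Lemma plateau_1 s1 d s : 0 < d -> Cmod (s - s1) <= d -> plateau s1 d s = 1%R.
Proof.
intros Hd H. unfold plateau. apply Rmin_left. eapply Rle_trans; [|apply Rmax_r].
assert (Cmod (s - s1) / d <= 1) by (apply Rle_div_l; lra). lra.
Qed.

Lemma plateau_0 s1 d s : 0 < d -> 2 * d <= Cmod (s - s1) -> plateau s1 d s = 0%R.
Proof.
intros Hd H. unfold plateau. assert (2 <= Cmod (s - s1) / d) by (apply Rle_div_r; lra).
rewrite Rmax_left by lra. apply Rmin_right. lra.
Qed.

Lemma ccont_plateau s1 d s : 0 < d -> ccont (fun s => RtoC (plateau s1 d s)) s.
Proof.
intros Hd e He. exists (d * e)%R. split; [nra|]. intros y Hy.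
rewrite <- RtoC_minus, Cmod_R.
assert (H1 := Cmod_triangle_inv (y - s1) (s - s1)). assert (H2 := Cmod_triangle_inv (s - s1) (y - s1)).
replace (y - s1 - (s - s1)) with (y - s) in H1 by ring. replace (s - s1 - (y - s1)) with (s - y) in H2 by ring.
rewrite (Cmod_sub_sym s y) in H2.
set (p := Cmod (y - s1)) in *. set (q := Cmod (s - s1)) in *. set (m := Cmod (y - s)) in *.
assert (D : Rabs (p / d - q / d) < e).
{ replace (p / d - q / d)%R with ((p - q) / d)%R by (field; lra). unfold Rdiv.
  rewrite Rabs_mult, (Rabs_pos_eq (/ d)) by (left; apply Rinv_0_lt_compat; auto).
  apply Rlt_div_l; [auto|]. apply Rabs_def1; lra. }
apply Rabs_def2 in D. unfold plateau. fold p q. unfold Rmin, Rmax.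
apply Rabs_def1; repeat destruct Rle_dec; lra.
Qed.

(** * Concentration of powers of a rational kernel *)

Section Peak.
Context (L : R -> C) (HL : path_ioo L).

(** Its poles are s1 + eta and s1 - eta. On the vertical line through s1 it is the real bump eta^2 /
    (eta^2 + u^2), whose only maximum is the value 1 at s1. *)
Definition kernel (eta : R) (s1 s : C) : C := RtoC (eta * eta) / (RtoC (eta * eta) - (s - s1) * (s - s1)).

Lemma vline_sub t t1 : (vline t - vline t1) * (vline t - vline t1) = RtoC (- ((t - t1) * (t - t1))).
Proof. unfold vline. apply C_ext; simpl; ring. Qed.

Lemma Cmod_vline_sub t t1 : Cmod (vline t - vline t1) = Rabs (t - t1).
Proof.
replace (vline t - vline t1) with (vline (t - t1)) by (unfold vline; apply C_ext; simpl; ring). apply Cmod_vline.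
Qed.

Definition rker (eta u : R) : R := (eta * eta / (eta * eta + u * u))%R.

Lemma kernel_vline eta t1 t : 0 < eta -> kernel eta (vline t1) (vline t) = RtoC (rker eta (t - t1)).
Proof.
intros He. unfold kernel, rker. rewrite vline_sub.
assert (B := Rle_0_sqr (t - t1)). unfold Rsqr in B. assert (0 < eta * eta + (t - t1) * (t - t1)) by nra.
rewrite <- RtoC_minus. replace (eta * eta - - ((t - t1) * (t - t1)))%R with (eta * eta + (t - t1) * (t - t1))%R by ring.
symmetry. apply RtoC_div. lra.
Qed.

Lemma rker_pos eta u : 0 < eta -> 0 < rker eta u <= 1.
Proof.
intros He. unfold rker. assert (A : 0 < eta * eta) by nra. assert (B := Rle_0_sqr u). unfold Rsqr in B.
split; [apply Rdiv_lt_0_compat; lra|]. apply Rle_div_l; lra.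
Qed.

Lemma rker_mono eta u v : 0 < eta -> Rabs u <= Rabs v -> rker eta v <= rker eta u.
Proof.
intros He H. unfold rker, Rdiv. assert (A : 0 < eta * eta) by nra. assert (B := Rle_0_sqr u). unfold Rsqr in B.
apply Rmult_le_compat_l; [lra|]. apply Rinv_le_contravar; [lra|].
assert (Q : Rsqr u <= Rsqr v) by (apply Rsqr_le_abs_1; auto). unfold Rsqr in Q. lra.
Qed.

Lemma rker_strict eta u v : 0 < eta -> Rabs u < Rabs v -> rker eta v < rker eta u.
Proof.
intros He H. unfold rker, Rdiv. assert (A : 0 < eta * eta) by nra. assert (B := Rle_0_sqr u).
apply Rmult_lt_compat_l; [lra|].
assert (Q : Rsqr u < Rsqr v) by (apply Rsqr_lt_abs_1; auto). unfold Rsqr in *. apply Rinv_lt_contravar; [apply Rmult_lt_0_compat|]; lra.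
Qed.

(** Suppose f does not vanish at s1. Near s1 the integrand kernel^N f keeps nearly the direction of
    f (s1), which forces the integral there to be at least of order k2^N. Away from s1 the kernel is
    at most q < k2, so the rest is of order q^N and cannot compensate for large N. *)
Lemma peak (f : C -> C) (M T R0 eta t1 : R) : 0 <= M -> 0 < eta ->
  (forall t, rcont (fun t => f (L t)) t) -> (forall t, Cmod (f (L t)) <= M / (1 + t * t)) ->
  (forall t, T <= Rabs t -> L t = vline t) -> (forall t, Cmod (L t - vline t) <= R0) ->
  (0 <= T) -> T + R0 + 2 * eta + 2 <= Rabs t1 ->
  (forall t, rcont (fun t => kernel eta (vline t1) (L t)) t) ->
  (forall N, intL L (fun s => kernel eta (vline t1) s ^ N * f s) 0) ->
  f (vline t1) = 0.
Proof.
intros HM He Hf Hb HT HR HT0 Ht1 Hk HI.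
destruct (Ceq_dec (f (vline t1)) 0) as [E|Hf1]; auto. exfalso.
assert (HR0 : 0 <= R0) by (eapply Rle_trans; [apply Cmod_ge_0|apply (HR 0%R)]).
assert (E1 : L t1 = vline t1) by (apply HT; lra).
set (s1 := vline t1) in *. set (f1 := f s1) in *. set (kap := kernel eta s1) in *.
assert (Pf : 0 < Cmod f1) by (apply Cmod_gt_0; auto).
destruct (Hf t1 (Cmod f1 / 2)%R) as [d [Hd Hd']]; [lra|]. rewrite E1 in Hd'. fold f1 in Hd'.
(* [d / 4] keeps f close to f (s1) on the support of the cutoff, [eta] gives q >= 1/2, and [1 / 2]
   keeps the support within the straight part of [L]. *)
set (dl := Rmin (d / 4) (Rmin eta (1 / 2))).
assert (D0 : 0 < dl) by (unfold dl; apply Rmin_case; [lra|apply Rmin_case; lra]).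
assert (D1 : dl <= d / 4) by apply Rmin_l.
assert (D2 : dl <= eta) by (eapply Rle_trans; [apply Rmin_r|apply Rmin_l]).
assert (D3 : dl <= 1 / 2) by (eapply Rle_trans; [apply Rmin_r|apply Rmin_r]).
set (tau := fun s => RtoC (plateau s1 dl s)).
set (q := rker eta dl). destruct (rker_pos eta dl He) as [Hq0 Hq1]. fold q in Hq0, Hq1.
assert (Hq2 : 1 / 2 <= q).
{ assert (A : dl * dl <= eta * eta) by (apply Rmult_le_compat; lra).
  assert (B : 0 < dl * dl) by (apply Rmult_lt_0_compat; lra).
  apply (Rmult_le_reg_r (eta * eta + dl * dl)); [lra|]. unfold q, rker, Rdiv.
  rewrite (Rmult_assoc (eta * eta)), Rinv_l by lra. lra. }
(* On the bent part the kernel is not a real bump, but at distance at least 2 eta it is at most 1/2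
   in modulus, hence at most q. *)
assert (Bent : forall t, Rabs t < T -> 2 * eta <= Cmod (L t - s1)).
{ intros t Hs.
  generalize (Cmod_triangle (L t - vline t) (s1 - L t)). replace (L t - vline t + (s1 - L t)) with (s1 - vline t) by ring.
  rewrite (Cmod_sub_sym s1 (L t)). generalize (Cmod_triangle_inv s1 (vline t)). unfold s1 at 1. rewrite !Cmod_vline. generalize (HR t). lra. }
assert (Sep : forall t, 2 * dl < Rabs (t - t1) -> 2 * dl <= Cmod (L t - s1)).
{ intros t Ht. destruct (Rle_dec T (Rabs t)) as [Hs|Hs].
  - rewrite (HT t Hs). unfold s1. rewrite Cmod_vline_sub. lra.
  - eapply Rle_trans; [|apply Bent; lra]. lra. }
assert (Far : forall t, dl <= Cmod (L t - s1) -> Cmod (kap (L t)) <= q).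
{ intros t Ht. destruct (Rle_dec T (Rabs t)) as [Hs|Hs].
  - rewrite (HT t Hs) in *. unfold kap, s1. rewrite kernel_vline by auto. rewrite Cmod_R.
    unfold s1 in Ht. rewrite Cmod_vline_sub in Ht. rewrite Rabs_pos_eq by (left; apply rker_pos; auto).
    apply rker_mono; auto. rewrite (Rabs_pos_eq dl) by lra. auto.
  - apply Rnot_le_lt in Hs. eapply Rle_trans; [|exact Hq2].
    assert (B := Bent t Hs).
    unfold kap, kernel. set (z := L t - s1) in *.
    assert (B2 : 2 * (eta * eta) <= Cmod (RtoC (eta * eta) - z * z)).
    { rewrite Cmod_sub_sym. generalize (Cmod_triangle_inv (z * z) (RtoC (eta * eta))). rewrite Cmod_mult, Cmod_R, Rabs_pos_eq by nra. nra. }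
    rewrite Cmod_div.
    + rewrite Cmod_R, Rabs_pos_eq by nra. apply Rle_div_l; nra.
    + intros Z. rewrite Z, Cmod_0 in B2. nra. }
assert (Ctau : forall t, rcont (fun t => tau (L t)) t).
{ intros t. apply (econt_comp rsub tau L); [apply ccont_plateau; auto|apply path_cont; auto]. }
destruct (intL_exists L HL) as [K [HK0 HK]].
assert (Ckf : forall N t, rcont (fun t => kap (L t) ^ N * f (L t)) t).
{ intros N t. apply (econt_mult rsub (fun t => kap (L t) ^ N) (fun t => f (L t))); auto. apply (rcont_pow (fun t => kap (L t))); auto. }
assert (Outer : forall N, exists l, intL L (fun s => kap s ^ N * f s * (1 - tau s)) l /\ Cmod l <= K * (M * q ^ N)).
{ intros N. apply HK.
  - apply Rmult_le_pos; auto. apply pow_le; lra.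
  - intros t. apply (econt_mult rsub (fun t => kap (L t) ^ N * f (L t))); auto. apply (econt_minus rsub (fun _ => RtoC 1)); auto. apply econt_const.
  - intros t. rewrite !Cmod_mult, Cmod_pow.
    assert (P2 : 0 < 1 + t * t) by nra.
    destruct (Rle_dec dl (Cmod (L t - s1))) as [H|H].
    + replace (M * q ^ N / (1 + t * t))%R with (q ^ N * (M / (1 + t * t)) * 1)%R by (unfold Rdiv; ring).
      unfold tau. rewrite <- RtoC_minus, Cmod_R. assert (R := plateau_range s1 dl (L t)).
      rewrite Rabs_pos_eq by lra. apply Rmult_le_compat; [|lra| |lra].
      * apply Rmult_le_pos; [apply pow_le|]; apply Cmod_ge_0.
      * apply Rmult_le_compat; auto; [apply pow_le| |]; try apply Cmod_ge_0. apply pow_incr. split; [apply Cmod_ge_0|auto].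
    + unfold tau. rewrite plateau_1 by lra. replace (1 - 1) with (RtoC 0) by ring. rewrite Cmod_0, Rmult_0_r.
      apply Rdiv_le_0_compat; auto. apply Rmult_le_pos; auto. apply pow_le; lra. }
set (k2 := rker eta (dl / 2)).
assert (Hk2 : q < k2) by (apply rker_strict; auto; rewrite !Rabs_pos_eq by lra; lra).
assert (Key : forall N, dl * (1 / 2 * k2 ^ N) <= K * (M * q ^ N) / Cmod f1).
{ intros N. destruct (Outer N) as [l2 [Hl2 Bl2]].
  assert (Hin := intL_minus L _ _ _ _ (HI N) Hl2).
  apply (intL_ext L _ (fun s => kap s ^ N * f s * tau s)) in Hin; [|intros; cbv beta; ring].
  (* Divides by f (s1) and by the direction -i of the straight part, so that the near integrand
     acquires a nonnegative real part. *)
  set (cf := / (- Ci * f1)).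
  assert (Ncf : - Ci * f1 <> 0).
  { apply Cmult_neq_0; auto. intros E. apply (f_equal Cmod) in E. rewrite Cmod_opp, Cmod_Ci, Cmod_0 in E. lra. }
  assert (Mcf : Cmod cf = (/ Cmod f1)%R) by (unfold cf; rewrite Cmod_inv by auto; rewrite Cmod_mult, Cmod_opp, Cmod_Ci; f_equal; ring).
  apply Rnot_lt_le. intros Hlt.
  set (gap := (dl * (1 / 2 * k2 ^ N) - K * (M * q ^ N) / Cmod f1)%R).
  assert (Hgap : 0 < gap) by (unfold gap; lra).
  destruct Hin as [Hex Hlim]. destruct (Hlim (gap * Cmod f1)%R) as [T1 HT1]; [nra|].
  set (b := (Rabs T1 + Rabs t1 + 2)%R).
  assert (Hb1 : Rabs t1 + 2 <= b /\ T1 < b) by (unfold b; generalize (Rle_abs T1) (Rabs_pos T1) (Rabs_pos t1); lra).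
  assert (Ab := Rle_abs t1). assert (Ab' := Rle_abs (- t1)). rewrite Rabs_Ropp in Ab'.
  destruct (Hex (- b)%R b) as [I HII]; [generalize (Rabs_pos t1); lra|].
  specialize (HT1 (- b)%R b I ltac:(lra) ltac:(lra) ltac:(generalize (Rabs_pos t1); lra) HII).
  assert (HI2 := isI_scal cf _ _ _ _ HII). apply isI_re_im in HI2. destruct HI2 as [HI2 _].
  assert (Low := RInt_lower _ (- b)%R (t1 - dl / 2)%R (t1 + dl / 2)%R b _ (1 / 2 * k2 ^ N)%R ltac:(lra) ltac:(lra) HI2).
  assert (Val : forall t, Rabs (t - t1) <= 2 * dl ->
     Re (cf * (kap (L t) ^ N * f (L t) * tau (L t) * path_derive L t)) = (rker eta (t - t1) ^ N * plateau s1 dl (L t) * Re (f (L t) / f1))%R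
     /\ 1 / 2 <= Re (f (L t) / f1)).
  { intros t Ht. assert (Hs : T < Rabs t).
    { generalize (Rabs_triang (t1 - t) t). replace (t1 - t + t)%R with t1 by ring. rewrite (Rabs_minus_sym t1 t). lra. }
    split.
    - rewrite (path_derive_straight L T t HT Hs). assert (E2 : kap (L t) = RtoC (rker eta (t - t1))).
      { rewrite (HT t) by lra. apply kernel_vline; auto. }
      rewrite E2, <- RtoC_pow. unfold tau.
      replace (cf * (RtoC (rker eta (t - t1) ^ N) * f (L t) * RtoC (plateau s1 dl (L t)) * - Ci))
        with (RtoC (rker eta (t - t1) ^ N * plateau s1 dl (L t)) * (f (L t) / f1)).
      + rewrite re_scal_l. reflexivity.
      + rewrite RtoC_mult. unfold cf. field. split; auto. intros Z. apply Ncf. rewrite Z. ring.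
    - specialize (Hd' t). assert (Hr : Cmod (rsub t t1) < d) by (unfold rsub; rewrite Cmod_R; lra).
      specialize (Hd' Hr).
      assert (Q : Cmod (f (L t) / f1 - 1) <= 1 / 2).
      { replace (f (L t) / f1 - 1) with ((f (L t) - f1) / f1) by (field; auto). rewrite Cmod_div by auto.
        apply Rle_div_l; [auto|]. lra. }
      assert (Q2 := re_le_Cmod (f (L t) / f1 - 1)). rewrite re_sub in Q2. simpl (Re 1) in Q2.
      assert (Q3 := Rle_abs (- (Re (f (L t) / f1) - 1))). rewrite Rabs_Ropp in Q3. lra. }
  assert (Lowv := fun A => Low A). clear Low. cbv beta in Lowv.
  specialize (Lowv ltac:(intros t Ht; destruct (Rle_dec (Rabs (t - t1)) (2 * dl)) as [H|H];
    [destruct (Val t H) as [V1 V2]; rewrite V1; apply Rmult_le_pos; [|lra]; apply Rmult_le_pos; [apply pow_le; left; apply rker_pos; auto|apply plateau_range]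
    |right; unfold tau; rewrite (plateau_0 s1 dl (L t)); [|auto|apply Sep; lra]; symmetry;
     replace (cf * (kap (L t) ^ N * f (L t) * 0 * path_derive L t)) with (RtoC 0) by ring; reflexivity])).
  assert (Low := fun A => Lowv A). clear Lowv. rename Low into Lowv.
  assert (Hmid : forall t, t1 - dl / 2 <= t <= t1 + dl / 2 ->
     (1 / 2 * k2 ^ N <= Re (cf * (kap (L t) ^ N * f (L t) * tau (L t) * path_derive L t))%C)).
  { intros t Ht. assert (H : Rabs (t - t1) <= dl / 2) by (apply Rabs_le; lra).
      destruct (Val t) as [V1 V2]; [lra|]. rewrite V1, plateau_1; auto.
      - rewrite Rmult_1_r. rewrite (Rmult_comm (1 / 2)). apply Rmult_le_compat; [apply pow_le; left; apply rker_pos; auto|lra| |auto].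
        apply pow_incr. split; [left; apply rker_pos; auto|]. apply rker_mono; auto. rewrite (Rabs_pos_eq (dl / 2)) by lra. auto.
      - rewrite (HT t). { unfold s1. rewrite Cmod_vline_sub. lra. }
        generalize (Rabs_triang (t1 - t) t). replace (t1 - t + t)%R with t1 by ring. rewrite (Rabs_minus_sym t1 t). lra. }
  specialize (Lowv Hmid).
  replace (0 - l2) with (- l2) in HT1 by ring.
  assert (F1 : Re (cf * I) <= Cmod (cf * I)) by (eapply Rle_trans; [apply Rle_abs|apply re_le_Cmod]).
  assert (F2 : Cmod I <= Cmod (I - - l2)%C + Cmod l2).
  { replace I with (I - - l2 + - l2) at 1 by ring. eapply Rle_trans; [apply Cmod_triangle|]. rewrite Cmod_opp. lra. }
  rewrite Cmod_mult, Mcf in F1.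
  assert (F3 : / Cmod f1 * Cmod I < gap + K * (M * q ^ N) / Cmod f1).
  { replace (gap + K * (M * q ^ N) / Cmod f1)%R with (/ Cmod f1 * (gap * Cmod f1 + K * (M * q ^ N)))%R by (field; lra).
    apply Rmult_lt_compat_l; [apply Rinv_0_lt_compat; auto|]. lra. }
  unfold gap in F3. replace (t1 + dl / 2 - (t1 - dl / 2))%R with dl in Lowv by field. lra. }
assert (Hk0 : 0 < k2) by lra.
set (X := (K * M / Cmod f1)%R). assert (HX : 0 <= X) by (unfold X; apply Rdiv_le_0_compat; auto; nra).
destruct (pow_lt_1_zero (q / k2) ltac:(rewrite Rabs_pos_eq; [apply Rlt_div_l; lra|apply Rdiv_le_0_compat; lra]) (dl / (2 * (X + 1)))%R) as [N HN].
{ apply Rdiv_lt_0_compat; lra. }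
specialize (HN N (Nat.le_refl _)). specialize (Key N).
rewrite Rabs_pos_eq in HN by (apply pow_le, Rdiv_le_0_compat; lra).
unfold Rdiv in HN at 1. rewrite Rpow_mult_distr, pow_inv in HN.
assert (Pk : 0 < k2 ^ N) by (apply pow_lt; auto). assert (Pq : 0 < q ^ N) by (apply pow_lt; auto).
assert (H1 : q ^ N < dl / (2 * (X + 1)) * k2 ^ N).
{ apply (Rmult_lt_compat_r (k2 ^ N)) in HN; auto. rewrite Rmult_assoc, Rinv_l, Rmult_1_r in HN by lra. auto. }
replace (K * (M * q ^ N) / Cmod f1)%R with (X * q ^ N)%R in Key by (unfold X; field; lra).
assert (H2 : X * q ^ N <= X * (dl / (2 * (X + 1)) * k2 ^ N)) by (apply Rmult_le_compat_l; lra).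
assert (H3 : X * (dl / (2 * (X + 1)) * k2 ^ N) < dl * (1 / 2 * k2 ^ N)).
{ replace (X * (dl / (2 * (X + 1)) * k2 ^ N))%R with (X / (X + 1) * (dl * (1 / 2 * k2 ^ N)))%R by (field; lra).
  rewrite <- (Rmult_1_l (dl * (1 / 2 * k2 ^ N))) at 2. apply Rmult_lt_compat_r; [|apply Rlt_div_l; lra].
  apply Rmult_lt_0_compat; auto. lra. }
lra.
Qed.

End Peak.

Definition strip2 (w : C) : Prop := (0 < Im w < 2 * PI).

Lemma strip2_open : copen strip2. Proof. exact (copen_im _ (oint_between _ _)). Qed.

Lemma strip2_convex : convex strip2. Proof. exact (convex_im _ (oint_between _ _)). Qed.

(** * Weights with vanishing transform *)

Section Null.
Context (L : R -> C) (HL : path_ioo L) (R0 : R).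
Hypothesis HR0 : forall t, Cmod (L t - vline t) <= R0.

Definition null (om : C -> C) : Prop :=
  (forall y, 0 < y < 2 * PI -> expdec L om y) /\ (forall w, strip2 w -> J L om w = 0).

Lemma null_ext f g : (forall t, f (L t) = g (L t)) -> null f -> null g.
Proof.
intros E [H1 H2]. split.
- intros y Hy. apply (expdec_ext L f); auto.
- intros w Hw. rewrite <- (H2 w Hw). symmetry. apply J_ext; auto.
Qed.

Lemma null_scal c f : null f -> null (fun s => c * f s).
Proof.
intros [H1 H2]. split.
- intros y Hy. apply expdec_scal; auto.
- intros w Hw. rewrite J_scal, H2 by auto. ring.
Qed.

Lemma Re_path t : Rabs (Re (L t)) <= R0.
Proof.
eapply Rle_trans; [|apply (HR0 t)]. replace (Re (L t)) with (Re (L t - vline t)) by (rewrite re_sub; simpl; ring). apply re_le_Cmod.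
Qed.

Definition mid (x : R) : C := (x, PI).

(** Since [L] stays within [R0] of the imaginary axis, the transform grows at most like exp (R0 |x|)
    along the line Im w = pi. A pole with |Re p| > R0 gives an exponential that grows faster in one
    direction. *)
Lemma expdec_line_bound om : expdec L om PI -> exists M, 0 <= M /\ forall x t,
  (Cmod (om (L t) * Cexp (mid x * L t)) <= M * exp (R0 * Rabs x) / (1 + t * t)).
Proof.
intros [_ [M [r [HM [Hr H]]]]]. destruct (inv_sq_exp r Hr) as [A [HA0 HA]].
exists (M * exp (PI * R0) * A)%R. assert (P0 := exp_pos (PI * R0)). split; [repeat apply Rmult_le_pos; lra|].
intros x t. rewrite Cmod_mult, Cmod_Cexp.
assert (E : Re (mid x * L t) <= R0 * Rabs x + PI * R0 + PI * t).
{ unfold mid. simpl. assert (B1 := Re_path t).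
  assert (B2 : Rabs (Im (L t) + t) <= R0).
  { eapply Rle_trans; [|apply (HR0 t)]. replace (Im (L t) + t)%R with (Im (L t - vline t)) by (rewrite im_sub; simpl; ring). apply im_le_Cmod. }
  assert (B3 : x * Re (L t) <= R0 * Rabs x).
  { eapply Rle_trans; [apply Rle_abs|]. rewrite Rabs_mult, Rmult_comm. apply Rmult_le_compat_r; [apply Rabs_pos|auto]. }
  assert (B4 := Rle_abs (- (Im (L t) + t))). rewrite Rabs_Ropp in B4. assert (PP := PI_RGT_0). unfold Re, Im in *. nra. }
apply exp_le in E. rewrite !exp_plus in E. specialize (H t). specialize (HA t).
assert (C0 := Cmod_ge_0 (om (L t))). assert (P1 := exp_pos (R0 * Rabs x)). assert (P2 := exp_pos (PI * t)).
apply Rle_trans with (Cmod (om (L t)) * (exp (R0 * Rabs x) * exp (PI * R0) * exp (PI * t)))%R; [apply Rmult_le_compat_l; auto|].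
replace (M * exp (PI * R0) * A * exp (R0 * Rabs x) / (1 + t * t))%R with (exp (R0 * Rabs x) * exp (PI * R0) * (M * (A / (1 + t * t))))%R by (unfold Rdiv; ring).
replace (Cmod (om (L t)) * (exp (R0 * Rabs x) * exp (PI * R0) * exp (PI * t)))%R with (exp (R0 * Rabs x) * exp (PI * R0) * (Cmod (om (L t)) * exp (PI * t)))%R by ring.
apply Rmult_le_compat_l; [apply Rmult_le_pos; lra|]. eapply Rle_trans; [exact H|]. apply Rmult_le_compat_l; auto.
Qed.

Lemma strip2_mid x : strip2 (mid x).
Proof. unfold strip2, mid. simpl. generalize PI_RGT_0. lra. Qed.

Lemma pole_distance p t : Rabs (Re p) - R0 <= Cmod (L t - p).
Proof.
assert (H := re_le_Cmod (L t - p)). rewrite re_sub in H. assert (H1 := Re_path t).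
generalize (Rabs_triang (Re (L t)) (- (Re (L t) - Re p))). rewrite Rabs_Ropp.
replace (Re (L t) + - (Re (L t) - Re p))%R with (Re p) by ring. lra.
Qed.

(* Y = J (om / (s - p)) satisfies Y' = p Y, hence Y = C exp(p w), which outgrows J unless C = 0. *)
Lemma null_pole om p : null om -> R0 < Rabs (Re p) -> null (fun s => / (s - p) * om s).
Proof.
intros [H1 H2] Hp. set (gap := (Rabs (Re p) - R0)%R). assert (Hg : 0 < gap) by (unfold gap; lra).
assert (Nz : forall t, L t - p <> 0).
{ intros t E. generalize (pole_distance p t). rewrite E, Cmod_0. fold gap. lra. }
assert (HE : forall y, 0 < y < 2 * PI -> expdec L (fun s => / (s - p) * om s) y).
{ intros y Hy. apply expdec_mult; auto.
  - intros t. apply (econt_comp rsub Cinv (fun t => L t - p)); [apply ccont_inv; auto|].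
    apply econt_minus; [apply path_cont; auto|apply econt_const].
  - exists (/ gap)%R, O. intros t. rewrite Cmod_inv by auto. simpl. rewrite Rmult_1_r.
    apply Rinv_le_contravar; auto. apply pole_distance. }
split; auto. set (Y := J L (fun s => / (s - p) * om s)).
assert (HY : forall w, strip2 w -> cder Y w (p * Y w)).
{ intros w Hw. eapply eder_eq; [|apply (J_der L HL); apply HE; exact Hw].
  rewrite (J_ext L HL _ (fun s => om s + p * (/ (s - p) * om s))).
  - rewrite J_plus; auto; [|apply expdec_scal; auto]. rewrite J_scal, H2 by auto. unfold Y. ring.
  - intros t. cbv beta. field. auto.
  - apply expdec_ext with (fun s => (s + 0) * (/ (s - p) * om s)); [intros; ring|]. apply expdec_lin; auto. }
assert (HYe : forall w, strip2 w -> Y w = Y (mid 0) * Cexp (p * (w - mid 0))).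
{ intros w Hw. assert (K : Y w * Cexp (- p * w) = Y (mid 0) * Cexp (- p * mid 0)).
  { apply (cder0_const (fun w => Y w * Cexp (- p * w))). intros t Ht.
    eapply eder_eq; [|apply eder_mult; [apply HY; apply strip2_convex; auto using strip2_mid|apply cder_Cexp_lin]]. cbv beta. ring. }
  replace (p * (w - mid 0)) with (- p * mid 0 + - (- p * w)) by ring. rewrite Cexp_plus, Cmult_assoc, <- K.
  rewrite <- Cmult_assoc, (Cmult_comm (Cexp _)), Cexp_neg. ring. }
assert (Y0 : Y (mid 0) = 0).
{ destruct (expdec_line_bound _ (HE PI ltac:(generalize PI_RGT_0; lra))) as [M [HM0 HM]].
  destruct (intL_exists L HL) as [K [HK0 HK]].
  assert (B : forall x, Cmod (Y (mid x)) <= K * (M * exp (R0 * Rabs x))).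
  { intros x. destruct (HK (fun s => / (s - p) * om s * Cexp (mid x * s)) (M * exp (R0 * Rabs x))%R) as [l [Hl Bl]].
    - apply Rmult_le_pos; auto. left; apply exp_pos.
    - intros t. apply (econt_mult rsub (fun t => / (L t - p) * om (L t))); [|apply rcont_Cexp_path; auto].
      apply (HE PI). generalize PI_RGT_0. lra.
    - intros t. apply HM.
    - unfold Y, J. rewrite (intL_path_integral L _ _ Hl). auto. }
  apply Cmod_le_eps_0. intros e He. destruct (exp_small (K * M) gap e Hg He) as [X [HX0 HX]].
  eapply Rle_trans; [|apply (HX X (Rle_refl _))].
  assert (Q : forall x, (Rabs x = X)%R -> (Re p * x = Rabs (Re p) * X)%R -> Cmod (Y (mid 0)) <= K * M * exp (- (gap * X))).
  { intros x Hx Hpx. specialize (B x). rewrite (HYe (mid x) (strip2_mid x)), Cmod_mult, Cmod_Cexp in B.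
    assert (E : Re (p * (mid x - mid 0)) = (Rabs (Re p) * X)%R) by (replace (mid x - mid 0) with (RtoC x) by (unfold mid; apply C_ext; simpl; ring); rewrite Cmult_comm, re_scal_l, <- Hpx; ring).
    rewrite E, Hx in B. apply (Rmult_le_compat_r (exp (- (Rabs (Re p) * X)))) in B; [|left; apply exp_pos].
    rewrite Rmult_assoc, <- exp_plus in B. replace (Rabs (Re p) * X + - (Rabs (Re p) * X))%R with 0%R in B by ring. rewrite exp_0, Rmult_1_r in B.
    eapply Rle_trans; [exact B|]. right. unfold gap. rewrite <- Rmult_assoc, (Rmult_assoc (K * M)), <- exp_plus. do 2 f_equal. ring. }
  destruct (Rle_dec 0 (Re p)).
  - apply (Q X); rewrite ?Rabs_pos_eq by lra; auto.
  - apply (Q (- X)%R); [rewrite Rabs_Ropp, Rabs_pos_eq; lra|]. rewrite Rabs_left by lra. ring. }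
intros w Hw. fold (Y w). rewrite HYe by auto. rewrite Y0. ring.
Qed.

(** The kernel is a constant times the product of two simple fractions, with poles at vertical
    distance 0 and horizontal distance eta > R0 from [vline t1], so each power costs two
    applications of [null_pole]. *)
Lemma null_kernel eta t1 om N : null om -> R0 < eta -> null (fun s => kernel eta (vline t1) s ^ N * om s).
Proof.
intros H He. assert (HR : 0 <= R0) by (eapply Rle_trans; [apply Cmod_ge_0|apply (HR0 0%R)]).
induction N; [apply (null_ext om); auto; intros; simpl; ring|].
assert (P1 : Re (vline t1 + RtoC eta) = eta) by (simpl; ring).
assert (P2 : Re (vline t1 - RtoC eta) = (- eta)%R) by (simpl; ring).
apply (null_pole _ (vline t1 + RtoC eta)) in IHN; [|rewrite P1, Rabs_pos_eq; lra].
apply (null_pole _ (vline t1 - RtoC eta)) in IHN; [|rewrite P2, Rabs_Ropp, Rabs_pos_eq; lra].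
apply (null_scal (- RtoC (eta * eta))) in IHN. revert IHN. apply null_ext. intros t.
assert (N1 : L t - (vline t1 + RtoC eta) <> 0).
{ intros E. generalize (pole_distance (vline t1 + RtoC eta) t). rewrite E, Cmod_0, P1, Rabs_pos_eq; lra. }
assert (N2 : L t - (vline t1 - RtoC eta) <> 0).
{ intros E. generalize (pole_distance (vline t1 - RtoC eta) t). rewrite E, Cmod_0, P2, Rabs_Ropp, Rabs_pos_eq; lra. }
change (kernel eta (vline t1) (L t) ^ S N) with (kernel eta (vline t1) (L t) * kernel eta (vline t1) (L t) ^ N).
set (k := kernel eta (vline t1) (L t) ^ N). unfold kernel. rewrite RtoC_mult.
set (s := L t) in *. set (v := vline t1) in *. set (h := RtoC eta) in *.
assert (F : h * h - (s - v) * (s - v) = - ((s - (v + h)) * (s - (v - h)))) by ring.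
rewrite F. field; repeat split; auto.
Qed.

Theorem null_vanishes om : null om -> exists T, forall t, T <= Rabs t -> om (vline t) = 0.
Proof.
intros H. assert (HR : 0 <= R0) by (eapply Rle_trans; [apply Cmod_ge_0|apply (HR0 0%R)]).
destruct (path_straight L HL) as [T [HT1 HT]].
(* The threshold of [peak] for eta = R0 + 1, the kernel width that puts its poles off [L]. *)
exists (T + R0 + 2 * (R0 + 1) + 2)%R. intros t1 Ht1.
assert (HPI : 0 < PI < 2 * PI) by (generalize PI_RGT_0; lra).
destruct (expdec_line_bound om (proj1 H PI HPI)) as [M [HM0 HM]].
assert (Z : om (vline t1) * Cexp (mid 0 * vline t1) = 0).
{ apply (peak L HL (fun s => om s * Cexp (mid 0 * s)) M T R0 (R0 + 1) t1); auto; try lra.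
  - intros t. apply (econt_mult rsub (fun t => om (L t))); [apply (proj1 H PI HPI)|apply rcont_Cexp_path; auto].
  - intros t. generalize (HM 0%R t). rewrite Rabs_R0, Rmult_0_r, exp_0, Rmult_1_r. auto.
  - intros t. apply (econt_mult rsub (fun _ => RtoC ((R0 + 1) * (R0 + 1)))); [apply econt_const|].
    apply (econt_comp rsub Cinv (fun t => RtoC ((R0 + 1) * (R0 + 1)) - (L t - vline t1) * (L t - vline t1))).
    + apply ccont_inv. intros E.
      assert (F : (L t - (vline t1 + RtoC (R0 + 1))) * (L t - (vline t1 - RtoC (R0 + 1))) = 0).
      { replace (RtoC 0) with (- RtoC 0) by ring. rewrite <- E, RtoC_mult. ring. }
      apply (f_equal Cmod) in F. rewrite Cmod_mult, Cmod_0 in F.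
      assert (D1 := pole_distance (vline t1 + RtoC (R0 + 1)) t). assert (D2 := pole_distance (vline t1 - RtoC (R0 + 1)) t).
      replace (Re (vline t1 + RtoC (R0 + 1))) with (R0 + 1)%R in D1 by (simpl; ring).
      replace (Re (vline t1 - RtoC (R0 + 1))) with (- (R0 + 1))%R in D2 by (simpl; ring).
      rewrite Rabs_Ropp in D2. rewrite Rabs_pos_eq in D1, D2 by lra. nra.
    + apply econt_minus; [apply econt_const|]. apply econt_mult; apply econt_minus; try apply econt_const; apply path_cont; auto.
  - intros N. destruct (null_kernel (R0 + 1) t1 om N H ltac:(lra)) as [K1 K2].
    rewrite <- (K2 (mid 0) (strip2_mid 0)).
    apply (intL_ext L (fun s => kernel (R0 + 1) (vline t1) s ^ N * om s * Cexp (mid 0 * s))); [intros; ring|].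
    apply J_intL; auto. }
destruct (Ceq_dec (om (vline t1)) 0) as [E|E]; auto. exfalso. revert Z. apply Cmult_neq_0; auto. apply Cexp_neq_0.
Qed.

Lemma expdec_twist om h y : expdec L om (y + Im h) -> expdec L (fun s => om s * Cexp (h * s)) y.
Proof.
intros [Hc [M [r [HM [Hr H]]]]]. destruct (Cmod_Cexp_path L HL) as [Q [HQ0 HQ]]. split.
- intros t. apply (econt_mult rsub (fun t => om (L t))); auto. apply rcont_Cexp_path; auto.
- exists (M * exp (Cmod h * Q))%R, r. assert (P := exp_pos (Cmod h * Q)). split; [apply Rmult_le_pos; lra|]. split; auto.
  intros t. specialize (H t). specialize (HQ h t). rewrite Cmod_mult. rewrite Rmult_plus_distr_r, exp_plus in H.
  assert (P1 := exp_pos (y * t)). assert (C0 := Cmod_ge_0 (om (L t))).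
  apply Rle_trans with (Cmod (om (L t)) * (exp (Cmod h * Q) * exp (Im h * t)) * exp (y * t))%R.
  + apply Rmult_le_compat_r; [lra|]. apply Rmult_le_compat_l; auto.
  + replace (Cmod (om (L t)) * (exp (Cmod h * Q) * exp (Im h * t)) * exp (y * t))%R with (Cmod (om (L t)) * (exp (y * t) * exp (Im h * t)) * exp (Cmod h * Q))%R by ring.
    replace (M * exp (Cmod h * Q) * exp (- (r * Rabs t)))%R with (M * exp (- (r * Rabs t)) * exp (Cmod h * Q))%R by ring.
    apply Rmult_le_compat_r; lra.
Qed.

Lemma J_twist om h w : J L (fun s => om s * Cexp (h * s)) w = J L om (w + h).
Proof.
unfold J. f_equal. apply functional_extensionality. intros s. rewrite <- Cmult_assoc, <- Cexp_plus. do 2 f_equal. ring.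
Qed.

Lemma J_Csum (f : nat -> C -> C) m w : (forall j, (j < m)%nat -> expdec L (f j) (Im w)) ->
  expdec L (fun _ => 0) (Im w) ->
  expdec L (fun s => Csum (fun j => f j s) m) (Im w) /\ J L (fun s => Csum (fun j => f j s) m) w = Csum (fun j => J L (f j) w) m.
Proof.
intros H H0. induction m; simpl.
- split; auto. rewrite (J_ext L HL _ (fun s => 0 * (fun _ => 0) s)); auto; [|intros; ring]. rewrite J_scal by auto. ring.
- destruct IHm as [I1 I2]; [intros; apply H; lia|]. split; [apply expdec_plus; auto|]. rewrite J_plus, I2; auto.
Qed.

End Null.

(** Letting x tend to 0 gives c 0 = 0; dividing by x lowers the degree. An interval at 0 is what the
    far end of the path provides. *)
Lemma polynomial_zero n : forall (c : nat -> C) x0, 0 < x0 ->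
  (forall x, 0 < x < x0 -> Csum (fun j => c j * RtoC x ^ j) n = 0) -> forall j, (j < n)%nat -> c j = 0.
Proof.
induction n; intros c x0 Hx0 H j Hj; [lia|].
assert (C0 : c O = 0).
{ assert (K : ccont (fun z => Csum (fun j => c j * z ^ j) (S n)) 0).
  { apply (econt_Csum Cminus (fun j z => c j * z ^ j)). intros k _. apply econt_mult; [apply econt_const|]. eapply eder_cont, cder_pow. }
  assert (V : Csum (fun j => c j * 0 ^ j) (S n) = c O).
  { rewrite Csum_shift. rewrite (Csum_ext _ (fun _ => 0)), Csum_0; [simpl; ring|]. intros k _. simpl. ring. }
  apply Cmod_le_eps_0. intros e He. destruct (K e He) as [d [Hd HK]]. cbv beta in HK. rewrite V in HK.
  set (x := (Rmin x0 d / 2)%R). assert (Hx : (0 < x < x0 /\ x < d)%R).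
  { assert (0 < Rmin x0 d) by (apply Rmin_case; auto). generalize (Rmin_l x0 d) (Rmin_r x0 d). unfold x. lra. }
  specialize (HK (RtoC x)). replace (RtoC x - 0) with (RtoC x) in HK by ring. rewrite Cmod_R, Rabs_pos_eq in HK by lra.
  specialize (HK ltac:(lra)). rewrite H in HK by lra. replace (0 - c O) with (- c O) in HK by ring. rewrite Cmod_opp in HK. lra. }
destruct j; auto. apply (IHn (fun j => c (S j)) x0 Hx0); [|lia]. intros x Hx. specialize (H x Hx).
rewrite Csum_shift, C0 in H.
assert (Nx : RtoC x <> 0) by (apply RtoC_neq; lra).
replace (Csum (fun j => c (S j) * RtoC x ^ j) n) with (/ RtoC x * (0 * RtoC x ^ 0 + Csum (fun k => c (S k) * RtoC x ^ S k) n)).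
- rewrite H. ring.
- rewrite Cmult_plus_distr_l, <- Csum_scal. replace (/ RtoC x * (0 * RtoC x ^ 0)) with (RtoC 0) by ring. rewrite Cplus_0_l.
  apply Csum_ext. intros k _. simpl. field. auto.
Qed.

Theorem mb_independent n alpha beta L (HL : mellin_barnes_path n alpha beta L) (c : nat -> C) :
  (forall w, strip2 w -> Csum (fun j => c j * J L (mb_weight n alpha beta) (shift w j)) n = 0) ->
  forall j, (j < n)%nat -> c j = 0.
Proof.
intros H. assert (HP := proj1 HL). destruct (path_near_vline L HP) as [R0 [_ HR0]].
set (W := mb_weight n alpha beta). fold W in H.
set (om := fun s => Csum (fun j => c j * (W s * Cexp (RtoC (INR j) * period * s))) n).
assert (HPI := PI_RGT_0).
assert (HE : forall j y, (j < n)%nat -> 0 < y < 2 * PI -> expdec L (fun s => c j * (W s * Cexp (RtoC (INR j) * period * s))) y).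
{ intros j y Hj Hy. apply expdec_scal; auto. apply (expdec_twist L HP). apply (expdec_mb_weight n alpha beta L HL).
  rewrite im_scal_l, im_period. assert (J0 := pos_INR j). apply le_INR in Hj. rewrite S_INR in Hj. nra. }
assert (H0 : forall y, (0 < n)%nat -> 0 < y < 2 * PI -> expdec L (fun _ => 0) y).
{ intros y Hn Hy. apply (expdec_ext L (fun s => 0 * (c O * (W s * Cexp (RtoC (INR 0) * period * s))))); [intros; ring|].
  apply expdec_scal; auto. }
intros j Hj.
assert (N : null L om).
{ split.
  - intros y Hy. apply (J_Csum L HP (fun j s => c j * (W s * Cexp (RtoC (INR j) * period * s))) n (0, y)); simpl; [auto|apply H0; auto; lia].
  - intros w Hw. unfold om. rewrite (proj2 (J_Csum L HP (fun j s => c j * (W s * Cexp (RtoC (INR j) * period * s))) n w (fun j Hj => HE j _ Hj Hw) (H0 _ ltac:(lia) Hw))).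
    rewrite <- (H w Hw). apply Csum_ext. intros i Hi. rewrite J_scal; auto.
    + rewrite J_twist. reflexivity.
    + apply (expdec_twist L HP). apply (expdec_mb_weight n alpha beta L HL).
      rewrite im_scal_l, im_period. unfold strip2 in Hw. assert (J0 := pos_INR i). apply le_INR in Hi. rewrite S_INR in Hi. nra. }
destruct (null_vanishes L HP R0 HR0 om N) as [T HT].
destruct (path_straight L HP) as [T' [HT1 HT']].
assert (TM := Rmax_l T T'). assert (TM' := Rmax_r T T'). set (T2 := Rmax T T') in *.
apply (polynomial_zero n c (exp (- (2 * PI * T2)))); auto; [apply exp_pos|]. intros x Hx.
(* Chosen so that e^(2 pi i s) = x at s = [vline t]; a small x corresponds to a distant point of the
   imaginary axis. *)
set (t := (ln x / (2 * PI))%R).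
assert (Ht : t < - T2).
{ unfold t. apply Rlt_div_l; [lra|]. rewrite <- (ln_exp (- T2 * (2 * PI))). apply ln_increasing; [lra|].
  replace (- T2 * (2 * PI))%R with (- (2 * PI * T2))%R by ring. lra. }
assert (Rt : T2 <= Rabs t) by (rewrite Rabs_left by lra; lra).
specialize (HT t ltac:(lra)). unfold om in HT.
assert (NW : W (vline t) <> 0).
{ rewrite <- HT' by lra. unfold W, mb_weight. apply Cmult_neq_0; [|apply Cexp_neq_0].
  unfold gamma_prod. assert (Q : forall m, (m <= n)%nat -> Cprod (fun k => Gamma (alpha k + L t) * Gamma (1 - beta k - L t)) m <> 0).
  { induction m; intros Hm; simpl; [exact C1_nz|]. apply Cmult_neq_0; [apply IHm; lia|].
    apply Cmult_neq_0; apply Gamma_neq_0; [apply (mb_not_pole_l n alpha beta L HL)|apply (mb_not_pole_r n alpha beta L HL)]; lia. }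
  apply Q; auto. }
assert (E : W (vline t) * Csum (fun j => c j * RtoC x ^ j) n = 0).
{ rewrite <- Csum_scal, <- HT. apply Csum_ext. intros i _.
  replace (Cexp (RtoC (INR i) * period * vline t)) with (RtoC x ^ i); [ring|].
  rewrite <- Cmult_assoc, Cexp_pow. f_equal.
  replace (period * vline t) with (RtoC (ln x)).
  - rewrite Cexp_RtoC, exp_ln; auto. lra.
  - unfold period, vline, t. apply C_ext; simpl; field; lra. }
destruct (Ceq_dec (Csum (fun j => c j * RtoC x ^ j) n) 0) as [E1|E1]; auto. exfalso. revert E. apply Cmult_neq_0; auto.
Qed.

(** * The Mellin-Barnes basis *)

Lemma ex_derive_iff (f : C -> C) z : ex_derive f z <-> exists l, cder f z l.
Proof. split; intros [l H]; exists l; apply cder_iff; auto. Qed.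

Lemma lin_comb_Csum n c F z : (1 <= n)%nat -> lin_comb n c F z = Csum (fun j => c j * F j z) n.
Proof.
intros Hn. unfold lin_comb. destruct n; [lia|]. simpl pred. clear Hn.
induction n; [rewrite sum_O; simpl; ring|]. rewrite sum_Sn, IHn. reflexivity.
Qed.

Lemma Dprod_ext U c f g : copen U -> hol U f -> (forall w, U w -> f w = g w) -> forall m w, U w -> Dprod c m f w = Dprod c m g w.
Proof.
intros HU Hf E. induction m; intros w Hw; simpl; auto. rewrite IHm by auto. f_equal.
symmetry. apply cder_C_derive. apply (cder_ext_open U (Dprod c m f)); auto.
apply (hol_der U); auto. apply Dprod_hol; auto.
Qed.

Lemma Dprod_translate U c f k h : copen U -> hol U f -> forall m w, U (w + h) ->
  Dprod c m (fun w => k * f (w + h)) w = k * Dprod c m f (w + h).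
Proof.
intros HU Hf. induction m; intros w Hw; [reflexivity|].
change (C_derive (Dprod c m (fun w => k * f (w + h))) w + c (S m) * Dprod c m (fun w => k * f (w + h)) w
  = k * (C_derive (Dprod c m f) (w + h) + c (S m) * Dprod c m f (w + h))).
rewrite IHm by auto.
rewrite (cder_C_derive _ _ (k * C_derive (Dprod c m f) (w + h))); [ring|].
apply (cder_ext_open (fun w => U (w + h)) (fun w => k * Dprod c m f (w + h))); auto.
- intros z Hz. destruct (HU _ Hz) as [d [Hd H]]. exists d. split; auto. intros y Hy. apply H.
  replace (y + h - (z + h)) with (y - z) by ring. auto.
- intros y Hy. symmetry. apply IHm; auto.
- apply eder_scal. apply cder_translate. apply (hol_der U); auto. apply Dprod_hol; auto.
Qed.

Lemma theta_prod_hol U c m f : copen U -> hol U f -> hol U (theta_prod c m f).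
Proof.
intros HU Hf. induction m; simpl; auto. intros z Hz. unfold theta.
destruct (hol_C_derive U _ HU IHm z Hz) as [l1 H1]. destruct (IHm z Hz) as [l2 H2].
eexists. apply eder_plus; [apply eder_mult; [apply cder_id|exact H1]|apply eder_scal; exact H2].
Qed.

Lemma theta_prod_Cexp c f : hol slit_plane f -> forall m w, strip2 w ->
  theta_prod c m f (Cexp w) = Dprod c m (fun w => f (Cexp w)) w.
Proof.
intros Hf. induction m; intros w Hw; [reflexivity|].
change (Cexp w * C_derive (theta_prod c m f) (Cexp w) + c (S m) * theta_prod c m f (Cexp w)
  = C_derive (Dprod c m (fun w => f (Cexp w))) w + c (S m) * Dprod c m (fun w => f (Cexp w)) w).
rewrite IHm by auto. f_equal. symmetry. apply cder_C_derive.
apply (cder_ext_open strip2 (fun w => theta_prod c m f (Cexp w))); auto using strip2_open.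
eapply eder_eq; [|apply (eder_comp Cminus (theta_prod c m f) Cexp); [|apply cder_Cexp]].
- apply Cmult_comm.
- apply (hol_der slit_plane); auto using slit_open; [apply theta_prod_hol; auto using slit_open|].
  apply clog_unique; auto.
Qed.

Definition log_solution (n : nat) (alpha beta : nat -> C) (phi : C -> C) : Prop :=
  hol strip2 phi /\ forall w, strip2 w -> Cexp w * Dprod alpha n phi w = Dprod (fun k => beta k - 1) n phi w.

Lemma hol_comp U V (f g : C -> C) : hol V f -> hol U g -> (forall z, U z -> V (g z)) -> hol U (fun z => f (g z)).
Proof.
intros Hf Hg H z Hz. destruct (Hg z Hz) as [l Hl]. destruct (Hf _ (H z Hz)) as [m Hm].
eexists. apply (eder_comp Cminus f g); eauto.
Qed.

Lemma clog_hol : hol slit_plane clog.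
Proof. intros z Hz. eexists. apply cder_clog; auto. Qed.

Lemma log_solution_of n alpha beta f : hypergeometric_solution n alpha beta f -> log_solution n alpha beta (fun w => f (Cexp w)).
Proof.
intros [H1 H2].
assert (Hf : hol slit_plane f) by (intros z Hz; apply ex_derive_iff; auto).
assert (S : forall w, strip2 w -> slit_plane (Cexp w)) by (intros; apply clog_unique; auto).
split.
- apply (hol_comp strip2 slit_plane); auto. intros w _. eexists. apply cder_Cexp.
- intros w Hw. rewrite <- !theta_prod_Cexp by auto. specialize (H2 (Cexp w) (S w Hw)). apply Ceq_minus. exact H2.
Qed.

Lemma solution_of_log n alpha beta phi : log_solution n alpha beta phi -> hypergeometric_solution n alpha beta (fun z => phi (clog z)).
Proof.
intros [H1 H2].
assert (Hf : hol slit_plane (fun z => phi (clog z))).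
{ apply (hol_comp slit_plane strip2); auto using clog_hol. intros z Hz. apply Im_clog; auto. }
split; [intros z Hz; apply ex_derive_iff; auto|].
intros z Hz. assert (Hw : strip2 (clog z)) by (apply Im_clog; auto).
assert (Ez := Cexp_clog z (slit_neq_0 z Hz)). revert Ez. set (w := clog z) in *. clearbody w. intros <-.
rewrite !theta_prod_Cexp by auto.
assert (E : forall w, strip2 w -> phi w = phi (clog (Cexp w))).
{ intros v Hv. rewrite (proj2 (clog_unique v Hv)). reflexivity. }
rewrite <- (Dprod_ext strip2 alpha phi) by auto using strip2_open.
rewrite <- (Dprod_ext strip2 (fun k => beta k - 1) phi) by auto using strip2_open. rewrite H2 by auto. ring.
Qed.

Section Basis.
Context (n : nat) (alpha beta : nat -> C) (L : R -> C) (hn : (1 <= n)%nat) (HL : mellin_barnes_path n alpha beta L).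

Definition mb_const : C := (-1) ^ n / (2 * RtoC PI * Ci) ^ n.

Lemma mb_const_neq_0 : mb_const <> 0.
Proof.
assert (N : 2 * RtoC PI * Ci <> 0).
{ intros E. apply (f_equal Im) in E. fold period in E. rewrite im_period in E. simpl in E. generalize PI_RGT_0. lra. }
apply Cpow_nz with (n := n) in N. unfold mb_const. intros E.
assert (Z : (-1) ^ n = 0) by (transitivity ((-1) ^ n / (2 * RtoC PI * Ci) ^ n * (2 * RtoC PI * Ci) ^ n); [field; auto|rewrite E; ring]).
revert Z. apply Cpow_nz. intros Z. apply (f_equal Re) in Z. simpl in Z. lra.
Qed.

Definition G : C -> C := J L (mb_weight n alpha beta).

(** e^((2 j - n) pi i s) z^s = e^(- n pi i s) e^((log z + 2 pi i j) s), so j enters only as a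
    translation of the variable. *)
Lemma mellin_barnes_G j z : mellin_barnes n alpha beta L j z = mb_const * G (clog z + RtoC (INR j) * period).
Proof.
unfold mellin_barnes, mb_const, G, J. f_equal. f_equal. apply functional_extensionality. intros s.
unfold mb_weight, cpow. fold (clog z). unfold gamma_prod. rewrite <- !Cmult_assoc. f_equal.
rewrite <- !Cexp_plus. f_equal. unfold rot, period. rewrite RtoC_minus, RtoC_mult. ring.
Qed.

Definition wide_strip (w : C) : Prop := (0 < Im w < 2 * PI * INR n).

Lemma wide_strip_open : copen wide_strip. Proof. exact (copen_im _ (oint_between _ _)). Qed.

Lemma wide_strip_convex : convex wide_strip. Proof. exact (convex_im _ (oint_between _ _)). Qed.

Lemma G_hol : hol wide_strip G.
Proof.
intros w Hw. eexists. apply J_der; [exact (proj1 HL)|]. apply (expdec_mb_weight n alpha beta L HL). exact Hw.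
Qed.

Lemma G_equation w : wide_strip w -> Cexp w * Dprod alpha n G w = Dprod (fun k => beta k - 1) n G w.
Proof. apply (mb_ode n alpha beta L HL). Qed.

Lemma wide_strip_shift j w : (j < n)%nat -> strip2 w -> wide_strip (shift w j).
Proof.
intros Hj Hw. unfold strip2, wide_strip in *. rewrite im_plus, im_scal_l, im_period.
assert (J0 := pos_INR j). apply le_INR in Hj. rewrite S_INR in Hj. generalize PI_RGT_0. nra.
Qed.

Lemma Cexp_periods w j : Cexp (shift w j) = Cexp w.
Proof. rewrite Cmult_comm. apply Cexp_period. Qed.

Lemma log_solution_G j : (j < n)%nat -> log_solution n alpha beta (fun w => mb_const * G (shift w j)).
Proof.
intros Hj. split.
- intros w Hw. destruct (G_hol _ (wide_strip_shift j w Hj Hw)) as [l Hl]. eexists. apply eder_scal. apply cder_translate. exact Hl.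
- intros w Hw. assert (Hw' := wide_strip_shift j w Hj Hw).
  rewrite !(Dprod_translate wide_strip) by auto using wide_strip_open, G_hol.
  rewrite <- G_equation, Cexp_periods by auto. ring.
Qed.

Lemma mb_hypergeometric_solution j : (j < n)%nat -> hypergeometric_solution n alpha beta (mellin_barnes n alpha beta L j).
Proof.
intros Hj. replace (mellin_barnes n alpha beta L j) with (fun z => (fun w => mb_const * G (shift w j)) (clog z)).
- apply (solution_of_log n alpha beta (fun w => mb_const * G (shift w j))), log_solution_G; auto.
- apply functional_extensionality. intros z. rewrite mellin_barnes_G. reflexivity.
Qed.

Lemma log_basis_independent (c : nat -> C) : 
  (forall w, strip2 w -> Csum (fun j => c j * (mb_const * G (shift w j))) n = 0) -> forall j, (j < n)%nat -> c j = 0.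
Proof.
intros H. apply (mb_independent n alpha beta L HL). intros w Hw. specialize (H w Hw).
rewrite (Csum_ext _ (fun j => mb_const * (c j * G (shift w j)))), Csum_scal in H by (intros; ring).
fold G. set (X := Csum _ _) in *. destruct (Ceq_dec X 0) as [E|E]; auto. exfalso. revert H. apply Cmult_neq_0; auto using mb_const_neq_0.
Qed.

Lemma strip2_exp_neq_1 w : strip2 w -> 1 - Cexp w <> 0.
Proof.
intros Hw E. apply (proj1 (clog_unique w Hw)). replace (Cexp w) with (RtoC 1); [simpl; lra|].
transitivity (1 - (1 - Cexp w)); [rewrite E|]; ring.
Qed.

Theorem mb_basis : basis_of_solutions n alpha beta (mellin_barnes n alpha beta L).
Proof.
split; [exact mb_hypergeometric_solution|]. split.
- intros c H. apply log_basis_independent. intros w Hw. destruct (clog_unique w Hw) as [S E].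
  rewrite <- (H (Cexp w) S), lin_comb_Csum by auto. apply Csum_ext. intros j _. rewrite mellin_barnes_G, E. reflexivity.
- intros f Hf. destruct (log_solution_of _ _ _ _ Hf) as [Hphi1 Hphi2]. set (phi := fun w => f (Cexp w)) in *.
  set (b := fun k => beta k - 1) in *. set (a := companion n (Dcoef alpha b n) b qexp).
  set (g := fun j w => mb_const * G (shift w j)).
  assert (Hg : forall j, (j < n)%nat -> linsys n a strip2 (fun k => Dprod b k (g j))).
  { intros j Hj. destruct (log_solution_G j Hj). apply companion_of_equation; auto using strip2_open, strip2_exp_neq_1. }
  assert (Ha : forall k j z, (k < n)%nat -> (j < n)%nat -> strip2 z -> ccont (a k j) z).
  { intros. apply companion_qexp_cont. apply strip2_exp_neq_1; auto. }
  (* Row j is the initial vector of the j-th function at [mid 0]. A combination of rows equal to 0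
     would vanish identically by uniqueness, against independence; otherwise the initial vector of
     [phi] is matched, and uniqueness identifies the two solutions. *)
  destruct (LinAlg.kernel_or_solvable n (fun j k => Dprod b k (g j) (mid 0))) as [[c [[j0 [Hj0 Hc0]] Hc]]|Hs].
  + exfalso. apply Hc0. apply log_basis_independent; auto. intros w Hw.
    apply (linsys_unique n a strip2 (fun k w => Csum (fun j => c j * Dprod b k (g j) w) n) (mid 0)) with (k := O); auto using strip2_convex, strip2_mid.
    apply (linsys_comb n a strip2 n c (fun j k => Dprod b k (g j))); auto.
  + destruct (Hs (fun k => Dprod b k phi (mid 0))) as [c Hc]. exists c. intros z Hz.
    assert (Hw : strip2 (clog z)) by (apply Im_clog; auto).
    rewrite lin_comb_Csum by auto.
    rewrite (Csum_ext _ (fun j => c j * Dprod b 0 (g j) (clog z))) by (intros; rewrite mellin_barnes_G; reflexivity).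
    replace (f z) with (Dprod b 0 phi (clog z)) by (unfold phi; simpl; rewrite Cexp_clog; auto using slit_neq_0).
    apply Ceq_minus.
    apply (linsys_unique n a strip2 (fun k w => Dprod b k phi w - Csum (fun j => c j * Dprod b k (g j) w) n) (mid 0)) with (k := O); auto using strip2_convex, strip2_mid.
    * apply linsys_minus; [|apply (linsys_comb n a strip2 n c (fun j k => Dprod b k (g j))); auto].
      apply companion_of_equation; auto using strip2_open, strip2_exp_neq_1.
    * intros k Hk. rewrite <- (Hc k Hk). ring.
Qed.

End Basis.

(** * Analytic continuation *)

Definition near (z : C) (P : C -> Prop) : Prop := exists d, 0 < d /\ forall y, Cmod (y - z) < d -> P y.

Lemma near_and z P Q : near z P -> near z Q -> near z (fun y => P y /\ Q y).
Proof.
intros [d [Hd H]] [e [He K]]. exists (Rmin d e). split; [apply Rmin_case; auto|].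
intros y Hy. split; [apply H|apply K]; eapply Rlt_le_trans; eauto; [apply Rmin_l|apply Rmin_r].
Qed.

Lemma near_impl z (P Q : C -> Prop) : (forall y, P y -> Q y) -> near z P -> near z Q.
Proof. intros H [d [Hd K]]. exists d. auto. Qed.

Lemma near_all z (P : C -> Prop) : (forall y, P y) -> near z P.
Proof. intros H. exists 1%R. split; [lra|auto]. Qed.

Lemma near_open U z : copen U -> U z -> near z U.
Proof. intros H Hz. apply H; auto. Qed.

Definition Iab (a b t : R) : Prop := (a <= t <= b).

(** The conditions of [analytic_continuation] over an arbitrary parameter interval, so that arcs of
    a path can be treated separately and glued. *)
Definition family (gamma : R -> C) (a b : R) (Phi : R -> C -> C) : Prop :=
  (forall t, Iab a b t -> near (gamma t) (fun z => exists l, cder (Phi t) z l)) /\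
  (forall t, Iab a b t -> exists d, 0 < d /\ forall u, Iab a b u -> Rabs (u - t) < d ->
     near (gamma u) (fun z => Phi u z = Phi t z)).

Definition acont (gamma : R -> C) (a b : R) (f g : C -> C) : Prop :=
  exists Phi, family gamma a b Phi /\ near (gamma a) (fun z => Phi a z = f z) /\ near (gamma b) (fun z => Phi b z = g z).

Definition cont_on (gamma : R -> C) (a b : R) : Prop :=
  forall t, Iab a b t -> forall e, 0 < e -> exists d, 0 < d /\ forall u, Iab a b u -> Rabs (u - t) < d ->
    (Cmod (gamma u - gamma t) < e).

Lemma acont_iff gamma f g : acont gamma 0 1 f g <-> analytic_continuation gamma f g.
Proof.
split.
- intros [Phi [[H1 H2] [H3 H4]]]. exists Phi. split; [|split; [|split; apply locally_C_iff; auto]].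
  + intros t Ht. apply locally_C_iff. destruct (H1 t Ht) as [d [Hd H]]. exists d. split; auto.
    intros y Hy. apply ex_derive_iff. auto.
  + intros t Ht. destruct (H2 t Ht) as [d [Hd H]]. exists d. split; auto. intros u Hu Hut. apply locally_C_iff. apply H; auto.
- intros [Phi [H1 [H2 [H3 H4]]]]. exists Phi. split; [split|split; apply locally_C_iff; auto].
  + intros t Ht. specialize (H1 t Ht). apply locally_C_iff in H1. destruct H1 as [d [Hd H]]. exists d. split; auto.
    intros y Hy. apply ex_derive_iff. auto.
  + intros t Ht. destruct (H2 t Ht) as [d [Hd H]]. exists d. split; auto. intros u Hu Hut. apply locally_C_iff. apply H; auto.
Qed.

Lemma acont_ext gamma a b f g f' g' : near (gamma a) (fun z => f z = f' z) -> near (gamma b) (fun z => g z = g' z) ->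
  acont gamma a b f g -> acont gamma a b f' g'.
Proof.
intros Hf Hg [Phi [HF [H1 H2]]]. exists Phi. split; auto. split.
- apply (near_impl _ _ _ (fun y H => eq_trans (proj1 H) (proj2 H)) (near_and _ _ _ H1 Hf)).
- apply (near_impl _ _ _ (fun y H => eq_trans (proj1 H) (proj2 H)) (near_and _ _ _ H2 Hg)).
Qed.

Lemma acont_hol U gamma a b f : copen U -> hol U f -> (forall t, Iab a b t -> U (gamma t)) -> acont gamma a b f f.
Proof.
intros HU Hf Hg. exists (fun _ => f). split; [split|split; apply near_all; auto].
- intros t Ht. apply (near_impl _ U); auto. apply near_open; auto.
- intros t Ht. exists 1%R. split; [lra|]. intros. apply near_all; auto.
Qed.

Lemma family_path_ext gamma gamma' a b Phi : (forall t, Iab a b t -> gamma t = gamma' t) -> family gamma a b Phi -> family gamma' a b Phi.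
Proof.
intros E [H1 H2]. split.
- intros t Ht. rewrite <- E by auto. auto.
- intros t Ht. destruct (H2 t Ht) as [d [Hd H]]. exists d. split; auto. intros u Hu Hut. rewrite <- E by auto. auto.
Qed.

Lemma family_reparam gamma a b Phi (phi : R -> R) a' b' K : 0 < K -> (forall t, Iab a' b' t -> Iab a b (phi t)) ->
  (forall t u, Rabs (phi u - phi t) <= K * Rabs (u - t)) -> family gamma a b Phi ->
  family (fun t => gamma (phi t)) a' b' (fun t => Phi (phi t)).
Proof.
intros HK Hphi Hlip [H1 H2]. split; [intros t Ht; auto|].
intros t Ht. destruct (H2 (phi t) (Hphi t Ht)) as [d [Hd H]]. exists (d / K)%R. split; [apply Rdiv_lt_0_compat; auto|].
intros u Hu Hut. apply H; auto. eapply Rle_lt_trans; [apply Hlip|]. apply Rlt_div_r in Hut; auto. rewrite Rmult_comm. auto.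
Qed.

Lemma cont_reparam gamma a b (phi : R -> R) a' b' K : 0 < K -> (forall t, Iab a' b' t -> Iab a b (phi t)) ->
  (forall t u, Rabs (phi u - phi t) <= K * Rabs (u - t)) -> cont_on gamma a b -> cont_on (fun t => gamma (phi t)) a' b'.
Proof.
intros HK Hphi Hlip H t Ht e He. destruct (H (phi t) (Hphi t Ht) e He) as [d [Hd Hd']].
exists (d / K)%R. split; [apply Rdiv_lt_0_compat; auto|].
intros u Hu Hut. apply Hd'; auto. eapply Rle_lt_trans; [apply Hlip|]. apply Rlt_div_r in Hut; auto. rewrite Rmult_comm. auto.
Qed.

Lemma cont_glue gamma a c b : cont_on gamma a c -> cont_on gamma c b -> cont_on gamma a b.
Proof.
intros H1 H2 t Ht e He. unfold cont_on, Iab in *.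
destruct (Rtotal_order t c) as [Hc|[Hc|Hc]].
- destruct (H1 t ltac:(lra) e He) as [d [Hd H]]. exists (Rmin d (c - t)). split; [apply Rmin_case; lra|].
  intros u Hu Hut. assert (A := Rmin_l d (c - t)). assert (B := Rmin_r d (c - t)).
  assert (Q := Rabs_def2 _ _ (Rlt_le_trans _ _ _ Hut B)). apply H; lra.
- subst t. destruct (Rle_dec a c) as [Hac|]; [|lra]. destruct (Rle_dec c b) as [Hcb|]; [|lra].
  destruct (H1 c ltac:(lra) e He) as [d [Hd H]]. destruct (H2 c ltac:(lra) e He) as [d' [Hd' H']].
  exists (Rmin d d'). split; [apply Rmin_case; lra|].
  intros u Hu Hut. assert (A := Rmin_l d d'). assert (B := Rmin_r d d').
  destruct (Rle_dec u c); [apply H|apply H']; lra.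
- destruct (H2 t ltac:(lra) e He) as [d [Hd H]]. exists (Rmin d (t - c)). split; [apply Rmin_case; lra|].
  intros u Hu Hut. assert (A := Rmin_l d (t - c)). assert (B := Rmin_r d (t - c)).
  assert (Q := Rabs_def2 _ _ (Rlt_le_trans _ _ _ Hut B)). apply H; lra.
Qed.

(** At the joint the two families agree as germs at gamma c only. Continuity of gamma keeps later
    points inside the disc of agreement, which gives compatibility across c. *)
Lemma acont_glue gamma a c b f g h : a <= c <= b -> cont_on gamma a b -> acont gamma a c f g -> acont gamma c b g h -> acont gamma a b f h.
Proof.
intros Hc Hg [P1 [[A1 A2] [A3 A4]]] [P2 [[B1 B2] [B3 B4]]].
set (Phi := fun t => if Rle_dec t c then P1 t else P2 t).
assert (E1 : forall t, t <= c -> Phi t = P1 t) by (intros; unfold Phi; destruct Rle_dec; auto; lra).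
assert (E2 : forall t, c < t -> Phi t = P2 t) by (intros; unfold Phi; destruct Rle_dec; auto; lra).
assert (J : near (gamma c) (fun z => P2 c z = P1 c z)).
{ apply (near_impl _ _ _ (fun y H => eq_trans (proj1 H) (eq_sym (proj2 H))) (near_and _ _ _ B3 A4)). }
assert (E3 : near (gamma b) (fun z => Phi b z = P2 b z)).
{ destruct (Rle_dec b c) as [Hb|Hb].
  - replace b with c by lra. rewrite E1 by lra. apply (near_impl _ _ _ (fun y H => eq_sym H) J).
  - rewrite E2 by lra. apply near_all; auto. }
exists Phi. unfold family, cont_on, Iab in *. split; [split|split].
- intros t Ht. destruct (Rle_dec t c); [rewrite E1 by auto; apply A1; lra|rewrite E2 by lra; apply B1; lra].
- intros t Ht. destruct (Rtotal_order t c) as [Htc|[Htc|Htc]].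
  + destruct (A2 t ltac:(lra)) as [d [Hd H]]. exists (Rmin d (c - t)). split; [apply Rmin_case; lra|].
    intros u Hu Hut. assert (A := Rmin_l d (c - t)). assert (B := Rmin_r d (c - t)).
    assert (Q := Rabs_def2 _ _ (Rlt_le_trans _ _ _ Hut B)). rewrite !E1 by lra. apply H; lra.
  + subst t. destruct (A2 c ltac:(lra)) as [d1 [Hd1 H1]]. destruct (B2 c ltac:(lra)) as [d2 [Hd2 H2]].
    (* Half of the radius r is for the move from gamma c to gamma u, the other half for the
       neighbourhood of gamma u. *)
    destruct J as [r [Hr HJ]]. destruct (Hg c Hc (r / 2)%R) as [d3 [Hd3 H3]]; [lra|].
    exists (Rmin d1 (Rmin d2 d3)). split; [repeat apply Rmin_case; auto|]. intros u Hu Hut.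
    assert (M1 := Rmin_l d1 (Rmin d2 d3)). assert (M2 := Rmin_r d1 (Rmin d2 d3)). assert (M3 := Rmin_l d2 d3). assert (M4 := Rmin_r d2 d3).
    destruct (Rle_dec u c).
    * rewrite !E1 by lra. apply H1; lra.
    * rewrite E2, E1 by lra. specialize (H2 u ltac:(lra) ltac:(lra)). specialize (H3 u ltac:(lra) ltac:(lra)).
      destruct H2 as [r2 [Hr2 H2]]. exists (Rmin r2 (r / 2)). split; [apply Rmin_case; lra|].
      intros y Hy. assert (M5 := Rmin_l r2 (r / 2)). assert (M6 := Rmin_r r2 (r / 2)).
      rewrite H2 by lra. apply HJ. replace (y - gamma c) with (y - gamma u + (gamma u - gamma c)) by ring.
      eapply Rle_lt_trans; [apply Cmod_triangle|]. lra.
  + destruct (B2 t ltac:(lra)) as [d [Hd H]]. exists (Rmin d (t - c)). split; [apply Rmin_case; lra|].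
    intros u Hu Hut. assert (A := Rmin_l d (t - c)). assert (B := Rmin_r d (t - c)).
    assert (Q := Rabs_def2 _ _ (Rlt_le_trans _ _ _ Hut B)). rewrite !E2 by lra. apply H; lra.
- rewrite E1 by lra. auto.
- apply (near_impl _ _ _ (fun y H => eq_trans (proj1 H) (proj2 H)) (near_and _ _ _ E3 B4)).
Qed.

Lemma acont_plus gamma a b f g f' g' : acont gamma a b f g -> acont gamma a b f' g' -> acont gamma a b (fun z => f z + f' z) (fun z => g z + g' z).
Proof.
intros [P1 [[A1 A2] [A3 A4]]] [P2 [[B1 B2] [B3 B4]]]. exists (fun t z => P1 t z + P2 t z). split; [split|split].
- intros t Ht. generalize (near_and _ _ _ (A1 t Ht) (B1 t Ht)). apply near_impl. intros y [[l H1] [m H2]].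
  exists (l + m). apply eder_plus; auto.
- intros t Ht. destruct (A2 t Ht) as [d1 [Hd1 H1]]. destruct (B2 t Ht) as [d2 [Hd2 H2]].
  exists (Rmin d1 d2). split; [apply Rmin_case; auto|]. intros u Hu Hut.
  assert (M1 := Rmin_l d1 d2). assert (M2 := Rmin_r d1 d2).
  apply (near_impl _ _ _ (fun y H => f_equal2 Cplus (proj1 H) (proj2 H)) (near_and _ _ _ (H1 u Hu ltac:(lra)) (H2 u Hu ltac:(lra)))).
- apply (near_impl _ _ _ (fun y H => f_equal2 Cplus (proj1 H) (proj2 H)) (near_and _ _ _ A3 B3)).
- apply (near_impl _ _ _ (fun y H => f_equal2 Cplus (proj1 H) (proj2 H)) (near_and _ _ _ A4 B4)).
Qed.

Lemma acont_scal gamma a b c f g : acont gamma a b f g -> acont gamma a b (fun z => c * f z) (fun z => c * g z).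
Proof.
intros [P1 [[A1 A2] [A3 A4]]]. exists (fun t z => c * P1 t z). split; [split|split].
- intros t Ht. generalize (A1 t Ht). apply near_impl. intros y [l H1]. exists (c * l). apply eder_scal; auto.
- intros t Ht. destruct (A2 t Ht) as [d [Hd H]]. exists d. split; auto. intros u Hu Hut.
  apply (near_impl _ _ _ (fun y H => f_equal (Cmult c) H) (H u Hu Hut)).
- apply (near_impl _ _ _ (fun y H => f_equal (Cmult c) H) A3).
- apply (near_impl _ _ _ (fun y H => f_equal (Cmult c) H) A4).
Qed.

Lemma acont_Csum gamma a b (c : nat -> C) (f g : nat -> C -> C) m : (forall j, (j < m)%nat -> acont gamma a b (f j) (g j)) ->
  acont gamma a b (fun z => Csum (fun j => c j * f j z) m) (fun z => Csum (fun j => c j * g j z) m).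
Proof.
induction m; intros H; simpl.
- apply (acont_hol (fun _ => True)); auto; [intros z _; exists 1%R; split; [lra|auto]|].
  intros z _. exists 0. apply (eder_const Cminus 0).
- apply (acont_plus gamma a b (fun z => Csum (fun j => c j * f j z) m)); [apply IHm; intros; apply H; lia|].
  apply acont_scal. auto.
Qed.

Lemma acont_reverse gamma f g : acont gamma 0 1 f g -> acont (path_reverse gamma) 0 1 g f.
Proof.
intros [Phi [HF [H1 H2]]]. exists (fun t => Phi (1 - t)%R). split; [|split].
- apply (family_reparam gamma 0 1 Phi (fun t => 1 - t)%R 0 1 1); auto; unfold Iab; [lra|intros; lra|].
  intros t u. rewrite Rmult_1_l. right. rewrite <- Rabs_Ropp. f_equal. ring.
- unfold path_reverse. rewrite Rminus_0_r. auto.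
- unfold path_reverse. rewrite Rminus_diag. auto.
Qed.

Lemma concat_l gamma delta t : Iab 0 (1 / 2) t -> gamma (2 * t)%R = path_concat gamma delta t.
Proof. intros H. unfold path_concat, Iab in *. destruct Rle_dec; auto. lra. Qed.

(** At t = 1/2 [path_concat] follows the first path, hence the hypothesis that the ends meet. *)
Lemma concat_r gamma delta t : gamma 1%R = delta 0%R -> Iab (1 / 2) 1 t -> delta (2 * t - 1)%R = path_concat gamma delta t.
Proof.
intros E H. unfold path_concat, Iab in *. destruct Rle_dec; auto. replace t with (1 / 2)%R by lra.
replace (2 * (1 / 2))%R with 1%R by field. rewrite E. f_equal. field.
Qed.

Lemma lip2 m t u : Rabs (2 * u - m - (2 * t - m)) <= 2 * Rabs (u - t).
Proof.
replace (2 * u - m - (2 * t - m))%R with (2 * (u - t))%R by ring. rewrite Rabs_mult, (Rabs_pos_eq 2) by lra. lra.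
Qed.

Lemma cont_ext gamma gamma' a b : (forall t, Iab a b t -> gamma t = gamma' t) -> cont_on gamma a b -> cont_on gamma' a b.
Proof.
intros E H t Ht e He. destruct (H t Ht e He) as [d [Hd H']]. exists d. split; auto.
intros u Hu Hut. rewrite <- !E by auto. auto.
Qed.

Lemma cont_concat gamma delta : gamma 1%R = delta 0%R -> cont_on gamma 0 1 -> cont_on delta 0 1 -> cont_on (path_concat gamma delta) 0 1.
Proof.
intros E H1 H2. apply cont_glue with (1 / 2)%R.
- apply (cont_ext (fun t => gamma (2 * t - 0)%R)); [intros t Ht; rewrite Rminus_0_r; apply concat_l; auto|].
  apply (cont_reparam gamma 0 1 (fun t => 2 * t - 0)%R 0 (1 / 2) 2); auto; [lra|unfold Iab; intros; lra|intros; apply lip2].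
- apply (cont_ext (fun t => delta (2 * t - 1)%R)); [intros t Ht; apply concat_r; auto|].
  apply (cont_reparam delta 0 1 (fun t => 2 * t - 1)%R (1 / 2) 1 2); auto; [lra|unfold Iab; intros; lra|intros; apply lip2].
Qed.

Lemma acont_concat gamma delta f g h : gamma 1%R = delta 0%R -> cont_on gamma 0 1 -> cont_on delta 0 1 ->
  acont gamma 0 1 f g -> acont delta 0 1 g h -> acont (path_concat gamma delta) 0 1 f h.
Proof.
intros E C1 C2 [P1 [A1 [A3 A4]]] [P2 [B1 [B3 B4]]].
apply acont_glue with (1 / 2)%R g; [lra|apply cont_concat; auto| |].
- exists (fun t => P1 (2 * t - 0)%R). split; [|split].
  + apply (family_path_ext (fun t => gamma (2 * t - 0)%R)); [intros t Ht; rewrite Rminus_0_r; apply concat_l; auto|].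
    apply (family_reparam gamma 0 1 P1 (fun t => 2 * t - 0)%R 0 (1 / 2) 2); auto; [lra|unfold Iab; intros; lra|intros; apply lip2].
  + rewrite <- concat_l by (unfold Iab; lra). replace (2 * 0 - 0)%R with 0%R by ring. rewrite Rmult_0_r. auto.
  + rewrite <- concat_l by (unfold Iab; lra). replace (2 * (1 / 2) - 0)%R with 1%R by field. replace (2 * (1 / 2))%R with 1%R by field. auto.
- exists (fun t => P2 (2 * t - 1)%R). split; [|split].
  + apply (family_path_ext (fun t => delta (2 * t - 1)%R)); [intros t Ht; apply concat_r; auto|].
    apply (family_reparam delta 0 1 P2 (fun t => 2 * t - 1)%R (1 / 2) 1 2); auto; [lra|unfold Iab; intros; lra|intros; apply lip2].
  + rewrite <- concat_r by (auto; unfold Iab; lra). replace (2 * (1 / 2) - 1)%R with 0%R by field. auto.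
  + rewrite <- concat_r by (auto; unfold Iab; lra). replace (2 * 1 - 1)%R with 1%R by ring. auto.
Qed.

Lemma cont_reverse gamma : cont_on gamma 0 1 -> cont_on (path_reverse gamma) 0 1.
Proof.
apply (cont_reparam gamma 0 1 (fun t => 1 - t)%R 0 1 1); [lra|unfold Iab; intros; lra|].
intros t u. rewrite Rmult_1_l. right. rewrite <- Rabs_Ropp. f_equal. ring.
Qed.

Lemma rcont_cont_on gamma a b : (forall t, rcont gamma t) -> cont_on gamma a b.
Proof.
intros H t _ e He. destruct (H t e He) as [d [Hd H']]. exists d. split; auto. intros u _ Hut. apply H'.
unfold rsub. rewrite Cmod_R. auto.
Qed.

Lemma circle_form x p t : 0 < Im p -> Im x = 0%R -> circle x p t = x + Cexp (clog (p - x) + RtoC t * period).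
Proof.
intros Hp Hx. unfold circle. rewrite Cexp_plus, Cexp_clog.
- do 2 f_equal. f_equal. unfold period. rewrite RtoC_mult, RtoC_mult. ring.
- intros E. apply (f_equal Im) in E. rewrite im_sub in E. simpl in E. lra.
Qed.

Lemma circle_cont x p : cont_on (circle x p) 0 1.
Proof.
apply rcont_cont_on. intros t. apply econt_plus; [apply econt_const|]. apply econt_mult; [apply econt_const|].
apply (econt_ext rsub (fun t => Cexp (RtoC t * period))); [intros; f_equal; unfold period; rewrite !RtoC_mult; ring|].
eapply rder_rcont. apply rder_Cexp_line.
Qed.

Lemma circle_start x p : circle x p 0 = p.
Proof. unfold circle. rewrite Rmult_0_r, Cmult_0_l, Cexp_0. ring. Qed.

Lemma circle_end x p : circle x p 1 = p.
Proof.
unfold circle. rewrite Rmult_1_r, RtoC_mult. change (Cexp (RtoC 2 * RtoC PI * Ci)) with (Cexp (2 * RtoC PI * Ci)). rewrite Cexp_2PI. ring.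
Qed.

Lemma copen_upper : copen (fun z => 0 < Im z). Proof. exact (copen_im _ oint_pos). Qed.

(** The way out and the way back stay in the upper half-plane, where f and g are single holomorphic
    functions; only the circle changes the germ. *)
Lemma acont_loop x b sigma f g : approach x b sigma -> hol (fun z => (0 < Im z)) f -> hol (fun z => (0 < Im z)) g ->
  acont (circle x (sigma 1%R)) 0 1 f g -> cont_on (loop x sigma) 0 1 /\ loop x sigma 0 = b /\ loop x sigma 1 = b /\ acont (loop x sigma) 0 1 f g.
Proof.
intros [Hs1 [Hs2 [Hs3 Hs4]]] Hf Hg H.
assert (HU := copen_upper).
assert (Cs : cont_on sigma 0 1).
{ intros t Ht e He. destruct (continuous_on_unit sigma t Hs1 Ht e He) as [d [Hd K]]. exists d. auto. }
assert (Cr := cont_reverse sigma Cs). assert (Cc := circle_cont x (sigma 1%R)).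
assert (E1 : circle x (sigma 1%R) 1 = path_reverse sigma 0) by (rewrite circle_end; unfold path_reverse; f_equal; ring).
assert (E2 : sigma 1%R = path_concat (circle x (sigma 1%R)) (path_reverse sigma) 0).
{ rewrite <- concat_l by (unfold Iab; lra). rewrite Rmult_0_r, circle_start. reflexivity. }
assert (C2 := cont_concat _ _ E1 Cc Cr).
split; [apply cont_concat; auto|]. split; [|split].
- unfold loop. rewrite <- concat_l by (unfold Iab; lra). rewrite Rmult_0_r. auto.
- unfold loop. rewrite <- concat_r by (auto; unfold Iab; lra). replace (2 * 1 - 1)%R with 1%R by ring.
  rewrite <- concat_r by (auto; unfold Iab; lra). replace (2 * 1 - 1)%R with 1%R by ring.
  unfold path_reverse. rewrite Rminus_diag. auto.
- apply acont_concat with f; auto.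
  + apply (acont_hol (fun z => (0 < Im z))); auto.
  + apply acont_concat with g; auto. apply (acont_hol (fun z => (0 < Im z))); auto.
    intros t Ht. apply Hs3. unfold Iab, unit_interval in *. lra.
Qed.

(** * The two circles *)

Definition opp_slit (z : C) : Prop := slit_plane (- z).

(* The principal logarithm *)
Definition plog (z : C) : C := clog (- z) - RtoC PI * Ci.

Lemma opp_slit_open : copen opp_slit.
Proof.
intros z Hz. destruct (slit_open _ Hz) as [d [Hd H]]. exists d. split; auto. intros y Hy. apply H.
replace (- y - - z) with (- (y - z)) by ring. rewrite Cmod_opp. auto.
Qed.

Lemma plog_hol : hol opp_slit plog.
Proof.
intros z Hz. eexists. apply eder_minus; [|apply (eder_const Cminus (RtoC PI * Ci))].
apply (eder_comp Cminus clog Copp); [apply cder_clog; exact Hz|apply eder_opp, cder_id].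
Qed.

Lemma Im_PI_Ci : Im (RtoC PI * Ci) = PI. Proof. simpl. ring. Qed.
Lemma Re_PI_Ci : Re (RtoC PI * Ci) = 0%R. Proof. simpl. ring. Qed.

Lemma plog_range z : opp_slit z -> - PI < Im (plog z) < PI.
Proof. intros H. unfold plog. rewrite im_sub, Im_PI_Ci. generalize (Im_clog _ H). lra. Qed.

Lemma clog_opp z w : slit_plane z -> w = clog z + RtoC PI * Ci \/ w = clog z - RtoC PI * Ci -> 0 < Im w < 2 * PI ->
  opp_slit z /\ clog (- z) = w.
Proof.
intros Hz Hw HI. assert (E : Cexp w = - z).
{ assert (P : Cexp (- (RtoC PI * Ci)) = -1).
  { rewrite Cexp_opp, Cexp_PI. field. }
  destruct Hw as [-> | ->]; unfold Cminus; rewrite Cexp_plus, Cexp_clog by (apply slit_neq_0; auto); [rewrite Cexp_PI|rewrite P]; ring. }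
unfold opp_slit. rewrite <- E. apply clog_unique; auto.
Qed.

Lemma plog_upper z : 0 < Im z -> opp_slit z /\ plog z = clog z.
Proof.
intros H. destruct (upper_clog z H) as [S I].
destruct (clog_opp z (clog z + RtoC PI * Ci) S) as [O E]; [auto|rewrite im_plus, Im_PI_Ci; lra|].
split; auto. unfold plog. rewrite E. ring.
Qed.

Lemma plog_lower z : Im z < 0 -> opp_slit z /\ plog z + period = clog z.
Proof.
intros H. destruct (lower_clog z H) as [S I].
destruct (clog_opp z (clog z - RtoC PI * Ci) S) as [O E]; [auto|rewrite im_sub, Im_PI_Ci; lra|].
split; auto. unfold plog. rewrite E. unfold period. ring.
Qed.

Lemma plog_range_upper z : 0 < Im z -> 0 < Im (plog z) < PI.
Proof. intros H. rewrite (proj2 (plog_upper z H)). apply upper_clog; auto. Qed.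

Lemma plog_range_lower z : Im z < 0 -> - PI < Im (plog z) < 0.
Proof.
intros H. assert (E := f_equal Im (proj2 (plog_lower z H))). rewrite im_plus, im_period in E.
generalize (proj2 (lower_clog z H)). lra.
Qed.

Lemma Re_plog z : Re (plog z) = Re (clog z).
Proof. unfold plog. rewrite re_sub, Re_PI_Ci. simpl. rewrite Cmod_opp. ring. Qed.

Lemma plog_lhp z : opp_slit z -> Cmod z < 1 -> lhp (plog z).
Proof.
intros Hz H. unfold lhp. rewrite Re_plog. apply Re_clog_neg; auto. intros E. apply (slit_neq_0 _ Hz). rewrite E. ring.
Qed.

Lemma plog_rhp z : 1 < Cmod z -> rhp (plog z).
Proof. intros H. unfold rhp. rewrite Re_plog. apply Re_clog_pos; auto. Qed.

Lemma copen_and U V : copen U -> copen V -> copen (fun z => U z /\ V z).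
Proof. intros HU HV z [H1 H2]. exact (near_and z U V (HU z H1) (HV z H2)). Qed.

Lemma copen_Cmod_lt x r : copen (fun z => (Cmod (z - x) < r)).
Proof.
intros z Hz. exists (r - Cmod (z - x))%R. split; [lra|]. intros y Hy.
replace (y - x) with (y - z + (z - x)) by ring. eapply Rle_lt_trans; [apply Cmod_triangle|]. lra.
Qed.

Lemma copen_Cmod_gt r : copen (fun z => (r < Cmod z)).
Proof.
intros z Hz. exists (Cmod z - r)%R. split; [lra|]. intros y Hy.
assert (H := Cmod_triangle_inv z (z - y)). replace (z - (z - y)) with y in H by ring. rewrite (Cmod_sub_sym z y) in H. lra.
Qed.

Lemma copen_translate U x : copen U -> copen (fun z => U (z - x)).
Proof.
intros HU z Hz. destruct (HU _ Hz) as [d [Hd H]]. exists d. split; auto. intros y Hy. apply H.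
replace (y - x - (z - x)) with (y - z) by ring. auto.
Qed.

Lemma copen_lower : copen (fun z => Im z < 0). Proof. exact (copen_im _ oint_neg). Qed.

(** Joins functions given on the upper and lower half-planes across a piece of the real axis. By
    [patch_hol] the result is holomorphic as soon as m continues both near that piece. *)
Definition patch (u m l : C -> C) (z : C) : C :=
  if Rlt_dec 0 (Im z) then u z else if Rlt_dec (Im z) 0 then l z else m z.

Lemma patch_upper u m l z : 0 < Im z -> patch u m l z = u z.
Proof. intros H. unfold patch. destruct Rlt_dec; [auto|lra]. Qed.

Lemma patch_lower u m l z : Im z < 0 -> patch u m l z = l z.
Proof. intros H. unfold patch. destruct Rlt_dec; [lra|]. destruct Rlt_dec; [auto|lra]. Qed.

Lemma patch_hol (U N : C -> Prop) u m l : copen N ->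
  hol (fun z => U z /\ 0 < Im z) u -> hol (fun z => U z /\ Im z < 0) l -> hol N m ->
  (forall z, U z -> Im z = 0%R -> N z) ->
  (forall z, N z -> 0 < Im z -> m z = u z) -> (forall z, N z -> Im z < 0 -> m z = l z) ->
  hol U (patch u m l).
Proof.
intros HN Hu Hl Hm HU Eu El z Hz. destruct (Rtotal_order (Im z) 0) as [H|[H|H]].
- destruct (Hl z (conj Hz H)) as [d Hd]. exists d. apply (cder_ext_open (fun z => (Im z < 0)) l); auto using copen_lower.
  intros y Hy. symmetry. apply patch_lower; auto.
- destruct (Hm z (HU z Hz H)) as [d Hd]. exists d. apply (cder_ext_open N m); auto.
  intros y Hy. unfold patch. destruct Rlt_dec; auto. destruct Rlt_dec; auto.
- destruct (Hu z (conj Hz H)) as [d Hd]. exists d. apply (cder_ext_open (fun z => (0 < Im z)) u); auto using copen_upper.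
  intros y Hy. symmetry. apply patch_upper; auto.
Qed.

(* The circle from p is cut at the point below its centre: the first part avoids the ray to the right of the centre, the second the one to the left. *)
Lemma circle_halves x p : 0 < Im p -> Im x = 0%R -> exists c, 0 <= c <= 1 /\
  (forall t, 0 <= t <= c -> slit_plane (circle x p t - x)) /\
  (forall t, c <= t <= 1 -> opp_slit (circle x p t - x)) /\
  (Im (circle x p c) < 0) /\ forall t, Cmod (circle x p t - x) = Cmod (p - x).
Proof.
intros Hp Hx. assert (HPI := PI_RGT_0).
destruct (upper_clog (p - x)) as [S I]; [rewrite im_sub; lra|]. set (w := clog (p - x)) in *.
assert (E : forall t, circle x p t - x = Cexp (along w t)) by (intros; rewrite circle_form by auto; fold w; ring).
assert (IE : forall t, Im (along w t) = (Im w + 2 * PI * t)%R) by (intros; rewrite im_plus, im_scal_l, im_period; ring).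
set (c := ((3 * (PI / 2) - Im w) / (2 * PI))%R).
assert (Hc : (2 * PI * c = 3 * (PI / 2) - Im w)%R) by (unfold c; field; lra).
exists c. split; [split|split; [|split; [|split]]].
- unfold c. apply Rdiv_le_0_compat; lra.
- unfold c. apply Rle_div_l; lra.
- intros t Ht. rewrite E. apply clog_unique. rewrite IE. assert (2 * PI * t <= 2 * PI * c) by nra. nra.
- intros t Ht. rewrite E. unfold opp_slit.
  replace (- Cexp (along w t)) with (Cexp (w + RtoC t * period + - (RtoC PI * Ci))).
  + apply clog_unique. rewrite im_plus, IE, im_opp, Im_PI_Ci. assert (2 * PI * c <= 2 * PI * t) by nra. assert (2 * PI * t <= 2 * PI) by nra. lra.
  + rewrite Cexp_plus, Cexp_opp, Cexp_PI. field.
- replace (Im (circle x p c)) with (Im (circle x p c - x)) by (rewrite im_sub; lra).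
  rewrite E, Cexp_cis, im_scal_l, IE. replace (Im w + 2 * PI * c)%R with (3 * (PI / 2))%R by lra.
  simpl. rewrite sin_3PI2. generalize (exp_pos (Re (along w c))). simpl. lra.
- intros t. rewrite E, Cmod_Cexp, re_plus, re_scal_l, re_period, Rmult_0_r, Rplus_0_r.
  rewrite <- Cmod_Cexp. unfold w. rewrite Cexp_clog; auto using slit_neq_0.
Qed.

(** The circle is run with f down to its lowest point and with g from there on; the two only have to
    agree in the lower half-plane. *)
Lemma acont_circle x p f g U V : 0 < Im p -> Im x = 0%R -> copen U -> copen V -> hol U f -> hol V g ->
  (forall z, slit_plane (z - x) -> Cmod (z - x) = Cmod (p - x) -> U z) ->
  (forall z, opp_slit (z - x) -> Cmod (z - x) = Cmod (p - x) -> V z) ->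
  (forall z, U z -> V z -> Im z < 0 -> f z = g z) -> acont (circle x p) 0 1 f g.
Proof.
intros Hp Hx HU HV Hf Hg KU KV E.
destruct (circle_halves x p Hp Hx) as [c [Hc [H1 [H2 [H3 H4]]]]].
apply acont_glue with c f; auto using circle_cont.
- apply (acont_hol U); try assumption. intros t Ht. apply KU; [apply H1; exact Ht|apply H4].
- apply (acont_ext _ _ _ g g); [|apply near_all; auto|].
  + assert (N := copen_and _ _ (copen_and _ _ HU HV) copen_lower).
    destruct (N (circle x p c)) as [d [Hd K]].
    { split; auto. split; [apply KU; auto; apply H1; lra|apply KV; auto; apply H2; lra]. }
    exists d. split; auto. intros y Hy. destruct (K y Hy) as [[K1 K2] K3]. symmetry. auto.
  + apply (acont_hol V); try assumption. intros t Ht. apply KV; [apply H2; exact Ht|apply H4].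
Qed.

Lemma disc1_re z : Cmod (z - 1) < 1 -> 0 < Re z.
Proof.
intros H. assert (K := re_le_Cmod (z - 1)). rewrite re_sub in K. simpl (Re 1) in K.
assert (Q := Rabs_def2 _ _ (Rle_lt_trans _ _ _ K H)). lra.
Qed.

Lemma re_opp_slit z : 0 < Re z -> opp_slit z.
Proof. intros H [_ K]. rewrite re_opp in K. lra. Qed.

Lemma Cmod_real z : Im z = 0%R -> Cmod z = Rabs (Re z).
Proof. intros H. replace z with (RtoC (Re z)) at 1; [apply Cmod_R|]. apply C_ext; simpl; auto. Qed.

Lemma Csum_first f n : (1 <= n)%nat -> Csum f n = f O + Csum (fun j => match j with O => 0 | S _ => f j end) n.
Proof. destruct n; intros H; [lia|]. rewrite !Csum_shift. ring. Qed.

Lemma Csum_rev f n : Csum (fun k => f (n - k)%nat) (S n) = Csum f (S n).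
Proof.
induction n; [reflexivity|].
rewrite Csum_shift. replace (S n - 0)%nat with (S n) by lia.
rewrite (Csum_ext (fun k => f (S n - S k)%nat) (fun k => f (n - k)%nat)) by (intros; f_equal; lia).
rewrite IHn. simpl. ring.
Qed.

Lemma sum_n_Csum (f : nat -> C) n : sum_n f n = Csum f (S n).
Proof. induction n; [rewrite sum_O; simpl; ring|]. rewrite sum_Sn, IHn. reflexivity. Qed.

(** * The monodromy matrices *)

Lemma coeff_mk_matrix n (f : nat -> nat -> C) i j : (i < n)%nat -> (j < n)%nat ->
  coeff_mat zero (mk_matrix n n f) i j = f i j.
Proof. intros Hi Hj. apply coeff_mat_bij; auto. Qed.

Lemma monic_poly_last n A r : monic_poly_with_roots n A r -> A n = Cprod (fun k => - r k) n.
Proof.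
intros [_ H]. rewrite (Cprod_ext _ (fun k => 0 - r k)) by (intros; ring). rewrite <- H, sum_n_Csum.
simpl. rewrite Nat.sub_diag, (Csum_ext _ (fun _ => 0)), Csum_0; [simpl; ring|].
intros k Hk. replace (n - k)%nat with (S (n - S k)) by lia. simpl. ring.
Qed.

Lemma monic_poly_last_neq_0 n A (r : nat -> C) : (forall k, r k <> 0) -> monic_poly_with_roots n A r -> A n <> 0.
Proof.
intros Hr H. rewrite (monic_poly_last n A r H). apply Cprod_neq_0. intros k _ E. apply (Hr k).
transitivity (- - r k); [ring|]. rewrite E. ring.
Qed.

Lemma monic_poly_rev n A r : monic_poly_with_roots n A r ->
  forall x, Csum (fun k => A (n - k)%nat * x ^ k) (S n) = Cprod (fun k => x - r k) n.
Proof.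
intros [_ H] x. rewrite <- H, sum_n_Csum, <- Csum_rev. apply Csum_ext. intros k Hk.
replace (n - (n - k))%nat with k by lia. reflexivity.
Qed.

(** Reversing the coefficients inverts the roots. It connects [A], defined by e^(- 2 pi i alpha_k),
    with the roots e^(2 pi i alpha_k) that the reflected system produces. *)
Lemma monic_poly_inv n A (r : nat -> C) : (forall k, r k <> 0) -> monic_poly_with_roots n A r ->
  forall x, Csum (fun k => A k * x ^ k) (S n) = A n * Cprod (fun k => x - / r k) n.
Proof.
intros Hr HA x. assert (E : Cprod (fun k => 1 - r k * x) n = A n * Cprod (fun k => x - / r k) n).
{ rewrite (monic_poly_last n A r HA), <- Cprod_mult. apply Cprod_ext. intros k _. field. apply Hr. }
rewrite <- E. destruct HA as [A0 HA]. destruct (Ceq_dec x 0) as [->|Hx].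
- rewrite Csum_shift, (Csum_ext _ (fun _ => 0)), Csum_0, A0; [|intros; simpl; ring].
  rewrite (Cprod_ext _ (fun _ => 1)), Cprod_const, Cpow_1_l by (intros; ring). simpl. ring.
- rewrite (Cprod_ext _ (fun k => x * (/ x - r k))) by (intros; field; auto).
  rewrite Cprod_mult, Cprod_const, <- HA, sum_n_Csum, <- Csum_scal. apply Csum_ext. intros k Hk.
  replace (x ^ n) with (x ^ k * x ^ (n - k)) by (rewrite <- Cpow_add_r; f_equal; lia). rewrite Cpow_inv by auto.
  assert (N := Cpow_nz x (n - k) Hx). set (y := x ^ (n - k)) in *. set (v := x ^ k). field. auto.
Qed.

(** The first row of M_inf applied to a column of companion shape: the shift rows raise the index by
    one, and the last row enters with coefficient A_0 = 1. *)
Lemma Csum_companion n (A r v : nat -> C) s : (1 <= n)%nat -> A O = 1 -> (forall j, (S j < n)%nat -> r j = v (S j)) -> r (n - 1)%nat = - s ->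
  Csum (fun j => A (n - 1 - j)%nat * r j) n = Csum (fun j => match j with O => 0 | S _ => A (n - j)%nat * v j end) n - s.
Proof.
intros Hn A0 Hr Hl. destruct n as [|m]; [lia|]. replace (S m - 1)%nat with m in * by lia.
rewrite (Csum_shift (fun j => match j with O => 0 | S _ => A (S m - j)%nat * v j end)).
change (Csum (fun j => A (m - j)%nat * r j) (S m)) with (Csum (fun j => A (m - j)%nat * r j) m + A (m - m)%nat * r m).
rewrite Nat.sub_diag, A0, Hl, (Csum_ext _ (fun k => A (S m - S k)%nat * v (S k))); [ring|].
intros k Hk. rewrite Hr by lia. reflexivity.
Qed.

Section Monodromy.
Context (n : nat) (alpha beta A B : nat -> C) (L : R -> C) (hn : (1 <= n)%nat).
Hypothesis hA : monic_poly_with_roots n A (fun k => Cexp (- (2 * RtoC PI * Ci * alpha k))).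
Hypothesis hB : monic_poly_with_roots n B (fun k => Cexp (- (2 * RtoC PI * Ci * beta k))).
Hypothesis HL : mellin_barnes_path n alpha beta L.

Notation F := (mellin_barnes n alpha beta L).
Notation G := (G n alpha beta L).
Notation kappa := (mb_const n).

Lemma A_n_neq_0 : A n <> 0.
Proof. exact (monic_poly_last_neq_0 _ _ _ (fun k => Cexp_neq_0 _) hA). Qed.

Lemma B_n_neq_0 : B n <> 0.
Proof. exact (monic_poly_last_neq_0 _ _ _ (fun k => Cexp_neq_0 _) hB). Qed.

Lemma base_in_strip x : wide_strip n (mid x).
Proof.
unfold wide_strip, mid. simpl. apply le_INR in hn. simpl in hn. generalize PI_RGT_0. nra.
Qed.

Lemma convex_and U V : convex U -> convex V -> convex (fun z => U z /\ V z).
Proof. intros HU HV x y t [H1 H2] [H3 H4] Ht. split; auto. Qed.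

Lemma rhp_open : copen rhp. Proof. exact (copen_re _ oint_pos). Qed.

Lemma rhp_convex : convex rhp. Proof. exact (convex_re _ oint_pos). Qed.

Lemma left_extension : exists H, hol lhp H /\ (forall w, wide_strip n w -> lhp w -> H w = G w) /\
  forall w, lhp w -> Csum (fun m => B (n - m)%nat * H (shift w m)) (S n) = 0.
Proof.
destruct (lhp_extension n alpha (fun k => beta k - 1) (fun w => wide_strip n w /\ lhp w) G (mid (-1))) as [H [H1 [H2 H3]]]; auto.
- apply copen_and; [apply wide_strip_open|apply lhp_open].
- apply convex_and; [apply wide_strip_convex|apply lhp_is_convex].
- intros w [_ Hw]; auto.
- split; [apply base_in_strip|unfold lhp, mid; simpl; lra].
- intros w [Hw _]. apply G_hol; auto.
- intros w [Hw _]. apply G_equation; auto.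
- exists H. split; auto. split; auto. intros w Hw. apply H3; auto. intros x.
  rewrite (monic_poly_rev _ _ _ hB). apply Cprod_ext. intros k _. f_equal.
  replace (- (period * (beta k - 1))) with (- (2 * RtoC PI * Ci * beta k) + period) by (unfold period; ring).
  rewrite Cexp_plus_period. reflexivity.
Qed.

Lemma right_extension : exists H, hol rhp H /\ (forall w, wide_strip n w -> rhp w -> H w = G w) /\
  forall w, rhp w -> Csum (fun m => A m * H (w - RtoC (INR m) * period)) (S n) = 0.
Proof.
destruct (rhp_extension n alpha (fun k => beta k - 1) (fun w => wide_strip n w /\ rhp w) G (mid 1)) as [H [H1 [H2 H3]]]; auto.
- apply copen_and; [apply wide_strip_open|apply rhp_open].
- apply convex_and; [apply wide_strip_convex|apply rhp_convex].
- intros w [_ Hw]; auto.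
- split; [apply base_in_strip|unfold rhp, mid; simpl; lra].
- intros w [Hw _]. apply G_hol; auto.
- intros w [Hw _]. apply G_equation; auto.
- exists H. split; auto. split; auto. intros w Hw.
  (* The reversed polynomial is made monic by dividing by A_n. *)
  assert (K := H3 (fun k => / A n * A (n - k)%nat)).
  transitivity (A n * Csum (fun m => / A n * A (n - (n - m))%nat * H (w - RtoC (INR m) * period)) (S n)).
  + rewrite <- Csum_scal. apply Csum_ext. intros m Hm. replace (n - (n - m))%nat with m by lia. field. apply A_n_neq_0.
  + rewrite K; auto; [ring|]. intros x.
    transitivity (/ A n * Csum (fun k => A k * x ^ k) (S n)).
    { rewrite <- Csum_scal. apply Csum_ext. intros k Hk. replace (n - (n - k))%nat with k by lia. ring. }
    rewrite (monic_poly_inv _ _ _ (fun k => Cexp_neq_0 _) hA).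
    transitivity (Cprod (fun k => x - / Cexp (- (2 * RtoC PI * Ci * alpha k))) n); [field; apply A_n_neq_0|].
    apply Cprod_ext. intros k _. rewrite <- Cexp_opp. do 2 f_equal. unfold period. ring.
Qed.

Definition row (M : matrix n n) (i : nat) (f : nat -> C -> C) (z : C) : C := Csum (fun j => coeff_mat zero M i j * f j z) n.

Lemma F_upper_hol i : (i < n)%nat -> hol (fun z => (0 < Im z)) (F i).
Proof.
intros Hi z Hz. apply ex_derive_iff. apply (mb_hypergeometric_solution n alpha beta L HL i Hi).
apply upper_clog; auto.
Qed.

Lemma F_slit_hol i : (i < n)%nat -> hol slit_plane (F i).
Proof. intros Hi z Hz. apply ex_derive_iff. apply (mb_hypergeometric_solution n alpha beta L HL i Hi). auto. Qed.

Lemma row_hol U M i f : (forall j, (j < n)%nat -> hol U (f j)) -> hol U (row M i f).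
Proof.
intros Hf z Hz. unfold row. set (c := fun j => coeff_mat zero M i j).
assert (H : forall m, (m <= n)%nat -> exists l, cder (fun z => Csum (fun j => c j * f j z) m) z l).
{ induction m; intros Hm; [exists 0; apply (eder_const Cminus 0)|]. destruct IHm as [l1 H1]; [lia|].
  destruct (Hf m ltac:(lia) z Hz) as [l2 H2]. eexists. simpl. apply eder_plus; [exact H1|apply eder_scal; exact H2]. }
exact (H n (Nat.le_refl _)).
Qed.

Lemma INR_lt_1 j m : (j < m)%nat -> INR j + 1 <= INR m.
Proof. intros H. apply le_INR in H. rewrite S_INR in H. auto. Qed.

Lemma shift_wide w j : (j <= n)%nat -> 0 < Im w + 2 * PI * INR j < 2 * PI * INR n -> wide_strip n (shift w j).
Proof. intros _ H. unfold wide_strip. rewrite im_plus, im_scal_l, im_period. lra. Qed.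

Lemma shift_lhp w j : lhp w -> lhp (shift w j).
Proof. unfold lhp. rewrite re_plus, re_scal_l, re_period. lra. Qed.

Lemma shift_rhp w j : rhp w -> rhp (shift w j).
Proof. unfold rhp. rewrite re_plus, re_scal_l, re_period. lra. Qed.

Lemma shift_S w j : shift w (S j) = shift (w + period) j.
Proof. rewrite S_INR, RtoC_plus. ring. Qed.

Lemma row_M0_shift i f z : (S i < n)%nat -> row (M0 n B) i f z = f (S i) z.
Proof.
intros Hi. unfold row. rewrite <- (Csum_delta (fun j => f j z) n (S i) Hi). apply Csum_ext. intros j Hj.
unfold M0. rewrite coeff_mk_matrix by lia. replace (Nat.eqb i (n - 1)) with false by (symmetry; apply Nat.eqb_neq; lia). reflexivity.
Qed.

Lemma row_M0_last f z : row (M0 n B) (n - 1) f z = - Csum (fun j => B (n - j)%nat * f j z) n.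
Proof.
unfold row. transitivity (Csum (fun j => (-1) * (B (n - j)%nat * f j z)) n); [|rewrite Csum_scal; ring].
apply Csum_ext. intros j Hj. unfold M0. rewrite coeff_mk_matrix by lia. rewrite Nat.eqb_refl. ring.
Qed.

Lemma row_M1_id i f z : (0 < i)%nat -> (i < n)%nat -> row (M1 n A B) i f z = f i z.
Proof.
intros Hi Hn. unfold row. rewrite <- (Csum_delta (fun j => f j z) n i Hn). apply Csum_ext. intros j Hj.
unfold M1. rewrite coeff_mk_matrix by lia. destruct i; [lia|]. reflexivity.
Qed.

Lemma row_M1_0 f z : row (M1 n A B) 0 f z =
  - / B n * (Csum (fun j => match j with O => 0 | S _ => B (n - j)%nat * f j z end) n - Csum (fun j => A (n - j)%nat * f j z) n).
Proof.
assert (E := Csum_first (fun j => B (n - j)%nat * f j z) n hn). cbv beta in E. rewrite Nat.sub_0_r in E.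
set (T := Csum (fun j => match j with O => 0 | S _ => B (n - j)%nat * f j z end) n) in *.
set (SA := Csum (fun j => A (n - j)%nat * f j z) n). set (SB := Csum (fun j => B (n - j)%nat * f j z) n) in *.
transitivity (f O z + / B n * (SA - SB)).
- unfold row. transitivity (Csum (fun j => delta 0 j * f j z) n + (/ B n * SA + (- / B n) * SB)).
  + unfold SA, SB. rewrite <- !Csum_scal, <- !Csum_plus. apply Csum_ext. intros j Hj. unfold M1. rewrite coeff_mk_matrix by lia. simpl Nat.eqb.
    cbv iota. unfold Cdiv. ring.
  + rewrite Csum_delta by lia. ring.
- rewrite E. field. apply B_n_neq_0.
Qed.

Lemma row_scaled M i k (f : nat -> C -> C) z z' : (forall j, (j < n)%nat -> F j z = k * f j z') -> row M i F z = k * row M i f z'.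
Proof. intros H. unfold row. rewrite <- Csum_scal. apply Csum_ext. intros j Hj. rewrite H by auto. ring. Qed.

(** After half a turn the logarithm is the principal one plus 2 pi i, so I_i arrives as the
    translate of index i + 1. For i = n - 1 this translate leaves the strip of [G] and exists only
    through the extension to Re w < 0; the relation with the B_k then expresses it by the other
    translates. *)
Lemma circle_M0 p i : 0 < Im p -> Cmod (p - 0) < 1 -> (i < n)%nat -> acont (circle 0 p) 0 1 (F i) (row (M0 n B) i F).
Proof.
intros Hp H1 Hi. destruct left_extension as [H [HH [HG HB]]].
set (V := fun z => opp_slit z /\ Cmod (z - 0) < 1).
assert (HV : copen V) by (apply copen_and; [apply opp_slit_open|apply copen_Cmod_lt]).
assert (VL : forall z, V z -> lhp (plog z)).
{ intros z [H2 H3]. apply plog_lhp; auto. replace (z - 0) with z in H3 by ring. auto. }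
set (g := fun z => kappa * H (shift (plog z) (S i))).
apply (acont_ext _ _ _ (F i) g); [apply near_all; auto| |].
- rewrite circle_end. destruct (copen_and _ _ copen_upper HV p) as [d [Hd K]].
  { split; auto. split; auto. apply plog_upper; auto. }
  exists d. split; auto. intros z Hz. destruct (K z Hz) as [Hi1 HVz]. clear K. unfold g.
  assert (R := plog_range_upper z Hi1). assert (LL := VL z HVz).
  destruct (plog_upper z Hi1) as [_ EP].
  assert (EF : forall j, (j < n)%nat -> F j z = kappa * (fun j w => H (shift w j)) j (plog z)).
  { intros j Hj. rewrite mellin_barnes_G. rewrite <- EP. f_equal. symmetry. apply HG; [|apply shift_lhp; auto].
    apply shift_wide; [lia|]. generalize (INR_lt_1 _ _ Hj) (pos_INR j) PI_RGT_0. nra. }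
  rewrite (row_scaled _ _ _ _ _ _ EF). f_equal. destruct (Nat.eq_dec (S i) n) as [E|E].
  + replace i with (n - 1)%nat at 2 by lia. rewrite row_M0_last, E.
    specialize (HB _ LL). simpl Csum in HB. rewrite Nat.sub_diag, (proj1 hB) in HB.
    transitivity (Csum (fun j => B (n - j)%nat * H (shift (plog z) j)) n + 1 * H (shift (plog z) n) - Csum (fun j => B (n - j)%nat * H (shift (plog z) j)) n); [ring|].
    rewrite HB. ring.
  + rewrite row_M0_shift by lia. reflexivity.
- apply (acont_circle 0 p (F i) g slit_plane V); auto using slit_open, F_slit_hol.
  + intros z [H2 H3]. assert (LL := VL z (conj H2 H3)).
    destruct (plog_hol z H2) as [l Hl]. destruct (HH (shift (plog z) (S i)) (shift_lhp _ _ LL)) as [m Hm].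
    eexists. apply eder_scal. apply (eder_comp Cminus (fun w => H (shift w (S i))) plog); [apply cder_translate; exact Hm|exact Hl].
  + intros z Hz _. replace (z - 0) with z in Hz by ring. auto.
  + intros z Hz E. split; [replace (z - 0) with z in Hz by ring; auto|]. rewrite E. auto.
  + intros z _ HVz Hz. unfold g. rewrite mellin_barnes_G, shift_S, (proj2 (plog_lower z Hz)). f_equal. symmetry. apply HG.
    * apply shift_wide; [lia|]. generalize (proj2 (lower_clog z Hz)) (INR_lt_1 _ _ Hi) (pos_INR i) PI_RGT_0. nra.
    * apply shift_lhp. rewrite <- (proj2 (plog_lower z Hz)). apply lhp_plus_period. auto.
Qed.

Lemma hol_shift_G U j : (forall z, U z -> opp_slit z /\ wide_strip n (shift (plog z) j)) -> hol U (fun z => G (shift (plog z) j)).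
Proof.
intros HU z Hz. destruct (HU z Hz) as [H1 H2]. destruct (plog_hol z H1) as [l Hl]. destruct (G_hol n alpha beta L HL _ H2) as [m Hm].
eexists. apply (eder_comp Cminus (fun w => G (shift w j)) plog); [apply cder_translate; exact Hm|exact Hl].
Qed.

Lemma disc1_wide z j : (0 < j)%nat -> (j < n)%nat -> opp_slit z -> wide_strip n (shift (plog z) j).
Proof.
intros Hj Hn Hz. apply shift_wide; [lia|]. assert (R := plog_range z Hz).
assert (HPI := PI_RGT_0). assert (J1 := INR_lt_1 _ _ Hn). assert (J0 := INR_lt_1 _ _ Hj). rewrite INR_0 in J0.
assert (0 <= PI * (INR j - 1)) by (apply Rmult_le_pos; lra).
assert (0 <= PI * (INR n - (INR j + 1))) by (apply Rmult_le_pos; lra). nra.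
Qed.

Definition disc1 (z : C) : Prop := (Cmod (z - 1) < 1).

Lemma disc1_opp_slit z : disc1 z -> opp_slit z.
Proof. intros H. apply re_opp_slit, disc1_re, H. Qed.

(** For 0 < i < n the translate by 2 pi i stays in the strip of [G] for all arguments between - pi
    and pi, so I_i continues to a holomorphic function on the disc around 1. *)
Lemma circle_M1_pos p i : 0 < Im p -> disc1 p -> (0 < i)%nat -> (i < n)%nat -> acont (circle 1 p) 0 1 (F i) (row (M1 n A B) i F).
Proof.
intros Hp H1 Hi Hn. set (g := fun z => kappa * G (shift (plog z) i)).
assert (E : near p (fun z => g z = F i z)).
{ destruct (copen_upper p Hp) as [d [Hd K]]. exists d. split; auto. intros z Hz. unfold g.
  rewrite mellin_barnes_G, (proj2 (plog_upper z (K z Hz))). reflexivity. }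
assert (E' : near p (fun z => g z = row (M1 n A B) i F z)).
{ generalize E. apply near_impl. intros z Ez. rewrite row_M1_id by auto. auto. }
apply (acont_ext _ _ _ g g); [rewrite circle_start; auto|rewrite circle_end; auto|].
assert (Hg : hol disc1 g).
{ intros z Hz. destruct (hol_shift_G disc1 i) with (z := z) as [l Hl]; auto.
  - intros y Hy. split; [apply disc1_opp_slit; auto|apply disc1_wide; auto using disc1_opp_slit].
  - eexists. apply eder_scal. exact Hl. }
apply (acont_circle 1 p g g disc1 disc1); auto; try apply copen_Cmod_lt; intros z _ K; unfold disc1; rewrite K; auto.
Qed.

(* The terms common to the three expressions of the continuation of I_0 past the cut. *)
Definition tail (w : C) : C := Csum (fun j => match j with O => 0 | S _ => B (n - j)%nat * G (shift w j) end) n.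

Lemma tail_hol : hol disc1 (fun z => tail (plog z)).
Proof.
intros z Hz. unfold tail.
assert (H : forall m, (m <= n)%nat -> exists l, cder (fun z => Csum (fun j => match j with O => 0 | S _ => B (n - j)%nat * G (shift (plog z) j) end) m) z l).
{ induction m; intros Hm; [exists 0; apply (eder_const Cminus 0)|]. destruct IHm as [l1 H1]; [lia|].
  destruct m as [|m]; [eexists; simpl; apply eder_plus; [exact H1|apply (eder_const Cminus 0)]|].
  destruct (hol_shift_G disc1 (S m)) with (z := z) as [l2 H2]; auto.
  - intros y Hy. split; [apply disc1_opp_slit; auto|apply disc1_wide; auto using disc1_opp_slit; lia].
  - eexists. apply eder_plus; [exact H1|apply eder_scal; exact H2]. }
exact (H n (Nat.le_refl _)).
Qed.

Lemma pos_slit z : disc1 z -> Im z = 0%R -> slit_plane (z - 1) -> Cmod z < 1.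
Proof.
intros Hz Hi Hs. rewrite Cmod_real, Rabs_pos_eq by (auto; left; apply disc1_re; auto).
apply Rnot_le_lt. intros K. apply Hs. rewrite im_sub, re_sub. simpl. lra.
Qed.

Lemma neg_slit z : disc1 z -> Im z = 0%R -> opp_slit (z - 1) -> 1 < Cmod z.
Proof.
intros Hz Hi Hs. rewrite Cmod_real, Rabs_pos_eq by (auto; left; apply disc1_re; auto).
apply Rnot_le_lt. intros K. apply Hs. rewrite im_opp, re_opp, im_sub, re_sub. simpl. lra.
Qed.

Lemma wide_upper z j : 0 < Im z -> (j < n)%nat -> wide_strip n (shift (plog z) j).
Proof.
intros Hz Hj. apply shift_wide; [lia|]. assert (R := plog_range_upper z Hz). generalize (INR_lt_1 _ _ Hj) (pos_INR j) PI_RGT_0. nra.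
Qed.

Lemma wide_lower z j : Im z < 0 -> (0 < j <= n)%nat -> wide_strip n (shift (plog z) j).
Proof.
intros Hz Hj. apply shift_wide; [lia|]. assert (R := plog_range_lower z Hz).
assert (Q := le_INR _ _ (proj2 Hj)). assert (HPI := PI_RGT_0). assert (J0 := INR_lt_1 _ _ (proj1 Hj)). rewrite INR_0 in J0.
assert (0 <= PI * (INR j - 1)) by (apply Rmult_le_pos; lra).
assert (0 <= PI * (INR n - INR j)) by (apply Rmult_le_pos; lra). nra.
Qed.

(** I_0 is the one function whose argument leaves the strip on crossing the real axis. The circle
    first crosses between 0 and 1, where |z| < 1 and the B-relation trades the translate of index 0
    for those of index 1, ..., n. It returns to the right of 1, where |z| > 1 and the A-relation
    trades the translate of index n for those of index 0, ..., n - 1. *)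
Lemma circle_M1_0 p : 0 < Im p -> disc1 p -> acont (circle 1 p) 0 1 (F 0) (row (M1 n A B) 0 F).
Proof.
intros Hp H1. assert (Bn := B_n_neq_0).
destruct left_extension as [H0 [HH0 [HG0 HB]]]. destruct right_extension as [Hi [HHi [HGi HA]]].
set (U := fun z => slit_plane (z - 1) /\ disc1 z). set (V := fun z => opp_slit (z - 1) /\ disc1 z).
assert (HU : copen U) by (apply copen_and; [apply copen_translate, slit_open|apply copen_Cmod_lt]).
assert (HV : copen V) by (apply copen_and; [apply copen_translate, opp_slit_open|apply copen_Cmod_lt]).
set (N0 := fun z => disc1 z /\ Cmod (z - 0) < 1). set (N1 := fun z => disc1 z /\ 1 < Cmod z).
assert (HN0 : copen N0) by (apply copen_and; apply copen_Cmod_lt).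
assert (HN1 : copen N1) by (apply copen_and; [apply copen_Cmod_lt|apply copen_Cmod_gt]).
assert (L0 : forall z, N0 z -> lhp (plog z)).
{ intros z [K1 K2]. apply plog_lhp; [apply disc1_opp_slit; auto|]. replace (z - 0) with z in K2 by ring. auto. }
assert (L1 : forall z, N1 z -> rhp (plog z)) by (intros z [K1 K2]; apply plog_rhp; auto).
(* In the lower half-plane the principal logarithm has negative imaginary part: the translates of
   index 1, ..., n lie in the strip there, while that of index 0 does not. *)
set (low := fun z => kappa * (- / B n * (tail (plog z) + G (shift (plog z) n)))).
(* [fA] crosses the axis to the left of 1 by means of the extension [H0], and [fB] to its right by
   means of [Hi]; both equal [low] below the axis. *)
set (fA := patch (fun z => kappa * G (shift (plog z) 0)) (fun z => kappa * H0 (shift (plog z) 0)) low).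
set (fB := patch (fun z => kappa * (- / B n * (tail (plog z) - Csum (fun j => A (n - j)%nat * G (shift (plog z) j)) n)))
  (fun z => kappa * (- / B n * (tail (plog z) + Hi (shift (plog z) n)))) low).
assert (Hlow : hol (fun z => disc1 z /\ Im z < 0) low).
{ intros z [K1 K2]. destruct (tail_hol z K1) as [l Hl].
  destruct (hol_shift_G (fun z => disc1 z /\ Im z < 0) n) with (z := z) as [m Hm]; auto.
  - intros y [M1 M2]. split; [apply disc1_opp_slit; auto|apply wide_lower; auto; lia].
  - eexists. apply eder_scal, eder_scal, eder_plus; [exact Hl|exact Hm]. }
assert (HfA : hol U fA).
{ apply (patch_hol U N0); auto.
  - intros z [[K1 K2] K3]. destruct (hol_shift_G (fun z => disc1 z /\ 0 < Im z) 0) with (z := z) as [m Hm]; auto.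
    + intros y [M1 M2]. split; [apply disc1_opp_slit; auto|apply wide_upper; auto].
    + eexists. apply eder_scal. exact Hm.
  - intros z [[K1 K2] K3]. apply Hlow. auto.
  - intros z Hz. destruct (plog_hol z (disc1_opp_slit z (proj1 Hz))) as [l Hl].
    destruct (HH0 (shift (plog z) 0) (shift_lhp _ _ (L0 z Hz))) as [m Hm].
    eexists. apply eder_scal. apply (eder_comp Cminus (fun w => H0 (shift w 0)) plog); [apply cder_translate; exact Hm|exact Hl].
  - intros z [K1 K2] K3. split; auto. replace (z - 0) with z by ring. apply pos_slit; auto.
  - intros z Hz K. f_equal. apply HG0; [apply wide_upper; auto|apply shift_lhp, L0; auto].
  - intros z Hz K. unfold low. f_equal. specialize (HB _ (L0 z Hz)).
    change (Csum (fun m => B (n - m)%nat * H0 (shift (plog z) m)) n + B (n - n)%nat * H0 (shift (plog z) n) = 0) in HB.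
    rewrite Nat.sub_diag, (proj1 hB), (Csum_first _ n hn) in HB. cbv beta in HB. rewrite Nat.sub_0_r in HB.
    rewrite (HG0 (shift (plog z) n)) in HB by (auto using shift_lhp; apply wide_lower; auto; lia).
    rewrite (Csum_ext _ (fun j => match j with O => 0 | S _ => B (n - j)%nat * G (shift (plog z) j) end)) in HB.
    2:{ intros j Hj. destruct j; auto. rewrite HG0 by (auto using shift_lhp; apply wide_lower; auto; lia). reflexivity. }
    fold (tail (plog z)) in HB. set (X := H0 (shift (plog z) 0)) in *.
    transitivity (/ B n * (B n * X + tail (plog z) + 1 * G (shift (plog z) n)) - / B n * (tail (plog z) + G (shift (plog z) n))); [field; auto|].
    rewrite HB. ring. }
assert (HfB : hol V fB).
{ apply (patch_hol V N1); auto.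
  - intros z [[K1 K2] K3]. destruct (tail_hol z K2) as [l Hl].
    assert (Q : forall m, (m <= n)%nat -> exists l, cder (fun z => Csum (fun j => A (n - j)%nat * G (shift (plog z) j)) m) z l).
    { induction m; intros Hm; [exists 0; apply (eder_const Cminus 0)|]. destruct IHm as [l1 Hl1]; [lia|].
      destruct (hol_shift_G (fun z => disc1 z /\ 0 < Im z) m) with (z := z) as [l2 Hl2]; auto.
      - intros y [M1 M2]. split; [apply disc1_opp_slit; auto|apply wide_upper; auto; lia].
      - eexists. simpl. apply eder_plus; [exact Hl1|apply eder_scal; exact Hl2]. }
    destruct (Q n (Nat.le_refl _)) as [m Hm]. eexists. apply eder_scal, eder_scal, eder_minus; [exact Hl|exact Hm].
  - intros z [[K1 K2] K3]. apply Hlow. auto.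
  - intros z Hz. destruct (plog_hol z (disc1_opp_slit z (proj1 Hz))) as [l Hl]. destruct (tail_hol z (proj1 Hz)) as [l' Hl'].
    destruct (HHi (shift (plog z) n) (shift_rhp _ _ (L1 z Hz))) as [m Hm].
    eexists. apply eder_scal, eder_scal, eder_plus; [exact Hl'|].
    apply (eder_comp Cminus (fun w => Hi (shift w n)) plog); [apply cder_translate; exact Hm|exact Hl].
  - intros z [K1 K2] K3. split; auto. apply neg_slit; auto.
  - intros z Hz K. f_equal. f_equal. unfold Cminus. f_equal.
    assert (RR := shift_rhp _ n (L1 z Hz)). specialize (HA _ RR). rewrite Csum_shift, (proj1 hA) in HA.
    replace (shift (plog z) n - RtoC (INR 0) * period) with (shift (plog z) n) in HA by (simpl; ring).
    rewrite (Csum_ext _ (fun k => A (S k) * G (shift (plog z) (n - S k)))) in HA.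
    2:{ intros k Hk. f_equal. replace (shift (plog z) n - RtoC (INR (S k)) * period) with (shift (plog z) (n - S k)).
        - apply HGi; [apply wide_upper; auto; lia|apply shift_rhp, L1; auto].
        - rewrite minus_INR, RtoC_minus by lia. ring. }
    replace (Csum (fun j => A (n - j)%nat * G (shift (plog z) j)) n) with (Csum (fun k => A (S k) * G (shift (plog z) (n - S k))) n).
    + transitivity (1 * Hi (shift (plog z) n) + Csum (fun k => A (S k) * G (shift (plog z) (n - S k))) n - Csum (fun k => A (S k) * G (shift (plog z) (n - S k))) n); [ring|].
      rewrite HA. ring.
    + destruct n as [|m] eqn:En; [lia|]. rewrite <- (Csum_rev (fun j => A (S m - j)%nat * _)). apply Csum_ext. intros k Hk.
      replace (S m - (m - k))%nat with (S k) by lia. replace (S m - S k)%nat with (m - k)%nat by lia. reflexivity.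
  - intros z Hz K. unfold low. do 3 f_equal. apply HGi; [apply wide_lower; auto; lia|apply shift_rhp, L1; auto]. }
assert (EF : forall z, 0 < Im z -> forall j, F j z = kappa * (fun j w => G (shift w j)) j (plog z)).
{ intros z Hz j. rewrite mellin_barnes_G, (proj2 (plog_upper z Hz)). reflexivity. }
assert (NU := copen_upper p Hp).
apply (acont_ext _ _ _ fA fB).
- rewrite circle_start. generalize NU. apply near_impl. intros z Hz. unfold fA. rewrite patch_upper, EF by auto. reflexivity.
- rewrite circle_end. generalize NU. apply near_impl. intros z Hz. unfold fB. rewrite patch_upper by auto.
  rewrite (row_scaled _ _ kappa (fun j w => G (shift w j)) z (plog z) (fun j _ => EF z Hz j)), row_M1_0. reflexivity.
- apply (acont_circle 1 p fA fB U V); auto.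
  + intros z K E. split; auto. unfold disc1. rewrite E. auto.
  + intros z K E. split; auto. unfold disc1. rewrite E. auto.
  + intros z _ _ Hz. unfold fA, fB. rewrite !patch_lower by auto. reflexivity.
Qed.

Lemma circle_M1 p i : 0 < Im p -> disc1 p -> (i < n)%nat -> acont (circle 1 p) 0 1 (F i) (row (M1 n A B) i F).
Proof. intros. destruct i; [apply circle_M1_0; auto|apply circle_M1_pos; auto; lia]. Qed.

(* M_inf M_0 M_1 = 1 *)
Lemma matrix_relation i z : (i < n)%nat -> row (Minf n A) i (fun j => row (M0 n B) j (fun k => row (M1 n A B) k F)) z = F i z.
Proof.
intros Hi. set (u := fun k => row (M1 n A B) k F).
destruct i as [|i].
- assert (An := A_n_neq_0). assert (Bn := B_n_neq_0).
  unfold row at 1. rewrite (Csum_ext _ (fun j => - / A n * (A (n - 1 - j)%nat * row (M0 n B) j u z))), Csum_scal.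
  2:{ intros j Hj. unfold Minf. rewrite coeff_mk_matrix by lia. simpl Nat.eqb. cbv iota. unfold Cdiv. ring. }
  assert (E1 : Csum (fun j => A (n - 1 - j)%nat * row (M0 n B) j u z) n =
     Csum (fun j => match j with O => 0 | S _ => A (n - j)%nat * F j z end) n - Csum (fun j => B (n - j)%nat * u j z) n).
  { apply (Csum_companion n A (fun j => row (M0 n B) j u z) (fun j => F j z)); auto.
    - apply hA.
    - intros j Hj. rewrite row_M0_shift by auto. unfold u. apply row_M1_id; lia.
    - apply row_M0_last. }
  rewrite E1.
  assert (EB := Csum_first (fun j => B (n - j)%nat * u j z) n hn). cbv beta in EB. rewrite Nat.sub_0_r in EB.
  rewrite (Csum_ext (fun j => match j with O => 0 | S _ => B (n - j)%nat * u j z end) (fun j => match j with O => 0 | S _ => B (n - j)%nat * F j z end)) in EB.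
  2:{ intros j Hj. destruct j; auto. f_equal. unfold u. apply row_M1_id; lia. }
  rewrite EB. unfold u. rewrite row_M1_0.
  assert (EA := Csum_first (fun j => A (n - j)%nat * F j z) n hn). cbv beta in EA. rewrite Nat.sub_0_r in EA.
  rewrite EA. field. auto.
- unfold row at 1. transitivity (row (M0 n B) i u z).
  + rewrite <- (Csum_delta (fun j => row (M0 n B) j u z) n i) by lia. apply Csum_ext. intros j Hj.
    unfold Minf. rewrite coeff_mk_matrix by lia. reflexivity.
  + rewrite row_M0_shift by lia. apply row_M1_id; lia.
Qed.

End Monodromy.

Theorem theorem2p6
  (n : nat) (alpha beta A B : nat -> C) (L : R -> C)
  (b : C) (sigma0 sigma1 : R -> C)
  (hn : (1 <= n)%nat)
  (hdiff : forall k l : nat, (1 <= k <= n)%nat -> (1 <= l <= n)%nat ->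
     forall m : Z, alpha k - beta l <> RtoC (IZR m))
  (hA : monic_poly_with_roots n A
          (fun k => Cexp (- (2 * RtoC PI * Ci * alpha k))))
  (hB : monic_poly_with_roots n B
          (fun k => Cexp (- (2 * RtoC PI * Ci * beta k))))
  (hL : mellin_barnes_path n alpha beta L)
  (hsigma0 : approach 0 b sigma0)
  (hsigma1 : approach 1 b sigma1) :
  let F := mellin_barnes n alpha beta L in
  let gamma0 := loop 0 sigma0 in
  let gamma1 := loop 1 sigma1 in
  let gammainf := path_reverse (path_concat gamma0 gamma1) in
  basis_of_solutions n alpha beta F /\
  is_monodromy_matrix n F gamma0 (M0 n B) /\
  is_monodromy_matrix n F gamma1 (M1 n A B) /\
  is_monodromy_matrix n F gammainf (Minf n A).
Proof.
intros F gamma0 gamma1 gammainf.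
assert (I0 : 0 < Im (sigma0 1%R) /\ Cmod (sigma0 1%R - 0) < 1).
{ destruct hsigma0 as [_ [_ [K1 K2]]]. split; auto. apply K1. unfold unit_interval. lra. }
assert (I1 : 0 < Im (sigma1 1%R) /\ disc1 (sigma1 1%R)).
{ destruct hsigma1 as [_ [_ [K1 K2]]]. split; auto. apply K1. unfold unit_interval. lra. }
assert (HF : forall i, (i < n)%nat -> hol (fun z => (0 < Im z)) (F i)) by (intros; apply F_upper_hol; auto).
assert (Q0 : forall i, (i < n)%nat -> cont_on gamma0 0 1 /\ gamma0 0%R = b /\ gamma0 1%R = b /\ acont gamma0 0 1 (F i) (row n (M0 n B) i F)).
{ intros i Hi. apply acont_loop; auto; [apply row_hol; auto|]. apply circle_M0; tauto. }
assert (Q1 : forall i, (i < n)%nat -> cont_on gamma1 0 1 /\ gamma1 0%R = b /\ gamma1 1%R = b /\ acont gamma1 0 1 (F i) (row n (M1 n A B) i F)).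
{ intros i Hi. apply acont_loop; auto; [apply row_hol; auto|]. apply circle_M1; tauto. }
assert (E : forall (M : matrix n n) i z, row n M i F z = lin_comb n (fun j => coeff_mat zero M i j) F z).
{ intros. rewrite lin_comb_Csum by auto. reflexivity. }
split; [apply mb_basis; auto|]. split; [|split]; intros i Hi; apply acont_iff.
- destruct (Q0 i Hi) as [_ [_ [_ K]]]. revert K. apply acont_ext; apply near_all; auto.
- destruct (Q1 i Hi) as [_ [_ [_ K]]]. revert K. apply acont_ext; apply near_all; auto.
(* It suffices to continue M_inf F along gamma0 followed by gamma1 and to arrive at F. The first
   loop replaces F by M_0 F, the second replaces the inner F by M_1 F, and M_inf M_0 M_1 = 1 closes
   the argument. *)
- apply acont_reverse.
  apply (acont_ext _ _ _ (row n (Minf n A) i F) (row n (Minf n A) i (fun j => row n (M0 n B) j (fun k => row n (M1 n A B) k F)))).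
  + apply near_all; auto.
  + apply near_all. intros z. apply matrix_relation; auto.
  + destruct (Q0 i Hi) as [C0 [S0 [T0 _]]]. destruct (Q1 i Hi) as [C1 [S1 [T1 _]]].
    apply acont_concat with (row n (Minf n A) i (fun j => row n (M0 n B) j F)); auto; [rewrite S1; auto| |].
    * apply acont_Csum. intros j Hj. apply Q0; auto.
    * apply acont_Csum. intros j Hj. apply acont_Csum. intros k Hk. apply Q1; auto.
Qed.
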